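(* Consider the axisymmetric Bianchi IX cosmological model with cosmological constant $\lambda$, i.e. the complex analytic Hamiltonian system with two degrees of freedom, canonical coordinates $(A,B)$ and conjugate momenta $(P_A,P_B)$, defined by $$H(A,B,P_A,P_B)=\frac{P_AP_B}{4B}-\frac{AP_A^2}{8B^2}+2A-\frac{A^3}{2B^2}-2\lambda AB^2 .$$ Let $G$ be the differential Galois group and $\gamma_1,\gamma_2: G\to\mathbb{C}$ the functions defined in the context (they depend on $(E,\lambda)$). Assume the following conjecture: for generic $(E,\lambda)$ with $\lambda\neq 0$ and $E\neq 0$, $\gamma_1$ and $\gamma_2$ are not simultaneously zero, i.e. there is $\sigma\in G$ with $(\gamma_1(\sigma),\gamma_2(\sigma))\neq(0,0)$ (equivalently, at least one of the functions $I_1,I_2$ of the context does not belong to $L_1=\overline{K}(\xi_1,\xi_1')$). Then, for generic values of $(E,\lambda)$, the Hamiltonian system defined by $H$ is not meromorphically integrable.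
   Context: **Integrability.** The system is $\dot A=\partial H/\partial P_A$, $\dot B=\partial H/\partial P_B$, $\dot P_A=-\partial H/\partial A$, $\dot P_B=-\partial H/\partial B$. It is meromorphically integrable if there are two meromorphic functions $f_1=H,f_2$ that are functionally independent (their differentials are linearly independent on a dense open set) and in involution, $\{f_1,f_2\}=0$. For given $(E,\lambda)$, integrability is considered in a neighbourhood of the integral curve $\Gamma_E$ of energy $E$ lying in the invariant plane $A=B$, $P_B=2P_A$: with $x=A=B$ and $P_A=4x\dot x$, it is given by $$\Gamma_E:\quad 6x\dot x^2+\tfrac{3x}{2}-2\lambda x^3-E=0 .$$ **Genericity.** ''Generic'' $(E,\lambda)$ means $(E,\lambda)$ outside a proper exceptional (algebraic) subset of the parameter space, this subset containing the degenerate cases $\lambda=0$, $E=0$, $4E^2\lambda=1$, $E^2\lambda+2450=0$. **Functions.** Put $$C_1(x)=4\lambda x^3-3x+2E,\qquad C_2(x)=35\lambda x^3+210x+4E,\qquad \mu=i\sqrt{486(E^2\lambda+2450)},$$ $$\xi_1(x)=\sqrt[4]{\tfrac{C_1(x)}{x}}\,\sqrt{C_2(x)}\,\exp\Big(\mu\int\frac{\sqrt{x}\,dx}{C_2(x)\sqrt{C_1(x)}}\Big),\qquad \xi_2(x)=\sqrt[4]{\tfrac{C_1(x)}{x}}\,\sqrt{C_2(x)}\,\exp\Big(-\mu\int\frac{\sqrt{x}\,dx}{C_2(x)\sqrt{C_1(x)}}\Big).$$ These form a basis of solutions of $\xi''=g(x)\xi$ with $$g(x)=\frac{128\lambda^2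 x^6-552\lambda x^4+128E\lambda x^3+315x^2-222Ex+5E^2}{4x^2C_1(x)^2},$$ and their Wronskian $W$ is the constant $W=18i\sqrt{6E^2\lambda+14700}$. Let $\mathcal{P}(\sqrt{x})=\sum_{k=0}^{18}a_k(\sqrt{x})^k$ with $a_{18}=-\frac{31850}{3}\lambda^3$, $a_{17}=0$, $a_{16}=4900\lambda^3$, $a_{15}=-560\lambda^2\mu$, $a_{14}=\frac{104125}{2}\lambda^2$, $a_{13}=-\frac{1960}{3}\lambda^2\mu$, $a_{12}=\lambda\big((-2835E+96775)\lambda-\frac83\mu^2\big)$, $a_{11}=-2940\lambda\mu$, $a_{10}=1120\lambda^2E+\frac{64}{3}\mu^2\lambda+1771350\lambda$, $a_9=-344\lambda\mu\big(E+\frac{2975}{172}\big)$, $a_8=(21560E+632100)\lambda+2\mu^2$, $a_7=-\frac{364}{3}\lambda E\mu+2520\mu$, $a_6=-232\lambda E^2-\frac43\mu^2+15400\lambda-8\mu^2+6460650$, $a_5=(-1632E-12180)\mu$, $a_4=64\lambda E^2+\frac83E\mu^2+231420E+1367100$, $a_3=-32E\mu(E+16)$, $a_2=1784E^2+52080E$, $a_1=-\frac{16}{3}E^2\mu$, $a_0=-\frac{16}{3}E^2(E-93)$. Define $$I_1=\int\frac{\mathcal{P}(\sqrt{x})}{x^{4}C_1(x)^{3/4}C_2(x)}\,\xi_1(x)\,dx,\qquad I_2=\int\frac{\mathcal{P}(\sqrt{x})}{x^{7/2}C_1(x)^{5/4}C_2(x)^2}\,\xi_1(x)^3\,dx,\qquad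 \omega_p=-\frac{\xi_1}{W}I_1+\frac{\xi_2}{W}I_2 .$$ **Galois group.** Let $K=\mathbb{C}(x)$ with derivation $d/dx$, let $\overline{K}$ be its algebraic closure, and let $L_1=\overline{K}(\xi_1,\xi_1')$. Let $G$ be the differential Galois group (group of differential automorphisms fixing $\overline{K}$) of the extension $\overline{K}(\xi_1,\xi_1',\omega_p,\omega_p')$ of $\overline{K}$, which is the Picard–Vessiot extension of the linear system (linearized second order variational equation along $\Gamma_E$) $$\begin{pmatrix}\omega\\ \omega'\\ \varphi\end{pmatrix}'=\begin{pmatrix}0&1&0\\ g&0&s\\ 0&0&2h\end{pmatrix}\begin{pmatrix}\omega\\ \omega'\\ \varphi\end{pmatrix},\qquad s(x)=\frac{\mathcal{P}(\sqrt{x})}{x^{7/2}C_1(x)^{5/4}C_2(x)^2},\quad h(x)=\frac{\xi_1'(x)}{\xi_1(x)},\quad \varphi=\xi_1^2 .$$ For each $\sigma\in G$ there is $\delta=\delta(\sigma)\in\mathbb{C}^*$ with $\sigma(\xi_1)=\delta\xi_1$ and $\sigma(\xi_2)=\delta^{-1}\xi_2$, and there are constants $\gamma_1=\gamma_1(\sigma),\gamma_2=\gamma_2(\sigma)\in\mathbb{C}$ determined by $$\sigma(I_1)=\delta I_1+\gamma_1,\qquad \sigma(I_2)=\delta^3I_2+\gamma_2 .$$ *)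

(* Defs.v *)
From HB Require Import structures.
From mathcomp Require Import all_boot all_order all_algebra.
From mathcomp Require Import fraction mxpoly.
From mathcomp Require Import boolp classical_sets reals topology normedtype derive.
From mathcomp Require Import complex.

Set Implicit Arguments.
Unset Strict Implicit.
Unset Printing Implicit Defensive.

Import Order.TTheory GRing.Theory Num.Theory.
Import numFieldNormedType.Exports.

Local Open Scope classical_set_scope.
Local Open Scope ring_scope.

(* [C] is an abstract [numClosedFieldType], because the library
   gives the normed-space structures only to abstract number fields; the theorem
   takes [C := R[i]] with [R : realType], so that differentiability over [C] is
   complex differentiability. *)

Section Hamiltonian.
Variable C : numClosedFieldType.

(* A point of phase space is the row (A, B, P_A, P_B). *)
Notation V := 'rV[C]_4.

Definition holomorphic_on (U : set V) (f : V -> C) :=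
  forall p, U p -> differentiable f p.

Definition dense_in (D U : set V) := D `<=` U /\ U `<=` closure D.

(* Locally a quotient of holomorphic functions whose denominator vanishes
   identically on no nonempty open set.  A meromorphic function is represented
   by a total function, whose values on the zeros of the denominator are
   irrelevant. *)
Definition meromorphic_on (U : set V) (f : V -> C) :=
  forall p, U p -> exists (N : set V) (a b : V -> C),
    [/\ open N, N p, N `<=` U, holomorphic_on N a & holomorphic_on N b] /\
    dense_in (N `&` [set q | b q != 0]) N /\
    (forall q, N q -> b q != 0 -> f q = a q / b q).

Definition partial (i : 'I_4) (f : V -> C) (p : V) : C :=
  'd f p (delta_mx 0 i).

(* Coordinates 0, 1 are the positions, 2, 3 their conjugate momenta. *)
Definition poisson (f g : V -> C) (p : V) : C :=
  (partial 0 f p * partial 2 g p - partial 2 f p * partial 0 g p) +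
  (partial 1 f p * partial 3 g p - partial 3 f p * partial 1 g p).

Definition indep_differentials (f g : V -> C) (p : V) :=
  forall a b : C, (forall v : V, a * 'd f p v + b * 'd g p v = 0) ->
    a = 0 /\ b = 0.

Definition meromorphically_integrable_on (U : set V) (H : V -> C) :=
  meromorphic_on U H /\
  exists f : V -> C, meromorphic_on U f /\
  exists D : set V,
    [/\ open D, dense_in D U, holomorphic_on D H & holomorphic_on D f] /\
    (forall p, D p -> indep_differentials H f p) /\
    (forall p, D p -> poisson H f p = 0).

Definition meromorphically_integrable_near (Gam : set V) (H : V -> C) :=
  exists U : set V, [/\ open U, Gam `<=` U & meromorphically_integrable_on U H].

Definition bianchi_H (lam : C) (p : V) : C :=
  let A := p 0 0 in let B := p 0 1 in let PA := p 0 2 in let PB := p 0 3 in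
  PA * PB / (4 * B) - A * PA ^+ 2 / (8 * B ^+ 2) + 2 * A
  - A ^+ 3 / (2 * B ^+ 2) - 2 * lam * A * B ^+ 2.

(* The variable [dx] stands for the time derivative of x.  For E != 0 the
   equation forces x != 0, so that the curve avoids the pole B = 0 of H. *)
Definition bianchi_curve (E lam : C) : set V :=
  [set p | exists x dx : C,
     6 * x * dx ^+ 2 + 3 / 2 * x - 2 * lam * x ^+ 3 - E = 0 /\
     [/\ p 0 0 = x, p 0 1 = x, p 0 2 = 4 * x * dx & p 0 3 = 2 * (4 * x * dx)]].

End Hamiltonian.

Section Genericity.
Variable C : numClosedFieldType.

(* Outer variable of the bivariate polynomials: lambda; inner one: E. *)
Definition zero_locus (S : seq {poly {poly C}}) (E lam : C) :=
  forall F, F \in S -> F.[lam%:P].[E] = 0.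

Definition degenerate (E lam : C) :=
  [\/ lam = 0, E = 0, 4 * E ^+ 2 * lam = 1 | E ^+ 2 * lam + 2450 = 0].

Definition generic (Q : C -> C -> Prop) :=
  exists S : seq {poly {poly C}},
    [/\ exists E lam, ~ zero_locus S E lam,
        forall E lam, degenerate E lam -> zero_locus S E lam &
        forall E lam, ~ zero_locus S E lam -> Q E lam].

End Genericity.

Section DifferentialGalois.
Variable C : numClosedFieldType.

(* A differential field extension of an algebraic closure [acl] of C(x), with
   the derivation extending d/dx and with no constants besides those of C. *)
Record diff_ext := DiffExt {
  acl : closedFieldType;
  incl : {rmorphism {fraction {poly C}} -> acl};
  incl_alg : forall u : acl, algebraicOver incl u;
  carrier : fieldType;
  emb : {rmorphism acl -> carrier};
  der : carrier -> carrier;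
  derD : {morph der : a b / a + b};
  derM : forall a b, der (a * b) = der a * b + a * der b;
  der_x : der (emb (incl (tofrac ('X : {poly C})))) = 1;
  der_constP : forall a,
    der a = 0 <-> exists c : C, a = emb (incl (tofrac c%:P)) }.

Definition ratf (M : diff_ext) (p : {poly C}) : acl M := incl M (tofrac p).

Definition cst (M : diff_ext) (c : C) : carrier M := emb M (ratf M c%:P).

Definition generated_by (M : diff_ext) (T : set (carrier M)) :=
  forall S : {pred carrier M}, GRing.divring_closed S ->
    (forall u : acl M, emb M u \in S) -> (forall a, T a -> a \in S) ->
    forall a, a \in S.

(* The differential Galois group of [carrier M] over [acl M]. *)
Definition in_gal (M : diff_ext) (s : {rmorphism carrier M -> carrier M}) :=
  [/\ bijective s, forall a, s (der a) = der (s a) &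
      forall u : acl M, s (emb M u) = emb M u].

End DifferentialGalois.

Section Bianchi.
Variables (C : numClosedFieldType) (E lam : C).

Definition C1 : {poly C} := (4 * lam) *: 'X^3 - 3 *: 'X + (2 * E)%:P.

Definition C2 : {poly C} := (35 * lam) *: 'X^3 + 210 *: 'X + (4 * E)%:P.

Definition mu : C := 'i * sqrtC (486 * (E ^+ 2 * lam + 2450)).

(* This is the Wronskian xi1' xi2 - xi1 xi2' = 2 mu.  The opposite sign would
   only replace omega by its opposite, and the extension would be the same. *)
Definition wronskian : C :=
  18 * 'i * sqrtC (6 * E ^+ 2 * lam + (14 * 1000 + 700)).

(* The coefficients a_0, ..., a_18 of the polynomial P, in this order.  Numerals
   are unary, hence the large ones are split as n * 1000 + m. *)
Definition calP : {poly C} := Poly [::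
  - (16 / 3) * E ^+ 2 * (E - 93);
  - (16 / 3) * E ^+ 2 * mu;
  1784 * E ^+ 2 + (52 * 1000 + 80) * E;
  - 32 * E * mu * (E + 16);
  64 * lam * E ^+ 2 + 8 / 3 * E * mu ^+ 2 + (231 * 1000 + 420) * E
    + (1367 * 1000 + 100);
  (- 1632 * E - (12 * 1000 + 180)) * mu;
  - 232 * lam * E ^+ 2 - 4 / 3 * mu ^+ 2 + (15 * 1000 + 400) * lam - 8 * mu ^+ 2
    + (6460 * 1000 + 650);
  - (364 / 3) * lam * E * mu + 2520 * mu;
  ((21 * 1000 + 560) * E + (632 * 1000 + 100)) * lam + 2 * mu ^+ 2;
  - 344 * lam * mu * (E + 2975 / 172);
  1120 * lam ^+ 2 * E + 64 / 3 * mu ^+ 2 * lam + (1771 * 1000 + 350) * lam;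
  - 2940 * lam * mu;
  lam * ((- 2835 * E + (96 * 1000 + 775)) * lam - 8 / 3 * mu ^+ 2);
  - (1960 / 3) * lam ^+ 2 * mu;
  (104 * 1000 + 125) / 2 * lam ^+ 2;
  - 560 * lam ^+ 2 * mu;
  4900 * lam ^+ 3;
  0;
  - ((31 * 1000 + 850) / 3) * lam ^+ 3].

(* The functions of the problem inside a differential extension.  All fractional
   powers are powers of one choice of x^(1/4), C1^(1/4), C2^(1/2), and every
   indefinite integral is an element with prescribed derivative.  The roots and
   the constants of integration are arbitrary. *)
Record bianchi_ext := BianchiExt {
  ext :> diff_ext C;
  x4 : acl ext;
  C14 : acl ext;
  C22 : acl ext;
  x4E : x4 ^+ 4 = ratf ext 'X;
  C14E : C14 ^+ 4 = ratf ext C1;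
  C22E : C22 ^+ 2 = ratf ext C2;
  expi : carrier ext;
  expi_neq0 : expi != 0;
  der_expi : der expi =
    cst ext mu * emb ext (x4 ^+ 2 / (ratf ext C2 * C14 ^+ 2)) * expi;
  xi1 : carrier ext := emb ext (C14 / x4 * C22) * expi;
  xi2 : carrier ext := emb ext (C14 / x4 * C22) * expi^-1;
  Psqrt : acl ext := (map_poly (fun c : C => ratf ext c%:P) calP).[x4 ^+ 2];
  I1 : carrier ext;
  I2 : carrier ext;
  der_I1 : der I1 =
    emb ext (Psqrt / (ratf ext 'X ^+ 4 * C14 ^+ 3 * ratf ext C2)) * xi1;
  der_I2 : der I2 =
    emb ext (Psqrt / (x4 ^+ 14 * C14 ^+ 5 * ratf ext C2 ^+ 2)) * xi1 ^+ 3;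
  omega : carrier ext :=
    - (xi1 / cst ext wronskian) * I1 + xi2 / cst ext wronskian * I2;
  ext_gen : generated_by
    [set a | [\/ a = xi1, a = der xi1, a = omega | a = der omega]] }.

Definition gal_constants (M : bianchi_ext)
    (s : {rmorphism carrier M -> carrier M}) (delta gamma1 gamma2 : C) :=
  delta != 0 /\
  [/\ s (xi1 M) = cst M delta * xi1 M,
      s (xi2 M) = cst M delta^-1 * xi2 M,
      s (I1 M) = cst M delta * I1 M + cst M gamma1 &
      s (I2 M) = cst M (delta ^+ 3) * I2 M + cst M gamma2].

(* A Picard-Vessiot extension exists and is unique up to isomorphism, and for
   generic (E, lam) the choices of roots are conjugate over C(x).  The constants of
   integration do matter: I1 + c instead of I1 changes gamma1 by c (1 - delta).
   With the quantification over all of them, the property holds for generic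
   (E, lam) iff I1 or I2 is not in the subfield generated by xi1 and xi1' over the
   algebraic closure of C(x). *)
Definition gammas_not_both_zero :=
  forall M : bianchi_ext,
  exists s : {rmorphism carrier M -> carrier M},
    in_gal s /\
    exists delta gamma1 gamma2 : C,
      gal_constants s delta gamma1 gamma2 /\ (gamma1, gamma2) <> (0, 0).

End Bianchi.

(* Main.v *)
Require Import Defs.
From mathcomp Require Import all_boot all_order all_algebra.
From mathcomp Require Import boolp classical_sets reals topology normedtype derive.
From mathcomp Require Import landau sequences trigo exp.
From mathcomp Require Import complex ring lra zify.

Set Implicit Arguments.
Unset Strict Implicit.
Unset Printing Implicit Defensive.

Import Order.TTheory GRing.Theory Num.Theory.
Import numFieldNormedType.Exports.

Local Open Scope ring_scope.

(* Take [s = B], [eta], [b = A / B - 1] and [H - E] as coordinates, so that [Gamma_E]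
   becomes a line, and blow this line up.  Let [F] be a second first integral; the
   leading part [T1 de + T2 db] of its transversal differential is a nonzero covector,
   which is transported by the first order variational equation.

   At [s = 0] the first order equation has the exponents [0] and [- 1 / 2].  Write
   [s = z ^+ 2] and [z = exp w].  When [w] increases by [2 i pi] the first order
   solutions return to themselves, while the second order ones are shifted, in the
   direction of the regular first order solution, by [540 u ^ 2 / E ^ 2 * (2 i pi)],
   where [u] is the amplitude of the singular one.  As [F] is constant along solutions,
   it takes the same value at the shifted point, so that its leading differential
   annihilates the regular solution.

   It then annihilates the analytic continuation of that solution along every path
   which avoids [s = 0] and the roots of [C1].  A nonzero covector annihilates a single
   line, and the quadratic form [Qf] is constant on solutions, so the continuation is
   unique up to sign: the square of the solution is single valued.  It grows at most
   polynomially at the roots of [C1] and at infinity, hence it is [g / C1 ^ k] with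
   [g] a polynomial.  The equation satisfied by squares of solutions forces [C1] to
   divide [g] as long as [k > 0]; and it has no polynomial solution. *)

(** * Complex calculus *)

(** No exact solution near the curve is constructed. Let [m] and [n] be the orders of [B] and of
    [B dA - A dB] in the blow-up parameter [e]. A path which solves the reduced flow up to [e^3]
    changes [F] by [O(e^(n - 2m + 3))], while a shift by [e^2] times a transversal vector changes it
    by [e^(n - 2m + 2)] times the leading covector on that vector, up to a nonzero factor. So
    expansions of order two decide, and poles of [F] do no harm once numerator and denominator are
    kept apart. The obstacle is that the leading term of [B] may vanish for some times and
    amplitudes: statements along paths are made for generic ones and completed by the identity
    theorem. In reduced coordinates [P_A] is a square root [r] of [sq], hence the extra argument of
    [F]; on the curve [sq] is [s] times a function which is nonzero at [s = 0], so [z] makes [r]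
    single valued as well. The constant 540 is a residue in [z], and the value 2 of [Qf] on the
    annihilated solution is the quotient of [C2] and [C1] at 0. The sign of this solution is chosen
    arbitrarily at each point, since only moduli and squares matter afterwards. *)

(* The complex numbers over [R], seen from an abstract [numClosedFieldType]:
   the instances of the library on [R[i]] itself do not include its topology. *)
Record cdata (R : realType) (C : numClosedFieldType) := CData {
  jr : {rmorphism R -> C};
  cre : C -> R;
  jr_le : {mono jr : x y / x <= y};
  creE : forall z, jr (cre z) = 'Re z }.

(** * Moduli and limits of complex numbers *)

Section Norm.
Variables (R : realType) (C : numClosedFieldType) (K : cdata R C).
Notation j := (jr K).

Definition cN (z : C) : R := cre K `|z|.
Definition cim (z : C) : R := cre K ('Im z).
Notation N := cN.

Lemma jr_inj : injective j.
Proof.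
by move=> x y e; apply/eqP; rewrite eq_le -(jr_le K) -(jr_le K y) e lexx.
Qed.

Lemma jr_lt : {mono j : x y / x < y}.
Proof. by move=> x y; rewrite !lt_def (jr_le K) (inj_eq jr_inj). Qed.

Lemma jr_real x : j x \is Num.real.
Proof. by rewrite realE -{1 2}(rmorph0 j) !(jr_le K) le_total. Qed.

Lemma cre_jr x : cre K (j x) = x.
Proof. by apply: jr_inj; rewrite creE; apply/Creal_ReP/jr_real. Qed.

Lemma cNE z : j (N z) = `|z|.
Proof. by rewrite creE; apply/Creal_ReP/normr_real. Qed.

Lemma cimE z : j (cim z) = 'Im z.
Proof. by rewrite creE; apply/Creal_ReP/Creal_Im. Qed.

Lemma c_rect z : z = j (cre K z) + 'i * j (cim z).
Proof. by rewrite creE cimE -Crect. Qed.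

Lemma cN_ge0 z : 0 <= N z.
Proof. by rewrite -(jr_le K) rmorph0 cNE. Qed.

Lemma cN0 : N 0 = 0.
Proof. by apply: jr_inj; rewrite cNE normr0 rmorph0. Qed.

Lemma cN1 : N 1 = 1.
Proof. by apply: jr_inj; rewrite cNE normr1 rmorph1. Qed.

Lemma cN_eq0 z : (N z == 0) = (z == 0).
Proof. by rewrite -(inj_eq jr_inj) cNE rmorph0 normr_eq0. Qed.

Lemma cN_gt0 z : (0 < N z) = (z != 0).
Proof. by rewrite lt_def cN_eq0 cN_ge0 andbT. Qed.

Lemma cNM x y : N (x * y) = N x * N y.
Proof. by apply: jr_inj; rewrite rmorphM !cNE normrM. Qed.

Lemma cNV x : N x^-1 = (N x)^-1.
Proof. by apply: jr_inj; rewrite fmorphV !cNE normfV. Qed.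

Lemma cNX x n : N (x ^+ n) = N x ^+ n.
Proof. by apply: jr_inj; rewrite rmorphXn !cNE normrX. Qed.

Lemma cNN x : N (- x) = N x.
Proof. by apply: jr_inj; rewrite !cNE normrN. Qed.

Lemma cN_nat n : N n%:R = n%:R.
Proof. by apply: jr_inj; rewrite cNE rmorph_nat normr_nat. Qed.

Lemma cN_jr x : N (j x) = `|x|.
Proof.
apply: jr_inj; rewrite cNE; case: (leP 0 x) => x0.
  by rewrite [in RHS]ger0_norm // ger0_norm // -(rmorph0 j) (jr_le K).
rewrite [in RHS]ltr0_norm // rmorphN ltr0_norm //.
by rewrite -(rmorph0 j) jr_lt.
Qed.

Lemma cN_i : N 'i = 1.
Proof. by apply: jr_inj; rewrite cNE normCi rmorph1. Qed.

Lemma cN_tri x y : N (x + y) <= N x + N y.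
Proof. by rewrite -(jr_le K) rmorphD !cNE ler_normD. Qed.

Lemma cN_triB x y : N (x - y) <= N x + N y.
Proof. by rewrite -(cNN y) cN_tri. Qed.

Lemma cNB x y : N (x - y) = N (y - x).
Proof. by rewrite -cNN opprB. Qed.

Lemma cN_dist x y z : N (x - z) <= N (x - y) + N (y - z).
Proof. by have := cN_tri (x - y) (y - z); rewrite addrA subrK. Qed.

Lemma cN_low x y : N x - N y <= N (x - y).
Proof. by have := cN_tri (x - y) y; rewrite subrK lerBlDr. Qed.

Lemma cN_sum (I : Type) (r : seq I) (P : pred I) (F : I -> C) :
  N (\sum_(i <- r | P i) F i) <= \sum_(i <- r | P i) N (F i).
Proof.
elim/big_rec2: _ => [|i y x _ le_xy]; first by rewrite cN0.
by apply: le_trans (cN_tri _ _) _; rewrite lerD2l.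
Qed.

Lemma cN_re z : `|cre K z| <= N z.
Proof.
rewrite -(jr_le K) cNE -[in leLHS]cN_jr cNE creE.
have := normC2_Re_Im z; move=> e.
rewrite -(ler_pXn2r (n := 2)) ?nnegrE // real_normK ?Creal_Re // e.
by rewrite lerDl -realEsqr Creal_Im.
Qed.

Lemma cN_im z : `|cim z| <= N z.
Proof.
rewrite -(jr_le K) cNE -[in leLHS]cN_jr cNE cimE.
have := normC2_Re_Im z; move=> e.
rewrite -(ler_pXn2r (n := 2)) ?nnegrE // real_normK ?Creal_Im // e.
by rewrite lerDr -realEsqr Creal_Re.
Qed.

Lemma creB : {morph cre K : x y / x - y}.
Proof. by move=> x y; apply: jr_inj; rewrite rmorphB !creE raddfB. Qed.

Lemma cimB : {morph cim : x y / x - y}.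
Proof. by move=> x y; apply: jr_inj; rewrite rmorphB !cimE raddfB. Qed.

Lemma small_eq0 z (A : R) : (forall e : R, 0 < e -> N z <= A * e) -> z = 0.
Proof.
move=> h; apply/eqP; rewrite -cN_eq0 eq_le cN_ge0 andbT leNgt; apply/negP => z0.
have := h (N z / 2 / (`|A| + 1)).
have A1 : 0 < `|A| + 1 by apply: ltr_wpDl.
move=> /(_ _); rewrite !divr_gt0 // => /(_ isT); rewrite leNgt => /negP; apply.
have A2 : A <= `|A| + 1 by apply: le_trans (ler_norm _) _; rewrite lerDl.
apply: (@le_lt_trans _ _ (N z / 2)); last by lra.
by rewrite mulrA ler_pdivrMr // mulrC ler_wpM2l // divr_ge0 // ltW.
Qed.

Definition clim (u : nat -> C) (l : C) :=
  forall e : R, 0 < e -> exists n0, forall n, (n0 <= n)%N -> N (u n - l) <= e.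

Lemma clim_le u l x (M : R) : clim u l -> (forall n, N (u n - x) <= M) ->
  N (l - x) <= M.
Proof.
move=> ul hM; apply/ler_addgt0Pr => e e0; have [n0 /(_ n0 (leqnn _)) h] := ul e e0.
apply: le_trans (cN_dist _ (u n0) _) _; rewrite cNB.
by have := hM n0; lra.
Qed.

Lemma clim_uniq u l l' : clim u l -> clim u l' -> l = l'.
Proof.
move=> h h'; apply/eqP; rewrite -subr_eq0; apply/eqP; apply: (@small_eq0 _ 2) => e e0.
have [n1 h1] := h e e0; have [n2 h2] := h' e e0.
have := h1 (maxn n1 n2) (leq_maxl _ _); have := h2 (maxn n1 n2) (leq_maxr _ _).
move=> a b; apply: le_trans (cN_dist _ (u (maxn n1 n2)) _) _.
by rewrite cNB; lra.
Qed.

Lemma rcauchy (u : nat -> R) :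
  (forall e : R, 0 < e -> exists n0, forall m n, (n0 <= m)%N -> (n0 <= n)%N ->
     `|u m - u n| <= e) ->
  exists l, forall e : R, 0 < e -> exists n0, forall n, (n0 <= n)%N -> `|u n - l| <= e.
Proof.
move=> cu; suff /cvg_ex [l ul] : cvgn u.
  exists l => e e0; have /cvgrPdist_le /(_ e e0) := ul.
  move=> [n0 _ h]; exists n0 => n nn; rewrite distrC; exact: h.
apply/cauchy_cvgP/cauchyP => e e0.
have [n0 h] := cu (e / 2) (divr_gt0 e0 (ltr0n _ 2)).
exists (u n0), n0 => // n /= hn; rewrite /ball /=.
by apply: le_lt_trans (h _ _ (leqnn _) hn) _; lra.
Qed.

Lemma ccauchy (u : nat -> C) :
  (forall e : R, 0 < e -> exists n0, forall m n, (n0 <= m)%N -> (n0 <= n)%N ->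
     N (u m - u n) <= e) -> exists l, clim u l.
Proof.
move=> cu.
have [a ha] : exists l, forall e : R, 0 < e -> exists n0, forall n, (n0 <= n)%N ->
    `|cre K (u n) - l| <= e.
  apply: rcauchy => e /cu [n0 h]; exists n0 => m n hm hn.
  by rewrite -creB; apply: le_trans (cN_re _) (h _ _ hm hn).
have [b hb] : exists l, forall e : R, 0 < e -> exists n0, forall n, (n0 <= n)%N ->
    `|cim (u n) - l| <= e.
  apply: rcauchy => e /cu [n0 h]; exists n0 => m n hm hn.
  by rewrite -cimB; apply: le_trans (cN_im _) (h _ _ hm hn).
exists (j a + 'i * j b) => e e0.
have e2 : 0 < e / 2 by rewrite divr_gt0.
have [n1 h1] := ha _ e2; have [n2 h2] := hb _ e2.
exists (maxn n1 n2) => n; rewrite geq_max => /andP[/h1 k1 /h2 k2].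
rewrite {1}(c_rect (u n)).
have -> : j (cre K (u n)) + 'i * j (cim (u n)) - (j a + 'i * j b) =
  j (cre K (u n) - a) + 'i * j (cim (u n) - b) by rewrite !rmorphB; ring.
apply: le_trans (cN_tri _ _) _; rewrite cNM cN_i mul1r !cN_jr; lra.
Qed.

End Norm.
Arguments clim {R C} K u l.

(** * Complex derivatives in one variable *)

Section Calculus.
Variables (R : realType) (C : numClosedFieldType) (K : cdata R C).
Notation j := (jr K).
Notation N := (cN K).
Implicit Types (f g : C -> C) (t l : C).

Definition cont f t :=
  forall e : R, 0 < e -> exists2 d : R, 0 < d &
    forall s, N (s - t) < d -> N (f s - f t) <= e.

(* Caratheodory's form of differentiability: products and compositions become
   algebra of continuous slopes. *)
Definition cd g t l :=
  exists2 phi : C -> C, cont phi t /\ phi t = l &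
    forall s, g s = g t + phi s * (s - t).

Lemma cont_cst c t : cont (fun=> c) t.
Proof. by move=> e e0; exists 1 => // s _; rewrite subrr cN0 ltW. Qed.

Lemma cont_id t : cont id t.
Proof. by move=> e e0; exists e => // s /ltW. Qed.

Lemma cont_ext f g t (d : R) : 0 < d -> (forall s, N (s - t) < d -> f s = g s) ->
  cont f t -> cont g t.
Proof.
move=> d0 fg cf e e0; have [d' d'0 h] := cf e e0.
exists (Num.min d d'); first by rewrite lt_min d0.
move=> s; rewrite lt_min => /andP[sd sd'].
by rewrite -!fg ?subrr ?cN0 // h.
Qed.

Lemma contD f g t : cont f t -> cont g t -> cont (fun s => f s + g s) t.
Proof.
move=> cf cg e e0; have e2 : 0 < e / 2 by lra.
have [a a0 ha] := cf _ e2; have [b b0 hb] := cg _ e2.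
exists (Num.min a b); first by rewrite lt_min a0.
move=> s; rewrite lt_min => /andP[/ha {}ha /hb {}hb].
have -> : f s + g s - (f t + g t) = (f s - f t) + (g s - g t) by ring.
by apply: le_trans (cN_tri _ _ _) _; lra.
Qed.

Lemma cont_bdd f t : cont f t -> exists2 d : R, 0 < d &
  forall s, N (s - t) < d -> N (f s) <= N (f t) + 1.
Proof.
move=> cf; have [d d0 h] := cf 1 ltr01; exists d => // s /h.
by have := cN_low K (f s) (f t); lra.
Qed.

Lemma contM f g t : cont f t -> cont g t -> cont (fun s => f s * g s) t.
Proof.
move=> cf cg e e0.
set M := N (f t) + N (g t) + 2; have M0 : 0 < M.
  by rewrite /M; have := cN_ge0 K (f t); have := cN_ge0 K (g t); lra.
have eM : 0 < e / 2 / M by rewrite !divr_gt0.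
have [a a0 ha] := cf _ eM; have [b b0 hb] := cg _ eM; have [c c0 hc] := cont_bdd cg.
exists (Num.min a (Num.min b c)); first by rewrite !lt_min a0 b0.
move=> s; rewrite !lt_min => /and3P[/ha {}ha /hb {}hb /hc {}hc].
have -> : f s * g s - f t * g t = (f s - f t) * g s + f t * (g s - g t) by ring.
apply: le_trans (cN_tri _ _ _) _; rewrite !cNM.
have h1 : N (f s - f t) * N (g s) <= e / 2 / M * M.
  by apply: ler_pM; rewrite ?cN_ge0 // /M; have := cN_ge0 K (f t); lra.
have h2 : N (f t) * N (g s - g t) <= M * (e / 2 / M).
  by apply: ler_pM; rewrite ?cN_ge0 // /M; have := cN_ge0 K (g t); lra.
rewrite divfK ?gt_eqF // in h1; rewrite [M * _]mulrC divfK ?gt_eqF // in h2; lra.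
Qed.

Lemma contN f t : cont f t -> cont (fun s => - f s) t.
Proof.
by move=> cf e /cf [d d0 h]; exists d => // s /h; rewrite -opprD cNN.
Qed.

Lemma cont_comp f g t : cont f t -> cont g (f t) -> cont (fun s => g (f s)) t.
Proof.
move=> cf cg e /cg [d d0 h]; have d2 : 0 < d / 2 by lra.
have [d' d'0 h'] := cf _ d2; exists d' => // s /h' k; apply: h; lra.
Qed.

Lemma cont_nz f t : cont f t -> f t != 0 -> exists2 d : R, 0 < d &
  forall s, N (s - t) < d -> N (f t) / 2 <= N (f s).
Proof.
move=> cf f0; have p : 0 < N (f t) by rewrite cN_gt0.
have p2 : 0 < N (f t) / 2 by lra.
have [d d0 h] := cf _ p2; exists d => // s /h.
by have := cN_low K (f t) (f s); rewrite (cNB _ (f t)); lra.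
Qed.

Lemma contV f t : cont f t -> f t != 0 -> cont (fun s => (f s)^-1) t.
Proof.
move=> cf f0 e e0; have [a a0 ha] := cont_nz cf f0.
have p : 0 < N (f t) by rewrite cN_gt0.
have q : 0 < e * (N (f t) / 2 * N (f t)) by rewrite !mulr_gt0 // invr_gt0.
have [b b0 hb] := cf _ q.
exists (Num.min a b); first by rewrite lt_min a0.
move=> s; rewrite lt_min => /andP[/ha {}ha /hb {}hb].
have ps : 0 < N (f s) by lra.
have fs : f s != 0 by rewrite -(cN_gt0 K).
have -> : (f s)^-1 - (f t)^-1 = (f t - f s) / (f s * f t).
  by field; apply/andP.
rewrite cNM cNV cNM ler_pdivrMr ?mulr_gt0 // cNB.
by apply: le_trans hb _; apply: ler_wpM2l; [exact: ltW | rewrite ler_pM2r].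
Qed.

Lemma cd_cst c t : cd (fun=> c) t 0.
Proof. by exists (fun=> 0); [split=> //; apply: cont_cst | move=> s; ring]. Qed.

Lemma cd_id t : cd id t 1.
Proof. by exists (fun=> 1); [split=> //; apply: cont_cst | move=> s; ring]. Qed.

Lemma cdD f g t l l' : cd f t l -> cd g t l' -> cd (fun s => f s + g s) t (l + l').
Proof.
move=> [p [cp <-] hp] [q [cq <-] hq]; exists (fun s => p s + q s).
  by split=> //; apply: contD.
by move=> s; rewrite hp hq; ring.
Qed.

Lemma cdN f t l : cd f t l -> cd (fun s => - f s) t (- l).
Proof.
move=> [p [cp <-] hp]; exists (fun s => - p s); first by split=> //; apply: contN.
by move=> s; rewrite hp; ring.
Qed.

Lemma cdB f g t l l' : cd f t l -> cd g t l' -> cd (fun s => f s - g s) t (l - l').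
Proof. by move=> hf hg; apply: cdD hf (cdN hg). Qed.

Lemma cd_cont g t l : cd g t l -> cont g t.
Proof.
move=> [p [cp _] hp].
apply: (@cont_ext (fun s => g t + p s * (s - t)) _ _ 1) => //.
apply: contD; first exact: cont_cst.
apply: contM => //; apply: contD; [exact: cont_id | exact: cont_cst].
Qed.

Lemma cdM f g t l l' : cd f t l -> cd g t l' ->
  cd (fun s => f s * g s) t (l * g t + f t * l').
Proof.
move=> hf hg; have cg := cd_cont hg.
case: hf hg => [p [cp <-] hp] [q [cq <-] hq].
exists (fun s => p s * g s + f t * q s).
  by split=> //; apply: contD; apply: contM => //; apply: cont_cst.
by move=> s; rewrite (hp s) {2}(hq s) (hq s); ring.
Qed.

Lemma cdZ c g t l : cd g t l -> cd (fun s => c * g s) t (c * l).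
Proof.
by move=> h; have := cdM (cd_cst c t) h; rewrite mul0r add0r.
Qed.

Lemma cd_comp f g t l l' : cd f t l -> cd g (f t) l' ->
  cd (fun s => g (f s)) t (l' * l).
Proof.
move=> hf; have cf := cd_cont hf; case: hf => [p [cp <-] hp] [q [cq <-] hq].
exists (fun s => q (f s) * p s).
  by split=> //; apply: contM => //; apply: cont_comp.
by move=> s; rewrite hq {2}(hp s); ring.
Qed.

Lemma cdV f t l : cd f t l -> f t != 0 ->
  cd (fun s => (f s)^-1) t (- l / f t ^+ 2).
Proof.
move=> hf f0; have cf := cd_cont hf; case: hf => [p [cp <-] hp].
have [d d0 hd] := cont_nz cf f0.
have p0 : 0 < N (f t) by rewrite cN_gt0.
(* The equation in [cd] is required for all [s], also where [f] vanishes far from [t]; there the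
   slope is just the difference quotient. *)
pose q s := if N (s - t) < d then - p s / (f s * f t)
            else ((f s)^-1 - (f t)^-1) / (s - t).
have qt : q t = - p t / f t ^+ 2 by rewrite /q subrr cN0 d0 expr2.
exists q; first split=> //.
  apply: (@cont_ext (fun s => - p s / (f s * f t)) _ _ d) => //.
    by move=> s sd; rewrite /q sd.
  apply: contM; first exact: contN.
  by apply: contV; [apply: contM => //; exact: cont_cst | rewrite mulf_neq0].
move=> s; rewrite /q; case: ifPn => [/hd fs|].
  have fs0 : f s != 0 by rewrite -(cN_gt0 K); lra.
  have -> : - p s / (f s * f t) * (s - t) = - (p s * (s - t)) / (f s * f t).
    by field; apply/andP.
  have -> : p s * (s - t) = f s - f t by rewrite hp; ring.
  by field; apply/andP.
rewrite -leNgt => ds; rewrite divfK; first by ring.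
by rewrite -(cN_gt0 K); lra.
Qed.

Lemma cdX f t l n : cd f t l ->
  cd (fun s => f s ^+ n) t (n%:R * f t ^+ n.-1 * l).
Proof.
move=> hf; elim: n => [|n ih].
  by rewrite !mul0r; apply: cd_cst.
have -> : n.+1%:R * f t ^+ n.+1.-1 * l = l * f t ^+ n + f t * (n%:R * f t ^+ n.-1 * l).
  by case: n {ih} => [|n] /=; rewrite -?natr1 ?exprS; ring.
have := cdM hf ih; congr cd; apply/funext => s; by rewrite exprS.
Qed.

Lemma cd_ext f g t l (d : R) : 0 < d -> (forall s, N (s - t) < d -> f s = g s) ->
  cd f t l -> cd g t l.
Proof.
move=> d0 fg [p [cp <-] hp].
have gt : f t = g t by apply: fg; rewrite subrr cN0.
pose q s := if N (s - t) < d then p s else (g s - g t) / (s - t).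
have qt : q t = p t by rewrite /q subrr cN0 d0.
exists q; first split=> //.
  by apply: (@cont_ext p _ _ d) => // s sd; rewrite /q sd.
move=> s; rewrite /q; case: ifPn => [sd|]; first by rewrite -fg // -gt hp.
rewrite -leNgt => ds; rewrite divfK; first by ring.
by rewrite -(cN_gt0 K); lra.
Qed.

Lemma cdP g t l : cd g t l <->
  forall e : R, 0 < e -> exists2 d : R, 0 < d &
    forall s, N (s - t) < d -> N (g s - g t - l * (s - t)) <= e * N (s - t).
Proof.
split=> [[p [cp <-] hp] e /cp [d d0 h]|h].
  exists d => // s /h hs; rewrite hp.
  have -> : g t + p s * (s - t) - g t - p t * (s - t) = (p s - p t) * (s - t) by ring.
  by rewrite cNM ler_wpM2r // cN_ge0.
pose q s := if s == t then l else (g s - g t) / (s - t).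
exists q; first split.
- move=> e e0; have [d d0 {}h] := h e e0; exists d => // s /h; rewrite /q eqxx => {h}; case: eqP => [->|/eqP st].
    by move=> _; rewrite subrr cN0 ltW.
  have st' : s - t != 0 by rewrite subr_eq0.
  have p : 0 < N (s - t) by rewrite cN_gt0.
  have -> : g s - g t - l * (s - t) = ((g s - g t) / (s - t) - l) * (s - t) by field.
  by rewrite cNM ler_pM2r.
- by rewrite /q eqxx.
move=> s; rewrite /q; case: eqP => [->|/eqP st]; first by rewrite subrr; ring.
by rewrite divfK ?subr_eq0 //; ring.
Qed.

Lemma cd_uniq g t l l' : cd g t l -> cd g t l' -> l = l'.
Proof.
move=> /cdP h /cdP h'; apply/eqP; rewrite -subr_eq0; apply/eqP.
apply: (@small_eq0 _ _ K _ 2) => e e0.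
have [a a0 ha] := h e e0; have [b b0 hb] := h' e e0.
pose x : R := Num.min a b / 2.
have m0 : 0 < Num.min a b by rewrite lt_min a0.
have x0 : 0 < x by rewrite /x; lra.
have Nx : N (t + j x - t) = x by rewrite addrC addKr cN_jr gtr0_norm.
have := ha (t + j x); have := hb (t + j x); rewrite Nx.
have : x < Num.min a b by rewrite /x; lra.
rewrite lt_min => /andP[xa xb] /(_ xb) {}hb /(_ xa) {}ha.
have e1 : (l - l') * j x = (g (t + j x) - g t - l' * (t + j x - t)) -
   (g (t + j x) - g t - l * (t + j x - t)) by ring.
have : N ((l - l') * j x) <= 2 * e * x.
  by rewrite e1; apply: le_trans (cN_triB _ _ _) _; lra.
by rewrite cNM cN_jr gtr0_norm // ler_pM2r.
Qed.

Definition hol g t := exists2 d : R, 0 < d &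
  forall s, N (s - t) < d -> exists l, cd g s l.

Definition der g t := xget 0 [set l | cd g t l]%classic.

Lemma derP g t : (exists l, cd g t l) -> cd g t (der g t).
Proof.
by move=> [l h]; rewrite /der; case: xgetP => [x -> //|/(_ l)].
Qed.

Lemma der_eq g t l : cd g t l -> der g t = l.
Proof. by move=> h; apply: (cd_uniq _ h); apply: derP; exists l. Qed.

Lemma hol_cd g t : hol g t -> exists l, cd g t l.
Proof. by move=> [d d0 h]; apply: h; rewrite subrr cN0. Qed.

Lemma hol_cont g t : hol g t -> cont g t.
Proof. by move=> /hol_cd [l /cd_cont]. Qed.

Lemma hol_near g t : hol g t -> exists2 d : R, 0 < d &
  forall s, N (s - t) < d -> hol g s.
Proof.
move=> [d d0 h]; exists d => // s sd; exists (d - N (s - t)); first lra.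
move=> u us; apply: h; have := cN_dist K u s t; lra.
Qed.

Lemma hol2 (op : C -> C -> C) f g t :
  (forall s l l', cd f s l -> cd g s l' -> exists m, cd (fun u => op (f u) (g u)) s m) ->
  hol f t -> hol g t -> hol (fun u => op (f u) (g u)) t.
Proof.
move=> h [a a0 ha] [b b0 hb]; exists (Num.min a b); first by rewrite lt_min a0.
move=> s; rewrite lt_min => /andP[/ha [l hl] /hb [m hm]]; exact: h hl hm.
Qed.

Lemma hol_cst c t : hol (fun=> c) t.
Proof. by exists 1 => // s _; exists 0; apply: cd_cst. Qed.

Lemma hol_id t : hol id t.
Proof. by exists 1 => // s _; exists 1; apply: cd_id. Qed.

Lemma holD f g t : hol f t -> hol g t -> hol (fun u => f u + g u) t.
Proof. by apply: (@hol2 +%R) => s l l' h h'; exists (l + l'); apply: cdD. Qed.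

Lemma holM f g t : hol f t -> hol g t -> hol (fun u => f u * g u) t.
Proof.
by apply: (@hol2 *%R) => s l l' h h'; exists (l * g s + f s * l'); apply: cdM.
Qed.

Lemma holN f t : hol f t -> hol (fun u => - f u) t.
Proof. by move=> [d d0 h]; exists d => // s /h [l hl]; exists (- l); apply: cdN. Qed.

Lemma holB f g t : hol f t -> hol g t -> hol (fun u => f u - g u) t.
Proof. by move=> hf hg; apply: holD hf (holN hg). Qed.

Lemma holV f t : hol f t -> f t != 0 -> hol (fun u => (f u)^-1) t.
Proof.
move=> hf f0; have [a a0 ha] := cont_nz (hol_cont hf) f0; case: hf => [b b0 hb].
have p0 : 0 < N (f t) by rewrite cN_gt0.
exists (Num.min a b); first by rewrite lt_min a0.
move=> s; rewrite lt_min => /andP[/ha fs /hb [l hl]]; exists (- l / f s ^+ 2).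
by apply: cdV => //; rewrite -(cN_gt0 K); lra.
Qed.

Lemma holX f t n : hol f t -> hol (fun u => f u ^+ n) t.
Proof.
by move=> [d d0 h]; exists d => // s /h [l hl]; exists (n%:R * f s ^+ n.-1 * l); apply: cdX.
Qed.

Lemma hol_comp f g t : hol f t -> hol g (f t) -> hol (fun u => g (f u)) t.
Proof.
move=> hf [b b0 hb]; have b2 : 0 < b / 2 by lra.
have [a a0 ha] := hol_cont hf b2; case: hf => [c c0 hc].
exists (Num.min a c); first by rewrite lt_min a0.
move=> s; rewrite lt_min => /andP[/ha fs /hc [l hl]].
by have [|m hm] := hb (f s); [lra | exists (m * l); apply: cd_comp].
Qed.

Lemma hol_ext f g t (d : R) : 0 < d -> (forall s, N (s - t) < d -> f s = g s) ->
  hol f t -> hol g t.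
Proof.
move=> d0 fg [a a0 ha]; exists (Num.min a d); first by rewrite lt_min a0.
move=> s; rewrite lt_min => /andP[/ha [l hl] sd]; exists l.
apply: (@cd_ext f _ _ _ (d - N (s - t))) hl; first lra.
by move=> u us; apply: fg; have := cN_dist K u s t; lra.
Qed.

(** Continuous induction: the supremum of the [t] with [Rel a t] is attained and cannot be less than
    [b]. It stands in for compactness of the segment in the mean value inequality, the identity
    theorem, all continuations along paths and the growth estimate. *)
Lemma chain (Rel : R -> R -> Prop) (a b : R) : a <= b ->
  (forall x y z, Rel x y -> Rel y z -> Rel x z) ->
  (forall t : R, a <= t <= b -> exists2 d : R, 0 < d &
     (forall x : R, a <= x <= t -> t - d < x -> Rel x t) /\
     (forall y : R, t <= y <= b -> y < t + d -> Rel t y)) -> Rel a b.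
Proof.
move=> ab tr loc.
pose S := [set t : R | a <= t <= b /\ Rel a t]%classic.
have Sa : S a.
  have [d d0 [h _]] := loc a (introT andP (conj (lexx a) ab)).
  by split; [rewrite lexx | apply: h; rewrite ?lexx //; lra].
have Sub : has_sup S by split; [exists a | exists b => t [/andP[]]].
pose c := sup S.
have ac : a <= c by apply: ub_le_sup => //; case: Sub.
have cb : c <= b by apply: ge_sup; [exists a | move=> t [/andP[]]].
have [d d0 [hl hr]] := loc c (introT andP (conj ac cb)).
have Rc : Rel a c.
  have [t [/andP[at' tb] Rt] ct] := sup_adherent d0 Sub.
  have tc : t <= c by apply: ub_le_sup; [case: Sub | rewrite /S /= at' tb].
  by apply: tr Rt (hl _ _ ct); rewrite at'.
case: (leP b (c + d / 2)) => [bc|cb'].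
  by apply: tr Rc (hr _ _ _); rewrite ?cb ?lexx //; lra.
have : S (c + d / 2).
  split; first by apply/andP; split; lra.
  by apply: tr Rc (hr _ _ _); [apply/andP; split; lra | lra].
by move=> /(ub_le_sup (proj2 Sub)); rewrite -/c; lra.
Qed.

(** [chain] is applied to the estimate with the slack [e], which absorbs the remainder of
    differentiability at each point and is removed at the end. *)
Lemma mvt g p q (M : R) :
  (forall x : R, 0 <= x <= 1 -> exists2 l, cd g (p + j x * (q - p)) l & N l <= M) ->
  N (g q - g p) <= M * N (q - p).
Proof.
move=> h; pose c x := p + j x * (q - p).
have c0 : c 0 = p by rewrite /c rmorph0; ring.
have c1 : c 1 = q by rewrite /c rmorph1; ring.
have cc x y : N (c y - c x) = `|y - x| * N (q - p).
  have -> : c y - c x = j (y - x) * (q - p) by rewrite /c rmorphB; ring.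
  by rewrite cNM cN_jr.
apply/ler_addgt0Pr => e e0; set L := N (q - p).
have L0 : 0 <= L by apply: cN_ge0.
have L1 : 0 < L + 1 by lra.
pose Rel (x y : R) := N (g (c y) - g (c x)) <= (M * L + e) * (y - x).
suff : Rel 0 1 by rewrite /Rel c0 c1 subr0 mulr1.
apply: (@chain Rel 0 1 ler01) => [x y z xy yz|t t01].
  rewrite /Rel; apply: le_trans (cN_dist K _ (g (c y)) _) _.
  by rewrite /Rel in xy yz; lra.
have [l hl lM] := h t t01; move/cdP: hl => /(_ (e / (L + 1))).
rewrite divr_gt0 // => /(_ isT) [d d0 hd].
have key (x : R) : `|x - t| * (L + 1) < d ->
    N (g (c x) - g (c t)) <= (M * L + e) * `|x - t|.
  move=> xd; have a0 : 0 <= `|x - t| by [].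
  have cd1 : N (c x - c t) < d.
    by rewrite cc; apply: le_lt_trans xd; rewrite ler_wpM2l //; rewrite -/L; lra.
  have := hd _ cd1; rewrite cc -/L => k.
  have -> : g (c x) - g (c t) = (g (c x) - g (c t) - l * (c x - c t)) + l * (c x - c t).
    by ring.
  apply: le_trans (cN_tri _ _ _) _; rewrite cNM cc -/L.
  have k1 : e / (L + 1) * (`|x - t| * L) <= e * `|x - t|.
    have -> : e / (L + 1) * (`|x - t| * L) = e * `|x - t| * (L / (L + 1)).
      by field; rewrite gt_eqF.
    by rewrite ler_piMr ?mulr_ge0 ?(ltW e0) // ler_pdivrMr //; lra.
  have k2 : N l * (`|x - t| * L) <= M * (`|x - t| * L).
    by rewrite ler_wpM2r // mulr_ge0.
  by apply: le_trans (lerD (le_trans k k1) k2) _; lra.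
exists (d / (L + 1)); first by rewrite divr_gt0.
split=> [x /andP[_ xt] tx|y /andP[ty _] yt]; rewrite /Rel.
  have e1 : `|x - t| = t - x by rewrite ler0_norm; lra.
  rewrite cNB -e1; apply: key; rewrite e1 -ltr_pdivlMr //; lra.
have e1 : `|y - t| = y - t by rewrite ger0_norm; lra.
rewrite -e1; apply: key; rewrite e1 -ltr_pdivlMr //; lra.
Qed.

End Calculus.

Lemma le4 (a b c d n : nat) : (a + b + c + d <= n)%N ->
  [/\ (a <= n)%N, (b <= n)%N, (c <= n)%N & (d <= n)%N].
Proof. by move=> h; split; lia. Qed.

Lemma in_unit (R : realType) (u s d : R) : 0 <= u -> u + d <= 1 -> u <= s <= u + d -> 0 <= s <= 1.
Proof. by lra. Qed.

Lemma close_in (R : realType) (u s x d : R) : u <= s <= u + d -> u <= x <= u + d -> `|s - x| <= d.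
Proof. by rewrite ler_norml; lra. Qed.

Lemma half_in (R : realType) (x d s : R) : 0 < d -> s = x \/ s = x + d / 2 ->
  x <= s /\ s + d / 2 <= x + d.
Proof. by move=> d0 [] ->; lra. Qed.

(** * Goursat's lemma for trapezoid sums over a parametrized square *)

Section Goursat.
Variables (R : realType) (C : numClosedFieldType) (K : cdata R C).
Notation j := (jr K).
Notation N := (cN K).

Definition tz (h : C -> C) (p q : C) := (h p + h q) / 2 * (q - p).

(* Trapezoid sum of [h dz] over the curve [c] on [x, x + d], with 2^n steps. *)
Fixpoint esum (h : C -> C) (c : R -> C) (n : nat) (x d : R) : C :=
  if n is m.+1 then esum h c m x (d / 2) + esum h c m (x + d / 2) (d / 2)
  else tz h (c x) (c (x + d)).

(* Trapezoid sums of affine functions telescope; this is the error term. *)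
Lemma esum_approx h c n (x d al L e : R) (a b : C) :
  0 <= d -> 0 <= e -> 0 <= L ->
  (forall s t, x <= s <= x + d -> x <= t <= x + d -> N (c s - c t) <= L * `|s - t|) ->
  (forall s, x <= s <= x + d -> N (h (c s) - a - b * c s) <= e) ->
  N (esum h c n x d - (a * c (x + d) + b / 2 * c (x + d) ^+ 2)
     + (a * c x + b / 2 * c x ^+ 2)) <= e * L * d.
Proof.
move=> + e0 L0; elim: n x d => [|n ih] x d d0 hc hh.
  have h1 := hh x; have h2 := hh (x + d).
  rewrite /= /tz.
  have -> : (h (c x) + h (c (x + d))) / 2 * (c (x + d) - c x) -
      (a * c (x + d) + b / 2 * c (x + d) ^+ 2) + (a * c x + b / 2 * c x ^+ 2) =
      ((h (c x) - a - b * c x) + (h (c (x + d)) - a - b * c (x + d))) / 2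
        * (c (x + d) - c x) by field.
  rewrite !cNM cNV cN_nat; apply: (@le_trans _ _ ((e + e) / 2 * (L * d))).
    apply: ler_pM; rewrite ?mulr_ge0 ?cN_ge0 ?invr_ge0 //.
      have {}h1 := h1 ltac:(apply/andP; split; lra).
      have {}h2 := h2 ltac:(apply/andP; split; lra).
      by have := cN_tri K (h (c x) - a - b * c x) (h (c (x + d)) - a - b * c (x + d)); lra.
    have := hc (x + d) x; rewrite addrAC subrr add0r ger0_norm // => -> //;
    apply/andP; split; lra.
  by lra.
have d20 : 0 <= d / 2 by lra.
rewrite /=; set m := x + d / 2.
have e1 : x + d = m + d / 2 by rewrite /m; lra.
have lm : x <= m by rewrite /m; lra.
have mr : m <= x + d by rewrite /m; lra.
set A := esum _ _ _ x _; set B := esum _ _ _ m _.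
have H1 : N (A - (a * c m + b / 2 * c m ^+ 2) + (a * c x + b / 2 * c x ^+ 2)) <=
    e * L * (d / 2).
  apply: ih => // [s t /andP[s1 s2] /andP[t1 t2]|s /andP[s1 s2]].
    by apply: hc; apply/andP; split; rewrite ?e1; lra.
  by apply: hh; apply/andP; split; rewrite ?e1; lra.
have H2 : N (B - (a * c (x + d) + b / 2 * c (x + d) ^+ 2) +
    (a * c m + b / 2 * c m ^+ 2)) <= e * L * (d / 2).
  rewrite e1; apply: ih => // [s t /andP[s1 s2] /andP[t1 t2]|s /andP[s1 s2]].
    by apply: hc; apply/andP; split; rewrite ?e1; lra.
  by apply: hh; apply/andP; split; rewrite ?e1; lra.
have -> : A + B - (a * c (x + d) + b / 2 * c (x + d) ^+ 2) + (a * c x + b / 2 * c x ^+ 2) =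
   (A - (a * c m + b / 2 * c m ^+ 2) + (a * c x + b / 2 * c x ^+ 2)) +
   (B - (a * c (x + d) + b / 2 * c (x + d) ^+ 2) + (a * c m + b / 2 * c m ^+ 2)) by ring.
apply: le_trans (cN_tri _ _ _) _.
by apply: le_trans (lerD H1 H2) _; lra.
Qed.

Definition bsum h (phi : R -> R -> C) n x y d :=
  esum h (phi^~ y) n x d + esum h (phi (x + d)) n y d
  - esum h (phi^~ (y + d)) n x d - esum h (phi x) n y d.

(** The identity is exact because one more halving is a concatenation of the sums over the two
    halves, and the inner sides cancel. *)
Lemma bsumS h phi n x y d : bsum h phi n.+1 x y d =
  bsum h phi n x y (d / 2) + bsum h phi n (x + d / 2) y (d / 2) +
  bsum h phi n x (y + d / 2) (d / 2) + bsum h phi n (x + d / 2) (y + d / 2) (d / 2).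
Proof.
have e (z : R) : z + d / 2 + d / 2 = z + d by lra.
rewrite /bsum /= !e; ring.
Qed.

Variables (h : C -> C) (phi : R -> R -> C) (L : R).
Hypothesis L0 : 0 <= L.
Hypothesis lipx : forall x x' y, 0 <= x <= 1 -> 0 <= x' <= 1 -> 0 <= y <= 1 ->
  N (phi x y - phi x' y) <= L * `|x - x'|.
Hypothesis lipy : forall x y y', 0 <= x <= 1 -> 0 <= y <= 1 -> 0 <= y' <= 1 ->
  N (phi x y - phi x y') <= L * `|y - y'|.
Hypothesis hcd : forall x y, 0 <= x <= 1 -> 0 <= y <= 1 -> exists l, cd K h (phi x y) l.

(** The lower bound is asked for arbitrarily large [n], not for all [n]: this passes to one of the
    four quarters, since four eventual upper bounds would add up. *)
Let bad (c : R) (k : nat) (s : R * R) :=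
  [/\ 0 <= s.1, s.1 + 2 ^- k <= 1, 0 <= s.2, s.2 + 2 ^- k <= 1 &
      forall n0, exists2 n, (n0 <= n)%N & c * (2 ^- k) ^+ 2 < N (bsum h phi n s.1 s.2 (2 ^- k))].

Let half k : 2 ^- k.+1 = 2 ^- k / 2 :> R.
Proof. by rewrite exprS invfM mulrC. Qed.

Lemma bad_step c k s : bad c k s -> exists s' : R * R, bad c k.+1 s' /\
  [/\ s.1 <= s'.1, s'.1 + 2 ^- k.+1 <= s.1 + 2 ^- k, s.2 <= s'.2 &
      s'.2 + 2 ^- k.+1 <= s.2 + 2 ^- k].
Proof.
case: s => x y [/= x0 x1 y0 y1 hb]; set d := 2 ^- k in x1 y1 hb *.
have d0 : 0 < d by rewrite invr_gt0 exprn_gt0.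
apply: contrapT => nex.
have good s : s.1 = x \/ s.1 = x + d / 2 -> s.2 = y \/ s.2 = y + d / 2 ->
    exists n0, forall n, (n0 <= n)%N ->
      N (bsum h phi n s.1 s.2 (d / 2)) <= c * (d / 2) ^+ 2.
  move=> h1 h2; apply: contrapT => ng; apply: nex; exists s; rewrite half -/d.
  have [l1 r1] := half_in d0 h1; have [l2 r2] := half_in d0 h2.
  split; last by split.
  rewrite /bad half -/d; split.
  - exact: le_trans l1.
  - exact: le_trans x1.
  - exact: le_trans l2.
  - exact: le_trans y1.
  move=> n0; apply: contrapT => nn; apply: ng; exists n0 => n hn.
  by rewrite leNgt; apply/negP => lt; apply: nn; exists n.
have [n1 g1] := good (x, y) (or_introl erefl) (or_introl erefl).
have [n2 g2] := good (x + d / 2, y) (or_intror erefl) (or_introl erefl).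
have [n3 g3] := good (x, y + d / 2) (or_introl erefl) (or_intror erefl).
have [n4 g4] := good (x + d / 2, y + d / 2) (or_intror erefl) (or_intror erefl).
have [n] := hb (n1 + n2 + n3 + n4).+1; case: n => // n; rewrite ltnS => hn.
rewrite ltNge => /negP; apply; rewrite bsumS.
have k1 := g1 n; have k2 := g2 n; have k3 := g3 n; have k4 := g4 n.
have [l1 l2 l3 l4] := le4 hn.
have {}k1 := k1 l1; have {}k2 := k2 l2; have {}k3 := k3 l3; have {}k4 := k4 l4.
rewrite /= in k1 k2 k3 k4.
apply: le_trans (cN_tri _ _ _) _; apply: le_trans (lerD (cN_tri _ _ _) k4) _.
apply: le_trans (lerD (lerD (cN_tri _ _ _) k3) (lexx _)) _.
apply: le_trans (lerD (lerD (lerD k1 k2) (lexx _)) (lexx _)) _.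
have -> : (d / 2) ^+ 2 = d ^+ 2 / 4 by field.
lra.
Qed.

(** The sums of an affine function cancel around the square, so that only the errors of
    [esum_approx] on the four sides remain. *)
Lemma bsum_small n x y d (P l : C) (e : R) : 0 <= x -> x + d <= 1 -> 0 <= y ->
  y + d <= 1 -> 0 <= d -> 0 <= e ->
  (forall s t, x <= s <= x + d -> y <= t <= y + d ->
    N (h (phi s t) - h P - l * (phi s t - P)) <= e) ->
  N (bsum h phi n x y d) <= 4 * (e * L * d).
Proof.
move=> x0 x1 y0 y1 d0 e0 hs; set a := h P - l * P.
have ea (z : C) : h z - a - l * z = h z - h P - l * (z - P) by rewrite /a; ring.
pose G p : C := a * p + l / 2 * p ^+ 2.
have Hx t : y <= t <= y + d -> N (esum h (phi^~ t) n x d - G (phi (x + d) t) + G (phi x t))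
    <= e * L * d.
  move=> ht; apply: esum_approx => // [s s' h1 h2|s h1]; last by rewrite ea; apply: hs.
  exact: lipx (in_unit x0 x1 h1) (in_unit x0 x1 h2) (in_unit y0 y1 ht).
have Hy s : x <= s <= x + d -> N (esum h (phi s) n y d - G (phi s (y + d)) + G (phi s y))
    <= e * L * d.
  move=> k; apply: esum_approx => // [t t' h1 h2|t h1]; last by rewrite ea; apply: hs.
  exact: lipy (in_unit x0 x1 k) (in_unit y0 y1 h1) (in_unit y0 y1 h2).
have q1 := Hx y ltac:(apply/andP; split; lra).
have q2 := Hx (y + d) ltac:(apply/andP; split; lra).
have q3 := Hy x ltac:(apply/andP; split; lra).
have q4 := Hy (x + d) ltac:(apply/andP; split; lra).
rewrite /bsum; move: q1 q2 q3 q4.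
set E1 := esum _ (phi^~ y) _ _ _; set E2 := esum _ (phi^~ (y + d)) _ _ _.
set E3 := esum _ (phi x) _ _ _; set E4 := esum _ (phi (x + d)) _ _ _.
move=> q1 q2 q3 q4.
have -> : E1 + E4 - E2 - E3 = (E1 - G (phi (x + d) y) + G (phi x y))
  + (E4 - G (phi (x + d) (y + d)) + G (phi (x + d) y))
  - (E2 - G (phi (x + d) (y + d)) + G (phi x (y + d)))
  - (E3 - G (phi x (y + d)) + G (phi x y)) by ring.
apply: le_trans (cN_triB _ _ _) _; apply: le_trans (lerD (cN_triB _ _ _) q3) _.
apply: le_trans (lerD (lerD (cN_tri _ _ _) q2) (lexx _)) _.
by apply: le_trans (lerD (lerD (lerD q1 q4) (lexx _)) (lexx _)) _; lra.
Qed.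

(** Goursat's bisection. The bad squares shrink to a point [(X, Y)]; differentiability of [h] at
    [phi X Y] makes [h] affine there up to [e] times the distance, and the boundary sum is at most
    [c] times the square of the side. *)
Lemma goursat (c : R) : 0 < c -> exists n0, forall n, (n0 <= n)%N ->
  N (bsum h phi n 0 0 1) <= c.
Proof.
move=> c0; have L0' := L0; apply: contrapT => nex.
have bad0 : bad c 0 (0, 0).
  rewrite /bad /= expr0 invr1; split; try lra.
  move=> n0; apply: contrapT => nn; apply: nex; exists n0 => n hn.
  rewrite leNgt; apply/negP => lt; apply: nn; exists n => //.
  by rewrite expr1n mulr1.
have step (ks : nat * (R * R)) : exists s' : R * R, bad c ks.1 ks.2 ->
    bad c ks.1.+1 s' /\ [/\ ks.2.1 <= s'.1,
    s'.1 + 2 ^- ks.1.+1 <= ks.2.1 + 2 ^- ks.1, ks.2.2 <= s'.2 &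
      s'.2 + 2 ^- ks.1.+1 <= ks.2.2 + 2 ^- ks.1].
  case: ks => k s /=.
  case: (pselect (bad c k s)) => [/bad_step [s' hs']|nb]; first by exists s'.
  by exists s.
pose f ks := projT1 (cid (step ks)); pose hf ks := projT2 (cid (step ks)).
pose u := fix u k := if k is m.+1 then f (m, u m) else (0, 0) : R * R.
have bu k : bad c k (u k).
  by elim: k => // k ih; have [] := hf (k, u k) ih.
have su k : [/\ (u k).1 <= (u k.+1).1, (u k.+1).1 + 2 ^- k.+1 <= (u k).1 + 2 ^- k,
    (u k).2 <= (u k.+1).2 & (u k.+1).2 + 2 ^- k.+1 <= (u k).2 + 2 ^- k].
  by have [_] := hf (k, u k) (bu k).
have mono k m : [/\ (u k).1 <= (u (k + m)%N).1,
    (u (k + m)%N).1 + 2 ^- (k + m) <= (u k).1 + 2 ^- k,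
    (u k).2 <= (u (k + m)%N).2 & (u (k + m)%N).2 + 2 ^- (k + m) <= (u k).2 + 2 ^- k].
  elim: m => [|m [i1 i2 i3 i4]]; first by rewrite addn0; split; apply: lexx.
  rewrite addnS; have [j1 j2 j3 j4] := su (k + m)%N.
  by split; [exact: le_trans j1 | exact: le_trans i2 | exact: le_trans j3 | exact: le_trans i4].
have p2 k : 0 < 2 ^- k :> R by rewrite invr_gt0 exprn_gt0.
have cmp k m : (u m).1 <= (u k).1 + 2 ^- k /\ (u m).2 <= (u k).2 + 2 ^- k.
  have := p2 k; have := p2 m; case: (leqP k m) => [km|/ltnW mk] hm hk.
    by have := mono k (m - k)%N; rewrite subnKC // => -[]; lra.
  by have := mono m (k - m)%N; rewrite subnKC // => -[]; lra.
have lim (v : nat -> R) : (forall k m, v m <= v k + 2 ^- k) ->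
    exists l, forall k, v k <= l <= v k + 2 ^- k.
  move=> hv; pose S := [set v k | k in setT]%classic.
  have S0 : S (v 0%N) by exists 0%N.
  have Sub : has_sup S.
    by split; [exists (v 0%N) | exists (v 0%N + 2 ^- 0) => _ [m _ <-]].
  exists (sup S) => k; apply/andP; split.
    by apply: ub_le_sup; [case: Sub | exists k].
  by apply: ge_sup; [exists (v 0%N) | move=> _ [m _ <-]].
have [X hX] := lim (fun k => (u k).1) (fun k m => (cmp k m).1).
have [Y hY] := lim (fun k => (u k).2) (fun k m => (cmp k m).2).
have X01 : 0 <= X <= 1.
  have [x0 x1 _ _ _] := bu 0%N; have hx := hX 0%N; rewrite expr0 invr1 in x1 hx.
  exact: in_unit x0 x1 hx.
have Y01 : 0 <= Y <= 1.
  have [_ _ y0 y1 _] := bu 0%N; have hy := hY 0%N; rewrite expr0 invr1 in y1 hy.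
  exact: in_unit y0 y1 hy.
have [l /cdP hl] := hcd X01 Y01; set P := phi X Y in hl.
(* The final bound is [8 e L^2 d^2], and this choice makes it at most [c / 2 * d^2]; [L + 1] avoids
   a division by zero. *)
pose e := c / (16 * (L + 1) ^+ 2).
have Ln : L + 1 != 0 by rewrite gt_eqF // ltr_wpDl.
have L1 : 0 < (L + 1) ^+ 2 by rewrite exprn_gt0 // ltr_wpDl.
have e0 : 0 < e by rewrite /e divr_gt0 // mulr_gt0.
have [dl dl0 hdl] := hl e e0.
have [k hk] : exists k, 2 ^- k * (2 * (L + 1)) < dl.
  have pos : 0 < 2 * (L + 1) / dl by rewrite divr_gt0 //; lra.
  exists (Num.bound (2 * (L + 1) / dl)).
  have hb := archi_boundP (ltW pos); set k := Num.bound _ in hb *.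
  have kk : (k%:R : R) <= 2 ^+ k by rewrite -natrX ler_nat ltnW // ltn_expl.
  have := lt_le_trans hb kk; rewrite ltr_pdivrMr // => h1.
  by rewrite [X in X < _]mulrC ltr_pdivrMr ?exprn_gt0 // [X in _ < X]mulrC.
have [x0 x1 y0 y1 /(_ 0%N) [n _]] := bu k.
rewrite ltNge => /negP; apply; set d := 2 ^- k in hk x1 y1 *.
have d0 : 0 < d by apply: p2.
have := hX k; have := hY k; rewrite -/d => /andP[Yl Yr] /andP[Xl Xr].
have near s t : (u k).1 <= s <= (u k).1 + d -> (u k).2 <= t <= (u k).2 + d ->
    N (phi s t - P) <= 2 * L * d.
  move=> hs ht; have t01 := in_unit y0 y1 ht.
  have b1 := lipx (in_unit x0 x1 hs) X01 t01; have b2 := lipy X01 t01 Y01.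
  have c1 := ler_wpM2l L0 (close_in hs (hX k)); have c2 := ler_wpM2l L0 (close_in ht (hY k)).
  apply: le_trans (cN_dist K _ (phi X t) _) _.
  by apply: le_trans (lerD (le_trans b1 c1) (le_trans b2 c2)) _; rewrite -/d -mulrA mulr_natl mulr2n.
have bs : N (bsum h phi n (u k).1 (u k).2 d) <= 4 * (e * (2 * L * d) * L * d).
  apply: (@bsum_small _ _ _ _ P l) => //; first exact: ltW.
    by rewrite mulr_ge0 ?(ltW e0) // mulr_ge0 ?(ltW d0) // mulr_ge0.
  move=> s t hs ht; have nr := near s t hs ht.
  have nd : N (phi s t - P) < dl.
    apply: le_lt_trans nr _; apply: le_lt_trans hk.
    by rewrite [leRHS]mulrC ler_wpM2r ?(ltW d0) // ler_wpM2l // lerDl.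
  by apply: le_trans (hdl _ nd) _; rewrite ler_wpM2l // ltW.
apply: le_trans bs _.
have -> : 4 * (e * (2 * L * d) * L * d) = (8 * e * L ^+ 2) * d ^+ 2 by ring.
rewrite ler_pM2r ?exprn_gt0 //.
have -> : 8 * e * L ^+ 2 = c / 2 * (L ^+ 2 / (L + 1) ^+ 2).
  by rewrite /e; field.
have : L ^+ 2 / (L + 1) ^+ 2 <= 1.
  by rewrite ler_pdivrMr // mul1r lerXn2r ?nnegrE ?addr_ge0 // lerDl.
move=> h1; apply: le_trans (ler_wpM2l _ h1) _; first by rewrite divr_ge0 // ltW.
by rewrite mulr1 ler_pdivrMr // ler_pMr // ler1n.
Qed.

End Goursat.

(** * Roots of unity and Cauchy's formula *)

Section Circle.
Variables (R : realType) (C : numClosedFieldType) (K : cdata R C).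
Notation j := (jr K).
Notation N := (cN K).
Implicit Types (x y r : R) (n : nat).

Definition cis x : C := j (cos x) + 'i * j (sin x).

Lemma cis0 : cis 0 = 1.
Proof. by rewrite /cis cos0 sin0 rmorph1 rmorph0 mulr0 addr0. Qed.

Lemma cisD x y : cis (x + y) = cis x * cis y.
Proof.
rewrite /cis cosD sinD rmorphB !rmorphD !rmorphM.
have : ('i : C) ^+ 2 = -1 := sqrCi C.
set i := 'i; set a := j (cos x); set b := j (cos y); set c := j (sin x); set d := j (sin y) => i2.
have -> : (a + i * c) * (b + i * d) = a * b + i * (a * d + c * b) + i ^+ 2 * (c * d) by ring.
by rewrite i2; ring.
Qed.

Lemma N_cis x : N (cis x) = 1.
Proof.
apply: (@pexpIrn _ 2) => //; rewrite ?nnegrE ?cN_ge0 ?ler01 //.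
rewrite expr1n -cNX; apply: (@jr_inj _ _ K); rewrite cNE normrX.
rewrite normC2_Re_Im rmorph1 /cis.
have re z w : 'Re (j z + 'i * j w) = j z.
  by apply: Re_rect; apply: jr_real.
have im z w : 'Im (j z + 'i * j w) = j w.
  by apply: Im_rect; apply: jr_real.
by rewrite re im -!rmorphXn -rmorphD cos2Dsin2 rmorph1.
Qed.

Lemma cis_neq0 x : cis x != 0.
Proof. by rewrite -(cN_gt0 K) N_cis. Qed.

Lemma cis2pi : cis (2 * pi) = 1.
Proof.
by rewrite /cis mulr_natl cos2pi sin2pi rmorph1 rmorph0 mulr0 addr0.
Qed.

Lemma cisX x n : cis x ^+ n = cis (n%:R * x).
Proof.
elim: n => [|n ih]; first by rewrite mul0r cis0.
by rewrite exprSr ih -cisD -natr1; congr cis; ring.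
Qed.

Lemma sin_le_norm x : `|sin x| <= `|x|.
Proof.
have pos y : 0 <= y -> `|sin y| <= y.
  move=> y0.
  have d1 z : z \in `]0, y[ -> is_derive z 1 (@sin R) (cos z).
    by move=> _; apply: is_derive_sin.
  have c1 : {within `[0, y], continuous (@sin R)}%classic.
    by apply: continuous_subspaceT => z; apply: continuous_sin.
  have [c _] := MVT_segment y0 d1 c1; rewrite sin0 !subr0 => ->.
  by rewrite normrM (ger0_norm y0) ler_piMl // cos_max.
case: (leP 0 x) => [x0|/ltW x0]; first by rewrite [leRHS]ger0_norm // pos.
by rewrite -normrN -sinN [leRHS]ler0_norm // pos // oppr_ge0.
Qed.

Lemma cos_sub1 x : `|cos x - 1| <= x ^+ 2.
Proof.
have h : cos x = 1 - 2 * sin (x / 2) ^+ 2.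
  have -> : x = (x / 2) *+ 2 by rewrite mulr2n; lra.
  rewrite cos_mulr2n; have := cos2Dsin2 (x / 2).
  have -> : (x / 2) *+ 2 / 2 = x / 2 by rewrite mulr2n; lra.
  by rewrite mulr2n; lra.
have := sin_le_norm (x / 2).
rewrite -(ler_pXn2r (n := 2)) ?nnegrE // !real_normK ?num_real // expr_div_n => b.
have s0 : 0 <= sin (x / 2) ^+ 2 by apply: sqr_ge0.
have x0 : 0 <= x ^+ 2 by apply: sqr_ge0.
rewrite h ler_norml; apply/andP; split; lra.
Qed.

Lemma cis_lip x y : N (cis x - cis y) <= 3 * `|x - y|.
Proof.
have -> : cis x - cis y = cis y * (cis (x - y) - 1).
  have e : y + (x - y) = x by ring.
  by rewrite mulrBr -cisD mulr1 e.
rewrite cNM N_cis mul1r; set u := x - y.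
case: (leP `|u| 1) => u1; last first.
  apply: le_trans (cN_triB _ _ _) _; rewrite N_cis cN1; lra.
have -> : cis u - 1 = j (cos u - 1) + 'i * j (sin u) by rewrite /cis rmorphB rmorph1; ring.
apply: le_trans (cN_tri _ _ _) _; rewrite cNM cN_i !cN_jr mul1r.
have := cos_sub1 u; have := sin_le_norm u; have := normr_ge0 u.
have : u ^+ 2 <= `|u| by rewrite -real_normK ?num_real // expr2 ler_piMl.
lra.
Qed.

Definition rt n i := cis (i%:R * (2 * pi / 2 ^+ n)).

Lemma rtE n i : rt n i = rt n 1 ^+ i.
Proof. by rewrite /rt cisX mul1r. Qed.

Lemma rt_full n : rt n (2 ^ n) = 1.
Proof.
rewrite /rt natrX; have -> : 2 ^+ n * (2 * pi / 2 ^+ n) = 2 * pi :> R.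
  by rewrite mulrC divfK // expf_neq0 // pnatr_eq0.
exact: cis2pi.
Qed.

Lemma N_rt n i : N (rt n i) = 1. Proof. exact: N_cis. Qed.
Lemma rt_neq0 n i : rt n i != 0. Proof. exact: cis_neq0. Qed.

(** Discrete form of the integral of [g(z) dz / (2 i pi z)] over the circle of radius [r]. *)
Definition avg n (g : C -> C) (r : R) : C :=
  (2 ^+ n)^-1 * \sum_(i < 2 ^ n) g (j r * rt n i).

Lemma avg_le n g r (M : R) : 0 <= r -> (forall z, N z = r -> N (g z) <= M) ->
  N (avg n g r) <= M.
Proof.
move=> r0 h; rewrite cNM cNV cNX cN_nat.
have p : 0 < 2 ^+ n :> R by rewrite exprn_gt0.
rewrite mulrC ler_pdivrMr //; apply: le_trans (cN_sum _ _ _ _) _.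
apply: le_trans (ler_sum _ _) _.
  by move=> i _; apply: h; rewrite cNM cN_jr N_rt mulr1 ger0_norm.
by rewrite sumr_const card_ord -[M *+ _]mulr_natr natrX.
Qed.

Lemma avg_ext n g h r : 0 <= r -> (forall z, N z = r -> g z = h z) -> avg n g r = avg n h r.
Proof.
move=> r0 e; rewrite /avg; congr (_ * _); apply: eq_bigr => i _; apply: e.
by rewrite cNM cN_jr N_rt mulr1 ger0_norm.
Qed.

Lemma avgZ n c g r : avg n (fun z => c * g z) r = c * avg n g r.
Proof. by rewrite /avg -mulr_sumr mulrCA. Qed.

Lemma avgB n g h r : avg n (fun z => g z - h z) r = avg n g r - avg n h r.
Proof. by rewrite /avg sumrB mulrBr. Qed.

Lemma avg_cst n c r : avg n (fun=> c) r = c.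
Proof.
rewrite /avg sumr_const card_ord -[c *+ _]mulr_natl natrX mulKf //.
by rewrite expf_neq0 ?pnatr_eq0 //.
Qed.

Lemma esumE h (c : R -> C) n x d : esum h c n x d =
  \sum_(i < 2 ^ n) tz h (c (x + i%:R * (d / 2 ^+ n))) (c (x + i.+1%:R * (d / 2 ^+ n))).
Proof.
elim: n x d => [|n ih] x d.
  by rewrite big_ord1 /= expr0 divr1 mul0r addr0 mul1r.
rewrite /= !ih expnS mul2n -addnn big_split_ord /=.
have p : 2 ^+ n != 0 :> R by rewrite expf_neq0 ?pnatr_eq0 //.
have e : d / 2 / 2 ^+ n = d / 2 ^+ n.+1 by rewrite exprS; field.
congr (_ + _); apply: eq_bigr => i _; rewrite e //.
congr (tz h (c _) (c _)).
  by rewrite natrD natrX exprS; field.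
by rewrite -addnS natrD natrX exprS; field.
Qed.

Lemma sum_shift (f : nat -> C) m : f m = f 0%N ->
  \sum_(i < m) f i.+1 = \sum_(i < m) f i.
Proof.
case: m => [|m] e; first by rewrite !big_ord0.
by rewrite big_ord_recr big_ord_recl /= addrC e.
Qed.

(** A shift of the summation index around the closed circle gathers the two trapezoid weights of
    each point; their sum is [(zeta - zeta^-1) / 2] with [zeta] the primitive root. *)
Lemma esum_circle h (a : C) r n :
  esum h (fun y => a + j r * cis (2 * pi * y)) n 0 1 =
  2 ^+ n * ((rt n 1 - (rt n 1)^-1) / 2) * avg n (fun z => h (a + z) * z) r.
Proof.
rewrite esumE /avg.
have p : 2 ^+ n != 0 :> C by rewrite expf_neq0 ?pnatr_eq0 //.
have pR : 2 ^+ n != 0 :> R by rewrite expf_neq0 ?pnatr_eq0 //.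
have cE i : cis (2 * pi * (0 + i%:R * (1 / 2 ^+ n))) = rt n i.
  by rewrite /rt; congr cis; field.
set w := fun i : nat => j r * rt n i.
set k := fun i : nat => h (a + w i).
have wp : w (2 ^ n)%N = w 0%N by rewrite /w rt_full rtE expr0.
have kp : k (2 ^ n)%N = k 0%N by rewrite /k wp.
have z0 := rt_neq0 n 1.
have wS i : w i.+1 = rt n 1 * w i by rewrite /w !(rtE n i) rtE exprS; ring.
have wS' i : w i = (rt n 1)^-1 * w i.+1 by rewrite wS mulKf.
rewrite (eq_bigr (fun i : 'I_(2 ^ n) => 2^-1 * (k i.+1 * w i.+1 - k i * w i) +
   2^-1 * (rt n 1 * (k i * w i) - (rt n 1)^-1 * (k i.+1 * w i.+1)))); last first.
  move=> i _; rewrite /tz !cE -/(w i) -/(w i.+1) -/(k i) -/(k i.+1).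
  have -> : rt n 1 * (k i * w i) = k i * w i.+1 by rewrite wS; ring.
  have -> : (rt n 1)^-1 * (k i.+1 * w i.+1) = k i.+1 * w i by rewrite mulrCA -wS'.
  by field.
rewrite big_split /= -!mulr_sumr !sumrB -!mulr_sumr.
rewrite (@sum_shift (fun i => k i * w i)) ?kp ?wp //.
rewrite subrr mulr0 add0r.
have -> : \sum_(i < 2 ^ n) h (a + j r * rt n i) * (j r * rt n i) =
  \sum_(i < 2 ^ n) k i * w i by [].
by field; rewrite p z0.
Qed.

Definition wind n : C := 2 ^+ n * ((rt n 1 - (rt n 1)^-1) / 2).

(** [wind n] equals [2^n i sin (2 pi / 2^n)] and replaces [2 i pi]. By the duplication formula its
    modulus does not decrease, and it is 4 for the fourth roots of unity; a lower bound is enough in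
    order to divide by it. *)
Lemma wind_ge n : 4 <= N (wind (n + 2)).
Proof.
elim: n => [|n ih].
  have e4 : rt 2 1 = 'i.
    rewrite /rt mul1r.
    have -> : 2 * pi / 2 ^+ 2 = pi / 2 :> R by field.
    by rewrite /cis cos_pihalf sin_pihalf rmorph0 rmorph1 mulr1 add0r.
  rewrite /wind e4 invCi.
  have -> : 2 ^+ 2 * (('i - - 'i) / 2) = 4 * 'i :> C by field.
  by rewrite cNM cN_i cN_nat mulr1.
apply: le_trans ih _; rewrite addSn; set m := (n + 2)%N.
have sq : rt m 1 = rt m.+1 1 ^+ 2.
  rewrite /rt cisX; congr cis; rewrite exprS; field; rewrite expf_neq0 ?pnatr_eq0 //.
have z0 := rt_neq0 m.+1 1.
have -> : wind m = wind m.+1 * ((rt m.+1 1 + (rt m.+1 1)^-1) / 2).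
  by rewrite /wind sq [2 ^+ m.+1]exprS; field.
rewrite cNM ler_piMr ?cN_ge0 // cNM cNV cN_nat.
have := cN_tri K (rt m.+1 1) (rt m.+1 1)^-1; rewrite cNV N_rt invr1; lra.
Qed.

(** Cauchy's integral formula. Goursat's lemma for [h z / (z - t)] compares the circle of radius [r]
    with a small circle around [t], on which the mean is close to [h t] by continuity. *)
Lemma mean_value (h : C -> C) (r : R) (t : C) : N t < r ->
  (forall z, N z <= r -> exists l, cd K h z l) ->
  clim K (fun n => avg n (fun z => h z * (z / (z - t))) r) (h t).
Proof.
move=> tr hh e e0.
have t0 : 0 <= N t by apply: cN_ge0.
have r0 : 0 < r by lra.
have e2 : 0 < e / 2 by lra.
have ct : cont K h t by have [l /cd_cont] := hh t (ltW tr).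
have [d1 d10 hd1] := ct _ e2.
pose d := Num.min (d1 / 2) (r - N t).
have d0 : 0 < d by rewrite lt_min; apply/andP; split; lra.
have dd1 : d <= d1 / 2 by rewrite ge_min lexx.
have drt : d <= r - N t by rewrite ge_min lexx orbT.
(* Linear homotopy from the circle of radius [r] around 0, at [x = 0], to the one of radius [d]
   around [t], at [x = 1]. It stays in the closed disc because [d <= r - N t], and it avoids [t]. *)
pose phi x y : C := j (1 - x) * (j r * cis (2 * pi * y)) + j x * (t + j d * cis (2 * pi * y)).
have pi0 : 0 <= 2 * pi :> R by rewrite mulr_ge0 // pi_ge0.
pose L := 2 * r + 6 * pi * r.
have L0 : 0 <= L.
  by rewrite /L addr_ge0 // ?mulr_ge0 ?(ltW r0) // pi_ge0.
pose H z := h z / (z - t).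
have lipx x x' y : 0 <= x <= 1 -> 0 <= x' <= 1 -> 0 <= y <= 1 ->
    N (phi x y - phi x' y) <= L * `|x - x'|.
  move=> _ _ _.
  have -> : phi x y - phi x' y = j (x - x') * ((t + j d * cis (2 * pi * y)) - j r * cis (2 * pi * y)).
    by rewrite /phi !rmorphB; ring.
  rewrite cNM cN_jr mulrC ler_wpM2r //.
  apply: le_trans (cN_triB _ _ _) _; apply: le_trans (lerD (cN_tri _ _ _) (lexx _)) _.
  rewrite !cNM !cN_jr !N_cis !mulr1 !gtr0_norm //.
  have : 0 <= 6 * pi * r by rewrite !mulr_ge0 ?pi_ge0 // ltW.
  by move: drt; rewrite /L; clear; lra.
have lipy x y y' : 0 <= x <= 1 -> 0 <= y <= 1 -> 0 <= y' <= 1 ->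
    N (phi x y - phi x y') <= L * `|y - y'|.
  move=> /andP[x0 x1] _ _.
  have -> : phi x y - phi x y' = (j ((1 - x) * r + x * d)) * (cis (2 * pi * y) - cis (2 * pi * y')).
    by rewrite /phi !(rmorphD, rmorphN, rmorphM, rmorph1); ring.
  have dr : d <= r by move: drt t0; clear; lra.
  rewrite cNM cN_jr; have := cis_lip (2 * pi * y) (2 * pi * y').
  rewrite -mulrBr normrM ger0_norm // => h1.
  have h2 : `|(1 - x) * r + x * d| <= r.
    rewrite ger0_norm; last by rewrite addr_ge0 // mulr_ge0 ?(ltW r0) ?(ltW d0) // subr_ge0.
    have := ler_wpM2l x0 dr; clear; lra.
  apply: le_trans (ler_pM (normr_ge0 _) (cN_ge0 _ _) h2 h1) _.
  have : 0 <= 2 * r * `|y - y'| by rewrite !mulr_ge0 // ltW.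
  by rewrite /L; clear; lra.
have Hcd x y : 0 <= x <= 1 -> 0 <= y <= 1 -> exists l, cd K H (phi x y) l.
  move=> /andP[x0 x1] _.
  have pt : phi x y - t = j ((1 - x) * r + x * d) * cis (2 * pi * y) - j (1 - x) * t.
    by rewrite /phi !(rmorphD, rmorphN, rmorphM, rmorph1); ring.
  have nz : phi x y - t != 0.
    rewrite -(cN_gt0 K) pt; apply: lt_le_trans (cN_low _ _ _).
    rewrite !cNM N_cis !cN_jr mulr1 (ger0_norm (x := 1 - x)) ?subr_ge0 //.
    rewrite ger0_norm; last by rewrite addr_ge0 // mulr_ge0 ?(ltW r0) ?(ltW d0) // subr_ge0.
    case: (eqVneq x 0) => [->|xn0]; first by move: tr; clear; lra.
    have h1 : 0 < x * d by rewrite mulr_gt0 // lt_def xn0.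
    have x1' : 0 <= 1 - x by rewrite subr_ge0.
    have := ler_wpM2l x1' (ltW tr); move: h1; clear; lra.
  have lr : N (phi x y) <= r.
    apply: le_trans (cN_tri _ _ _) _; rewrite !cNM !cN_jr N_cis mulr1.
    rewrite (ger0_norm (x := 1 - x)) ?subr_ge0 // (ger0_norm x0) (gtr0_norm r0).
    have h1 : N (t + j d * cis (2 * pi * y)) <= r.
      apply: le_trans (cN_tri _ _ _) _; rewrite cNM cN_jr N_cis mulr1 (gtr0_norm d0).
      by move: drt; clear; lra.
    have := ler_wpM2l x0 h1; clear; lra.
  have [l hl] := hh _ lr.
  have hv := cdV (cdB (cd_id K (phi x y)) (cd_cst K t (phi x y))) nz.
  by eexists; apply: cdM hl hv.
have [n0 hn0] := @goursat _ _ K H phi L L0 lipx lipy Hcd _ e0.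
exists (n0 + 2)%N => n hn.
have {}hn0 := hn0 n (leq_trans (leq_addr _ _) hn).
have nE : n = ((n - 2) + 2)%N by rewrite subnK // (leq_trans _ hn) // leq_addl.
have wg : 4 <= N (wind n) by rewrite nE; apply: wind_ge.
have b : bsum H phi n 0 0 1 = wind n * (avg n (fun z => h (t + z)) d
    - avg n (fun z => h z * (z / (z - t))) r).
  rewrite /bsum add0r.
  have -> : phi^~ 1 = phi^~ 0.
    by apply/funext => x; rewrite /phi !mulr1 mulr0 cis0 cis2pi.
  have -> : phi 1 = fun y => t + j d * cis (2 * pi * y).
    by apply/funext => y; rewrite /phi subrr rmorph0 rmorph1; ring.
  have -> : phi 0 = fun y => 0 + j r * cis (2 * pi * y).
    by apply/funext => y; rewrite /phi subr0 rmorph0 rmorph1; ring.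
  have r4 (u v w : C) : u + v - u - w = v - w by ring.
  rewrite r4 !esum_circle -/(wind n) -mulrBr; congr (_ * (_ - _)).
    apply: avg_ext; rewrite ?(ltW d0) // => z zd; rewrite /H addrAC subrr add0r.
    by rewrite divfK // -(cN_gt0 K) zd.
  apply: avg_ext; rewrite ?(ltW r0) // => z _; rewrite /H add0r; ring.
rewrite b cNM in hn0.
have avgh : N (avg n (fun z => h (t + z)) d - h t) <= e / 2.
  rewrite -{1}(avg_cst n (h t) d) -avgB; apply: avg_le; rewrite ?(ltW d0) // => z zd.
  by apply: hd1; rewrite addrAC subrr add0r zd; move: dd1 d10; clear; lra.
have k : N (avg n (fun z => h (t + z)) d - avg n (fun z => h z * (z / (z - t))) r) <= e / 4.
  rewrite ler_pdivlMr //; apply: le_trans hn0; by rewrite mulrC ler_wpM2r // cN_ge0.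
rewrite cNB; apply: le_trans (cN_dist _ _ (avg n (fun z => h (t + z)) d) _) _.
by move: avgh k e0; rewrite (cNB _ (h t)); clear; lra.
Qed.

End Circle.

(** * Consequences of Cauchy's formula in one variable *)

Section OneVariable.
Variables (R : realType) (C : numClosedFieldType) (K : cdata R C).
Notation j := (jr K).
Notation N := (cN K).
Notation cd := (cd K).
Notation hol := (hol K).
Notation avg := (avg K).
Notation clim := (clim K).
Implicit Types (h g : C -> C) (a b t z : C) (r M : R).

Definition hball h a r M :=
  forall z, N (z - a) <= r -> (exists l, cd h z l) /\ N (h z) <= M.

Lemma hball_ge0 h a r M : 0 <= r -> hball h a r M -> 0 <= M.
Proof.
by move=> r0 /(_ a); rewrite subrr cN0 => /(_ r0) [_]; apply: le_trans; apply: cN_ge0.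
Qed.

Lemma hball_sub h a r M b r' : hball h a r M -> N (b - a) + r' <= r -> hball h b r' M.
Proof.
move=> hb le z zb; apply: hb; apply: le_trans (cN_dist _ _ b _) _; lra.
Qed.

Lemma hol_hball h a : hol h a -> exists2 r : R, 0 < r & hball h a r (N (h a) + 1).
Proof.
move=> hh; have [d d0 hd] := cont_bdd (hol_cont hh); case: hh => [e e0 he].
have m0 : 0 < Num.min d e by rewrite lt_min d0.
exists (Num.min d e / 2); first lra.
move=> z zr; have : N (z - a) < Num.min d e by lra.
by rewrite lt_min => /andP[/hd ? /he].
Qed.

Lemma hball_hol h a r M : hball h a r M -> forall z, N (z - a) < r -> hol h z.
Proof.
move=> hb z za; exists (r - N (z - a)); first lra.
move=> s sz; have [] := hb s; last by [].
by have := cN_dist K s z a; lra.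
Qed.

Lemma mean_value_at h a r t : N t < r ->
  (forall z, N (z - a) <= r -> exists l, cd h z l) ->
  clim (fun n => avg n (fun z => h (a + z) * (z / (z - t))) r) (h (a + t)).
Proof.
move=> tr hh; apply: (@mean_value _ _ K (fun z => h (a + z))) => // z zr.
have [|l hl] := hh (a + z); first by rewrite addrAC subrr add0r.
exists (l * (0 + 1)); apply: cd_comp (cdD (cd_cst _ _ _) (cd_id _ _)) hl.
Qed.

Lemma clim_ext (u v : nat -> C) l : (forall n, u n = v n) -> clim u l -> clim v l.
Proof. by move=> e; have -> : v = u by apply/funext => n. Qed.

Lemma climB (u v : nat -> C) l m : clim u l -> clim v m ->
  clim (fun n => u n - v n) (l - m).
Proof.
move=> hu hv e e0; have e2 : 0 < e / 2 by lra.
have [n1 h1] := hu _ e2; have [n2 h2] := hv _ e2.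
exists (maxn n1 n2) => n; rewrite geq_max => /andP[/h1 k1 /h2 k2].
have -> : u n - v n - (l - m) = (u n - l) - (v n - m) by ring.
by apply: le_trans (cN_triB _ _ _) _; lra.
Qed.

Lemma climZ c (u : nat -> C) l : clim u l -> clim (fun n => c * u n) (c * l).
Proof.
move=> hu e e0; have c0 := cN_ge0 K c.
have p : 0 < N c + 1 by lra.
have [n1 h1] := hu _ (divr_gt0 e0 p); exists n1 => n /h1 k.
rewrite -mulrBr cNM; apply: le_trans (ler_wpM2l c0 k) _.
by rewrite mulrCA ler_piMr ?(ltW e0) // ler_pdivrMr //; lra.
Qed.

Lemma sep_gt0 r t z : N z = r -> N t < r -> z - t != 0.
Proof. by move=> zr tr; rewrite -(cN_gt0 K); have := cN_low K z t; lra. Qed.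

(* The integral formula for [(h (a + t) - h a) / t]; it makes sense at [t = 0]. *)
Lemma slope_formula h a r t : N t < r -> t != 0 ->
  (forall z, N (z - a) <= r -> exists l, cd h z l) ->
  clim (fun n => avg n (fun z => h (a + z) / (z - t)) r) ((h (a + t) - h a) / t).
Proof.
move=> tr t0 hh; have n0 : N (0 : C) < r by rewrite cN0; have := cN_ge0 K t; lra.
have r0 : 0 <= r by have := cN_ge0 K t; lra.
have m1 := mean_value_at tr hh; have m2 := mean_value_at n0 hh.
rewrite addr0 in m2; rewrite mulrC.
apply: clim_ext (climZ t^-1 (climB m1 m2)) => n.
rewrite -avgB -avgZ; apply: avg_ext => // z zr.
have zt := sep_gt0 zr tr; have z0 := sep_gt0 zr n0; rewrite subr0 in z0.
by field; rewrite t0 zt z0.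
Qed.

(** Difference of two instances of [slope_formula]; the 4 comes from the distance of [t] and [t'] to
    the circle, which is at least [r / 2]. *)
Lemma slope_lip h a r M t t' : 0 < r -> hball h a r M -> t != 0 -> t' != 0 ->
  N t <= r / 2 -> N t' <= r / 2 ->
  N ((h (a + t) - h a) / t - (h (a + t') - h a) / t') <= 4 * M / r ^+ 2 * N (t - t').
Proof.
move=> r0 hb t0 t0' tr tr'; have hh z zr := (hb z zr).1.
have lt : N t < r by lra.
have lt' : N t' < r by lra.
have s := climB (slope_formula lt t0 hh) (slope_formula lt' t0' hh).
rewrite -[X in N X]subr0; apply: (clim_le s) => n; rewrite subr0 -avgB.
apply: avg_le => [|z zr]; first exact: ltW.
have zt := sep_gt0 zr lt; have zt' := sep_gt0 zr lt'.
have -> : h (a + z) / (z - t) - h (a + z) / (z - t') =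
  h (a + z) * (t - t') / ((z - t) * (z - t')) by field; rewrite zt zt'.
have hz : N (h (a + z)) <= M by apply: (hb _ _).2; rewrite addrAC subrr add0r zr.
have b1 : r / 2 <= N (z - t) by have := cN_low K z t; lra.
have b2 : r / 2 <= N (z - t') by have := cN_low K z t'; lra.
have r2 : 0 < r / 2 by lra.
have p1 : 0 < N (z - t) by lra.
have p2 : 0 < N (z - t') by lra.
rewrite !cNM cNV cNM ler_pdivrMr ?mulr_gt0 //.
have k : r ^+ 2 <= 4 * (N (z - t) * N (z - t')).
  have := ler_pM (ltW r2) (ltW r2) b1 b2; rewrite expr2; lra.
have d0 := cN_ge0 K (t - t').
have rp : 0 < r ^+ 2 by rewrite exprn_gt0.
have M0 := hball_ge0 (ltW r0) hb.
apply: le_trans (ler_wpM2r d0 hz) _.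
have -> : 4 * M / r ^+ 2 * N (t - t') * (N (z - t) * N (z - t')) =
  M * N (t - t') * (4 * (N (z - t) * N (z - t')) / r ^+ 2) by field; rewrite gt_eqF.
by rewrite ler_peMr ?mulr_ge0 // ler_pdivlMr // mul1r.
Qed.

(** A Lipschitz difference quotient is Cauchy as [t] tends to 0. The hypothesis is an inequality
    between values of [h], so it survives pointwise limits; this is how limits of holomorphic
    functions are differentiated. *)
Lemma slope_der h a (rho Q : R) : 0 < rho -> 0 <= Q ->
  (forall t t', t != 0 -> t' != 0 -> N t <= rho -> N t' <= rho ->
    N ((h (a + t) - h a) / t - (h (a + t') - h a) / t') <= Q * N (t - t')) ->
  exists2 l, cd h a l & forall t, t != 0 -> N t <= rho ->
    N ((h (a + t) - h a) / t - l) <= Q * N t.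
Proof.
move=> rho0 Q0 lip.
pose x (n : nat) : R := rho / n.+1%:R.
have x0 n : 0 < x n by rewrite divr_gt0.
have xr n : x n <= rho by rewrite ler_pdivrMr // ler_peMr ?ler1n // ltW.
have Nx n : N (j (x n)) = x n by rewrite cN_jr gtr0_norm.
have jx0 n : j (x n) != 0 by rewrite -(cN_gt0 K) Nx.
pose u n := (h (a + j (x n)) - h a) / j (x n).
have xlim (e : R) : 0 < e -> exists n0, forall n, (n0 <= n)%N -> x n <= e.
  move=> e0; exists (Num.bound (rho / e)) => n hn.
  have b := archi_boundP (ltW (divr_gt0 rho0 e0)).
  rewrite ler_pdivrMr // mulrC -ler_pdivrMr //.
  apply: ltW; apply: lt_le_trans b _; rewrite ler_nat; exact: leq_trans hn _.
have [l ul] : exists l, clim u l.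
  apply: (@ccauchy _ _ K) => e e0.
  have p : 0 < 2 * (Q + 1) by lra.
  have [n0 hn0] := xlim (e / (2 * (Q + 1))) (divr_gt0 e0 p).
  exists n0 => m n hm hn; apply: le_trans (lip _ _ _ _ _ _) _; rewrite ?jx0 ?Nx ?xr //.
  have h1 : N (j (x m) - j (x n)) <= e / (Q + 1).
    apply: le_trans (cN_triB _ _ _) _; rewrite !Nx.
    have := hn0 _ hm; have := hn0 _ hn.
    have -> : e / (Q + 1) = e / (2 * (Q + 1)) + e / (2 * (Q + 1)) by field; lra.
    by clear; lra.
  apply: le_trans (ler_wpM2l Q0 h1) _.
  by rewrite mulrCA ler_piMr ?(ltW e0) // ler_pdivrMr; lra.
have key t : t != 0 -> N t <= rho -> N ((h (a + t) - h a) / t - l) <= Q * N t.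
  move=> t0 tr; apply/ler_addgt0Pr => e e0; have e2 : 0 < e / 2 by lra.
  have p : 0 < 2 * (Q + 1) by lra.
  have [n1 h1] := xlim (e / (2 * (Q + 1))) (divr_gt0 e0 p); have [n2 h2] := ul _ e2.
  have k1 := h1 (maxn n1 n2) (leq_maxl _ _); have k2 := h2 (maxn n1 n2) (leq_maxr _ _).
  set n := maxn n1 n2 in k1 k2.
  apply: le_trans (cN_dist _ _ (u n) _) _.
  apply: le_trans (lerD (lip _ _ t0 (jx0 n) tr _) k2) _; first by rewrite Nx.
  have h3 : N (t - j (x n)) <= N t + e / (2 * (Q + 1)).
    by apply: le_trans (cN_triB _ _ _) _; rewrite Nx lerD2l.
  have h4 : Q * (e / (2 * (Q + 1))) <= e / 2.
    have -> : Q * (e / (2 * (Q + 1))) = e / 2 * (Q / (Q + 1)) by field; lra.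
    by rewrite ler_piMr ?(ltW e2) // ler_pdivrMr; lra.
  have := ler_wpM2l Q0 h3; rewrite mulrDr; move: h4; clear; lra.
exists l => //; apply/cdP => e e0.
have p : 0 < Q + 1 by lra.
exists (Num.min rho (e / (Q + 1))); first by rewrite lt_min rho0 divr_gt0.
move=> s; rewrite lt_min => /andP[sr se].
case: (eqVneq s a) => [->|sa]; first by rewrite !subrr mulr0 subr0 cN0 mulr0.
have t0 : s - a != 0 by rewrite subr_eq0.
have := key (s - a) t0 (ltW sr); rewrite [a + _]addrC subrK => k.
have -> : h s - h a - l * (s - a) = ((h s - h a) / (s - a) - l) * (s - a) by field.
rewrite cNM ler_wpM2r ?cN_ge0 //; apply: le_trans k _.
apply: le_trans (ler_wpM2l Q0 (ltW se)) _.
by rewrite mulrCA ler_piMr ?(ltW e0) // ler_pdivrMr; lra.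
Qed.

(** Pointwise convergence with a common bound suffices, because the Lipschitz constant [Q] of the
    difference quotients depends only on [M] and [r]. The derivatives converge because all quotients
    are uniformly close to them at the same small increment [x]. *)
Lemma hol_lim (F : nat -> C -> C) h a r M : 0 < r -> (forall n, hball (F n) a r M) ->
  (forall z, N (z - a) <= r -> clim (fun n => F n z) (h z)) ->
  exists2 l, cd h a l & forall u, (forall n, cd (F n) a (u n)) -> clim u l.
Proof.
move=> r0 hF lim; set Q := 4 * M / r ^+ 2.
have M0 := hball_ge0 (ltW r0) (hF 0%N).
have Q0 : 0 <= Q by rewrite !mulr_ge0 // invr_ge0 ltW // exprn_gt0.
have r2 : 0 < r / 2 by lra.
have la t : N t <= r / 2 -> clim (fun n => F n (a + t)) (h (a + t)).
  by move=> tr; apply: lim; rewrite addrAC subrr add0r; lra.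
have ls t : N t <= r / 2 -> clim (fun n => (F n (a + t) - F n a) / t) ((h (a + t) - h a) / t).
  move=> tr; have l0 := la 0; rewrite addr0 cN0 in l0.
  rewrite mulrC; apply: clim_ext (climZ _ (climB (la t tr) (l0 (ltW r2)))) => n.
  by rewrite mulrC.
have lipF n := slope_lip r0 (hF n).
have [|l hl bl] := @slope_der h a (r / 2) Q r2 Q0.
  move=> t t' t0 t0' tr tr'; rewrite -[X in N X]subr0.
  by apply: (clim_le (climB (ls t tr) (ls t' tr'))) => n; rewrite subr0 lipF.
exists l => // u hu e e0.
have p : 0 < 4 * (Q + 1) by lra.
pose x : R := Num.min (r / 2) (e / (4 * (Q + 1))).
have x0 : 0 < x by rewrite lt_min r2 divr_gt0.
have Nx : N (j x) = x by rewrite cN_jr gtr0_norm.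
have jx0 : j x != 0 by rewrite -(cN_gt0 K) Nx.
have xr : N (j x) <= r / 2 by rewrite Nx ge_min lexx.
have Qx : Q * x <= e / 4.
  have xe : x <= e / (4 * (Q + 1)) by rewrite ge_min lexx orbT.
  apply: le_trans (ler_wpM2l Q0 xe) _.
  have -> : Q * (e / (4 * (Q + 1))) = e / 4 * (Q / (Q + 1)) by field; lra.
  by rewrite ler_piMr ?divr_ge0 ?(ltW e0) // ler_pdivrMr; lra.
have e4 : 0 < e / 4 by lra.
have [n0 hn0] := ls (j x) xr _ e4; exists n0 => n /hn0 k.
have [l' hl' bl'] := @slope_der (F n) a (r / 2) Q r2 Q0 (fun t t' => lipF t t' n).
have -> : u n = l' by apply: cd_uniq (hu n) hl'.
have k1 := bl _ jx0 xr; have k2 := bl' _ jx0 xr; rewrite Nx in k1 k2.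
apply: le_trans (cN_dist _ _ ((F n (a + j x) - F n a) / j x) _) _; rewrite cNB.
apply: le_trans (lerD k2 (cN_dist _ _ ((h (a + j x) - h a) / j x) _)) _.
by move: k k1 Qx e0; clear; lra.
Qed.

Lemma geo_small (x q A : R) : 0 <= q < 1 -> (forall k, x <= A * q ^+ k) -> x <= 0.
Proof.
move=> /andP[q0 q1] h; rewrite leNgt; apply/negP => x0.
have A0 : 0 < A by have := h 0%N; rewrite expr0 mulr1; lra.
case: (eqVneq q 0) => [qz|qn].
  by have := h 1%N; rewrite qz expr1 mulr0; lra.
have qp : 0 < q by rewrite lt_def qn.
pose d := q^-1 - 1; have d0 : 0 < d by rewrite subr_gt0 invf_gt1.
have bern k : 1 + k%:R * d <= q^-1 ^+ k.
  elim: k => [|k ih]; first by rewrite mul0r addr0 expr0.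
  have -> : q^-1 = 1 + d by rewrite /d; lra.
  have e1 : 1 + d = q^-1 by rewrite /d; lra.
  rewrite exprS -natr1; rewrite -e1 in ih.
  have d1 : 0 <= 1 + d by lra.
  apply: le_trans (ler_wpM2l d1 ih).
  have kd : 0 <= k%:R * d * d by rewrite !mulr_ge0 // ltW.
  by move: kd; clear; lra.
have pos : 0 <= A / x / d by rewrite ltW // !divr_gt0.
have hb := archi_boundP pos; set k := Num.bound _ in hb.
have := h k; have := bern k; rewrite exprVn => b1 b2.
have qk : 0 < q ^+ k by rewrite exprn_gt0.
have : x * (q ^+ k)^-1 <= A by rewrite ler_pdivrMr.
apply/negP; rewrite -ltNge; apply: lt_le_trans (ler_wpM2l (ltW x0) b1).
rewrite ltr_pdivrMr // ltr_pdivrMr // in hb.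
have -> : x * (1 + k%:R * d) = x + k%:R * d * x by ring.
by move: hb x0; clear; lra.
Qed.

(** A maximum principle with the factor [r / (r - N t)], read off from Cauchy's kernel. *)
Lemma mv_bound h a r M t : N t < r -> (forall z, N (z - a) <= r -> exists l, cd h z l) ->
  (forall z, N z = r -> N (h (a + z)) <= M) -> N (h (a + t)) <= M * (r / (r - N t)).
Proof.
move=> tr hh hM; have t0 := cN_ge0 K t; have r0 : 0 < r by lra.
rewrite -[X in N X]subr0; apply: (clim_le (mean_value_at tr hh)) => n; rewrite subr0.
apply: avg_le => [|z zr]; first exact: ltW.
have b : r - N t <= N (z - t) by have := cN_low K z t; lra.
have M0 : 0 <= M by apply: le_trans (hM z zr); apply: cN_ge0.
have p : 0 < r - N t by lra.
rewrite !cNM cNV zr; apply: ler_pM; rewrite ?cN_ge0 ?mulr_ge0 ?invr_ge0 ?cN_ge0 ?(ltW r0) //.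
  exact: hM.
by rewrite ler_pM2l // lef_pV2 // posrE; lra.
Qed.

(** Schwarz's estimate for [h / (z - a)^k] bounds [h] by a constant times the [k]-th power of
    [N (z - a) / r], for every [k]. *)
Lemma flat h a r M : 0 < r -> hball h a r M ->
  (forall k : nat, exists g, (forall z, N (z - a) <= r -> exists l, cd g z l) /\
     forall z, N (z - a) <= r -> h z = (z - a) ^+ k * g z) ->
  forall z, N (z - a) < r -> h z = 0.
Proof.
move=> r0 hb hk z za; apply/eqP; rewrite -(cN_eq0 K); apply/eqP/le_anti.
rewrite cN_ge0 andbT; set t := z - a in za *.
have ez : z = a + t by rewrite /t addrC subrK.
have t0 : 0 <= N t by apply: cN_ge0.
apply: (@geo_small _ (N t / r) (M * (r / (r - N t)))).
  by rewrite divr_ge0 ?(ltW r0) // ltr_pdivrMr // mul1r.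
move=> k; have [g [hg e]] := hk k.
have b := @mv_bound g a r (M / r ^+ k) t za hg.
rewrite (e z (ltW za)) cNM cNX -/t ez.
have rk : 0 < r ^+ k by rewrite exprn_gt0.
have {}b : N (g (a + t)) <= M / r ^+ k * (r / (r - N t)).
  apply: b => w wr; have wa : N (a + w - a) <= r by rewrite addrAC subrr add0r wr.
  have := (hb _ wa).2; rewrite e // addrAC subrr add0r cNM cNX wr => k1.
  by rewrite ler_pdivlMr // mulrC.
apply: le_trans (ler_wpM2l _ b) _; first by rewrite exprn_ge0.
have rt0 : r - N t != 0 by rewrite subr_eq0 gt_eqF.
have -> : M * (r / (r - N t)) * (N t / r) ^+ k = N t ^+ k * (M / r ^+ k * (r / (r - N t))).
  by rewrite expr_div_n; field; rewrite rt0 !gt_eqF.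
by [].
Qed.

Lemma ident_ball h a r M d : 0 < r -> hball h a r M -> 0 < d ->
  (forall z, N (z - a) < d -> h z = 0) -> forall z, N (z - a) < r -> h z = 0.
Proof.
move=> r0 hb d0 hz; apply: (flat r0 hb) => k.
have ha : h a = 0 by apply: hz; rewrite subrr cN0.
exists (fun z => h z / (z - a) ^+ k); split => z zr; last first.
  case: (eqVneq z a) => [->|za]; first by rewrite ha mul0r mulr0.
  by rewrite mulrC divfK // expf_neq0 // subr_eq0.
case: (eqVneq z a) => [->|za].
  exists 0; apply: (@cd_ext _ _ _ (fun=> 0) _ _ _ d) => //; last exact: cd_cst.
  by move=> s /hz ->; rewrite mul0r.
have [[l hl] _] := hb z zr.
have n0 : (z - a) ^+ k != 0 by rewrite expf_neq0 // subr_eq0.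
have := cdV (cdX k (cdB (cd_id K z) (cd_cst K a z))) n0 => hv.
by eexists; apply: cdM hl hv.
Qed.

Lemma ident_seg h b z : (forall x : R, 0 <= x <= 1 -> hol h (b + j x * (z - b))) ->
  (exists2 d : R, 0 < d & forall w, N (w - b) < d -> h w = 0) -> h z = 0.
Proof.
move=> hh Z0.
pose c (x : R) := b + j x * (z - b).
pose Z (x : R) := exists2 d : R, 0 < d & forall w, N (w - c x) < d -> h w = 0.
have c0 : c 0 = b by rewrite /c rmorph0 mul0r addr0.
have c1 : c 1 = z by rewrite /c rmorph1 mul1r addrC subrK.
suff [d d0 hd] : Z 1 by apply: hd; rewrite c1 subrr cN0.
rewrite -c0 in Z0.
suff : Z 0 -> Z 1 by apply.
apply: (@chain _ (fun x y => Z x -> Z y) 0 1 ler01) => [x y w xy yw /xy /yw //|x x01].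
have hc : hol h (c x) := hh x x01.
have [rho rho0 hb] := hol_hball hc.
set L := N (z - b); have L0 : 0 <= L by apply: cN_ge0.
have L1 : 0 < L + 1 by lra.
have cc u v : N (c u - c v) = `|u - v| * L.
  have -> : c u - c v = j (u - v) * (z - b) by rewrite /c rmorphB; ring.
  by rewrite cNM cN_jr.
pose e := rho / 3 / (L + 1); have e0 : 0 < e by rewrite !divr_gt0.
have nearc u : `|u - x| < e -> N (c u - c x) < rho / 3.
  move=> ux; rewrite cc; apply: (@le_lt_trans _ _ (`|u - x| * (L + 1))).
    by rewrite ler_wpM2l // lerDl.
  by rewrite -ltr_pdivlMr.
have tr u v : `|u - x| < e -> `|v - x| < e -> Z u -> Z v.
  move=> /nearc ux /nearc vx [d d0 hd].
  have r3 : 0 < rho / 3 by lra.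
  have hb' : hball h (c u) (2 * rho / 3) (N (h (c x)) + 1).
    by apply: hball_sub hb _; move: ux; clear; lra.
  exists (2 * rho / 3 - N (c v - c u)).
    have := cN_dist K (c v) (c x) (c u); rewrite (cNB _ (c x)).
    by move: ux vx; clear; lra.
  move=> w wv; apply: (ident_ball _ hb' d0 hd); first by move: rho0; clear; lra.
  by have := cN_dist K w (c v) (c u); move: wv; clear; lra.
exists e => //; split=> y /andP[y1 y2] y3; apply: tr; rewrite ?subrr ?normr0 //;
  rewrite ltr_norml; apply/andP; split; lra.
Qed.

Lemma ident h a r b : (forall z, N (z - a) < r -> hol h z) ->
  N (b - a) < r -> (exists2 d : R, 0 < d & forall z, N (z - b) < d -> h z = 0) ->
  forall z, N (z - a) < r -> h z = 0.
Proof.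
move=> hh ba Z0 z za; apply: (ident_seg _ Z0) => x /andP[x0 x1]; apply: hh.
have -> : b + j x * (z - b) - a = j (1 - x) * (b - a) + j x * (z - a).
  by rewrite rmorphB rmorph1; ring.
apply: le_lt_trans (cN_tri _ _ _) _; rewrite !cNM !cN_jr !ger0_norm ?subr_ge0 //.
case: (eqVneq x 0) => [->|xn]; first by move: ba; clear; lra.
have xp : 0 < x by rewrite lt_def xn.
have y0 : 0 <= 1 - x by rewrite subr_ge0.
have h1 := ler_wpM2l y0 (ltW ba).
have h2 : x * N (z - a) < x * r by rewrite ltr_pM2l.
by move: h1 h2; clear; lra.
Qed.

End OneVariable.

(** * Holomorphy in several variables *)

Section Several.
Variables (R : realType) (C : numClosedFieldType) (K : cdata R C).
Notation j := (jr K).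
Notation N := (cN K).
Notation cd := (cd K).
Notation hol := (hol K).
Notation avg := (avg K).
Notation clim := (clim K).
Notation hball := (hball K).

(** The coordinates will be [s], the blow-up parameter, eta, [b] and [H - E]; elsewhere some of them
    carry a time or amplitudes. *)
Definition pt := 'I_5 -> C.
Implicit Types (f g : pt -> C) (p q : pt) (k : 'I_5) (G : C -> pt).

Definition bal p (r : R) q := forall i, N (q i - p i) < r.

Definition holp (gam : C -> pt) t := forall i, hol (fun s => gam s i) t.

(* Holomorphy of functions of several variables is tested on holomorphic curves,
   which makes it stable under composition. *)
Definition ch f p := exists r M : R, [/\ 0 < r, forall q, bal p r q -> N (f q) <= M &
  forall G t, holp G t -> bal p r (G t) -> hol (fun s => f (G s)) t].

Definition upd q k z : pt := fun i => if i == k then z else q i.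

Lemma fin5 (P : 'I_5 -> R -> Prop) :
  (forall i (d d' : R), 0 < d' -> d' <= d -> P i d -> P i d') ->
  (forall i, exists2 d : R, 0 < d & P i d) -> exists2 d : R, 0 < d & forall i, P i d.
Proof.
move=> mono ex.
suff h m : exists2 d : R, 0 < d & forall i : 'I_5, (i < m)%N -> P i d.
  by have [d d0 hd] := h 5%N; exists d => // i; apply: hd.
elim: m => [|m [d d0 hd]]; first by exists 1.
case: (ltnP m 5) => [m5|m5]; last first.
  by exists d => // i _; apply: hd; apply: leq_trans (ltn_ord i) m5.
have [e e0 he] := ex (Ordinal m5).
have m0 : 0 < Num.min d e by rewrite lt_min d0.
exists (Num.min d e) => // i; rewrite ltnS leq_eqVlt => /orP[/eqP im|im].
  have -> : i = Ordinal m5 by apply: val_inj.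
  by apply: mono he; rewrite // ge_min lexx orbT.
by apply: mono (hd i im); rewrite // ge_min lexx.
Qed.

Lemma bal_self p (r : R) : 0 < r -> bal p r p.
Proof. by move=> r0 i; rewrite subrr cN0. Qed.

Lemma bal_sub p (r r' : R) q : r' <= r -> bal p r' q -> bal p r q.
Proof. by move=> le b i; apply: lt_le_trans (b i) le. Qed.

Lemma bal_near p (r : R) q : bal p r q ->
  exists2 d : R, 0 < d & forall q', bal q d q' -> bal p r q'.
Proof.
move=> b.
have [||d d0 hd] := @fin5 (fun i d => forall z, N (z - q i) < d -> N (z - p i) < r).
- by move=> i d d' _ le h z zd; apply: h; apply: lt_le_trans zd le.
- move=> i; exists (r - N (q i - p i)); first by have := b i; lra.
  by move=> z zd; have := cN_dist K z (q i) (p i); lra.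
by exists d => // q' bq i; apply: hd.
Qed.

Lemma holp_near G t : holp G t ->
  exists2 d : R, 0 < d & forall s, N (s - t) < d -> holp G s.
Proof.
move=> hG.
have [||d d0 hd] := @fin5 (fun i d => forall s, N (s - t) < d -> hol (fun s => G s i) s).
- by move=> i d d' _ le h z zd; apply: h; apply: lt_le_trans zd le.
- by move=> i; apply: hol_near.
by exists d => // s sd i; apply: hd.
Qed.

Lemma holp_cont G t (e : R) : holp G t -> 0 < e ->
  exists2 d : R, 0 < d & forall s, N (s - t) < d -> bal (G t) e (G s).
Proof.
move=> hG e0.
have [||d d0 hd] := @fin5 (fun i d => forall s, N (s - t) < d -> N (G s i - G t i) < e).
- by move=> i d d' _ le h z zd; apply: h; apply: lt_le_trans zd le.
- move=> i; have e2 : 0 < e / 2 by lra.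
  by have [d d0 h] := hol_cont (hG i) e2; exists d => // s /h; lra.
by exists d => // s sd i; apply: hd.
Qed.

Lemma holp_bal G t p (r : R) : holp G t -> bal p r (G t) ->
  exists2 d : R, 0 < d & forall s, N (s - t) < d -> holp G s /\ bal p r (G s).
Proof.
move=> hG /bal_near [e e0 he]; have [d d0 hd] := holp_near hG.
have [d' d'0 hd'] := holp_cont hG e0.
exists (Num.min d d'); first by rewrite lt_min d0.
by move=> s; rewrite lt_min => /andP[/hd ? /hd' /he].
Qed.

Lemma ch_near f p : ch f p -> exists2 r : R, 0 < r & forall q, bal p r q -> ch f q.
Proof.
move=> [r [M [r0 hM hf]]]; exists r => // q /bal_near [d d0 hd].
by exists d, M; split=> // [q' /hd /hM //|G t hG /hd]; apply: hf.
Qed.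

Lemma ch_holp f G t : ch f (G t) -> holp G t -> hol (fun s => f (G s)) t.
Proof. by move=> [r [M [r0 _ hf]]] hG; apply: hf => //; apply: bal_self. Qed.

Definition line p q : C -> pt := fun z i => p i + z * (q i - p i).

Lemma holp_line p q t : holp (line p q) t.
Proof.
move=> i; apply: holD; first exact: hol_cst.
by apply: holM; [apply: hol_id | apply: hol_cst].
Qed.

Lemma slope_bound (h : C -> C) a t (r M : R) : N t < r -> hball h a r M ->
  N (h (a + t) - h a) <= N t * (M / (r - N t)).
Proof.
move=> tr hb; case: (eqVneq t 0) => [->|t0]; first by rewrite addr0 subrr cN0 mul0r.
have hh z zr := (hb z zr).1; have t00 := cN_ge0 K t.
have r0 : 0 < r by lra.
have M0 := hball_ge0 (ltW r0) hb.
suff k : N ((h (a + t) - h a) / t) <= M / (r - N t).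
  have -> : h (a + t) - h a = t * ((h (a + t) - h a) / t) by rewrite mulrC divfK.
  by rewrite cNM ler_wpM2l.
rewrite -[X in N X]subr0; apply: (clim_le (slope_formula tr t0 hh)) => n; rewrite subr0.
apply: avg_le => [|z zr]; first exact: ltW.
have b : r - N t <= N (z - t) by have := cN_low K z t; lra.
have p : 0 < r - N t by lra.
rewrite cNM cNV; apply: ler_pM; rewrite ?cN_ge0 ?invr_ge0 ?cN_ge0 //.
  by apply: (hb _ _).2; rewrite addrAC subrr add0r zr.
by rewrite lef_pV2 // posrE; lra.
Qed.

Lemma ch_cont f p (e : R) : ch f p -> 0 < e ->
  exists2 d : R, 0 < d & forall q, bal p d q -> N (f q - f p) <= e.
Proof.
move=> [r [M [r0 hM hf]]] e0.
have M0 : 0 <= M by apply: le_trans (hM p (bal_self _ r0)); apply: cN_ge0.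
have p0 : 0 < M / e + 2 by rewrite ltr_wpDl // divr_ge0 // ltW.
(* For [q] so close to [p] the line through them stays in the ball up to parameter [M / e + 1], and
   [slope_bound] at parameter 1 gives the bound [M / (M / e) = e]. *)
exists (r / (M / e + 2)); first by rewrite divr_gt0.
move=> q bq; set rho := M / e + 2 in p0 bq.
have hb : hball (fun z => f (line p q z)) 0 (M / e + 1) M.
  move=> z; rewrite subr0 => zr.
  have bz : bal p r (line p q z).
    move=> i; rewrite /line addrAC subrr add0r cNM.
    have := bq i; rewrite ltr_pdivlMr // => k; have z0 := cN_ge0 K z.
    have d0 := cN_ge0 K (q i - p i).
    apply: le_lt_trans k; rewrite mulrC; apply: ler_wpM2l => //.
    by rewrite /rho; lra.
  by split; [apply: hol_cd; apply: hf => //; apply: holp_line | apply: hM].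
have Me : 0 <= M / e by rewrite divr_ge0 // ltW.
case: (eqVneq M 0) => [Mz|Mn].
  have z z' : bal p r z' -> f z' = 0.
    by move=> /hM; rewrite Mz => h; apply/eqP; rewrite -(cN_eq0 K) eq_le h cN_ge0.
  rewrite !z ?subrr ?cN0 ?ltW //; first exact: bal_self.
  apply: bal_sub bq; rewrite ler_pdivrMr // ler_peMr ?(ltW r0) //.
  by rewrite /rho; lra.
have Mp : 0 < M by rewrite lt_def Mn.
have Mep : 0 < M / e by rewrite divr_gt0.
have lt1 : N (1 : C) < M / e + 1 by rewrite cN1; lra.
have := slope_bound lt1 hb; rewrite add0r cN1 mul1r.
have -> : line p q 1 = q by apply/funext => i; rewrite /line mul1r addrC subrK.
have -> : line p q 0 = p by apply/funext => i; rewrite /line mul0r addr0.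
have -> : M / (M / e + 1 - 1) = e by rewrite addrK invf_div mulrCA divff // mulr1.
by [].
Qed.

Lemma ch_ext f g p (d : R) : 0 < d -> (forall q, bal p d q -> f q = g q) ->
  ch f p -> ch g p.
Proof.
move=> d0 fg [r [M [r0 hM hf]]].
have m0 : 0 < Num.min r d by rewrite lt_min r0.
have mr : Num.min r d <= r by rewrite ge_min lexx.
have md : Num.min r d <= d by rewrite ge_min lexx orbT.
exists (Num.min r d), M; split=> // [q bq|G t hG bG].
  by rewrite -fg; [apply: hM; apply: bal_sub bq | apply: bal_sub bq].
have [a a0 ha] := holp_bal hG (bal_sub md bG).
apply: (@hol_ext _ _ _ (fun s => f (G s)) _ _ a) => //.
  by move=> s /ha [_ /fg].
by apply: hf => //; apply: bal_sub bG.
Qed.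

Lemma ch_cst c p : ch (fun=> c) p.
Proof. by exists 1, (N c); split=> // G t _ _; apply: hol_cst. Qed.

Lemma ch_coord k p : ch (fun q => q k) p.
Proof.
exists 1, (N (p k) + 1); split=> // q /(_ k) bq.
by have := cN_low K (q k) (p k); lra.
Qed.

Lemma ch2 (op : C -> C -> C) f g p :
  (forall M M' : R, exists M'' : R, forall x y, N x <= M -> N y <= M' -> N (op x y) <= M'') ->
  (forall a b t, hol a t -> hol b t -> hol (fun u => op (a u) (b u)) t) ->
  ch f p -> ch g p -> ch (fun q => op (f q) (g q)) p.
Proof.
move=> bd ho [r [M [r0 hM hf]]] [r' [M' [r'0 hM' hg]]].
have [M'' hM''] := bd M M'.
have m0 : 0 < Num.min r r' by rewrite lt_min r0.
have mr : Num.min r r' <= r by rewrite ge_min lexx.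
have md : Num.min r r' <= r' by rewrite ge_min lexx orbT.
exists (Num.min r r'), M''; split=> // [q bq|G t hG bG].
  by apply: hM''; [apply: hM; apply: bal_sub bq | apply: hM'; apply: bal_sub bq].
by apply: ho; [apply: hf | apply: hg] => //; apply: bal_sub bG.
Qed.

Lemma chD f g p : ch f p -> ch g p -> ch (fun q => f q + g q) p.
Proof.
apply: (@ch2 +%R) => [M M'|a b t]; last exact: holD.
by exists (M + M') => x y hx hy; apply: le_trans (cN_tri _ _ _) (lerD hx hy).
Qed.

Lemma chM f g p : ch f p -> ch g p -> ch (fun q => f q * g q) p.
Proof.
apply: (@ch2 *%R) => [M M'|a b t]; last exact: holM.
by exists (M * M') => x y hx hy; rewrite cNM; apply: ler_pM; rewrite ?cN_ge0.
Qed.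

Lemma chN f p : ch f p -> ch (fun q => - f q) p.
Proof.
move=> hf; apply: (@ch_ext (fun q => -1 * f q) _ _ 1) => //.
  by move=> q _; rewrite mulN1r.
by apply: chM => //; apply: ch_cst.
Qed.

Lemma chB f g p : ch f p -> ch g p -> ch (fun q => f q - g q) p.
Proof. by move=> hf hg; apply: chD hf (chN hg). Qed.

Lemma chX f p n : ch f p -> ch (fun q => f q ^+ n) p.
Proof.
move=> hf; elim: n => [|n ih]; first exact: (ch_cst 1).
apply: (@ch_ext (fun q => f q * f q ^+ n) _ _ 1) => //.
  by move=> q _; rewrite exprS.
exact: chM.
Qed.

Lemma ch_comp f (F : pt -> pt) p : ch f (F p) -> (forall i, ch (fun q => F q i) p) ->
  ch (fun q => f (F q)) p.
Proof.
move=> [r [M [r0 hM hf]]] hF.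
have r2 : 0 < r / 2 by lra.
have [||d d0 hd] := @fin5 (fun i d => forall q, bal p d q -> N (F q i - F p i) < r /\
   ch (fun q => F q i) q).
- by move=> i d d' _ le h q bq; apply: h; apply: bal_sub bq.
- move=> i; have [d d0 h] := ch_cont (hF i) r2; have [d' d'0 h'] := ch_near (hF i).
  exists (Num.min d d'); first by rewrite lt_min d0.
  move=> q bq; split; last by apply: h'; apply: bal_sub bq; rewrite ge_min lexx orbT.
  by have /h : bal p d q by [apply: bal_sub bq; rewrite ge_min lexx]; lra.
exists d, M; split=> // [q bq|G t hG bG].
  by apply: hM => i; have [] := hd i q bq.
apply: (hf (fun s => F (G s))) => i; last by have [] := hd i _ bG.
by apply: (@ch_holp (fun q => F q i)) => //; have [] := hd i _ bG.
Qed.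

Lemma ch_hol (h : C -> C) f p : ch f p -> hol h (f p) -> ch (fun q => h (f q)) p.
Proof.
move=> hf hh.
have : ch (fun q => h (q ord0)) (fun=> f p).
  have [r r0 hb] := hol_hball hh.
  exists r, (N (h (f p)) + 1); split=> // [q /(_ ord0) bq|G t hG /(_ ord0) bG].
    by apply: (hb _ _).2; apply: ltW.
  by apply: hol_comp (hG ord0) _; apply: hball_hol hb _ bG.
by move=> /(@ch_comp _ (fun q _ => f q) p); apply.
Qed.

Lemma chV f p : ch f p -> f p != 0 -> ch (fun q => (f q)^-1) p.
Proof.
move=> hf f0; apply: (@ch_hol (fun z => z^-1)) => //.
by apply: holV; [apply: hol_id|].
Qed.

Lemma ch_lim (F : nat -> pt -> C) f p (r M : R) : 0 < r ->
  (forall n q, bal p r q -> N (F n q) <= M) ->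
  (forall n G t, holp G t -> bal p r (G t) -> hol (fun s => F n (G s)) t) ->
  (forall q, bal p r q -> clim (fun n => F n q) (f q)) -> ch f p.
Proof.
move=> r0 hM hF lim; exists r, M; split=> // [q bq|G t hG bG].
  by rewrite -[X in N X]subr0; apply: (clim_le (lim q bq)) => n; rewrite subr0; apply: hM.
have [d d0 hd] := holp_bal hG bG.
exists d => // s sd; pose e := (d - N (s - t)) / 2.
have e0 : 0 < e by rewrite /e; lra.
have near z : N (z - s) <= e -> holp G z /\ bal p r (G z).
  by move=> zs; apply: hd; have := cN_dist K z s t; rewrite /e in zs; lra.
have [||l hl _] := @hol_lim _ _ K (fun n z => F n (G z)) (fun z => f (G z)) s e M e0.
- by move=> n z /near [h1 h2]; split; [apply: hol_cd; apply: hF | apply: hM].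
- by move=> z /near [h1 h2]; apply: lim.
by exists l.
Qed.

End Several.

(** * Division by a coordinate and partial derivatives *)

Section Division.
Variables (R : realType) (C : numClosedFieldType) (K : cdata R C).
Notation j := (jr K).
Notation N := (cN K).
Notation cd := (cd K).
Notation hol := (hol K).
Notation avg := (avg K).
Notation clim := (clim K).
Notation hball := (hball K).
Notation pt := (pt C).
Notation ch := (ch K).
Notation bal := (bal K).
Notation holp := (holp K).
Notation der := (der K).
Implicit Types (f g : pt -> C) (p q : pt) (k : 'I_5) (G : C -> pt).

Lemma slope_formula0 (h : C -> C) a l (r M : R) : 0 < r -> hball h a r M -> cd h a l ->
  clim (fun n => avg n (fun z => h (a + z) / z) r) l.
Proof.
move=> r0 hb hl e e0; have hh z zr := (hb z zr).1.
set Q := 4 * M / r ^+ 2; have M0 := hball_ge0 (ltW r0) hb.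
have rp : 0 < r ^+ 2 by rewrite exprn_gt0.
have Q0 : 0 <= Q by rewrite !mulr_ge0 // invr_ge0 ltW.
have r2 : 0 < r / 2 by lra.
have [l' hl' bl] := @slope_der _ _ K h a (r / 2) Q r2 Q0 (fun t t' => slope_lip r0 hb).
have <- : l' = l by apply: cd_uniq hl' hl.
have p : 0 < 4 * (Q + 1) by lra.
pose x : R := Num.min (r / 2) (e / (4 * (Q + 1))).
have x0 : 0 < x by rewrite lt_min r2 divr_gt0.
have Nx : N (j x) = x by rewrite cN_jr gtr0_norm.
have jx0 : j x != 0 by rewrite -(cN_gt0 K) Nx.
have xr : N (j x) <= r / 2 by rewrite Nx ge_min lexx.
have xlt : N (j x) < r by lra.
have Qx : Q * x <= e / 4.
  have xe : x <= e / (4 * (Q + 1)) by rewrite ge_min lexx orbT.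
  apply: le_trans (ler_wpM2l Q0 xe) _.
  have -> : Q * (e / (4 * (Q + 1))) = e / 4 * (Q / (Q + 1)) by field; lra.
  by rewrite ler_piMr ?divr_ge0 ?(ltW e0) // ler_pdivrMr; lra.
have e4 : 0 < e / 4 by lra.
have [n0 hn0] := slope_formula xlt jx0 hh e4; exists n0 => n /hn0 k1.
have k2 := bl _ jx0 xr; rewrite Nx in k2.
have k3 : N (avg n (fun z => h (a + z) / z) r - avg n (fun z => h (a + z) / (z - j x)) r) <= e / 4.
  rewrite -avgB; apply: le_trans Qx; apply: avg_le => [|z zr]; first exact: ltW.
  have zx := sep_gt0 zr xlt.
  have z0 : z != 0 by rewrite -(cN_gt0 K) zr.
  have -> : h (a + z) / z - h (a + z) / (z - j x) = h (a + z) * (- j x) / (z * (z - j x)).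
    by field; rewrite z0 zx.
  have hz : N (h (a + z)) <= M by apply: (hb _ _).2; rewrite addrAC subrr add0r zr.
  have b2 : r / 2 <= N (z - j x) by have := cN_low K z (j x); lra.
  rewrite !cNM cNV cNM cNN Nx zr ler_pdivrMr; last by rewrite mulr_gt0 //; lra.
  apply: le_trans (ler_wpM2r (ltW x0) hz) _.
  have -> : Q * x * (r * N (z - j x)) = M * x * (4 * N (z - j x) / r).
    by rewrite /Q; field; rewrite gt_eqF.
  by rewrite ler_peMr ?mulr_ge0 ?(ltW x0) // ler_pdivlMr //; lra.
apply: le_trans (cN_dist _ _ (avg n (fun z => h (a + z) / (z - j x)) r) _) _.
apply: le_trans (lerD k3 (cN_dist _ _ ((h (a + j x) - h a) / j x) _)) _.
by move: k1 k2 Qx e0; clear; lra.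
Qed.

Lemma hol_sum (m : nat) (F : 'I_m -> C -> C) t : (forall i, hol (F i) t) ->
  hol (fun s => \sum_(i < m) F i s) t.
Proof.
elim: m F => [|m ih] F hF.
  apply: (@hol_ext _ _ _ (fun=> 0) _ _ 1) => //; last exact: hol_cst.
  by move=> s _; rewrite big_ord0.
apply: (@hol_ext _ _ _ (fun s => \sum_(i < m) F (widen_ord (leqnSn m) i) s + F ord_max s) _ _ 1) => //.
  by move=> s _; rewrite big_ord_recr.
by apply: holD => //; apply: ih.
Qed.

Lemma hol_avg n (G : C -> C -> C) (r : R) t : 0 <= r ->
  (forall z, N z = r -> hol (G z) t) -> hol (fun s => avg n (fun z => G z s) r) t.
Proof.
move=> r0 hG; apply: holM; first exact: hol_cst.
apply: hol_sum => i; apply: hG; by rewrite cNM cN_jr N_rt mulr1 ger0_norm.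
Qed.

Lemma upd_eq q k z : upd q k z k = z. Proof. by rewrite /upd eqxx. Qed.
Lemma upd_id q k : upd q k (q k) = q.
Proof. by apply/funext => i; rewrite /upd; case: eqP => // ->. Qed.
Lemma upd_upd q k z z' : upd (upd q k z) k z' = upd q k z'.
Proof. by apply/funext => i; rewrite /upd; case: eqP. Qed.

Lemma holp_upd G k (c : C -> C) t : holp G t -> hol c t ->
  holp (fun s => upd (G s) k (c s)) t.
Proof. by move=> hG hc i; rewrite /upd; case: eqP. Qed.

Lemma holp_upd1 q k t : holp (upd q k) t.
Proof. by apply: (@holp_upd (fun=> q)) => [i|]; [apply: hol_cst | apply: hol_id]. Qed.

Definition dv k f q := if q k == 0 then der (fun z => f (upd q k z)) 0 else f q / q k.

(** On and off the hyperplane [q k = 0] the quotient is the limit of the same averages, because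
    Cauchy's formula for the slope at 0 also makes sense at parameter 0. *)
Lemma ch_dv k f p (rr : R) : ch f p -> p k = 0 -> 0 < rr ->
  (forall q, bal p rr q -> q k = 0 -> f q = 0) -> ch (dv k f) p.
Proof.
move=> [r1 [M [r10 hM0 hf0]]] pk rr0 hz0.
pose r := Num.min r1 rr; have r0 : 0 < r by rewrite lt_min r10.
have rr1 : r <= r1 by rewrite ge_min lexx.
have rrr : r <= rr by rewrite ge_min lexx orbT.
have hM q : bal p r q -> N (f q) <= M by move=> b; apply: hM0; apply: bal_sub b.
have hf G t : holp G t -> bal p r (G t) -> hol (fun s => f (G s)) t.
  by move=> hG b; apply: hf0 => //; apply: bal_sub b.
have hz q : bal p r q -> q k = 0 -> f q = 0 by move=> b; apply: hz0; apply: bal_sub b.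
clear hM0 hf0 hz0 rr1 rrr.
have M0 : 0 <= M by apply: le_trans (hM p (bal_self _ _ r0)); apply: cN_ge0.
pose rho := r / 2; have rho0 : 0 < rho by rewrite /rho; lra.
have r4 : 0 < r / 4 by lra.
have ub q z : bal p (r / 4) q -> N z <= rho -> bal p r (upd q k z).
  move=> b zr i; rewrite /upd; case: eqP => [->|_]; first by rewrite pk subr0; rewrite /rho in zr; lra.
  by have := b i; lra.
have qk q : bal p (r / 4) q -> N (q k) < r / 4 by move=> /(_ k); rewrite pk subr0.
have hb q : bal p (r / 4) q -> hball (fun z => f (upd q k z)) 0 rho M.
  move=> b z; rewrite subr0 => zr; split; last by apply: hM; apply: ub.
  by apply: hol_cd; apply: hf (ub _ _ b zr); apply: holp_upd1.
have low q z : bal p (r / 4) q -> N z = rho -> r / 4 <= N (z - q k).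
  by move=> b zr; have := cN_low K z (q k); have := qk q b; rewrite zr /rho; lra.
apply: (@ch_lim _ _ K (fun n q => avg n (fun z => f (upd q k z) / (z - q k)) rho) _ _
   (r / 4) (M / (r / 4))) => // [n q b|n G t hG b|q b].
- apply: avg_le => [|z zr]; first exact: ltW.
  have lo := low q z b zr.
  rewrite cNM cNV; apply: ler_pM; rewrite ?cN_ge0 ?invr_ge0 ?cN_ge0 //.
    by apply: hM; apply: ub => //; rewrite zr.
  by rewrite lef_pV2 // posrE; lra.
- apply: hol_avg => [|z zr]; first exact: ltW.
  apply: holM.
    apply: (hf (fun s => upd (G s) k z)); last by apply: ub => //; rewrite zr.
    by apply: (@holp_upd _ _ (fun=> z)) => //; apply: hol_cst.
  apply: holV; first by apply: holB; [apply: hol_cst | apply: hG].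
  by rewrite -(cN_gt0 K); have := low _ _ b zr; lra.
have hbq := hb q b; rewrite /dv; case: eqP => [q0|/eqP q0].
  have [l hl] : exists l, cd (fun z => f (upd q k z)) 0 l.
    by apply: (hbq 0 _).1; rewrite subrr cN0 ltW.
  rewrite (der_eq hl) q0.
  apply: clim_ext (slope_formula0 rho0 hbq hl) => n.
  by apply: avg_ext => [|z _]; [exact: ltW | rewrite add0r subr0].
have lt : N (q k) < rho by have := qk q b; rewrite /rho; lra.
have := slope_formula lt q0 (fun z zr => (hbq z zr).1).
rewrite add0r upd_id (hz (upd q k 0)) ?subr0 ?upd_eq //; last first.
  by apply: ub => //; rewrite cN0 ltW.
by apply: clim_ext => n; apply: avg_ext => [|z _]; [exact: ltW | rewrite add0r].
Qed.

Definition pd k f q := der (fun z => f (upd q k z)) (q k).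

(** The derivative is a limit of averages over circles, which are holomorphic in [q] and uniformly
    bounded. *)
Lemma ch_pd k f p : ch f p -> ch (pd k f) p.
Proof.
move=> [r [M [r0 hM hf]]].
have M0 : 0 <= M by apply: le_trans (hM p (bal_self _ _ r0)); apply: cN_ge0.
pose rho := r / 2; have rho0 : 0 < rho by rewrite /rho; lra.
have r4 : 0 < r / 4 by lra.
have ub q z : bal p (r / 4) q -> N (z - q k) <= rho -> bal p r (upd q k z).
  move=> b zr i; rewrite /upd; case: eqP => [->|_]; last by have := b i; lra.
  by have := b k; have := cN_dist K z (q k) (p k); rewrite /rho in zr; lra.
have hb q : bal p (r / 4) q -> hball (fun z => f (upd q k z)) (q k) rho M.
  move=> b z zr; split; last by apply: hM; apply: ub.
  by apply: hol_cd; apply: hf (ub _ _ b zr); apply: holp_upd1.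
apply: (@ch_lim _ _ K (fun n q => avg n (fun z => f (upd q k (q k + z)) / z) rho) _ _
   (r / 4) (M / rho)) => // [n q b|n G t hG b|q b].
- apply: avg_le => [|z zr]; first exact: ltW.
  rewrite cNM cNV zr ler_pM2r ?invr_gt0 //.
  by apply: hM; apply: ub; rewrite // addrAC subrr add0r zr.
- apply: hol_avg => [|z zr]; first exact: ltW.
  apply: holM; last exact: hol_cst.
  apply: (hf (fun s => upd (G s) k (G s k + z))).
    by apply: holp_upd => //; apply: holD; [apply: hG | apply: hol_cst].
  by apply: ub; rewrite // addrAC subrr add0r zr.
have hbq := hb q b; have [|l hl] := (hbq (q k) _).1; first by rewrite subrr cN0 ltW.
by rewrite /pd (der_eq hl); apply: slope_formula0 hbq hl.
Qed.

Lemma ch_upd f p k (c : pt -> C) : ch f (upd p k (c p)) -> ch c p ->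
  ch (fun q => f (upd q k (c q))) p.
Proof.
move=> hf hc; apply: (@ch_comp _ _ K f (fun q => upd q k (c q))) => // i.
by rewrite /upd; case: eqP => // _; apply: ch_coord.
Qed.

(** The coordinates start to move one after the other, which is the role of [fz]. The slope [sl] in
    the coordinate [k] is holomorphic by [ch_dv], so each step is the derivative of a product. *)
Lemma chain_rule f G t (G' : 'I_5 -> C) : ch f (G t) -> holp G t ->
  (forall i, cd (fun s => G s i) t (G' i)) ->
  cd (fun s => f (G s)) t (\sum_(i < 5) pd i f (G t) * G' i).
Proof.
move=> hf hG dG.
pose fz m s : pt := fun i => if (i < m)%N then G s i else G t i.
have fzt m : fz m t = G t by apply/funext => i; rewrite /fz; case: ifP.
have hfz m : holp (fz m) t.
  by move=> i; rewrite /fz; case: (i < m)%N; [apply: hG | apply: hol_cst].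
suff h m (m5 : (m <= 5)%N) : cd (fun s => f (fz m s)) t
    (\sum_(i < m) pd (widen_ord m5 i) f (G t) * G' (widen_ord m5 i)).
  have := h 5%N (leqnn 5).
  have -> : (fun s => f (fz 5%N s)) = (fun s => f (G s)).
    by apply/funext => s; congr f; apply/funext => i; rewrite /fz ltn_ord.
  congr cd; apply: eq_bigr => i _.
  by have -> : widen_ord (leqnn 5) i = i by apply: val_inj.
elim: m m5 => [|m ih] m5.
  rewrite big_ord0; have -> : (fun s => f (fz 0%N s)) = fun=> f (G t).
    by apply/funext => s; congr f; apply/funext => i.
  exact: cd_cst.
rewrite big_ord_recr /=; set k : 'I_5 := widen_ord m5 ord_max.
have km : k = m :> nat by [].
pose c := G t k.
pose F q' := f (upd q' k (c + q' k)) - f (upd q' k c).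
pose sl q := dv k F (upd q k (q k - c)).
have slE q : f q = f (upd q k c) + sl q * (q k - c).
  rewrite /sl /dv upd_eq; case: eqP => [/eqP|/eqP q0].
    by rewrite subr_eq0 => /eqP e; rewrite e subrr mulr0 addr0 -e upd_id.
  rewrite divfK // /F !upd_upd upd_eq addrC subrK.
  have e : c + (q k - c) = q k by ring.
  by rewrite e upd_id.
have p0 : upd (G t) k (G t k - c) = upd (G t) k 0 by rewrite subrr.
have chF : ch F (upd (G t) k 0).
  apply: chB.
    apply: (@ch_upd _ _ _ (fun q => c + q k)).
      by rewrite upd_upd upd_eq addr0 upd_id.
    by apply: chD; [apply: ch_cst | apply: ch_coord].
  apply: (@ch_upd _ _ _ (fun=> c)); last exact: ch_cst.
  by rewrite upd_upd upd_id.
have chsl : ch sl (G t).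
  apply: (@ch_upd _ _ _ (fun q => q k - c)).
    rewrite p0; apply: (@ch_dv _ _ _ 1) => //; first by rewrite upd_eq.
    by move=> q _ q0; rewrite /F q0 addr0 subrr.
  by apply: chB; [apply: ch_coord | apply: ch_cst].
have slt : sl (G t) = pd k f (G t).
  rewrite /sl p0 /dv upd_eq eqxx.
  have [l hl] : exists l, cd (fun z => f (upd (G t) k z)) c l.
    apply: hol_cd; apply: (@ch_holp _ _ K f (upd (G t) k)); last exact: holp_upd1.
    by rewrite upd_id.
  rewrite /pd (der_eq hl); apply: der_eq.
  have -> : (fun z => F (upd (upd (G t) k 0) k z)) =
     fun z => f (upd (G t) k (c + z)) - f (upd (G t) k c).
    by apply/funext => z; rewrite /F !upd_upd upd_eq.
  rewrite -[l]subr0; apply: cdB; last exact: cd_cst.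
  rewrite -[l]mulr1 -[1]add0r.
  apply: (@cd_comp _ _ K (fun z => c + z) (fun z => f (upd (G t) k z)) 0 (0 + 1) l).
    by apply: cdD; [apply: cd_cst | apply: cd_id].
  by rewrite addr0.
have -> : (fun s => f (fz m.+1 s)) = fun s => f (fz m s) + sl (fz m.+1 s) * (G s k - c).
  apply/funext => s; rewrite slE; have -> : fz m.+1 s k = G s k by rewrite /fz km ltnSn.
  congr (f _ + _); apply/funext => i; rewrite /upd /fz.
  case: eqP => [->|/eqP ik]; first by rewrite km ltnn.
  rewrite ltnS leq_eqVlt; have -> : (i == m :> nat) = false; last by [].
  by rewrite -km (inj_eq val_inj); apply/negbTE.
apply: cdD.
  have := ih (ltnW m5); congr cd; apply: eq_bigr => i _.
  by have -> : widen_ord (ltnW m5) i = widen_ord m5 (widen_ord (leqnSn m) i)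
    by apply: val_inj.
have [l hl] : exists l, cd (fun s => sl (fz m.+1 s)) t l.
  by apply: hol_cd; apply: ch_holp; [rewrite fzt | apply: hfz].
have := cdM hl (cdB (dG k) (cd_cst K c t)).
by rewrite fzt slt subrr mulr0 add0r subr0.
Qed.

Lemma ch_ident f p q : (forall x : R, 0 <= x <= 1 -> ch f (line p q (j x))) ->
  (exists2 d : R, 0 < d & forall q', bal p d q' -> f q' = 0) -> f q = 0.
Proof.
move=> hf [d d0 hd].
have -> : q = line p q 1 by apply/funext => i; rewrite /line mul1r addrC subrK.
apply: (@ident_seg _ _ K (fun z => f (line p q z)) 0) => [x x01|].
  rewrite add0r subr0 mulr1; apply: ch_holp; [exact: hf | exact: holp_line].
have [e e0 he] := holp_cont (holp_line K p q (0 : C)) d0.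
exists e => // w we; apply: hd.
by have := he w we; have -> : line p q 0 = p by apply/funext => i; rewrite /line mul0r addr0.
Qed.

Definition opn (D : pt -> Prop) := forall q, D q -> exists2 d : R, 0 < d &
  forall q', bal q d q' -> D q'.

(** [n] is the least number of divisions after which one of the two functions is nonzero somewhere
    on the hyperplane. If there were none, both functions would be divisible by all powers of the
    coordinate, hence zero by [flat]; the third hypothesis joins every point of [D] to the
    hyperplane inside [D]. *)
Lemma ch_factor k (D : pt -> Prop) (f1 f2 : pt -> C) : opn D ->
  (forall q, D q -> ch f1 q /\ ch f2 q) ->
  (forall q, D q -> forall z, N z <= N (q k) -> D (upd q k z)) ->
  (exists2 q, D q & f1 q != 0 \/ f2 q != 0) ->
  exists n g1 g2, [/\ forall q, D q -> ch g1 q /\ ch g2 q,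
    forall q, D q -> f1 q = q k ^+ n * g1 q /\ f2 q = q k ^+ n * g2 q &
    exists q, [/\ D q, q k = 0 & g1 q != 0 \/ g2 q != 0]].
Proof.
move=> oD hf star ne.
pose nz m f := exists q, [/\ D q, q k = 0 & iter m (dv k) f q != 0].
have it f m : (forall q, D q -> ch f q) -> (forall m', (m' < m)%N -> ~ nz m' f) ->
    (forall q, D q -> ch (iter m (dv k) f) q) /\
    (forall q, D q -> f q = q k ^+ m * iter m (dv k) f q).
  move=> cf; elim: m => [|m ih] hm.
    by split=> // q _; rewrite expr0 mul1r.
  have [|i1 i2] := ih; first by move=> m' lt; apply: hm; apply: ltnW.
  have z q : D q -> q k = 0 -> iter m (dv k) f q = 0.
    move=> Dq q0; apply/eqP; rewrite -[_ == _]negbK; apply/negP => n0.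
    by apply: (hm m (ltnSn m)); exists q.
  split=> q Dq /=.
    case: (eqVneq (q k) 0) => [q0|q0].
      have [d d0 hd] := oD q Dq.
      apply: (@ch_dv _ _ _ d) => // [|q' /hd Dq']; [exact: i1 | exact: z].
    have qp : 0 < N (q k) by rewrite cN_gt0.
    apply: (@ch_ext _ _ _ (fun q => iter m (dv k) f q / q k) _ _ (N (q k))) => //.
      move=> q' /(_ k) b; rewrite /dv ifF //; apply/negbTE; apply/negP => /eqP q0'.
      by move: b; rewrite q0' sub0r cNN ltxx.
    by apply: chM; [apply: i1 | apply: chV => //; apply: ch_coord].
  rewrite i2 // /dv; case: eqP => [q0|/eqP q0].
    by rewrite z // mulr0 q0 expr0n mul0r.
  by rewrite exprSr -mulrA [q k * _]mulrC divfK.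
have [[m hm]|none] := pselect (exists m, nz m f1 \/ nz m f2).
  have ex : exists m, `[< nz m f1 \/ nz m f2 >] by exists m; apply/asboolP.
  have [n /asboolP hn min] := ex_minnP ex.
  have lt1 m' : (m' < n)%N -> ~ nz m' f1.
    by move=> lt h; have /min := introT (asboolP _) (or_introl h : nz m' f1 \/ nz m' f2); rewrite leqNgt lt.
  have lt2 m' : (m' < n)%N -> ~ nz m' f2.
    by move=> lt h; have /min := introT (asboolP _) (or_intror h : nz m' f1 \/ nz m' f2); rewrite leqNgt lt.
  have [a1 b1] := it f1 n (fun q Dq => (hf q Dq).1) lt1.
  have [a2 b2] := it f2 n (fun q Dq => (hf q Dq).2) lt2.
  exists n, (iter n (dv k) f1), (iter n (dv k) f2); split.
  - by move=> q Dq; split; [apply: a1 | apply: a2].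
  - by move=> q Dq; split; [apply: b1 | apply: b2].
  by case: hn => [[q [h1 h2 h3]]|[q [h1 h2 h3]]]; exists q; split=> //; [left|right].
have zero f : (forall q, D q -> ch f q) -> (forall m, ~ nz m f) -> forall q, D q -> f q = 0.
  move=> cf nn q Dq; case: (eqVneq (q k) 0) => [q0|q0].
    apply/eqP; rewrite -[_ == _]negbK; apply/negP => n0.
    by apply: (nn 0%N); exists q.
  have qp : 0 < N (q k) by rewrite cN_gt0.
  have hc g : (forall q, D q -> ch g q) -> forall z, N z <= N (q k) ->
      hol (fun z => g (upd q k z)) z.
    move=> cg z zq; apply: ch_holp; last exact: holp_upd1.
    by apply: cg; apply: star.
  rewrite -(upd_id q k).
  apply: (@ident_seg _ _ K (fun z => f (upd q k z)) 0) => [x /andP[x0 x1]|].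
    rewrite add0r subr0; apply: hc => //.
    by rewrite cNM cN_jr ger0_norm // ler_piMl // cN_ge0.
  have h0 : hol (fun z => f (upd q k z)) 0 by apply: hc => //; rewrite cN0 cN_ge0.
  have [r r0 hb] := hol_hball h0; set M := _ + 1 in hb.
  pose r' := Num.min r (N (q k)); have r'0 : 0 < r' by rewrite lt_min r0.
  have r'r : r' <= r by rewrite ge_min lexx.
  have r'q : r' <= N (q k) by rewrite ge_min lexx orbT.
  have hb' : hball (fun z => f (upd q k z)) 0 r' M.
    by move=> z zr; apply: hb; apply: le_trans zr r'r.
  exists r' => //; apply: (flat r'0 hb') => m.
  have [a b] := it f m cf (fun m' _ => nn m').
  exists (fun z => iter m (dv k) f (upd q k z)); split=> z; rewrite subr0 => zr.
    by apply: hol_cd; apply: hc => //; apply: le_trans zr r'q.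
  rewrite [LHS]b ?upd_eq //; apply: star => //; exact: le_trans zr r'q.
have [q Dq [n1|n2]] := ne.
  by rewrite (zero f1) ?eqxx // in n1 => [q' /hf []|m h]; last by apply: none; exists m; left.
by rewrite (zero f2) ?eqxx // in n2 => [q' /hf []|m h]; last by apply: none; exists m; right.
Qed.

End Division.

(** * Quotients whose derivative is small in a parameter *)

Section LocalConstancy.
Variables (R : realType) (C : numClosedFieldType) (K : cdata R C).
Notation j := (jr K).
Notation N := (cN K).
Notation cd := (cd K).
Notation hol := (hol K).
Notation pt := (pt C).
Notation ch := (ch K).
Notation bal := (bal K).
Notation pd := (pd K).

Definition i0 : 'I_5 := @Ordinal 5 0 isT.
Definition i1 : 'I_5 := @Ordinal 5 1 isT.
Definition i2 : 'I_5 := @Ordinal 5 2 isT.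
Definition i3 : 'I_5 := @Ordinal 5 3 isT.
Definition i4 : 'I_5 := @Ordinal 5 4 isT.

Lemma pd_cd f (q : pt) k : ch f q -> cd (fun z => f (upd q k z)) (q k) (pd k f q).
Proof.
move=> cf; apply: derP; apply: hol_cd; apply: (@ch_holp _ _ K f (upd q k)).
  by rewrite upd_id.
exact: holp_upd1.
Qed.

Lemma pd_eq f (q : pt) k l : cd (fun z => f (upd q k z)) (q k) l -> pd k f q = l.
Proof. exact: der_eq. Qed.

Lemma pdM f g (q : pt) k : ch f q -> ch g q ->
  pd k (fun q => f q * g q) q = pd k f q * g q + f q * pd k g q.
Proof.
move=> cf cg; apply: pd_eq; have := cdM (pd_cd k cf) (pd_cd k cg).
by rewrite upd_id.
Qed.

Lemma pdB f g (q : pt) k : ch f q -> ch g q ->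
  pd k (fun q => f q - g q) q = pd k f q - pd k g q.
Proof. by move=> cf cg; apply: pd_eq; apply: cdB; apply: pd_cd. Qed.

Lemma pd_ext f g (q : pt) k (d : R) : 0 < d -> (forall q', bal q d q' -> f q' = g q') ->
  ch f q -> pd k f q = pd k g q.
Proof.
move=> d0 fg cf; apply/esym/pd_eq; apply: (@cd_ext _ _ _ (fun z => f (upd q k z)) _ _ _ d) => //.
  move=> z zd; apply: fg => i; rewrite /upd; case: eqP => [->|_] //.
  by rewrite subrr cN0.
exact: pd_cd.
Qed.

Lemma pd_cst k (h : pt -> C) (q : pt) : (forall z, h (upd q k z) = h q) -> pd k h q = 0.
Proof.
move=> e; apply: pd_eq; have -> : (fun z => h (upd q k z)) = fun=> h q by apply/funext.
exact: cd_cst.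
Qed.

Lemma cont_zero (h : C -> C) t : cont K h t ->
  (exists2 d : R, 0 < d & forall z, z != t -> N (z - t) < d -> h z = 0) -> h t = 0.
Proof.
move=> ch [d d0 hd]; apply: (@small_eq0 _ _ K _ 1) => e e0; rewrite mul1r.
have [d' d'0 h'] := ch e e0.
pose x := Num.min d d' / 2.
have m0 : 0 < Num.min d d' by rewrite lt_min d0.
have x0 : 0 < x by rewrite /x; lra.
have Nx : N (t + j x - t) = x by rewrite addrC addKr cN_jr gtr0_norm.
have : x < Num.min d d' by rewrite /x; lra.
rewrite lt_min => /andP[xd xd'].
have := h' (t + j x); rewrite hd ?Nx //; last first.
  by rewrite -subr_eq0 -(cN_gt0 K) Nx.
by rewrite sub0r cNN; apply.
Qed.

(** Coordinates [i0] and [i1] hold the time and the blow-up parameter; the others are frozen. *)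
Definition pl (x : pt) u e : pt := upd (upd x i0 u) i1 e.

Lemma pl0 x u e : pl x u e i0 = u. Proof. by []. Qed.
Lemma pl1 x u e : pl x u e i1 = e. Proof. by []. Qed.
Lemma plU x u e v : upd (pl x u e) i0 v = pl x v e.
Proof. by apply/funext => i; rewrite /pl /upd; case: (i =P i0) => [->|]. Qed.
Lemma plU1 x u e v : upd (pl x u e) i1 v = pl x u v.
Proof. by rewrite /pl upd_upd. Qed.

Definition pr (x q : pt) : pt := pl x (q i0) (q i1).

Lemma ch_pr f x u e : ch f (pl x u e) -> ch (fun q => f (pr x q)) (pl x u e).
Proof.
move=> cf; apply: (@ch_comp _ _ K f (pr x)) => // i.
rewrite /pr /pl /upd; case: (i == i1); first exact: ch_coord.
by case: (i == i0); [exact: ch_coord | exact: ch_cst].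
Qed.

(* If [b da - a db = O(eps^m')] in the direction of [w], then [a / b] does not depend
   on [w] up to that order: each Taylor coefficient [L (w, 0)] of
   [a b (w') - a (w') b] is a constant multiple of [bh (w, 0)] and vanishes at [w']. *)
Lemma local_const_aux (w0 : C) (rho : R) (x : pt) (a b bh Z : pt -> C) (m m' : nat) :
  (forall q, a (pr x q) = a q) -> (forall q, b (pr x q) = b q) ->
  (forall w e, N (w - w0) < rho -> N e < rho -> let q := pl x w e in
    [/\ ch a q, ch b q, ch bh q & ch Z q] /\
    b q = e ^+ m * bh q /\
    b q * pd i0 a q - a q * pd i0 b q = e ^+ m' * Z q) ->
  forall w w', N (w - w0) < rho -> N (w' - w0) < rho ->
  bh (pl x w 0) != 0 -> bh (pl x w' 0) != 0 ->
  exists2 M : R, 0 <= M & exists2 d : R, 0 < d & forall e, e != 0 -> N e < d ->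
    let q := pl x w e in let q' := pl x w' e in
    [/\ b q != 0, b q' != 0 & N (a q / b q - a q' / b q') * N e ^+ (m + m) <= M * N e ^+ m'].
Proof.
move=> ia ib hyp w w' hw hw' nw nw'.
have rho0 : 0 < rho by apply: le_lt_trans hw; apply: cN_ge0.
pose P := pl x.
have P0 u e : P u e i0 = u by [].
have P1 u e : P u e i1 = e by [].
have PU u e v : upd (P u e) i0 v = P v e by apply: plU.
pose s q : pt := upd q i0 w'.
have cs f u e : ch f (P w' e) -> ch (fun q => f (s q)) (P u e).
  by move=> cf; apply: (@ch_upd _ _ K f _ i0 (fun=> w')); [rewrite  ?plU ?PU | apply: ch_cst].
(* The numerator of the difference of [a / b] at the current time and at [w']. As the values at [w']
   do not depend on the time, it inherits the differential relation of [a]. *)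
pose Lam q := a q * b (s q) - a (s q) * b q.
have N0 : N (0 : C) < rho by rewrite cN0.
have iL q : Lam (pr x q) = Lam q.
  have e : s (pr x q) = pr x (s q) by rewrite /s /pr  ?plU ?PU.
  by rewrite /Lam e !ia !ib.
have cLam u e : N (u - w0) < rho -> N e < rho -> ch Lam (P u e).
  move=> hu he; have [[ca cb _ _] _] := hyp u e hu he.
  have [[ca' cb' _ _] _] := hyp w' e hw' he.
  by apply: chB; apply: chM => //; apply: cs.
have dLam u e : N (u - w0) < rho -> N e < rho ->
    b (P u e) * pd i0 Lam (P u e) - Lam (P u e) * pd i0 b (P u e) =
    b (P w' e) * (e ^+ m' * Z (P u e)).
  move=> hu he; have [[ca cb _ _] [_ rel]] := hyp u e hu he.
  have [[ca' cb' _ _] _] := hyp w' e hw' he.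
  have z g : pd i0 (fun q => g (s q)) (P u e) = 0.
    by apply: pd_cst => v; rewrite /s  ?plU ?PU  ?plU ?PU.
  have ca1 := cs a u e ca'; have cb1 := cs b u e cb'.
  rewrite /Lam pdB; [|exact: chM|exact: chM].
  rewrite (pdM i0 ca cb1) (pdM i0 ca1 cb) !z.
  have se : s (P u e) = P w' e by rewrite /s  ?plU ?PU.
  by rewrite se -rel /P; ring.
have c1 (g : pt -> C) u e : ch g (P u e) -> cont K (fun z => g (P u z)) e.
  move=> cg; apply: hol_cont; apply: (@ch_holp _ _ K g (P u)) => // i.
  by rewrite /P /pl /upd; case: (i == i1); [apply: hol_id | apply: hol_cst].
have h0 (g : pt -> C) u e : ch g (P u e) -> hol (fun z => g (P z e)) u.
  move=> cg; apply: (@ch_holp _ _ K g (fun z => P z e)) => // i.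
  rewrite /P /pl /upd; case: (i == i1); first exact: hol_cst.
  by case: (i == i0); [apply: hol_id | apply: hol_cst].
(* One factor [e] is split off at a time. The vanishing at [w'] is carried along since it is the
   initial value for the next division. *)
have step k : (k <= m')%N -> exists L, [/\ forall q, L (pr x q) = L q,
    forall u e, N (u - w0) < rho -> N e < rho -> ch L (P u e),
    forall u e, N (u - w0) < rho -> N e < rho -> Lam (P u e) = e ^+ k * L (P u e) &
    forall e, e != 0 -> N e < rho -> L (P w' e) = 0].
  elim: k => [_|k ih lt].
    exists Lam; split=> // [u e _ _|e _ _]; first by rewrite expr0 mul1r.
    by rewrite /Lam /s  ?plU ?PU subrr.
  have [L [inL cL LE Lw']] := ih (ltnW lt).
  have L0 u : N (u - w0) < rho ->
      bh (P u 0) * pd i0 L (P u 0) - L (P u 0) * pd i0 bh (P u 0) = 0.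
    move=> hu.
    have := @cont_zero (fun z => bh (P u z) * pd i0 L (P u z) - L (P u z) * pd i0 bh (P u z)
      - z ^+ (m' - k) * (bh (P w' z) * Z (P u z))) 0.
    rewrite expr0n subn_eq0 leqNgt lt mul0r subr0; apply.
      have [[_ _ cbh cZ] _] := hyp u 0 hu N0; have [[_ _ cbh' _] _] := hyp w' 0 hw' N0.
      have cLu := cL u 0 hu N0.
      apply: contD; [apply: contD|apply: contN].
      - by apply: contM; apply: c1 => //; apply: ch_pd.
      - by apply: contN; apply: contM; apply: c1 => //; apply: ch_pd.
      apply: contM; first by apply: hol_cont; apply: holX; apply: hol_id.
      by apply: contM; apply: c1.
    exists rho => // z z0; rewrite subr0 => zr.
    have [[ca cb cbh cZ] [bE _]] := hyp u z hu zr.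
    have [_ [bE' _]] := hyp w' z hw' zr.
    have pL (f g : pt -> C) (l : nat) : ch g (P u z) ->
        (forall u' e', N (u' - w0) < rho -> N e' < rho -> f (P u' e') = e' ^+ l * g (P u' e')) ->
        pd i0 f (P u z) = z ^+ l * pd i0 g (P u z).
      move=> cg fg; apply: pd_eq; rewrite  ?pl0 ?P0.
      apply: (@cd_ext _ _ _ (fun v => z ^+ l * g (P v z)) _ _ _ (rho - N (u - w0))).
      - by rewrite subr_gt0.
      - move=> v hv; rewrite  ?plU ?PU fg //.
        by have := cN_dist K v u w0; move: hv; clear; lra.
      apply: cdZ; have := pd_cd i0 cg; rewrite  ?pl0 ?P0.
      by congr cd; apply/funext => v; rewrite  ?plU ?PU.
    have bE2 u' e' : N (u' - w0) < rho -> N e' < rho -> b (P u' e') = e' ^+ m * bh (P u' e').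
      by move=> hu' he'; have [_ []] := hyp u' e' hu' he'.
    have := dLam u z hu zr; rewrite (pL Lam L k (cL u z hu zr) LE) (pL b bh m cbh bE2).
    rewrite LE // !bE2 //.
    have zk : z ^+ m' = z ^+ k * z ^+ (m' - k) by rewrite -exprD subnKC // ltnW.
    rewrite zk; move: (bh (P u z)) (bh (P w' z)) (L (P u z)) (pd i0 L _) (pd i0 bh _) (Z (P u z)).
    move=> A B1 B2 B3 B4 B5.
    have zz : z ^+ m * z ^+ k != 0 by rewrite mulf_neq0 // expf_neq0.
    move: zz; set y := z ^+ (m' - k); set ym := z ^+ m; set yk := z ^+ k => zz e.
    apply: (mulfI zz); rewrite mulr0.
    have -> : ym * yk * (A * B3 - B2 * B4 - y * (B1 * B5)) =
      (ym * A * (yk * B3) - yk * B2 * (ym * B4)) - ym * yk * (y * (B1 * B5)) by ring.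
    by rewrite e; ring.
  have Lw'0 : L (P w' 0) = 0.
    apply: (@cont_zero (fun z => L (P w' z)) 0); first by apply: c1; apply: cL.
    by exists rho => // z z0; rewrite subr0; apply: Lw'.
  (* By [L0] the quotient of [L] and [bh] has derivative zero at [e = 0] near [w'], where [bh] is
     nonzero; so [L] vanishes near [w'], and on the whole disc by the identity theorem. Zeros of
     [bh] between [w'] and [u] are thus harmless. *)
  have Lz u : N (u - w0) < rho -> L (P u 0) = 0.
    move=> hu; apply: (@ident _ _ K (fun v => L (P v 0)) w0 rho w') => //.
      by move=> z zr; apply: h0; apply: cL.
    have [[_ _ cbh _] _] := hyp w' 0 hw' N0.
    have [d d0 hd] := cont_nz (hol_cont (h0 _ _ _ cbh)) nw'.
    pose d' := Num.min d (rho - N (w' - w0)).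
    have d'0 : 0 < d' by rewrite lt_min d0 subr_gt0.
    have in1 v : N (v - w') < d' -> N (v - w0) < rho /\ bh (P v 0) != 0.
      rewrite lt_min => /andP[/hd h1 h2]; split.
        by have := cN_dist K v w' w0; move: h2; clear; lra.
      by rewrite -(cN_gt0 K); apply: lt_le_trans h1; rewrite divr_gt0 // cN_gt0.
    exists d' => // v hv.
    have [_ nv] := in1 v hv.
    have rz : L (P v 0) / bh (P v 0) - L (P w' 0) / bh (P w' 0) = 0.
      apply/eqP; rewrite -(cN_eq0 K); apply/eqP/le_anti; rewrite cN_ge0 andbT.
      rewrite -(mul0r (N (v - w'))).
      apply: (@mvt _ _ K (fun u => L (P u 0) / bh (P u 0))) => y /andP[y0 y1].
      have hy : N (w' + j y * (v - w') - w') < d'.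
        rewrite addrAC subrr add0r cNM cN_jr ger0_norm //.
        by apply: le_lt_trans hv; rewrite ler_piMl // cN_ge0.
      set yy := w' + _ in hy *; have [hy1 hy2] := in1 yy hy.
      have [[_ _ cbhy _] _] := hyp yy 0 hy1 N0.
      have p1 := pd_cd i0 (cL yy 0 hy1 N0); have p2 := pd_cd i0 cbhy.
      have eU (g : pt -> C) : (fun z => g (upd (P yy 0) i0 z)) = fun z => g (P z 0).
        by apply/funext => z; rewrite  ?plU ?PU.
      rewrite !eU !P0 in p1 p2.
      eexists; first exact: cdM p1 (cdV p2 hy2).
      have -> : pd i0 L (P yy 0) * (bh (P yy 0))^-1 +
        L (P yy 0) * (- pd i0 bh (P yy 0) / bh (P yy 0) ^+ 2) =
        (bh (P yy 0) * pd i0 L (P yy 0) - L (P yy 0) * pd i0 bh (P yy 0)) / bh (P yy 0) ^+ 2.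
        by field.
      by rewrite L0 // mul0r cN0.
    move: rz; rewrite Lw'0 mul0r subr0 => /eqP; rewrite mulf_eq0 invr_eq0 (negbTE nv) orbF.
    by move/eqP.
  have LEE u e : N (u - w0) < rho -> N e < rho -> L (P u e) = e * dv K i1 L (P u e).
    move=> hu he; rewrite /dv  ?pl1 ?P1; case: eqP => [->|/eqP e0]; first by rewrite mul0r Lz.
    by rewrite mulrC divfK.
  exists (dv K i1 L); split.
  - move=> q; rewrite /dv /pr  ?pl1 ?P1 -/(pr x q) inL; case: eqP => // _.
    congr (der K _ _); apply/funext => z; rewrite -[RHS]inL; congr L.
    by rewrite /pr plU1.
  - move=> u e hu he; case: (eqVneq e 0) => [->|e0].
      apply: (@ch_dv _ _ _ _ _ _ (rho - N (u - w0))) => //.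
      + exact: cL.
      + by rewrite subr_gt0.
      move=> q bq q1; rewrite -inL /pr q1; apply: Lz.
      by have := bq i0; rewrite  ?pl0 ?P0; have := cN_dist K (q i0) u w0; clear; lra.
    apply: (@ch_ext _ _ _ (fun q => L q / q i1) _ _ (N e)).
    + by rewrite cN_gt0.
    + move=> q /(_ i1); rewrite  ?pl1 ?P1 /dv => bq; rewrite ifF //.
      by apply/negbTE; apply/negP => /eqP q0; move: bq; rewrite q0 sub0r cNN ltxx.
    by apply: chM; [apply: cL | apply: chV; [apply: ch_coord | ]].
  - by move=> u e hu he; rewrite LE // LEE // exprSr mulrA.
  move=> e e0 he; have := Lw' e e0 he; rewrite LEE // => /eqP.
  by rewrite mulf_eq0 (negbTE e0) => /eqP.
have [L [_ cL LE _]] := step m' (leqnn _).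
have bd (g : pt -> C) u : ch g (P u 0) -> g (P u 0) != 0 ->
    exists2 c : R, 0 < c & exists2 d : R, 0 < d & forall z, N z < d -> c <= N (g (P u z)).
  move=> cg gn; have [d d0 hd] := cont_nz (c1 _ _ _ cg) gn.
  exists (N (g (P u 0)) / 2); first by rewrite divr_gt0 // cN_gt0.
  by exists d => // z zd; apply: hd; rewrite subr0.
have [[_ _ cbh _] _] := hyp w 0 hw N0; have [[_ _ cbh' _] _] := hyp w' 0 hw' N0.
have [ca ca0 [d1 d10 h1]] := bd bh w cbh nw; have [cb cb0 [d2 d20 h2]] := bd bh w' cbh' nw'.
have [d3 d30 h3] := cont_bdd (c1 _ _ _ (cL w 0 hw N0)).
set ML := _ + 1 in h3.
have ML0 : 0 <= ML by rewrite addr_ge0 // cN_ge0.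
exists (ML / (ca * cb)); first by rewrite divr_ge0 // mulr_ge0 // ltW.
exists (Num.min (Num.min d1 d2) (Num.min d3 rho)); first by rewrite !lt_min d10 d20 d30.
move=> e e0; rewrite !lt_min => /andP[/andP[e1 e2] /andP[e3 er]] /=.
have k1 := h1 e e1; have k2 := h2 e e2; have k3 : N (L (P w e)) <= ML by apply: h3; rewrite subr0.
have [_ [bE _]] := hyp w e hw er; have [_ [bE' _]] := hyp w' e hw' er.
have b1 : bh (P w e) != 0 by rewrite -(cN_gt0 K); apply: lt_le_trans k1.
have b2 : bh (P w' e) != 0 by rewrite -(cN_gt0 K); apply: lt_le_trans k2.
have em : e ^+ m != 0 by rewrite expf_neq0.
have q1 : b (P w e) != 0 by rewrite bE mulf_neq0.
have q2 : b (P w' e) != 0 by rewrite bE' mulf_neq0.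
split=> //.
have -> : a (pl x w e) / b (pl x w e) - a (pl x w' e) / b (pl x w' e) =
    Lam (P w e) / (b (P w e) * b (P w' e)).
  rewrite /Lam /s  ?plU ?PU -/(P w' e); field; exact/andP.
rewrite LE // bE bE' !cNM cNV !cNM !cNX.
have en : 0 < N e by rewrite cN_gt0.
have n1 : 0 < N (bh (P w e)) by rewrite cN_gt0.
have n2 : 0 < N (bh (P w' e)) by rewrite cN_gt0.
have -> : N e ^+ m' * N (L (P w e)) / (N e ^+ m * N (bh (P w e)) * (N e ^+ m * N (bh (P w' e))))
   * N e ^+ (m + m) = N (L (P w e)) / (N (bh (P w e)) * N (bh (P w' e))) * N e ^+ m'.
  by rewrite exprD; field; rewrite expf_neq0 ?gt_eqF.
apply: ler_wpM2r; first by rewrite exprn_ge0 // ltW.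
apply: ler_pM; rewrite ?cN_ge0 ?invr_ge0 ?mulr_ge0 ?cN_ge0 //.
rewrite lef_pV2 ?posrE ?mulr_gt0 //.
by apply: ler_pM => //; apply: ltW.
Qed.

(** Composition with [pr x] freezes the remaining coordinates, which gives the invariance assumed in
    [local_const_aux]. *)
Lemma local_const (w0 : C) (rho : R) (x : pt) (a b bh Z : pt -> C) (m m' : nat) :
  (forall w e, N (w - w0) < rho -> N e < rho -> let q := pl x w e in
    [/\ ch a q, ch b q, ch bh q & ch Z q] /\
    b q = e ^+ m * bh q /\
    b q * pd i0 a q - a q * pd i0 b q = e ^+ m' * Z q) ->
  forall w w', N (w - w0) < rho -> N (w' - w0) < rho ->
  bh (pl x w 0) != 0 -> bh (pl x w' 0) != 0 ->
  exists2 M : R, 0 <= M & exists2 d : R, 0 < d & forall e, e != 0 -> N e < d ->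
    let q := pl x w e in let q' := pl x w' e in
    [/\ b q != 0, b q' != 0 & N (a q / b q - a q' / b q') * N e ^+ (m + m) <= M * N e ^+ m'].
Proof.
move=> hyp w w' hw hw' nw nw'.
have pp u e : pr x (pl x u e) = pl x u e by [].
have [|||M M0 [d d0 h]] := @local_const_aux w0 rho x (fun q => a (pr x q)) (fun q => b (pr x q)) bh Z m m'
  _ _ _ w w' hw hw' nw nw' => //.
  move=> u e hu he; have [[ca cb cbh cZ] [bE rel]] := hyp u e hu he.
  split; first by split=> //; apply: ch_pr.
  split; first by rewrite pp.
  have pdp (g : pt -> C) : pd i0 (fun q => g (pr x q)) (pl x u e) = pd i0 g (pl x u e).
    congr (der K _ _); apply/funext => z; congr g; by rewrite plU.
  by rewrite !pdp !pp.
by exists M => //; exists d.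
Qed.

End LocalConstancy.

(** * First integrals near the curve *)

Section Rep.
Variables (R : realType) (C : numClosedFieldType) (K : cdata R C) (E lam : C).
Notation j := (jr K).
Notation N := (cN K).
Notation hol := (hol K).
Notation pt := (pt C).
Notation ch := (ch K).
Notation bal := (bal K).
Notation pd := (pd K).

Definition mk (s e x y c : C) : pt := fun i => nth 0 [:: s; e; x; y; c] i.
Definition base (s : C) : pt := mk s 0 0 0 0.

Lemma ch_mk (f : 'I_5 -> pt -> C) q : (forall i, ch (f i) q) ->
  forall i, ch (fun q => mk (f i0 q) (f i1 q) (f i2 q) (f i3 q) (f i4 q) i) q.
Proof.
move=> h [[|[|[|[|[|n]]]]] //= Hn];
 [exact: (h i0)|exact: (h i1)|exact: (h i2)|exact: (h i3)|exact: (h i4)].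
Qed.

Lemma ptP (q q' : pt) : q i0 = q' i0 -> q i1 = q' i1 -> q i2 = q' i2 -> q i3 = q' i3 ->
  q i4 = q' i4 -> q = q'.
Proof.
move=> e0 e1 e2 e3 e4; apply/funext => -[[|[|[|[|[|n]]]]] //= Hn].
- by have -> : Ordinal Hn = i0 by apply: val_inj.
- by have -> : Ordinal Hn = i1 by apply: val_inj.
- by have -> : Ordinal Hn = i2 by apply: val_inj.
- by have -> : Ordinal Hn = i3 by apply: val_inj.
- by have -> : Ordinal Hn = i4 by apply: val_inj.
Qed.

Lemma balP (p q : pt) (r : R) : bal p r q <->
  [/\ N (q i0 - p i0) < r, N (q i1 - p i1) < r, N (q i2 - p i2) < r,
      N (q i3 - p i3) < r & N (q i4 - p i4) < r].
Proof.
split=> [h|[h0 h1 h2 h3 h4] [[|[|[|[|[|n]]]]] //= Hn]]; first by split; apply: h.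
- by have -> : Ordinal Hn = i0 by apply: val_inj.
- by have -> : Ordinal Hn = i1 by apply: val_inj.
- by have -> : Ordinal Hn = i2 by apply: val_inj.
- by have -> : Ordinal Hn = i3 by apply: val_inj.
- by have -> : Ordinal Hn = i4 by apply: val_inj.
Qed.

(* The blow-up of the curve [base]: [q i1] is the small parameter. *)
Definition bl (q : pt) : pt := mk (q i0) 0 (q i1 * q i2) (q i1 * q i3) (q i1 * q i4).

Lemma ch_bl i q : ch (fun q => bl q i) q.
Proof.
apply: (@ch_mk (fun i q => if i == i0 then q i0 else if i == i1 then 0 else q i1 * q i)).
move=> {}i; case: (i == i0); first exact: ch_coord.
case: (i == i1); first exact: ch_cst.
by apply: chM; apply: ch_coord.
Qed.

Definition c1 (s : C) := 4 * lam * s ^+ 3 - 3 * s + 2 * E.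
(** The quantity [P_A^2 / (16 B)], equal to [x dx^2] on the curve, in terms of the reduced
    coordinates; accordingly [sq] is [P_A^2]. *)
Definition yv (q : pt) := (c1 (q i0) + 2 * q i4) / 12 + q i2.
Definition sq (q : pt) := 16 * q i0 * yv q.

(* The reduced flow, with [s] as time: [q i2], [q i3], [q i4] stand for eta, b, H - E. *)
Definition X1 (q : pt) := 3 / 2 * q i3 + 3 / 4 * q i3 ^+ 2.
Definition X2 (q : pt) := (- 6 * q i2 - (E + q i4 - q i0) * q i3 - 6 * q i3 * q i2
  + 3 / 2 * q i0 * q i3 ^+ 2 + q i0 / 2 * q i3 ^+ 3) / (4 * q i0 * yv q).

(** [B^2] times a partial derivative of [A / B]; unlike the derivative itself it is holomorphic on
    the zeros of [B]. *)
Definition th (A B : pt -> C) k q := B q * pd k A q - A q * pd k B q.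

Lemma ch_th A B k q : ch A q -> ch B q -> ch (th A B k) q.
Proof. by move=> cA cB; apply: chB; apply: chM => //; apply: ch_pd. Qed.

(* Local expression [A / B] of a first integral [F] near a point of the curve,
   with the leading terms [Bh], [(T1, T2)] of [B] and of the transversal
   differential [B dA - A dB]. *)
Record rep (F : pt -> C -> C) (s0 r0 : C) := Rep {
  rho : R; rA : pt -> C; rB : pt -> C; rm : nat; rn : nat;
  rBh : pt -> C; rT1 : pt -> C; rT2 : pt -> C;
  rho_gt0 : 0 < rho;
  rAB_ch : forall q, bal (base s0) rho q -> ch rA q /\ ch rB q;
  r_val : forall q r, bal (base s0) rho q -> r ^+ 2 = sq q -> N (r - r0) < rho ->
    rB q != 0 -> F q r = rA q / rB q;
  r_rel : forall q, bal (base s0) rho q ->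
    th rA rB i0 q + X1 q * th rA rB i2 q + X2 q * th rA rB i3 q = 0;
  r_ch : forall q, bal (base s0) rho (bl q) -> [/\ ch rBh q, ch rT1 q & ch rT2 q];
  r_fac : forall q, bal (base s0) rho (bl q) -> [/\ rB (bl q) = q i1 ^+ rm * rBh q,
     th rA rB i2 (bl q) = q i1 ^+ rn * rT1 q & th rA rB i3 (bl q) = q i1 ^+ rn * rT2 q];
  r_Bnz : exists q, [/\ bal (base s0) rho (bl q), q i1 = 0 & rBh q != 0];
  r_Tnz : exists q, [/\ bal (base s0) rho (bl q), q i1 = 0 & rT1 q != 0 \/ rT2 q != 0] }.

Lemma bl1 q : bl (mk (q i0) 1 (q i2) (q i3) (q i4)) = upd q i1 0.
Proof. by apply: ptP; rewrite /bl /= ?mul1r. Qed.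

Lemma opn_bl s0 (rho : R) : opn K (fun q => bal (base s0) rho (bl q)).
Proof.
move=> q b; have [d d0 hd] := bal_near b.
have [||e e0 he] := @fin5 R (fun i e => forall q', bal q e q' -> N (bl q' i - bl q i) < d).
- by move=> i e e' _ le h q' bq; apply: h; apply: bal_sub bq.
- move=> i; have d2 : 0 < d / 2 by lra.
  have [e e0 he] := ch_cont (ch_bl i q) d2; exists e => // q' /he h; lra.
by exists e => // q' bq; apply: hd => i; apply: he.
Qed.

(** The leading terms come from [ch_factor] along the exceptional divisor [q i1 = 0] of the blow-up.
    The two transversal components are factored together, so that [T1] and [T2] have a common order
    and do not both vanish identically. Independence of the coordinate [i1] lets points with
    parameter 1 represent all points downstairs. *)
Lemma mk_rep F s0 r0 (rho : R) A B : 0 < rho ->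
  (forall q, bal (base s0) rho q -> ch A q /\ ch B q) ->
  (forall q, A (upd q i1 0) = A q) -> (forall q, B (upd q i1 0) = B q) ->
  (forall q r, bal (base s0) rho q -> r ^+ 2 = sq q -> N (r - r0) < rho ->
    B q != 0 -> F q r = A q / B q) ->
  (forall q, bal (base s0) rho q ->
    th A B i0 q + X1 q * th A B i2 q + X2 q * th A B i3 q = 0) ->
  (exists2 q, bal (base s0) rho q & B q != 0) ->
  (exists2 q, bal (base s0) rho q & th A B i2 q != 0 \/ th A B i3 q != 0) ->
  inhabited (rep F s0 r0).
Proof.
move=> rho0 cAB iA iB val rel [q1 b1 n1] [q2 b2 n2].
pose D q := bal (base s0) rho (bl q).
have star q : D q -> forall z, N z <= N (q i1) -> D (upd q i1 z).
  rewrite /D => /balP; rewrite /bl /base /= => -[h0 h1 h2 h3 h4] z zq; apply/balP => /=.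
  have k (c : C) : N (q i1 * c - 0) < rho -> N (z * c - 0) < rho.
    rewrite !subr0 !cNM; apply: le_lt_trans; apply: ler_wpM2r => //; exact: cN_ge0.
  by split=> //; apply: k.
have up q : bal (base s0) rho q -> D (mk (q i0) 1 (q i2) (q i3) (q i4)).
  move=> /balP [h0 h1 h2 h3 h4]; rewrite /D bl1; apply/balP; split=> //.
  by rewrite /= subrr cN0.
have cB f q : (forall q, bal (base s0) rho q -> ch f q) -> D q -> ch (fun q => f (bl q)) q.
  by move=> cf Dq; apply: (@ch_comp _ _ K f bl); [apply: cf | move=> i; apply: ch_bl].
have pdi f k q : k != i1 -> (forall q, f (upd q i1 0) = f q) ->
    pd k f (upd q i1 0) = pd k f q.
  move=> k1 inv; rewrite /pd /upd (negbTE k1); congr (der K _ _).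
  apply/funext => z; rewrite -[RHS]inv; congr f; apply/funext => i; rewrite /upd.
  by case: (eqVneq i i1) => // ->; rewrite eq_sym (negbTE k1).
have thi k q : k != i1 -> th A B k (upd q i1 0) = th A B k q.
  by move=> k1; rewrite /th iA iB !pdi.
(* Only one function is to be factored here, so it fills both places of the pair. *)
have [||m [g1 [g2 [m1 m2 m3]]]] :=
    @ch_factor _ _ K i1 D (fun q => B (bl q)) (fun q => B (bl q)) (@opn_bl s0 rho) _ star.
- by move=> q Dq; split; apply: cB => // q' /cAB [].
- by exists (mk (q1 i0) 1 (q1 i2) (q1 i3) (q1 i4)); [apply: up | left; rewrite bl1 iB].
have [||n [t1 [t2 [p1 p2 p3]]]] :=
    @ch_factor _ _ K i1 D (fun q => th A B i2 (bl q)) (fun q => th A B i3 (bl q))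
      (@opn_bl s0 rho) _ star.
- by move=> q Dq; split; apply: cB => // q' /cAB []; apply: ch_th.
- by exists (mk (q2 i0) 1 (q2 i2) (q2 i3) (q2 i4)); [apply: up | rewrite bl1 !thi].
have [qb [db qb0 nb]] := m3.
have nz : exists g, [/\ forall q, D q -> ch g q, forall q, D q -> B (bl q) = q i1 ^+ m * g q &
    g qb != 0].
  case: nb => nb; [exists g1 | exists g2]; split=> // q Dq;
  by [case: (m1 q Dq) | case: (m2 q Dq)].
have [g [gc gf gn]] := nz.
constructor; apply: (@Rep F s0 r0 rho A B m n g t1 t2) => //.
- by move=> q Dq; have [? ?] := p1 q Dq; split=> //; apply: gc.
- by move=> q Dq; have [? ?] := p2 q Dq; split=> //; apply: gf.
by exists qb.
Qed.

(** On the exceptional divisor [bl] forgets everything but [s]: the directions [q i2], [q i3],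
    [q i4] are arbitrary, however small the neighbourhood of the curve. *)
Lemma bal_slice s0 (r : R) q : 0 < r -> q i1 = 0 ->
  bal (base s0) r (bl q) <-> N (q i0 - s0) < r.
Proof.
move=> r0 q1; split=> [/balP [] //|h]; apply/balP.
by rewrite /bl /base /= q1 !mul0r subrr cN0; split.
Qed.

Definition conv (D : C -> Prop) := forall u v (x : R), 0 <= x <= 1 -> D u -> D v ->
  D (u + j x * (v - u)).

Lemma conv_disc s0 (r : R) : conv (fun s => N (s - s0) < r).
Proof.
move=> u v x /andP[x0 x1] hu hv.
have -> : u + j x * (v - u) - s0 = j (1 - x) * (u - s0) + j x * (v - s0).
  by rewrite rmorphB rmorph1; ring.
apply: le_lt_trans (cN_tri _ _ _) _; rewrite !cNM !cN_jr !ger0_norm ?subr_ge0 //.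
case: (eqVneq x 0) => [->|xn]; first by move: hu; clear; lra.
have xp : 0 < x by rewrite lt_def xn.
have y0 : 0 <= 1 - x by rewrite subr_ge0.
have h1 := ler_wpM2l y0 (ltW hu).
have h2 : x * N (v - s0) < x * r by rewrite ltr_pM2l.
by move: h1 h2; clear; lra.
Qed.

Lemma slice_ident_at (D : C -> Prop) (g : pt -> C) (p : pt) (d : R) : conv D ->
  (forall q, q i1 = 0 -> D (q i0) -> ch g q) -> p i1 = 0 -> D (p i0) -> 0 < d ->
  (forall q, q i1 = 0 -> bal p d q -> g q = 0) ->
  forall q, q i1 = 0 -> D (q i0) -> g q = 0.
Proof.
move=> cD cg p1 Dp d0 hz q q1 hq.
suff : g (upd q i1 0) = 0 by have := upd_id q i1; rewrite q1 => ->.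
apply: (@ch_ident _ _ K (fun q => g (upd q i1 0)) p) => [x x01|].
  apply: (@ch_upd _ _ K g _ i1 (fun=> 0)); last exact: ch_cst.
  by apply: cg => //; apply: cD.
exists d => // q' b; apply: hz; first exact: upd_eq.
by move=> i; rewrite /upd; case: eqP => [->|_]; [rewrite p1 subrr cN0|].
Qed.

Lemma slice_ident s0 (r : R) (g : pt -> C) s1 (d : R) : 0 < r ->
  (forall q, q i1 = 0 -> N (q i0 - s0) < r -> ch g q) -> N (s1 - s0) < r ->
  0 < d -> (forall q, q i1 = 0 -> N (q i0 - s1) < d -> N (q i0 - s0) < r -> g q = 0) ->
  forall q, q i1 = 0 -> N (q i0 - s0) < r -> g q = 0.
Proof.
move=> r0 cg hs1 d0 hz.
apply: (@slice_ident_at (fun s => N (s - s0) < r) g (base s1) (Num.min d (r - N (s1 - s0)))) => //.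
- exact: conv_disc.
- by rewrite lt_min d0 subr_gt0.
move=> q q1 /(_ i0); rewrite lt_min => /andP[h1 h2]; apply: hz => //=.
by have := cN_dist K (q i0) s1 s0; move: h2; rewrite /base /=; clear; lra.
Qed.

(** The identity theorem on the exceptional divisor: a holomorphic function which vanishes wherever
    [f] does not is zero. *)
Lemma slice_prod (D : C -> Prop) (f g : pt -> C) : conv D ->
  (forall q, q i1 = 0 -> D (q i0) -> ch f q /\ ch g q) ->
  (exists q, [/\ q i1 = 0, D (q i0) & f q != 0]) ->
  (exists q, [/\ q i1 = 0, D (q i0) & g q != 0]) ->
  (forall q, q i1 = 0 -> D (q i0) -> exists2 d : R, 0 < d & forall z, N (z - q i0) < d -> D z) ->
  exists q, [/\ q i1 = 0, D (q i0), f q != 0 & g q != 0].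
Proof.
move=> cD cfg [p [p1 Dp np]] [q [q1 Dq nq]] oD; apply: contrapT => none.
have p0 : 0 < N (f p) by rewrite cN_gt0.
have p2 : 0 < N (f p) / 2 by rewrite divr_gt0.
have [d d0 hd] := ch_cont (cfg p p1 Dp).1 p2; have [e e0 he] := oD p p1 Dp.
move/negP: nq; apply; apply/eqP.
apply: (@slice_ident_at D g p (Num.min d e)) => //.
- by move=> q' q'1 Dq'; have [] := cfg q' q'1 Dq'.
- by rewrite lt_min d0.
move=> q' q'1 bq'.
have /hd h : bal p d q' by apply: bal_sub bq'; rewrite ge_min lexx.
have Dq' : D (q' i0).
  by apply: he; apply: lt_le_trans (bq' i0) _; rewrite ge_min lexx orbT.
apply/eqP; rewrite -[_ == _]negbK; apply/negP => n0; apply: none; exists q'; split=> //.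
by apply/negP => /eqP f0; move: h; rewrite f0 sub0r cNN; move: p0; clear; lra.
Qed.

Lemma ch_dom (f g : pt -> C) p (r : R) : 0 < r ->
  (forall q, bal p r q -> ch f q /\ ch g q) -> (exists2 q, bal p r q & g q != 0) ->
  (forall q, bal p r q -> f q * g q = 0) -> forall q, bal p r q -> f q = 0.
Proof.
move=> r0 cfg [q0 b0 n0] hz q bq.
apply: (@ch_ident _ _ K f q0) => [x /andP[x0 x1]|].
  have [] // := cfg (line q0 q (j x)) _ => i.
  have -> : line q0 q (j x) i - p i = j (1 - x) * (q0 i - p i) + j x * (q i - p i).
    by rewrite /line rmorphB rmorph1; ring.
  apply: le_lt_trans (cN_tri _ _ _) _; rewrite !cNM !cN_jr !ger0_norm ?subr_ge0 //.
  have h1 := b0 i; have h2 := bq i.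
  case: (eqVneq x 0) => [->|xn]; first by move: h1; clear; lra.
  have xp : 0 < x by rewrite lt_def xn.
  have y0 : 0 <= 1 - x by rewrite subr_ge0.
  have k1 := ler_wpM2l y0 (ltW h1).
  have k2 : x * N (q i - p i) < x * r by rewrite ltr_pM2l.
  by move: k1 k2; clear; lra.
have p0 : 0 < N (g q0) by rewrite cN_gt0.
have p2 : 0 < N (g q0) / 2 by rewrite divr_gt0.
have [d d0 hd] := ch_cont (cfg q0 b0).2 p2; have [e e0 he] := bal_near b0.
exists (Num.min d e); first by rewrite lt_min d0.
move=> q' b'; have /hd h : bal q0 d q' by apply: bal_sub b'; rewrite ge_min lexx.
have /he /hz /eqP : bal q0 e q' by apply: bal_sub b'; rewrite ge_min lexx orbT.
rewrite mulf_eq0 => /orP[/eqP //|/eqP g0].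
by exfalso; move: h; rewrite g0 sub0r cNN; move: p0; clear; lra.
Qed.

(** Of the two roots of [z], one satisfies [N r <= N (y + r)], and then [N (y - r)] is controlled by
    [N (y^2 - r^2)]. *)
Lemma root_near r (e : R) : r != 0 -> 0 < e -> exists2 d : R, 0 < d &
  forall z, N (z - r ^+ 2) < d -> exists2 x, x ^+ 2 = z & N (x - r) < e.
Proof.
move=> r0 e0; have nr : 0 < N r by rewrite cN_gt0.
exists (e * N r); first by rewrite mulr_gt0.
move=> z hz; pose x := sqrtC z; have x2 : x ^+ 2 = z := sqrtCK z.
have fac (y : C) : y ^+ 2 = z -> N r <= N (y + r) -> N (y - r) < e.
  move=> y2 le; rewrite -(ltr_pM2r nr); apply: le_lt_trans hz.
  by rewrite -y2 subr_sqr cNM ler_wpM2l // cN_ge0.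
case: (leP (N r) (N (x + r))) => h; first by exists x => //; apply: fac.
exists (- x); first by rewrite sqrrN.
apply: fac; first by rewrite sqrrN.
have -> : - x + r = - (x + r) + 2 * r by ring.
have := cN_low K (2 * r) (x + r); rewrite cNM cN_nat.
have -> : 2 * r - (x + r) = - (x + r) + 2 * r by ring.
by move: h; clear; lra.
Qed.

Lemma ch_sq q : ch sq q.
Proof.
rewrite /sq /yv /c1.
by repeat first [exact: ch_cst | exact: ch_coord | apply: chM | apply: chD | apply: chN | apply: chX].
Qed.

(** * Comparison of two local expressions of the same first integral *)

Section Transfer.
Variables (F : pt -> C -> C) (s1 r1 s2 r2 : C) (P : rep F s1 r1) (Q : rep F s2 r2).
Variables (s r : C).
Hypothesis r_nz : r != 0.
Hypothesis r_sq : r ^+ 2 = sq (base s).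
Hypothesis sP : N (s - s1) < rho P.
Hypothesis rP : N (r - r1) < rho P.
Hypothesis sQ : N (s - s2) < rho Q.
Hypothesis rQ : N (r - r2) < rho Q.

Lemma base_in (u s0 : C) (d : R) : 0 < d -> N (u - s0) < d -> bal (base s0) d (base u).
Proof. by move=> d0 h; apply/balP; rewrite /= subrr cN0; split. Qed.

Lemma rep_Bnz (s0 r0 : C) (T : rep F s0 r0) (d : R) : 0 < d -> N (s - s0) < rho T ->
  exists q, [/\ q i1 = 0, N (q i0 - s) < d, N (q i0 - s0) < rho T & rBh T q != 0].
Proof.
move=> d0 sT; apply: contrapT => none; have [q [bq q1 nq]] := r_Bnz T.
have T0 := rho_gt0 T.
move/negP: nq; apply; apply/eqP; apply: (@slice_ident s0 (rho T) (rBh T) s d) => //.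
- by move=> q' q'1 h; have [] // := @r_ch _ _ _ T q'; apply/bal_slice.
- move=> q' q'1 h1 h2; apply/eqP; rewrite -[_ == _]negbK; apply/negP => n0.
  by apply: none; exists q'.
exact: ((bal_slice _ T0 q1).1 bq).
Qed.

Lemma rep_Tnz (s0 r0 : C) (T : rep F s0 r0) (d : R) : 0 < d -> N (s - s0) < rho T ->
  exists q, [/\ q i1 = 0, N (q i0 - s) < d, N (q i0 - s0) < rho T &
    rT1 T q != 0 \/ rT2 T q != 0].
Proof.
move=> d0 sT; apply: contrapT => none; have [q [bq q1 nq]] := r_Tnz T.
have T0 := rho_gt0 T.
have z (g : pt -> C) : (g = rT1 T \/ g = rT2 T) -> g q = 0.
  move=> hg; apply: (@slice_ident s0 (rho T) g s d) => //.
  - move=> q' q'1 h; have [] // := @r_ch _ _ _ T q'; first by apply/bal_slice.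
    by case: hg => ->.
  - move=> q' q'1 h1 h2; apply/eqP; rewrite -[_ == _]negbK; apply/negP => n0.
    by apply: none; exists q'; split=> //; case: hg n0 => ->; [left|right].
  exact: ((bal_slice _ T0 q1).1 bq).
by case: nq => /negP; apply; apply/eqP; apply: z; [left|right].
Qed.

(** Where both denominators are nonzero, both fractions are the value of [F] at a root near [r];
    such a root exists since [r] is nonzero. The denominators are then cancelled by [ch_dom], being
    not identically zero near [base s] because their leading terms are not. *)
Let near_both : exists2 d : R, 0 < d & forall q, bal (base s) d q ->
  [/\ bal (base s1) (rho P) q, bal (base s2) (rho Q) q &
   rA P q * rB Q q = rA Q q * rB P q].
Proof.
have [a a0 ha] := bal_near (base_in (rho_gt0 P) sP).
have [b b0 hb] := bal_near (base_in (rho_gt0 Q) sQ).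
pose e := Num.min (rho P - N (r - r1)) (rho Q - N (r - r2)).
have e0 : 0 < e by rewrite lt_min !subr_gt0 rP.
have [c c0 hc] := root_near r_nz e0; have c20 : 0 < c / 2 by rewrite divr_gt0.
have [c' c'0 hc'] := ch_cont (ch_sq (base s)) c20.
exists (Num.min a (Num.min b c')); first by rewrite !lt_min a0 b0.
set d := Num.min _ _.
have da : d <= a by rewrite ge_min lexx.
have db : d <= b by rewrite !ge_min lexx orbT.
have dc : d <= c' by rewrite !ge_min lexx !orbT.
have d0 : 0 < d by rewrite !lt_min a0 b0.
have inP q : bal (base s) d q -> bal (base s1) (rho P) q.
  by move=> bq; apply: ha; apply: bal_sub bq.
have inQ q : bal (base s) d q -> bal (base s2) (rho Q) q.
  by move=> bq; apply: hb; apply: bal_sub bq.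
move=> q bq; split; [exact: inP | exact: inQ |].
have Bnz (s0 r0 : C) (T : rep F s0 r0) : N (s - s0) < rho T ->
    (forall q, bal (base s) d q -> bal (base s0) (rho T) q) ->
    exists2 q, bal (base s) d q & rB T q != 0.
  move=> sT inT; apply: contrapT => none.
  have [q' [q'1 h1 h2 n]] := rep_Bnz d0 sT.
  have bq' : bal (base s0) (rho T) (bl q') by apply/bal_slice => //; apply: rho_gt0.
  have [cbh _ _] := r_ch bq'.
  have z : rBh T q' = 0; last by rewrite z eqxx in n.
  have cz : cont K (fun z => rBh T (upd q' i1 z)) 0.
    apply: hol_cont; apply: (@ch_holp _ _ K (rBh T) (upd q' i1)); last exact: holp_upd1.
    by rewrite -q'1 upd_id.
  rewrite -(upd_id q' i1) q'1; apply: (@cont_zero _ _ K (fun z => rBh T (upd q' i1 z)) 0 cz).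
  have : forall i, exists2 k : R, 0 < k & forall z, N z < k -> N (bl (upd q' i1 z) i - base s i) < d.
    move=> i; have cc : cont K (fun z => bl (upd q' i1 z) i) 0.
      apply: hol_cont; apply: (@ch_holp _ _ K (fun q => bl q i) (upd q' i1)); last exact: holp_upd1.
      exact: ch_bl.
    have hi : N (bl (upd q' i1 0) i - base s i) < d.
      have : bal (base s) d (bl (upd q' i1 0)) by apply/bal_slice.
      by apply.
    pose k := (d - N (bl (upd q' i1 0) i - base s i)) / 2.
    have k0 : 0 < k by rewrite divr_gt0 // subr_gt0.
    have [x x0 hx] := cc k k0; exists x => // z zx.
    have := hx z; rewrite subr0 => /(_ zx) h3.
    have := cN_dist K (bl (upd q' i1 z) i) (bl (upd q' i1 0) i) (base s i).
    by move: h3 hi; rewrite /k; lra.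
  move=> /(@fin5 R (fun i k => forall z, N z < k -> N (bl (upd q' i1 z) i - base s i) < d)).
  case=> [i k k' _ le h z zk|k k0 hk]; first by apply: h; apply: lt_le_trans le.
  exists k => // z z0; rewrite subr0 => zk.
  have bz : bal (base s) d (bl (upd q' i1 z)) by move=> i; apply: hk.
  have [fB _ _] := @r_fac _ _ _ T (upd q' i1 z) (inT _ bz).
  have : rB T (bl (upd q' i1 z)) = 0.
    apply/eqP; rewrite -[_ == _]negbK; apply/negP => n0.
    by apply: none; exists (bl (upd q' i1 z)).
  rewrite fB upd_eq => /eqP; rewrite mulf_eq0 expf_eq0 (negbTE z0) andbF /=.
  by move/eqP.
have cP q' (bq' : bal (base s) d q') := rAB_ch (inP q' bq').
have cQ q' (bq' : bal (base s) d q') := rAB_ch (inQ q' bq').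
have cross q' : bal (base s) d q' ->
    (rA P q' * rB Q q' - rA Q q' * rB P q') * rB P q' * rB Q q' = 0.
  move=> bq'; case: (eqVneq (rB P q') 0) => [->|nP]; first by rewrite mulr0 mul0r.
  case: (eqVneq (rB Q q') 0) => [->|nQ]; first by rewrite mulr0.
  have [|x x2 xr] := hc (sq q').
    rewrite r_sq; have /hc' : bal (base s) c' q' by apply: bal_sub bq'.
    by move: c0; lra.
  have xr1 := cN_dist K x r r1; have xr2 := cN_dist K x r r2.
  have : e <= rho P - N (r - r1) /\ e <= rho Q - N (r - r2).
    by rewrite !ge_min lexx lexx orbT.
  case=> e1 e2.
  have v1 := @r_val _ _ _ P q' x (inP _ bq') x2 ltac:(move: xr xr1 e1; lra) nP.
  have v2 := @r_val _ _ _ Q q' x (inQ _ bq') x2 ltac:(move: xr xr2 e2; lra) nQ.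
  have -> : rA P q' = rA Q q' / rB Q q' * rB P q' by rewrite -v2 v1 divfK.
  by field.
apply/eqP; rewrite -subr_eq0; apply/eqP.
apply: (@ch_dom (fun q => rA P q * rB Q q - rA Q q * rB P q) (rB P) (base s) d) => //.
- by move=> q' bq'; have [? ?] := cP q' bq'; have [? ?] := cQ q' bq'; split=> //; apply: chB; apply: chM.
- exact: Bnz.
move=> q' bq'; apply: (@ch_dom (fun q => (rA P q * rB Q q - rA Q q * rB P q) * rB P q) (rB Q) (base s) d) => //.
- move=> q'' bq''; have [? ?] := cP q'' bq''; have [? ?] := cQ q'' bq''.
  by split=> //; apply: chM => //; apply: chB; apply: chM.
exact: Bnz.
Qed.

Let th_eq : exists2 d : R, 0 < d & forall q k, bal (base s) d q ->
  [/\ bal (base s1) (rho P) q, bal (base s2) (rho Q) q &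
  rB Q q ^+ 2 * th (rA P) (rB P) k q = rB P q ^+ 2 * th (rA Q) (rB Q) k q].
Proof.
have [d d0 hd] := near_both; exists d => // q k bq.
have [bP bQ e] := hd q bq; split=> //; rewrite /th.
have [cA cB] := rAB_ch bP; have [cA' cB'] := rAB_ch bQ.
have := pdM k cA cB'; have [d' d'0 hd'] := bal_near bq.
rewrite (@pd_ext _ _ K _ (fun q => rA Q q * rB P q) q k d') //; last exact: chM.
  rewrite (pdM k cA' cB) => e'.
  move: e e'; set a := rA P q; set b := rB P q; set a' := rA Q q; set b' := rB Q q.
  move: (pd k (rA P) q) (pd k (rB P) q) (pd k (rA Q) q) (pd k (rB Q) q) => x y x' y' e e'.
  have -> : b' ^+ 2 * (b * x - a * y) = b * b' * (x * b' + a * y') - b * y' * (a * b') - b' * y * (a * b').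
    by ring.
  by rewrite -e' e; ring.
by move=> q' /hd' /hd [].
Qed.

(** [th_eq] written in the blow-up compares two power products of the parameter; division by the
    smaller power and passage to the exceptional divisor leave an identity of leading terms. *)
Let lead : exists2 d : R, 0 < d & forall q, q i1 = 0 -> N (q i0 - s) < d ->
  [/\ N (q i0 - s1) < rho P, N (q i0 - s2) < rho Q &
   [/\ (rn P + (rm Q + rm Q) < rn Q + (rm P + rm P))%N ->
     rBh Q q ^+ 2 * rT1 P q = 0 /\ rBh Q q ^+ 2 * rT2 P q = 0,
    (rn Q + (rm P + rm P) < rn P + (rm Q + rm Q))%N ->
     rBh P q ^+ 2 * rT1 Q q = 0 /\ rBh P q ^+ 2 * rT2 Q q = 0 &
    (rn P + (rm Q + rm Q) = rn Q + (rm P + rm P))%N ->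
     rBh Q q ^+ 2 * rT1 P q = rBh P q ^+ 2 * rT1 Q q /\
     rBh Q q ^+ 2 * rT2 P q = rBh P q ^+ 2 * rT2 Q q]].
Proof.
have [d d0 hd] := th_eq; exists d => // q q1 qs.
have bq0 : bal (base s) d (bl q) by apply/bal_slice.
have [bP bQ _] := hd _ i2 bq0; split.
- exact: ((bal_slice _ (rho_gt0 P) q1).1 bP).
- exact: ((bal_slice _ (rho_gt0 Q) q1).1 bQ).
have [cbP c1P c2P] := r_ch bP; have [cbQ c1Q c2Q] := r_ch bQ.
have qe : upd q i1 0 = q by have := upd_id q i1; rewrite q1.
have cz (g : pt -> C) : ch g q -> cont K (fun z => g (upd q i1 z)) 0.
  move=> cg; apply: hol_cont; apply: (@ch_holp _ _ K g (upd q i1)); last exact: holp_upd1.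
  by rewrite qe.
have [k k0 hk] := @opn_bl s d q bq0.
have bz z : N z < k -> bal (base s) d (bl (upd q i1 z)).
  move=> zk; apply: hk => i; rewrite /upd; case: eqP => [->|_]; first by rewrite q1 subr0.
  by rewrite subrr cN0.
pose n1 := (rn P + (rm Q + rm Q))%N; pose n2 := (rn Q + (rm P + rm P))%N.
have id1 z : N z < k -> let q' := upd q i1 z in
   z ^+ n1 * (rBh Q q' ^+ 2 * rT1 P q') = z ^+ n2 * (rBh P q' ^+ 2 * rT1 Q q') /\
   z ^+ n1 * (rBh Q q' ^+ 2 * rT2 P q') = z ^+ n2 * (rBh P q' ^+ 2 * rT2 Q q').
  move=> zk /=; have b := bz z zk.
  have [bP' bQ' e2] := hd _ i2 b; have [_ _ e3] := hd _ i3 b.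
  have [f1 f2 f3] := r_fac bP'; have [g1 g2 g3] := r_fac bQ'.
  rewrite upd_eq in f1 f2 f3 g1 g2 g3.
  rewrite f1 f2 g1 g2 in e2; rewrite f1 f3 g1 g3 in e3.
  rewrite /n1 /n2 !exprD; split.
    by rewrite [LHS](_ : _ = (z ^+ rm Q * rBh Q (upd q i1 z)) ^+ 2 * (z ^+ rn P * rT1 P (upd q i1 z))); [rewrite e2|]; ring.
  by rewrite [LHS](_ : _ = (z ^+ rm Q * rBh Q (upd q i1 z)) ^+ 2 * (z ^+ rn P * rT2 P (upd q i1 z))); [rewrite e3|]; ring.
have lim (a b : pt -> C) (u v : nat) : ch a q -> ch b q ->
   (forall z, N z < k -> z ^+ u * a (upd q i1 z) = z ^+ v * b (upd q i1 z)) ->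
   ((u < v)%N -> a q = 0) /\ (u = v -> a q = b q).
  move=> ca cb h; split=> [uv|uv].
    have := @cont_zero _ _ K (fun z => a (upd q i1 z) - z ^+ (v - u) * b (upd q i1 z)) 0.
    rewrite expr0n subn_eq0 leqNgt uv /= mul0r subr0 qe; apply.
      apply: contD; first exact: cz.
      apply: contN; apply: contM; last exact: cz.
      by apply: hol_cont; apply: holX; apply: hol_id.
    exists k => // z z0; rewrite subr0 => zk.
    have zu : z ^+ u != 0 by rewrite expf_neq0.
    apply: (mulfI zu); rewrite mulr0 mulrBr h // mulrA -exprD subnKC ?subrr //.
    exact: ltnW.
  have := @cont_zero _ _ K (fun z => a (upd q i1 z) - b (upd q i1 z)) 0.
  rewrite qe => c; apply/eqP; rewrite -subr_eq0; apply/eqP; apply: c.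
    by apply: contD; [apply: cz | apply: contN; apply: cz].
  exists k => // z z0; rewrite subr0 => zk.
  have zu : z ^+ u != 0 by rewrite expf_neq0.
  by apply: (mulfI zu); rewrite mulr0 mulrBr h // uv subrr.
have cc (a b : pt -> C) : ch a q -> ch b q -> ch (fun q => a q ^+ 2 * b q) q.
  by move=> ca cb; apply: chM => //; apply: chX.
have l1 := lim _ _ n1 n2 (cc _ _ cbQ c1P) (cc _ _ cbP c1Q) (fun z zk => (id1 z zk).1).
have l2 := lim _ _ n1 n2 (cc _ _ cbQ c2P) (cc _ _ cbP c2Q) (fun z zk => (id1 z zk).2).
have l3 := lim _ _ n2 n1 (cc _ _ cbP c1Q) (cc _ _ cbQ c1P) (fun z zk => esym (id1 z zk).1).
have l4 := lim _ _ n2 n1 (cc _ _ cbP c2Q) (cc _ _ cbQ c2P) (fun z zk => esym (id1 z zk).2).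
by split=> h; split; [apply: l1.1|apply: l2.1|apply: l3.1|apply: l4.1|apply: l1.2|apply: l2.2].
Qed.

Lemma conv_and (D D' : C -> Prop) : conv D -> conv D' -> conv (fun s => D s /\ D' s).
Proof. by move=> cD cD' u v x hx [? ?] [? ?]; split; [apply: cD|apply: cD']. Qed.

Let both : exists2 d : R, 0 < d & forall z, N (z - s) < d ->
  N (z - s1) < rho P /\ N (z - s2) < rho Q.
Proof.
exists (Num.min (rho P - N (s - s1)) (rho Q - N (s - s2))); first by rewrite lt_min !subr_gt0 sP.
move=> z; rewrite lt_min => /andP[h1 h2].
by have := cN_dist K z s s1; have := cN_dist K z s s2; split; lra.
Qed.

Let open_disc (d : R) (q : pt) : q i1 = 0 -> N (q i0 - s) < d ->
  exists2 e : R, 0 < e & forall z, N (z - q i0) < e -> N (z - s) < d.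
Proof.
move=> _ h; exists (d - N (q i0 - s)); first by rewrite subr_gt0.
by move=> z hz; have := cN_dist K z (q i0) s; lra.
Qed.

(** The order [n - 2m] of the transversal differential of [F] does not depend on the expression; it
    is stated without subtraction. Different orders would make a product of functions zero which are
    not identically zero. *)
Lemma rep_ord : (rn P + (rm Q + rm Q) = rn Q + (rm P + rm P))%N.
Proof.
have [d d0 hd] := lead; have [e e0 he] := both.
pose x := Num.min d e; have x0 : 0 < x by rewrite lt_min d0.
have dx z : N (z - s) < x -> N (z - s) < d by rewrite lt_min => /andP[].
have ex z : N (z - s) < x -> N (z - s) < e by rewrite lt_min => /andP[].
have key (s3 r3 s4 r4 : C) (T : rep F s3 r3) (T' : rep F s4 r4) :
    (forall z, N (z - s) < e -> N (z - s3) < rho T /\ N (z - s4) < rho T') ->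
    (forall q, q i1 = 0 -> N (q i0 - s) < d ->
      rBh T' q ^+ 2 * rT1 T q = 0 /\ rBh T' q ^+ 2 * rT2 T q = 0) -> False.
  move=> inT z0.
  have sT : N (s - s3) < rho T /\ N (s - s4) < rho T' by apply: inT; rewrite subrr cN0.
  have [q [q1 h1 h2 n]] := rep_Tnz x0 sT.1.
  have [q' [q'1 h1' h2' n']] := rep_Bnz x0 sT.2.
  have cT q0 : q0 i1 = 0 -> N (q0 i0 - s) < x -> [/\ ch (rBh T') q0, ch (rT1 T) q0 & ch (rT2 T) q0].
    move=> q01 hq; have [b1 b2] := inT _ (ex _ hq).
    have [_ c1 c2] := r_ch ((bal_slice _ (rho_gt0 T) q01).2 b1).
    by have [c3 _ _] := r_ch ((bal_slice _ (rho_gt0 T') q01).2 b2).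
  have no (g : pt -> C) : (g = rT1 T \/ g = rT2 T) -> g q != 0 -> False.
    move=> hg ng.
    have [||||q3 [q31 h3 n3 m3]] := @slice_prod (fun z => N (z - s) < x) (rBh T') g (@conv_disc s x).
    - by move=> q0 q01 /(cT q0 q01) [? ? ?]; split=> //; case: hg => ->.
    - by exists q'.
    - by exists q.
    - by move=> q0 q01; apply: open_disc.
    have [z1 z2] := z0 q3 q31 (dx _ h3).
    have : rBh T' q3 ^+ 2 * g q3 = 0 by case: hg => ->.
    by move/eqP; rewrite mulf_eq0 expf_eq0 (negbTE n3) (negbTE m3).
  by case: n => n; [apply: (no (rT1 T)) => //; left | apply: (no (rT2 T)) => //; right].
case: (ltngtP (rn P + (rm Q + rm Q)) (rn Q + (rm P + rm P))) => // lt; exfalso.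
  apply: (key _ _ _ _ P Q he) => q q1 h; have [_ _ [l _ _]] := hd q q1 h; exact: l.
apply: (key _ _ _ _ Q P) => [z /he []|q q1 h] //.
have [_ _ [_ l _]] := hd q q1 h; exact: l.
Qed.

(** Only the values of [q] with [q i1 = 0] enter, but all of them over [s] near [z]: the covector
    annihilates the vector for every direction in the blow-up. *)
Definition killn (s0 r0 : C) (T : rep F s0 r0) (e1 e2 : C -> C) (z : C) :=
  exists2 d : R, 0 < d & forall q, q i1 = 0 -> N (q i0 - z) < d ->
    rT1 T q * e1 (q i0) + rT2 T q * e2 (q i0) = 0.

(** By [lead] and [rep_ord] the two leading covectors are proportional over the common domain, with
    factors that are not identically zero. *)
Lemma kill_transfer e1 e2 : hol e1 s -> hol e2 s -> killn P e1 e2 s -> killn Q e1 e2 s.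
Proof.
move=> h1 h2 [d1 d10 hk]; have [d d0 hd] := lead; have [e e0 he] := both.
have [a a0 ha] := hol_near h1; have [b b0 hb] := hol_near h2.
pose x := Num.min (Num.min d e) (Num.min d1 (Num.min a b)).
have x0 : 0 < x by rewrite !lt_min d0 e0 d10 a0.
have dx z : N (z - s) < x -> [/\ N (z - s) < d, N (z - s) < e, N (z - s) < d1, N (z - s) < a & N (z - s) < b].
  by rewrite !lt_min => /andP[/andP[? ?] /and3P[? ? ?]].
exists x => // q q1 hq; apply/eqP; rewrite -[_ == _]negbK; apply/negP => n0.
pose h q := rT1 Q q * e1 (q i0) + rT2 Q q * e2 (q i0).
have [q' [q'1 h1' h2' n']] := rep_Bnz x0 sP.
have [||||q3 [q31 h3 n3 m3]] := @slice_prod (fun z => N (z - s) < x) (rBh P) h (@conv_disc s x).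
- move=> q0 q01 /dx [_ /he [b1 b2] _ /ha hh1 /hb hh2].
  have [cb _ _] := r_ch ((bal_slice _ (rho_gt0 P) q01).2 b1).
  have [_ c1 c2] := r_ch ((bal_slice _ (rho_gt0 Q) q01).2 b2); split=> //.
  by apply: chD; apply: chM => //; apply: ch_hol (ch_coord _ _ _) _.
- by exists q'.
- by exists q.
- by move=> q0 q01; apply: open_disc.
have [/(hd q3 q31) [_ _ [_ _ l]] _ /(hk q3 q31) z3 _ _] := dx _ h3.
have [l1 l2] := l rep_ord.
have : rBh P q3 ^+ 2 * h q3 = 0.
  transitivity (rBh Q q3 ^+ 2 * (rT1 P q3 * e1 (q3 i0) + rT2 P q3 * e2 (q3 i0))).
    by rewrite /h !mulrDr !mulrA l1 l2.
  by rewrite z3 mulr0.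
by move/eqP; rewrite mulf_eq0 expf_eq0 (negbTE n3) (negbTE m3).
Qed.

End Transfer.

(** Two annihilated vectors with nonzero determinant would force both components of the covector to
    vanish near [s]. *)
Lemma kill_uniq (F : pt -> C -> C) (s0 r0 : C) (T : rep F s0 r0) (e1 e2 f1 f2 : C -> C) (s : C) :
  N (s - s0) < rho T -> hol e1 s -> hol e2 s -> hol f1 s -> hol f2 s ->
  killn T e1 e2 s -> killn T f1 f2 s -> e1 s * f2 s - e2 s * f1 s = 0.
Proof.
move=> hs h1 h2 h3 h4 [d d0 hd] [d' d'0 hd'].
apply/eqP; rewrite -[_ == _]negbK; apply/negP => n0.
pose W z := e1 z * f2 z - e2 z * f1 z.
have cW : cont K W s by apply: hol_cont; apply: holB; apply: holM.
have [a a0 ha] := cont_nz cW n0.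
pose x := Num.min a (Num.min d d').
have x0 : 0 < x by rewrite !lt_min a0 d0.
have [q [q1 hq1 hq2 n]] := rep_Tnz x0 hs.
move: hq1; rewrite !lt_min => /and3P[/ha wq /(hd q q1) k1 /(hd' q q1) k2].
have Wq : W (q i0) != 0.
  by rewrite -(cN_gt0 K); apply: lt_le_trans wq; rewrite divr_gt0 // cN_gt0.
have z1 : rT1 T q * W (q i0) = 0.
  rewrite /W; transitivity (f2 (q i0) * (rT1 T q * e1 (q i0) + rT2 T q * e2 (q i0)) -
    e2 (q i0) * (rT1 T q * f1 (q i0) + rT2 T q * f2 (q i0))); first by ring.
  by rewrite k1 k2 !mulr0 subrr.
have z2 : rT2 T q * W (q i0) = 0.
  rewrite /W; transitivity (e1 (q i0) * (rT1 T q * f1 (q i0) + rT2 T q * f2 (q i0)) -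
    f1 (q i0) * (rT1 T q * e1 (q i0) + rT2 T q * e2 (q i0))); first by ring.
  by rewrite k1 k2 !mulr0 subrr.
move/eqP: z1; move/eqP: z2; rewrite !mulf_eq0 (negbTE Wq) !orbF => /eqP z2 /eqP z1.
by case: n; rewrite ?z1 ?z2 eqxx.
Qed.

(** Identity theorem over the intersection of two discs, which is convex. *)
Lemma kill_extend (F : pt -> C -> C) (s0 r0 : C) (T : rep F s0 r0) (e1 e2 : C -> C)
    (c : C) (re : R) (s : C) : (forall z, N (z - c) < re -> hol e1 z /\ hol e2 z) ->
  N (s - s0) < rho T -> N (s - c) < re -> killn T e1 e2 s ->
  forall q, q i1 = 0 -> N (q i0 - s0) < rho T -> N (q i0 - c) < re ->
    rT1 T q * e1 (q i0) + rT2 T q * e2 (q i0) = 0.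
Proof.
move=> he hs hc [d d0 hd] q q1 hq1 hq2.
apply: (@slice_ident_at (fun z => N (z - s0) < rho T /\ N (z - c) < re)
  (fun q => rT1 T q * e1 (q i0) + rT2 T q * e2 (q i0)) (base s) d) => //.
- by apply: conv_and; apply: conv_disc.
- move=> q0 q01 [b1 /he [h1 h2]].
  have [_ c1 c2] := r_ch ((bal_slice _ (rho_gt0 T) q01).2 b1).
  by apply: chD; apply: chM => //; apply: ch_hol (ch_coord _ _ _) _.
by move=> q0 q01 /(_ i0) b; apply: hd.
Qed.

End Rep.

(** * From differentiability on phase space to holomorphy along curves *)

Section Frechet.
Variables (R : realType) (C : numClosedFieldType) (K : cdata R C).
Notation j := (jr K).
Notation N := (cN K).
Notation cd := (cd K).
Notation pt := (pt C).
Notation ch := (ch K).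
Notation bal := (bal K).
Notation V := 'rV[C]_4.

Lemma norm_row_le (h : V) (m : R) : 0 <= m -> (forall i, N (h 0 i) <= m) -> `|h| <= j m.
Proof.
move=> m0 hm; case: (eqVneq (mx_norm h) 0) => [e|/mx_norm_neq0 [i e]].
  by rewrite /Num.norm /= e -(rmorph0 j) (jr_le K).
by rewrite /Num.norm /= e -(cNE K) (jr_le K) (ord1 i.1).
Qed.

Lemma cpos (e : C) : 0 < e -> j (cre K e) = e /\ 0 < cre K e.
Proof.
move=> e0; have ee : j (cre K e) = e by rewrite creE; apply/Creal_ReP/gtr0_real.
by split=> //; rewrite -(jr_lt K) rmorph0 ee.
Qed.

Lemma open_row (U : set V) p : open U -> U p ->
  exists2 d : R, 0 < d & forall q : V, (forall i, N (q 0 i - p 0 i) < d) -> U q.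
Proof.
rewrite openE => /(_ p) oU Up; have /nbhs_ballP [e /= e0 he] := oU Up.
have [ee er0] := cpos e0; exists (cre K e) => // q hq; apply: he.
split=> // i k; rewrite (ord1 i) /ball /= -(cNE K) -ee (jr_lt K) cNB; exact: hq.
Qed.

Lemma closure_row (D : set V) p (d : R) : 0 < d -> closure D p ->
  exists2 q, D q & forall i, N (q 0 i - p 0 i) < d.
Proof.
move=> d0 cl; have d0' : 0 < j d by rewrite -(rmorph0 j) jr_lt.
have [q [Dq bq]] := cl _ (nbhsx_ballx p (j d) d0').
exists q => // i; have := bq.2 0 i; rewrite /ball /= -(cNE K) (jr_lt K) cNB.
by [].
Qed.

Lemma frechet (f : V -> C) p (e : R) : differentiable f p -> 0 < e ->
  exists2 d : R, 0 < d & forall (h : V) (m : R), (forall i, N (h 0 i) < d) ->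
    0 <= m -> (forall i, N (h 0 i) <= m) ->
    N (f (p + h) - f p - 'd f p h) <= e * m.
Proof.
move=> /diff_locallyP [_ /eqaddoP h] e0.
have e0' : 0 < j e by rewrite -(rmorph0 j) jr_lt.
have /nbhs_ballP [d /= d0 hd] := h _ e0'.
have [dd dr0] := cpos d0; exists (cre K d) => // x m hx m0 hm.
have bx : ball (0 : V) d x.
  by split=> // i k; rewrite (ord1 i) /ball /= mxE -(cNE K) -dd (jr_lt K) sub0r cNN.
have k : `|f (x + p) - (f p + 'd f p x)| <= j e * `|x| := hd x bx.
rewrite -(jr_le K) cNE rmorphM; apply: le_trans (ler_wpM2l (ltW e0') (norm_row_le m0 hm)).
by move: k; rewrite [x + p]addrC opprD addrA.
Qed.

Lemma cont_sum (m : nat) (F : 'I_m -> C -> C) t : (forall i, cont K (F i) t) ->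
  cont K (fun s => \sum_(i < m) F i s) t.
Proof.
elim: m F => [|m ih] F hF.
  have -> : (fun s => \sum_(i < 0) F i s) = fun=> 0 by apply/funext => s; rewrite big_ord0.
  exact: cont_cst.
have -> : (fun s => \sum_(i < m.+1) F i s) =
    fun s => \sum_(i < m) F (widen_ord (leqnSn m) i) s + F ord_max s.
  by apply/funext => s; rewrite big_ord_recr.
by apply: contD => //; apply: ih.
Qed.

Lemma cd_diff (f : V -> C) (c : 'I_4 -> C -> C) (c' : 'I_4 -> C) t :
  differentiable f (\row_i c i t) -> (forall i, cd (c i) t (c' i)) ->
  cd (fun s => f (\row_i c i s)) t ('d f (\row_i c i t) (\row_i c' i)).
Proof.
move=> df hc; set p : V := \row_i c i t.
have [phi hphi] : exists phi : 'I_4 -> C -> C, forall i,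
    [/\ cont K (phi i) t, phi i t = c' i & forall s, c i s = c i t + phi i s * (s - t)].
  have ex i : exists phi : C -> C, [/\ cont K phi t, phi t = c' i &
      forall s, c i s = c i t + phi s * (s - t)].
    by have [ph [h1 h2] h3] := hc i; exists ph.
  by exists (fun i => projT1 (cid (ex i))) => i; apply: (projT2 (cid (ex i))).
have dE (x : 'I_4 -> C) : 'd f p (\row_i x i) = \sum_(i < 4) x i * 'd f p (delta_mx 0 i).
  rewrite (row_sum_delta (\row_i x i)) linear_sum /=; apply: eq_bigr => i _.
  by rewrite linearZ /= mxE.
have csum : cont K (fun s => 'd f p (\row_i phi i s)) t.
  have -> : (fun s => 'd f p (\row_i phi i s)) =
      fun s => \sum_(i < 4) phi i s * 'd f p (delta_mx 0 i) by apply/funext => s; rewrite dE.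
  apply: cont_sum => i; apply: contM; last exact: cont_cst.
  by have [] := hphi i.
have [M M0 [dM dM0 hM]] : exists2 M : R, 0 < M & exists2 d : R, 0 < d &
    forall s, N (s - t) < d -> forall i, N (phi i s) <= M.
  have bi i : exists2 d : R, 0 < d & forall s, N (s - t) < d -> N (phi i s) <= N (c' i) + 1.
    by have [h1 <- _] := hphi i; apply: cont_bdd.
  exists (\sum_(i < 4) (N (c' i) + 1) + 1).
    by rewrite ltr_wpDl // sumr_ge0 // => i _; rewrite addr_ge0 // cN_ge0.
  have [d d0 hd] : exists2 d : R, 0 < d & forall s, N (s - t) < d -> forall i : 'I_4, N (phi i s) <= N (c' i) + 1.
    pose d := \big[Num.min/1]_(i < 4) s2val (cid2 (bi i)).
    have dd i : d <= s2val (cid2 (bi i)) by rewrite /d; apply: bigmin_le_cond.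
    exists d; first by apply: lt_bigmin => // i _; apply: (s2valP (cid2 (bi i))).
    by move=> s sd i; apply: (s2valP' (cid2 (bi i))); apply: lt_le_trans sd (dd i).
  exists d => // s /hd h i; apply: le_trans (h i) _; rewrite (bigD1 i) //= -addrA lerDl.
  by rewrite addr_ge0 // sumr_ge0 // => k _; rewrite addr_ge0 // cN_ge0.
apply/cdP => e e0; have e2 : 0 < e / 2 by rewrite divr_gt0.
have [a a0 ha] := csum _ e2.
have [b b0 hb] := frechet df (divr_gt0 e2 M0).
exists (Num.min (Num.min a dM) (b / M)); first by rewrite !lt_min a0 dM0 divr_gt0.
move=> s; rewrite !lt_min ltr_pdivlMr // => /andP[/andP[/ha ka /hM kM] kb].
set h : V := \row_i (phi i s * (s - t)).
have ph : \row_i c i s = p + h.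
  by apply/matrixP => i k; rewrite !mxE; have [_ _] := hphi k.
have hi i : N (h 0 i) <= M * N (s - t) by rewrite mxE cNM ler_wpM2r ?cN_ge0.
have := hb h (M * N (s - t)) _ (mulr_ge0 (ltW M0) (cN_ge0 K _)) hi.
rewrite ph => k1; rewrite mulrC in kb; have {}k1 := k1 (fun i => le_lt_trans (hi i) kb).
have dh : 'd f p h = 'd f p (\row_i phi i s) * (s - t).
  by rewrite /h !dE mulr_suml; apply: eq_bigr => i _; rewrite mulrAC.
have pt' : 'd f p (\row_i phi i t) = 'd f p (\row_i c' i).
  by congr ('d f p _); apply/matrixP => i k; rewrite !mxE; have [_ -> _] := hphi k.
have -> : f (p + h) - f p - 'd f p (\row_i c' i) * (s - t) =
   (f (p + h) - f p - 'd f p h) + ('d f p (\row_i phi i s) - 'd f p (\row_i phi i t)) * (s - t).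
  by rewrite dh pt'; ring.
apply: le_trans (cN_tri _ _ _) _; rewrite cNM.
have k2 := ler_wpM2r (cN_ge0 K (s - t)) ka.
have -> : e * N (s - t) = e / 2 / M * (M * N (s - t)) + e / 2 * N (s - t).
  by field; rewrite gt_eqF.
exact: lerD.
Qed.

(** The local bound required by [ch] comes from the differential at the centre, and holomorphy along
    curves from [cd_diff]. *)
Lemma ch_diff (f : V -> C) (G : pt -> 'I_4 -> C) p :
  (exists2 d : R, 0 < d & forall q : V, (forall i, N (q 0 i - G p i) < d) -> differentiable f q) ->
  (forall i, ch (fun q => G q i) p) -> ch (fun q => f (\row_i G q i)) p.
Proof.
move=> [d d0 df] cG.
have near (d' : R) : 0 < d' -> exists2 e : R, 0 < e & forall q, bal p e q -> forall i,
    N (G q i - G p i) < d' /\ ch (fun q => G q i) q.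
  move=> d'0; have d2 : 0 < d' / 2 by rewrite divr_gt0.
  have bi i : exists2 e : R, 0 < e & forall q, bal p e q ->
      N (G q i - G p i) < d' /\ ch (fun q => G q i) q.
    have [a a0 ha] := ch_cont (cG i) d2; have [b b0 hb] := ch_near (cG i).
    exists (Num.min a b); first by rewrite lt_min a0.
    move=> q bq; split; last by apply: hb; apply: bal_sub bq; rewrite ge_min lexx orbT.
    have /ha : bal p a q by apply: bal_sub bq; rewrite ge_min lexx.
    by move: d'0; clear; lra.
  pose e := \big[Num.min/1]_(i < 4) s2val (cid2 (bi i)).
  have dd i : e <= s2val (cid2 (bi i)) by rewrite /e; apply: bigmin_le_cond.
  exists e; first by apply: lt_bigmin => // i _; apply: (s2valP (cid2 (bi i))).
  by move=> q bq i; apply: (s2valP' (cid2 (bi i))); apply: bal_sub bq.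
have dp : differentiable f (\row_i G p i).
  by apply: df => i; rewrite mxE subrr cN0.
have [b b0 hb] := frechet dp ltr01.
pose M := \sum_(i < 4) N ('d f (\row_i G p i) (delta_mx 0 i)).
have M0 : 0 <= M by apply: sumr_ge0 => i _; apply: cN_ge0.
have [e e0 he] : exists2 e : R, 0 < e & forall q, bal p e q -> forall i,
    [/\ N (G q i - G p i) < d, N (G q i - G p i) < Num.min b 1 & ch (fun q => G q i) q].
  have [a a0 ha] := near d d0.
  have [|c c0 hc] := near (Num.min b 1); first by rewrite lt_min b0 ltr01.
  exists (Num.min a c); first by rewrite lt_min a0.
  move=> q bq i; have [|h1 h2] := ha q _ i; first by apply: bal_sub bq; rewrite ge_min lexx.
  by have [|h3 _] := hc q _ i; first by apply: bal_sub bq; rewrite ge_min lexx orbT.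
exists e, (N (f (\row_i G p i)) + 1 + M); split=> // [q bq|H t hH bH].
  pose h : V := \row_i (G q i - G p i).
  have hh i : N (h 0 i) < b /\ N (h 0 i) < 1.
    by rewrite mxE; have [_ + _] := he q bq i; rewrite lt_min => /andP[].
  have eq : \row_i G q i = \row_i G p i + h.
    by apply/matrixP => i k; rewrite !mxE; ring.
  have k1 := hb h 1 (fun i => (hh i).1) ler01 (fun i => ltW (hh i).2).
  have k2 : N ('d f (\row_i G p i) h) <= M.
    rewrite (row_sum_delta h) linear_sum /=; apply: le_trans (cN_sum _ _ _ _) _.
    apply: ler_sum => i _; rewrite linearZ /= cNM; apply: ler_piMl; first exact: cN_ge0.
    exact: ltW (hh i).2.
  rewrite eq; set A := f (_ + h) in k1 *; set B := f _ in k1 *; set D := 'd f _ h in k1 k2 *.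
  have -> : A = (A - B - D) + (B + D) by ring.
  apply: le_trans (cN_tri _ _ _) _; apply: le_trans (lerD k1 (cN_tri _ _ _)) _.
  by move: k2; clear; lra.
have [x x0 hx] := holp_bal hH bH.
exists x => // s /hx [hHs bs].
have hol i : hol K (fun s => G (H s) i) s.
  by apply: (@ch_holp _ _ K (fun q => G q i)) => //; have [] := he _ bs i.
have cdi i : exists l, cd (fun s => G (H s) i) s l by apply: hol_cd.
have dq : differentiable f (\row_i G (H s) i).
  by apply: df => i; rewrite mxE; have [] := he _ bs i.
eexists; apply: (@cd_diff f (fun i s => G (H s) i) (fun i => projT1 (cid (cdi i)))) dq _.
by move=> i; apply: (projT2 (cid (cdi i))).
Qed.

End Frechet.

(** * Reduced coordinates on phase space *)

Section Chart.
Variables (R : realType) (C : numClosedFieldType) (K : cdata R C) (E lam : C).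
Notation j := (jr K).
Notation N := (cN K).
Notation cd := (cd K).
Notation hol := (hol K).
Notation pt := (pt C).
Notation ch := (ch K).
Notation bal := (bal K).
Notation pd := (pd K).
Notation V := 'rV[C]_4.
Notation c1 := (c1 E lam).
Notation yv := (yv E lam).
Notation sq := (sq E lam).
Notation X2 := (X2 E lam).
Notation H := (bianchi_H lam).

(** The branch is picked in the disc of radius [N r0 / 2] around [r0]. Two members of this disc
    satisfy [N r0 < N (x + y)], which yields uniqueness, continuity and the derivative from the
    factorization of [x^2 - y^2]. *)
Lemma lroot (r0 : C) : r0 != 0 -> exists2 g : C -> C, True & exists2 d : R, 0 < d &
  forall z, N (z - r0 ^+ 2) < d -> [/\ g z ^+ 2 = z, N (g z - r0) < N r0 / 2, hol g z &
    forall x, x ^+ 2 = z -> N (x - r0) < N r0 / 2 -> x = g z].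
Proof.
move=> r00; have n0 : 0 < N r0 by rewrite cN_gt0.
have n2 : 0 < N r0 / 2 by rewrite divr_gt0.
have [d d0 hd] := root_near K r00 n2.
pose g z := xget 0 [set x | x ^+ 2 = z /\ N (x - r0) < N r0 / 2]%classic.
have gP z : N (z - r0 ^+ 2) < d -> g z ^+ 2 = z /\ N (g z - r0) < N r0 / 2.
  move=> /hd [x x2 xr]; rewrite /g; case: xgetP => [y -> []//|/(_ x)].
  by case; split.
have low x y : N (x - r0) < N r0 / 2 -> N (y - r0) < N r0 / 2 -> N r0 < N (x + y).
  move=> hx hy.
  have -> : x + y = 2 * r0 + ((x - r0) + (y - r0)) by ring.
  have := cN_low K (2 * r0) (- ((x - r0) + (y - r0))); rewrite opprK cNN cNM cN_nat.
  by have := cN_tri K (x - r0) (y - r0); move: hx hy; clear; lra.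
have uniq z x : N (z - r0 ^+ 2) < d -> x ^+ 2 = z -> N (x - r0) < N r0 / 2 -> x = g z.
  move=> /gP [g2 gr] x2 xr; apply/eqP; rewrite -subr_eq0.
  have : (x - g z) * (x + g z) = 0 by rewrite -subr_sqr x2 g2 subrr.
  move/eqP; rewrite mulf_eq0 => /orP[//|/eqP e].
  by have := low x (g z) xr gr; rewrite e cN0; move: n0; clear; lra.
have cg z : N (z - r0 ^+ 2) < d -> exists l, cd g z l.
  move=> hz; have [g2 gr] := gP z hz.
  pose dz := d - N (z - r0 ^+ 2); have dz0 : 0 < dz by rewrite subr_gt0.
  have near s : N (s - z) < dz -> N (s - r0 ^+ 2) < d.
    by have := cN_dist K s z (r0 ^+ 2); rewrite /dz; clear; lra.
  have dist s : N (s - z) < dz -> (g s - g z) * (g s + g z) = s - z /\ N r0 < N (g s + g z).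
    move=> /near /gP [s2 sr]; split; last exact: low.
    by rewrite -subr_sqr s2 g2.
  have cont : cont K g z.
    move=> e e0; exists (Num.min dz (e * N r0)); first by rewrite lt_min dz0 mulr_gt0.
    move=> s; rewrite lt_min => /andP[/dist [e1 lo] h].
    rewrite -(ler_pM2r n0); apply: le_trans (ltW h); rewrite -e1 cNM.
    by apply: ler_wpM2l; [apply: cN_ge0 | apply: ltW].
  exists (g z + g z)^-1.
  pose ph s := if N (s - z) < dz then (g s + g z)^-1 else (g s - g z) / (s - z).
  have zz : N (z - z) < dz by rewrite subrr cN0.
  exists ph; first split.
  - apply: (@cont_ext _ _ _ (fun s => (g s + g z)^-1) _ _ dz) => //; first by move=> s hs; rewrite /ph hs.
    apply: contV; first by apply: contD => //; apply: cont_cst.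
    by rewrite -(cN_gt0 K); apply: lt_trans (dist z zz).2.
  - by rewrite /ph zz.
  move=> s; rewrite /ph; case: ifPn => [/dist [<- lo]|].
    have nz : g s + g z != 0 by rewrite -(cN_gt0 K); apply: lt_trans lo.
    by field.
  rewrite -leNgt => hs; rewrite divfK; first by ring.
  by rewrite -(cN_gt0 K); apply: lt_le_trans hs.
exists g => //; exists d => // z hz; have [g2 gr] := gP z hz; split=> //.
- exists (d - N (z - r0 ^+ 2)); first by rewrite subr_gt0.
  by move=> s hs; apply: cg; have := cN_dist K s z (r0 ^+ 2); move: hs; clear; lra.
- by move=> x; apply: uniq.
Qed.

(** The momentum [P_B], solved from the energy equation [H = E + q i4], which is linear in it. *)
Definition PBf (q : pt) (r : C) : C := 4 * q i0 / r *
  (E + q i4 + 2 * (1 + q i3) * yv q - 2 * q i0 * (1 + q i3)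
   + q i0 * (1 + q i3) ^+ 3 / 2 + 2 * lam * q i0 ^+ 3 * (1 + q i3)).

Definition Phc (q : pt) (r : C) (i : 'I_4) : C :=
  nth 0 [:: q i0 * (1 + q i3); q i0; r; PBf q r] i.

(* The point of phase space with reduced coordinates [q] and momentum [PA = r]. *)
Definition Ph (q : pt) (r : C) : V := \row_i Phc q r i.

Definition Hp (p : pt) : C := p i2 * p i3 / (4 * p i1) - p i0 * p i2 ^+ 2 / (8 * p i1 ^+ 2)
  + 2 * p i0 - p i0 ^+ 3 / (2 * p i1 ^+ 2) - 2 * lam * p i0 * p i1 ^+ 2.

Definition vp (p : V) : pt := mk (p 0 0) (p 0 1) (p 0 2) (p 0 3) 0.

(** The term in [H] makes eta vanish on the invariant plane at every energy; therefore a variation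
    of the energy does not enter the first order equation. *)
Definition eta_of (p : pt) := p i2 ^+ 2 / (16 * p i1) - (c1 (p i1) + 2 * (Hp p - E)) / 12.

Definition cqf (p : pt) : pt := mk (p i1) 0 (eta_of p) (p i0 / p i1 - 1) (Hp p - E).

Definition dHp (p v : pt) : C :=
  (v i2 * p i3 + p i2 * v i3) / (4 * p i1) - p i2 * p i3 * v i1 / (4 * p i1 ^+ 2)
  - (v i0 * p i2 ^+ 2 + 2 * p i0 * p i2 * v i2) / (8 * p i1 ^+ 2)
  + p i0 * p i2 ^+ 2 * v i1 / (4 * p i1 ^+ 3)
  + 2 * v i0 - 3 * p i0 ^+ 2 * v i0 / (2 * p i1 ^+ 2) + p i0 ^+ 3 * v i1 / p i1 ^+ 3
  - 2 * lam * (v i0 * p i1 ^+ 2 + 2 * p i0 * p i1 * v i1).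

Definition Lp (p v : pt) (t : C) : pt := fun i => p i + t * v i.

Lemma cd_Lp p v i t : cd (fun t => Lp p v t i) t (v i).
Proof.
rewrite /Lp -[X in cd _ _ X]add0r; apply: cdD; first exact: cd_cst.
by have := cdM (cd_id K t) (cd_cst K (v i) t); rewrite mul1r mulr0 addr0.
Qed.

Lemma Lp0 p v : Lp p v 0 = p.
Proof. by apply/funext => i; rewrite /Lp mul0r addr0. Qed.

Lemma cd_eq f t l l' : l = l' -> cd f t l -> cd f t l'.
Proof. by move=> ->. Qed.

Lemma cd_Hp p v : p i1 != 0 -> cd (fun t => Hp (Lp p v t)) 0 (dHp p v).
Proof.
move=> p1; have L0 i : Lp p v 0 i = p i by rewrite Lp0.
have c i := cd_Lp p v i 0.
have n1 : 4 * Lp p v 0 i1 != 0 by rewrite L0 mulf_neq0 // pnatr_eq0.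
have n2 : 8 * Lp p v 0 i1 ^+ 2 != 0 by rewrite L0 mulf_neq0 ?expf_neq0 // pnatr_eq0.
have n3 : 2 * Lp p v 0 i1 ^+ 2 != 0 by rewrite L0 mulf_neq0 ?expf_neq0 // pnatr_eq0.
have k1 := cdM (cdM (c i2) (c i3)) (cdV (cdZ 4 (c i1)) n1).
have k2 := cdM (cdM (c i0) (cdX 2 (c i2))) (cdV (cdZ 8 (cdX 2 (c i1))) n2).
have k3 := cdZ 2 (c i0).
have k4 := cdM (cdX 3 (c i0)) (cdV (cdZ 2 (cdX 2 (c i1))) n3).
have k5 := cdM (cdZ (2 * lam) (c i0)) (cdX 2 (c i1)).
have k := cdB (cdB (cdD (cdB k1 k2) k3) k4) k5.
apply: cd_eq k; rewrite !L0 /dHp; field; exact: p1.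
Qed.

Lemma ch_Hp p : p i1 != 0 -> ch Hp p.
Proof.
move=> p1; have c i := ch_coord K i p.
have n1 : 4 * p i1 != 0 by rewrite mulf_neq0 // pnatr_eq0.
have n2 : 8 * p i1 ^+ 2 != 0 by rewrite mulf_neq0 ?expf_neq0 // pnatr_eq0.
have n3 : 2 * p i1 ^+ 2 != 0 by rewrite mulf_neq0 ?expf_neq0 // pnatr_eq0.
have z (k : C) := ch_cst K k p.
apply: chB; [apply: chB; [apply: chD; [apply: chB|]|]|].
- by apply: chM; [apply: chM | apply: chV => //; apply: chM].
- by apply: chM; [apply: chM => //; apply: chX | apply: chV => //; apply: chM => //; apply: chX].
- by apply: chM.
- by apply: chM; [apply: chX | apply: chV => //; apply: chM => //; apply: chX].
- by apply: chM; [apply: chM => // | apply: chX].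
Qed.

Lemma ch_cqf i p : p i1 != 0 -> ch (fun p => cqf p i) p.
Proof.
move=> p1; have c k := ch_coord K k p; have z (k : C) := ch_cst K k p.
have n1 : 16 * p i1 != 0 by rewrite mulf_neq0 // pnatr_eq0.
have hp := ch_Hp p1.
apply: (@ch_mk _ _ K (fun i p => nth 0 [:: p i1; 0; eta_of p; p i0 / p i1 - 1; Hp p - E] i)).
move=> [[|[|[|[|[|n]]]]] //= Hn]; rewrite ?nth_nil //.
- apply: chB; first by apply: chM; [apply: chX | apply: chV => //; apply: chM].
  apply: chM => //; apply: chD; last by apply: chM => //; apply: chB.
  rewrite /c1; apply: chD => //; apply: chB; last exact: chM.
  by apply: chM => //; apply: chX.
- by apply: chB => //; apply: chM => //; apply: chV.
- exact: chB.
Qed.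

Definition dcq (p v : pt) : pt := mk (v i1) 0
  (2 * p i2 * v i2 / (16 * p i1) - p i2 ^+ 2 * v i1 / (16 * p i1 ^+ 2)
    - ((12 * lam * p i1 ^+ 2 - 3) * v i1 + 2 * dHp p v) / 12)
  (v i0 / p i1 - p i0 * v i1 / p i1 ^+ 2) (dHp p v).

Lemma cd_cqf p v i : p i1 != 0 -> cd (fun t => cqf (Lp p v t) i) 0 (dcq p v i).
Proof.
move=> p1; have L0 k : Lp p v 0 k = p k by rewrite Lp0.
have c k := cd_Lp p v k 0; have hH := cd_Hp v p1.
have n1 : 16 * Lp p v 0 i1 != 0 by rewrite L0 mulf_neq0 // pnatr_eq0.
have n2 : Lp p v 0 i1 != 0 by rewrite L0.
case: i => [[|[|[|[|[|n]]]]] //= Hn].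
- exact: (c i1).
- exact: cd_cst.
- have k1 := cdM (cdX 2 (c i2)) (cdV (cdZ 16 (c i1)) n1).
  have k2 := cdD (cdD (cdB (cdZ (4 * lam) (cdX 3 (c i1))) (cdZ 3 (c i1))) (cd_cst K (2 * E) 0))
     (cdZ 2 (cdB hH (cd_cst K E 0))).
  have k := cdB k1 (cdM k2 (cd_cst K 12^-1 0)).
  apply: cd_eq k; rewrite !L0 /dcq /mk /=; field; exact: p1.
- have k := cdB (cdM (c i0) (cdV (c i1) n2)) (cd_cst K 1 0).
  apply: cd_eq k; rewrite !L0 /dcq /mk /=; field; exact: p1.
- have k := cdB hH (cd_cst K E 0).
  by apply: cd_eq k; rewrite subr0.
Qed.

Lemma sq_cqf p : p i1 != 0 -> sq (cqf p) = p i2 ^+ 2.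
Proof. by move=> p1; rewrite /sq /yv /cqf /mk /= /eta_of; field. Qed.

Lemma PB_cqf p : p i1 != 0 -> p i2 != 0 -> PBf (cqf p) (p i2) = p i3.
Proof.
move=> p1 p2; rewrite /PBf /yv /cqf /mk /= /eta_of /Hp /c1.
by field; rewrite p1 p2.
Qed.

Lemma Ph_cqf (p : V) : p 0 1 != 0 -> p 0 2 != 0 -> Ph (cqf (vp p)) (p 0 2) = p.
Proof.
move=> p1 p2; apply/matrixP => i k; rewrite (ord1 i) mxE /Phc.
case: k => [[|[|[|[|n]]]] //= Hn].
- have -> : Ordinal Hn = 0 by apply: val_inj.
  by rewrite /cqf /vp /mk /=; field.
- have -> : Ordinal Hn = 1 by apply: val_inj.
  by [].
- have -> : Ordinal Hn = 2 by apply: val_inj.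
  by [].
- have -> : Ordinal Hn = 3 by apply: val_inj.
  exact: (@PB_cqf (vp p)).
Qed.

(** The component of [v] along [P_B] enters only through [dHp p v = 0], because eta and [b] involve
    [P_B] only through the energy. *)
Lemma reduced_flow (p v : pt) : p i1 != 0 -> p i2 != 0 -> dHp p v = 0 ->
  v i0 = p i3 / (4 * p i1) - p i0 * p i2 / (4 * p i1 ^+ 2) ->
  v i1 = p i2 / (4 * p i1) ->
  v i2 = - (- p i2 ^+ 2 / (8 * p i1 ^+ 2) + 2 - 3 * p i0 ^+ 2 / (2 * p i1 ^+ 2)
     - 2 * lam * p i1 ^+ 2) ->
  dcq p v i2 = v i1 * X1 (cqf p) /\ dcq p v i3 = v i1 * X2 (cqf p).
Proof.
move=> p1 p2 dH v0 v1 v2; rewrite /dcq /mk /= dH v0 v1 v2.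
have sqE := sq_cqf p1.
have s0 : cqf p i0 = p i1 by [].
have yE : yv (cqf p) = p i2 ^+ 2 / (16 * p i1).
  by rewrite /yv /cqf /mk /= /eta_of; field.
rewrite /X1 /X2 yE /cqf /mk /= /eta_of /Hp /c1.
by split; field; rewrite ?p1 ?p2.
Qed.

End Chart.

(** * The Hamiltonian vector field in the reduced coordinates *)

Section RepExists.
Variables (R : realType) (C : numClosedFieldType) (K : cdata R C) (E lam : C).
Notation j := (jr K).
Notation N := (cN K).
Notation cd := (cd K).
Notation hol := (hol K).
Notation pt := (pt C).
Notation ch := (ch K).
Notation bal := (bal K).
Notation pd := (pd K).
Notation V := 'rV[C]_4.
Notation c1 := (c1 E lam).
Notation yv := (yv E lam).
Notation sq := (sq E lam).
Notation X2 := (X2 E lam).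
Notation H := (bianchi_H lam).
Notation Hp := (Hp lam).
Notation dHp := (dHp lam).
Notation cqf := (cqf E lam).
Notation Ph := (Ph E lam).
Notation Phc := (Phc E lam).
Notation th := (th K).

Lemma near_nz (x r0 : C) : N (x - r0) < N r0 / 2 -> x != 0.
Proof.
move=> h; apply/negP => /eqP x0; move: h; rewrite x0 sub0r cNN.
by have := cN_ge0 K r0; lra.
Qed.

Lemma vp_row (p : V) (v : V) t : vp (\row_i (p 0 i + t * v 0 i)) = Lp (vp p) (vp v) t.
Proof. by apply: ptP; rewrite /vp /Lp /mk /= ?mxE ?mulr0 ?addr0. Qed.

Lemma cd_phase (F : V -> C) (p v : V) : differentiable F p ->
  cd (fun t => F (\row_i (p 0 i + t * v 0 i))) 0 ('d F p v).
Proof.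
move=> dF; have e : \row_i (p 0 i + 0 * v 0 i) = p.
  by apply/matrixP => i k; rewrite mxE mul0r addr0 (ord1 i).
have ev : \row_i (0 + (1 * v 0 i + 0 * 0)) = v.
  by apply/matrixP => i k; rewrite mxE mul1r mulr0 addr0 add0r (ord1 i).
have := @cd_diff _ _ K F (fun i t => p 0 i + t * v 0 i) (fun i => 0 + (1 * v 0 i + 0 * 0)) 0.
rewrite e ev; apply=> // i.
by apply: cdD (cd_cst _ _ _) _; apply: cdM (cd_id _ _) (cd_cst _ _ _).
Qed.

Lemma dH_phase (p v : V) : differentiable H p -> p 0 1 != 0 ->
  'd H p v = dHp (vp p) (vp v).
Proof.
move=> dH p1; apply: cd_uniq (cd_phase v dH) _.
have -> : (fun t => H (\row_i (p 0 i + t * v 0 i))) = fun t => Hp (Lp (vp p) (vp v) t).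
  by apply/funext => t; rewrite -vp_row.
exact: cd_Hp.
Qed.

Lemma d_row (F : V -> C) (p v : V) : 'd F p v = v 0 0 * partial 0 F p + v 0 1 * partial 1 F p
  + v 0 2 * partial 2 F p + v 0 3 * partial 3 F p.
Proof.
rewrite {1}(row_sum_delta v) linear_sum /= !big_ord_recl big_ord0 addr0 !linearZ /= !addrA.
have e1 : lift ord0 ord0 = 1 :> 'I_4 by apply: val_inj.
have e2 : lift ord0 (lift ord0 ord0) = 2 :> 'I_4 by apply: val_inj.
have e3 : lift ord0 (lift ord0 (lift ord0 ord0)) = 3 :> 'I_4 by apply: val_inj.
by rewrite e1 e2 e3.
Qed.

Definition ham (p : V) : V :=
  \row_i nth 0 [:: partial 2 H p; partial 3 H p; - partial 0 H p; - partial 1 H p] i.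

Lemma ham_at (p : V) : [/\ ham p 0 0 = partial 2 H p, ham p 0 1 = partial 3 H p,
  ham p 0 2 = - partial 0 H p & ham p 0 3 = - partial 1 H p].
Proof. by split; rewrite mxE. Qed.

Lemma d_ham f (p : V) : 'd f p (ham p) = - poisson H f p.
Proof.
rewrite d_row /poisson; have [-> -> -> ->] := ham_at p.
move: (partial 0 H p) (partial 1 H p) (partial 2 H p) (partial 3 H p) => a b c d.
by move: (partial 0 f p) (partial 1 f p) (partial 2 f p) (partial 3 f p) => a' b' c' d'; ring.
Qed.

Lemma ham_partial (p : V) : differentiable H p -> p 0 1 != 0 ->
  [/\ partial 2 H p = p 0 3 / (4 * p 0 1) - p 0 0 * p 0 2 / (4 * p 0 1 ^+ 2),
      partial 3 H p = p 0 2 / (4 * p 0 1) &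
      partial 0 H p = - p 0 2 ^+ 2 / (8 * p 0 1 ^+ 2) + 2 - 3 * p 0 0 ^+ 2 / (2 * p 0 1 ^+ 2)
        - 2 * lam * p 0 1 ^+ 2].
Proof.
move=> dH p1; rewrite /partial !dH_phase // /dHp /vp /mk /= !mxE /=.
move: (p 0 0) (p 0 1) (p 0 2) (p 0 3) p1 => x y z t y0.
by split; field.
Qed.

Lemma ham_flow (p : V) : differentiable H p -> p 0 1 != 0 -> p 0 2 != 0 ->
  let v := vp (ham p) in let q := cqf (vp p) in
  v i1 != 0 /\ [/\ dcq lam (vp p) v i0 = v i1, dcq lam (vp p) v i4 = 0,
    dcq lam (vp p) v i2 = v i1 * X1 q & dcq lam (vp p) v i3 = v i1 * X2 q].
Proof.
move=> dH p1 p2 v q; have [h0 h1 h2 h3] := ham_at p; have [e2 e3 e0] := ham_partial dH p1.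
have dHv : dHp (vp p) v = 0.
  by rewrite -dH_phase // d_ham /poisson !(mulrC (partial 2 H p)) !(mulrC (partial 3 H p)) !subrr addr0 oppr0.
have v1 : v i1 = vp p i2 / (4 * vp p i1) by rewrite [v i1]h1 e3.
have v0 : v i0 = vp p i3 / (4 * vp p i1) - vp p i0 * vp p i2 / (4 * vp p i1 ^+ 2).
  by rewrite [v i0]h0 e2.
have v2 : v i2 = - (- vp p i2 ^+ 2 / (8 * vp p i1 ^+ 2) + 2 - 3 * vp p i0 ^+ 2 / (2 * vp p i1 ^+ 2)
     - 2 * lam * vp p i1 ^+ 2) by rewrite [v i2]h2 e0.
have [f2 f3] := @reduced_flow _ E lam (vp p) v p1 p2 dHv v0 v1 v2.
split; last by split.
by rewrite v1 mulf_neq0 // invr_eq0 mulf_neq0 // pnatr_eq0.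
Qed.

End RepExists.

Lemma quotient_numerator (F : fieldType) (a b a' b' : F) : b != 0 ->
  b ^+ 2 * (a' * b^-1 + a * (- b' / b ^+ 2)) = b * a' - a * b'.
Proof. by move=> b0; field. Qed.

(** * Local expressions of a meromorphic first integral *)

Section RepExist.
Variables (R : realType) (C : numClosedFieldType) (K : cdata R C) (E lam : C).
Notation j := (jr K).
Notation N := (cN K).
Notation cd := (cd K).
Notation hol := (hol K).
Notation pt := (pt C).
Notation ch := (ch K).
Notation bal := (bal K).
Notation pd := (pd K).
Notation V := 'rV[C]_4.
Notation c1 := (c1 E lam).
Notation yv := (yv E lam).
Notation sq := (sq E lam).
Notation X2 := (X2 E lam).
Notation H := (bianchi_H lam).
Notation Hp := (Hp lam).
Notation dHp := (dHp lam).
Notation cqf := (cqf E lam).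
Notation Ph := (Ph E lam).
Notation Phc := (Phc E lam).
Notation th := (th K).
Notation cd_phase := (cd_phase K).

(** A local quotient [a / b] for [f] on phase space is pulled back by the inverse chart [Psi], on
    which the sign of [P_A] is fixed by the branch near [r0]. The flow relation follows from the
    involution and the nonvanishing of the transversal part from the independence of the
    differentials, first at good points and then by density. *)
Lemma rep_exists (U D : set V) (f : V -> C) (s0 r0 : C) :
  open U -> (bianchi_curve E lam `<=` U)%classic -> meromorphic_on U f ->
  open D -> dense_in D U -> holomorphic_on D H -> holomorphic_on D f ->
  (forall p, D p -> indep_differentials H f p) -> (forall p, D p -> poisson H f p = 0) ->
  s0 != 0 -> r0 != 0 -> r0 ^+ 2 = sq (base s0) ->
  inhabited (rep K E lam (fun q r => f (Ph q r)) s0 r0).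
Proof.
move=> oU GU mf oD [DU UD] hH hf ind poi s00 r00 rsq.
set p0 := Ph (base s0) r0.
have e4 : (4 : C) != 0 by rewrite pnatr_eq0.
have rsq' : r0 ^+ 2 = 16 * s0 * ((c1 s0 + 2 * 0) / 12 + 0) by rewrite rsq.
have Gp0 : bianchi_curve E lam p0.
  (* On the curve [P_A = 4 x dx], with [x = s0] and [P_A = r0]. *)
  exists s0, (r0 / (4 * s0)); split.
    have -> : 6 * s0 * (r0 / (4 * s0)) ^+ 2 = 6 * r0 ^+ 2 / (16 * s0) by field.
    by rewrite rsq' /c1; field.
  split; rewrite /p0 mxE /Phc /= /base /mk /=.
  - by rewrite addr0 mulr1.
  - by [].
  - by field.
  rewrite /PBf /yv /mk /=.
  have -> : E + 0 + 2 * (1 + 0) * ((c1 s0 + 2 * 0) / 12 + 0) - 2 * s0 * (1 + 0) +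
    s0 * (1 + 0) ^+ 3 / 2 + 2 * lam * s0 ^+ 3 * (1 + 0) = 8 * r0 ^+ 2 / (16 * s0).
    by rewrite rsq' /c1; field.
  by field; rewrite r00 s00.
have [W [a [b [[oW Wp WU ha hb] [[WbW Wb] fab]]]]] := mf p0 (GU _ Gp0).
have [dW dW0 hW] := open_row K oW Wp.
have [g _ [dg dg0 hg]] := lroot K r00.
have n0 : 0 < N r0 by rewrite cN_gt0.
have hg0 : g (r0 ^+ 2) = r0.
  have [|_ _ _ u] := hg (r0 ^+ 2); first by rewrite subrr cN0.
  by symmetry; apply: u; rewrite // subrr cN0 divr_gt0.
pose G q i := Phc q (g (sq q)) i.
pose Psi q : V := \row_i G q i.
have G0 : forall i, G (base s0) i = p0 0 i.
  by move=> i; rewrite /G -rsq hg0 mxE.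
have chG q i : N (sq q - r0 ^+ 2) < dg -> ch (fun q => G q i) q.
  move=> hq; have [g2 gr gh _] := hg _ hq.
  have gn : g (sq q) != 0 by apply: near_nz gr.
  have cs := ch_sq K E lam q; have cg : ch (fun q => g (sq q)) q by apply: ch_hol.
  have c k := ch_coord K k q; have z (k : C) := ch_cst K k q.
  have cy : ch yv q by rewrite /yv /c1;
    repeat first [exact: ch_cst | exact: ch_coord | apply: chM | apply: chD | apply: chN | apply: chX].
  have cP : ch (fun q => PBf E lam q (g (sq q))) q.
    rewrite /PBf; apply: chM; first by apply: chM; [apply: chM | apply: chV].
    repeat first [exact: cy | exact: ch_cst | exact: ch_coord | apply: chM | apply: chD | apply: chN | apply: chX].
  rewrite /G /Phc; case: i => [[|[|[|[|n]]]] //= Hn]; rewrite ?nth_nil //.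
  by apply: chM => //; apply: chD.
have [rho rho0 [hr1 hr2 hr3 hr4]] : exists2 rho : R, 0 < rho & [/\ rho <= N r0 / 2,
    forall q, bal (base s0) rho q -> N (sq q - r0 ^+ 2) < dg,
    forall q, bal (base s0) rho q -> forall i, N (G q i - p0 0 i) < dW &
    forall q, bal (base s0) rho q -> q i0 != 0].
  have d2 : 0 < dg / 2 by rewrite divr_gt0.
  have [x x0 hx] := ch_cont (ch_sq K E lam (base s0)) d2.
  have w2 : 0 < dW / 2 by rewrite divr_gt0.
  have bi i : exists2 y : R, 0 < y & forall q, bal (base s0) y q -> N (G q i - p0 0 i) <= dW / 2.
    rewrite -G0; apply: ch_cont w2; apply: chG; by rewrite -rsq subrr cN0.
  pose y := \big[Num.min/1]_(i < 4) s2val (cid2 (bi i)).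
  have yy i : y <= s2val (cid2 (bi i)) by rewrite /y; apply: bigmin_le_cond.
  have y0 : 0 < y by apply: lt_bigmin => // i _; apply: (s2valP (cid2 (bi i))).
  have s0p : 0 < N s0 by rewrite cN_gt0.
  exists (Num.min (Num.min (N r0 / 2) x) (Num.min y (N s0))).
    by rewrite !lt_min divr_gt0 // x0 y0.
  split; first by rewrite !ge_min lexx.
  - move=> q bq; have /hx : bal (base s0) x q by apply: bal_sub bq; rewrite !ge_min lexx orbT.
    by rewrite -rsq; move: dg0; clear; lra.
  - move=> q bq i; have k : N (G q i - p0 0 i) <= dW / 2.
      apply: (s2valP' (cid2 (bi i))); apply: bal_sub bq; apply: le_trans (yy i).
      by rewrite !ge_min lexx !orbT.
    by move: k dW0; clear; lra.
  move=> q bq; have : N (q i0 - s0) < N s0.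
    by apply: lt_le_trans (bq i0) _; rewrite !ge_min lexx !orbT.
  by move=> h; apply/negP => /eqP e; move: h; rewrite e sub0r cNN ltxx.
have WPsi q : bal (base s0) rho q -> W (Psi q).
  by move=> bq; apply: hW => i; rewrite mxE; apply: hr3.
have gnz q : bal (base s0) rho q -> g (sq q) != 0.
  move=> /hr2 hq; have [g2 gr gh _] := hg _ hq.
  exact: near_nz gr.
pose A q := a (Psi q); pose B q := b (Psi q).
have chW (F : V -> C) q : holomorphic_on W F -> bal (base s0) rho q -> ch (fun q => F (Psi q)) q.
  move=> hF bq; apply: ch_diff; last by move=> i; apply: chG; apply: hr2.
  have [d d0 hd] := open_row K oW (WPsi q bq); exists d => // p hp.
  by apply: hF; apply: hd => i; have := hp i; rewrite mxE.
have cAB q : bal (base s0) rho q -> ch A q /\ ch B q.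
  by move=> bq; split; apply: chW.
have Psi_coord q : bal (base s0) rho q -> [/\ Psi q 0 1 != 0, Psi q 0 2 != 0 & Psi q 0 2 = g (sq q)].
  by move=> bq; rewrite !mxE; split; [exact: hr4 bq | exact: gnz | ].
have sect (p : V) : p 0 1 != 0 -> p 0 2 != 0 -> bal (base s0) rho (cqf (vp p)) ->
    N (p 0 2 - r0) < N r0 / 2 -> Psi (cqf (vp p)) = p.
  move=> p1 p2 bq pr; have [_ _ _ u] := hg _ (hr2 _ bq).
  have e : g (sq (cqf (vp p))) = p 0 2.
    by symmetry; apply: u => //; rewrite sq_cqf.
  by rewrite -[RHS](Ph_cqf E lam p1 p2); apply/matrixP => i k; rewrite !mxE /G e.
have cq_Psi q : bal (base s0) rho q -> cqf (vp (Psi q)) = upd q i1 0.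
  move=> bq; have q0 := hr4 q bq; have gn := gnz q bq.
  have [g2 _ _ _] := hg _ (hr2 q bq).
  have HP : Hp (vp (Psi q)) = E + q i4.
    rewrite /Hp /vp /mk /= !mxE /G /Phc /= /PBf.
    have -> : yv q = g (sq q) ^+ 2 / (16 * q i0) by rewrite g2 /sq; field.
    by field; rewrite q0 gn.
  apply: ptP; rewrite /cqf /mk /= /eta_of ?HP //.
  - by rewrite /vp /mk /= !mxE.
  - rewrite (_ : upd q i1 0 i2 = q i2) // /vp /mk /= !mxE /G /Phc /= g2 /sq /yv.
    by field; exact: q0.
  - rewrite (_ : upd q i1 0 i3 = q i3) // /vp /mk /= !mxE /G /Phc /=.
    by field; exact: q0.
  by rewrite (_ : upd q i1 0 i4 = q i4) // addrC addKr.
have inv (F : V -> C) q : F (Psi (upd q i1 0)) = F (Psi q).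
  by congr F; apply/matrixP => i k; rewrite !mxE.
have star q : bal (base s0) rho q -> bal (base s0) rho (upd q i1 0).
  move=> bq i; rewrite /upd; case: eqP => [->|_]; last exact: bq.
  by rewrite /= subrr cN0.
pose good q := [/\ bal (base s0) rho q, D (Psi q) & b (Psi q) != 0].
(* A differential on phase space expressed through partial derivatives in the chart: both sides are
   the derivative of [F] along the line with direction [v], computed directly and through [cqf]. *)
have chain q (v : V) : bal (base s0) rho q -> q i1 = 0 -> forall F, holomorphic_on W F ->
    'd F (Psi q) v = \sum_(i < 5) pd i (fun q => F (Psi q)) q * dcq lam (vp (Psi q)) (vp v) i.
  move=> bq q1 F hF; have [p1 p2 p2E] := Psi_coord q bq.
  have [_ gr _ _] := hg _ (hr2 q bq).
  have dF : differentiable F (Psi q) by apply: hF; apply: WPsi.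
  have qE : cqf (vp (Psi q)) = q by rewrite cq_Psi // -q1 upd_id.
  pose cur t := cqf (Lp (vp (Psi q)) (vp v) t).
  have cur0 : cur 0 = q by rewrite /cur Lp0 qE.
  have hcur : holp K cur 0.
    move=> i; apply: (@ch_holp _ _ K (fun p => cqf p i) (Lp (vp (Psi q)) (vp v))).
      by rewrite Lp0; apply: ch_cqf.
    by move=> k; exists 1 => // t _; exists (vp v k); apply: cd_Lp.
  have chF : ch (fun q => F (Psi q)) (cur 0) by rewrite cur0; apply: chW.
  have dcur i : cd (fun t => cur t i) 0 (dcq lam (vp (Psi q)) (vp v) i) by apply: cd_cqf.
  have := chain_rule chF hcur dcur.
  rewrite cur0 => k; apply: cd_uniq (cd_phase v dF) _.
  have bcur : bal (base s0) rho (cur 0) by rewrite cur0.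
  have [x x0 hx] := holp_bal hcur bcur.
  have nz0 : Psi q 0 2 + 0 * v 0 2 != 0 by rewrite mul0r addr0.
  have nz1 : Psi q 0 1 + 0 * v 0 1 != 0 by rewrite mul0r addr0.
  have cl (k' : 'I_4) : cont K (fun t => Psi q 0 k' + t * v 0 k') 0.
    by apply: contD; [apply: cont_cst | apply: contM; [apply: cont_id | apply: cont_cst]].
  have [y1 y10 hy1] := cont_nz (cl 2) nz0; have [y2 y20 hy2] := cont_nz (cl 1) nz1.
  pose ee := (N r0 / 2 - N (g (sq q) - r0)) / 2.
  have ee0 : 0 < ee by rewrite divr_gt0 // subr_gt0.
  have [y3 y30 hy3] := cl 2 _ ee0.
  apply: (@cd_ext _ _ _ (fun t => F (Psi (cur t))) _ _ _ (Num.min (Num.min x y1) (Num.min y2 y3))) => //.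
    by rewrite !lt_min x0 y10 y20.
  move=> t; rewrite !lt_min => /andP[/andP[/hx [_ bt] /hy1 t1] /andP[/hy2 t2 /hy3 t3]].
  set p' : V := \row_i (Psi q 0 i + t * v 0 i).
  have ecur : cur t = cqf (vp p') by rewrite /p' vp_row.
  congr F; rewrite ecur; apply: sect.
  - by rewrite mxE -(cN_gt0 K); apply: lt_le_trans t2; rewrite divr_gt0 // cN_gt0.
  - by rewrite mxE -(cN_gt0 K); apply: lt_le_trans t1; rewrite divr_gt0 // cN_gt0.
  - by rewrite -ecur.
  rewrite mxE; apply: le_lt_trans (cN_dist K _ (Psi q 0 2) _) _.
  rewrite mul0r addr0 in t3.
  by move: t3 gr; rewrite /ee -p2E; clear; lra.
(* The quotient rule for [f = a / b], cleared of denominators; the coordinate [i1] does not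
   contribute, as [dcq] vanishes there. *)
have key q (v : V) : good q -> q i1 = 0 -> b (Psi q) ^+ 2 * 'd f (Psi q) v =
    th A B i0 q * dcq lam (vp (Psi q)) (vp v) i0 + th A B i2 q * dcq lam (vp (Psi q)) (vp v) i2
    + th A B i3 q * dcq lam (vp (Psi q)) (vp v) i3 + th A B i4 q * dcq lam (vp (Psi q)) (vp v) i4.
  move=> [bq Dq bn] q1.
  have Wq := WPsi q bq.
  have da := ha _ Wq; have db := hb _ Wq; have df := hf _ Dq.
  have line0 : \row_i (Psi q 0 i + 0 * v 0 i) = Psi q.
    by apply/matrixP => i k; rewrite mxE mul0r addr0 (ord1 i).
  have e : b (Psi q) ^+ 2 * 'd f (Psi q) v = b (Psi q) * 'd a (Psi q) v - a (Psi q) * 'd b (Psi q) v.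
    have cb := cd_phase v db; have ca := cd_phase v da.
    have bn' : b (\row_i (Psi q 0 i + 0 * v 0 i)) != 0 by rewrite line0.
    have k := cdM ca (cdV cb bn'); rewrite line0 in k.
    have df' : 'd f (Psi q) v = 'd a (Psi q) v * (b (Psi q))^-1 + a (Psi q) * (- 'd b (Psi q) v / b (Psi q) ^+ 2).
      apply: cd_uniq (cd_phase v df) _.
      have [d d0 hd] := open_row K oW Wq.
      have [y y0 hy] := cont_nz (cd_cont cb) bn'.
      have hol_l i : hol (fun t => Psi q 0 i + t * v 0 i) 0.
        by apply: holD; [apply: hol_cst | apply: holM; [apply: hol_id | apply: hol_cst]].
      have d2 : 0 < d / 2 by rewrite divr_gt0.
      have bi i : exists2 z : R, 0 < z & forall t, N (t - 0) < z ->
          N (Psi q 0 i + t * v 0 i - (Psi q 0 i + 0 * v 0 i)) <= d / 2.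
        exact: (hol_cont (hol_l i)).
      pose z := \big[Num.min/1]_(i < 4) s2val (cid2 (bi i)).
      have zz i : z <= s2val (cid2 (bi i)) by rewrite /z; apply: bigmin_le_cond.
      have z0 : 0 < z by apply: lt_bigmin => // i _; apply: (s2valP (cid2 (bi i))).
      apply: (@cd_ext _ _ _ _ _ _ _ (Num.min y z)) k; first by rewrite lt_min y0.
      move=> t; rewrite lt_min => /andP[/hy ty tz]; rewrite fab //.
        apply: hd => i; rewrite mxE.
        have : N (Psi q 0 i + t * v 0 i - (Psi q 0 i + 0 * v 0 i)) <= d / 2.
          by apply: (s2valP' (cid2 (bi i))); apply: lt_le_trans tz (zz i).
        by rewrite mul0r addr0; move: d0; clear; lra.
      by rewrite -(cN_gt0 K); apply: lt_le_trans ty; rewrite divr_gt0 // cN_gt0.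
    by apply: etrans (congr1 ( *%R _) df') _; apply: quotient_numerator.
  apply: etrans (etrans e (congr2 (fun z z' => b (Psi q) * z - a (Psi q) * z')
    (chain q v bq q1 a ha) (chain q v bq q1 b hb))) _.
  have o5 (F : 'I_5 -> C) : \sum_(i < 5) F i = F i0 + F i1 + F i2 + F i3 + F i4.
    rewrite !big_ord_recl big_ord0 addr0 !addrA.
    by do 4?congr (_ + _); congr F; apply: val_inj.
  have d1 : dcq lam (vp (Psi q)) (vp v) i1 = 0 by [].
  by rewrite !o5 d1 /th -/A -/B /A /B; ring.
have hHq q : good q -> q i1 = 0 -> forall v, 'd H (Psi q) v = dHp (vp (Psi q)) (vp v).
  move=> [bq Dq _] _ v; have [p1 _ _] := Psi_coord q bq.
  by apply: (dH_phase K) => //; apply: hH.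
pose Rel q := th A B i0 q + X1 q * th A B i2 q + X2 q * th A B i3 q.
have relg q : good q -> q i1 = 0 -> Rel q = 0.
  move=> gq q1; have [bq Dq bn] := gq; have [p1 p2 _] := Psi_coord q bq.
  set p := Psi q in p1 p2.
  have dH : differentiable H p by apply: hH.
  have dfv : 'd f p (ham lam p) = 0 by rewrite d_ham poi // oppr0.
  have [vn [f0 f4 f2 f3]] := ham_flow K E dH p1 p2.
  have qE : cqf (vp p) = q by rewrite cq_Psi // -q1 upd_id.
  have := key q (ham lam p) gq q1; rewrite -/p dfv mulr0 f0 f4 f2 f3 qE /Rel.
  clear -vn; move: (vp _ i1) (th A B i0 q) (th A B i2 q) (th A B i3 q) vn => y t0 t2 t3 vn e.
  by apply: (mulfI vn); rewrite mulr0 e; ring.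
(* If both transversal components vanish, so does the one along [s] by the flow relation. Then
   [b^2 df] is a multiple of [dH], against independence. *)
have thg q : good q -> q i1 = 0 -> th A B i2 q != 0 \/ th A B i3 q != 0.
  move=> gq q1; have [bq Dq bn] := gq.
  case: (eqVneq (th A B i2 q) 0) => [e2|]; last by left.
  case: (eqVneq (th A B i3 q) 0) => [e3|]; last by right.
  have e0 : th A B i0 q = 0 by have := relg q gq q1; rewrite /Rel e2 e3 !mulr0 !addr0.
  have [_ /eqP] : - th A B i4 q = 0 /\ b (Psi q) ^+ 2 = 0.
    apply: (ind _ Dq) => v; rewrite (key q v gq q1) e0 e2 e3 (hHq q gq q1).
    have -> : dcq lam (vp (Psi q)) (vp v) i4 = dHp (vp (Psi q)) (vp v) by [].
    by ring.
  by rewrite expf_eq0 (negbTE bn) andbF.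
(* In phase space a point with [b != 0] is taken first, then a point of [D] so close to it that [b]
   stays nonzero; the chart carries it back. *)
have dens q (d : R) : 0 < d -> bal (base s0) rho q -> q i1 = 0 ->
    exists q', [/\ good q', q' i1 = 0 & bal q d q'].
  move=> d0 bq q1; have [p1 p2 p2E] := Psi_coord q bq.
  have [_ gr _ _] := hg _ (hr2 q bq).
  have qE : cqf (vp (Psi q)) = q by rewrite cq_Psi // -q1 upd_id.
  have bq' : bal (base s0) rho (cqf (vp (Psi q))) by rewrite qE.
  have [d' d'0 hd'] := bal_near bq'.
  pose m := Num.min d d' / 2.
  have mm0 : 0 < Num.min d d' by rewrite lt_min d0.
  have m0 : 0 < m by rewrite divr_gt0.
  have mlt : m < Num.min d d' by rewrite /m gtr_pMr // invf_lt1 ?ltr1n ?ltr0n.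
  have [e e0 he] := @fin5 R (fun i e => forall P, bal (vp (Psi q)) e P -> N (cqf P i - cqf (vp (Psi q)) i) < Num.min d d')
     (fun i x y _ le h P bP => h P (bal_sub le bP))
     (fun i => let: ex_intro2 e e0 he := ch_cont (@ch_cqf _ _ K E lam i (vp (Psi q)) p1) m0 in
        ex_intro2 _ _ e e0 (fun P bP => le_lt_trans (he P bP) mlt)).
  have pp1 : 0 < N (Psi q 0 1) by rewrite cN_gt0.
  have pp2 : 0 < N (Psi q 0 2) by rewrite cN_gt0.
  pose ee := N r0 / 2 - N (g (sq q) - r0).
  have ee0 : 0 < ee by rewrite subr_gt0.
  have [w w0 hw] := open_row K oW (WPsi q bq).
  pose x := Num.min (Num.min e ee) (Num.min w (Num.min (N (Psi q 0 1)) (N (Psi q 0 2)))).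
  have x0 : 0 < x by rewrite !lt_min e0 ee0 w0 pp1.
  have x2 : 0 < x / 2 by rewrite divr_gt0.
  have [pb [Wpb bpb] hpb] := closure_row K x2 (Wb _ (WPsi q bq)).
  have [y y0 hy] := frechet K (hb _ Wpb) ltr01.
  have [y' y'0 hy'] : exists2 y' : R, 0 < y' & forall p : V, (forall i, N (p 0 i - pb 0 i) < y') -> b p != 0.
    have bp0 : 0 < N (b pb) by rewrite cN_gt0.
    pose M := \sum_(i < 4) N ('d b pb (delta_mx 0 i)) + 1.
    have M0 : 0 < M by rewrite ltr_wpDl // sumr_ge0 // => i _; apply: cN_ge0.
    have M1 : 0 < M + 1 by rewrite addr_gt0.
    exists (Num.min y (N (b pb) / 2 / (M + 1))); first by rewrite lt_min y0 !divr_gt0.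
    move=> p hp; set t := Num.min y _ in hp.
    have t0 : 0 < t by rewrite lt_min y0 !divr_gt0.
    have ty : t <= y by rewrite ge_min lexx.
    have tb : t <= N (b pb) / 2 / (M + 1) by rewrite ge_min lexx orbT.
    pose h : V := p - pb.
    have hh i : N (h 0 i) < t by have := hp i; rewrite !mxE.
    have k1 := hy h t (fun i => lt_le_trans (hh i) ty) (ltW t0) (fun i => ltW (hh i)).
    have k2 : N ('d b pb h) <= M * t.
      rewrite (row_sum_delta h) linear_sum /=; apply: le_trans (cN_sum _ _ _ _) _.
      apply: (@le_trans _ _ ((\sum_(i < 4) N ('d b pb (delta_mx 0 i))) * t)).
        rewrite mulr_suml; apply: ler_sum => i _; rewrite linearZ /= cNM mulrC.
        by apply: ler_wpM2l; [apply: cN_ge0 | apply: ltW].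
      by rewrite ler_pM2r // lerDl.
    rewrite ler_pdivlMr // in tb.
    have ep : pb + h = p by rewrite addrC subrK.
    rewrite ep in k1; apply/negP => /eqP bp; rewrite bp in k1.
    have e1 : b pb = - (0 - b pb - 'd b pb h) - 'd b pb h by ring.
    have : N (b pb) <= 1 * t + M * t.
      by rewrite {1}e1; apply: le_trans (cN_triB _ _ _) _; rewrite cNN; apply: lerD.
    by move: tb bp0; clear; lra.
  have z0 : 0 < Num.min y' (x / 2) by rewrite lt_min y'0.
  have [p'' Dp'' hp''] := closure_row K z0 (UD _ (WU _ Wpb)).
  have clo i : N (p'' 0 i - Psi q 0 i) < x.
    have := hp'' i; rewrite lt_min => /andP[_ h1]; have h2 := hpb i.
    by have := cN_dist K (p'' 0 i) (pb 0 i) (Psi q 0 i); move: h1 h2; clear; lra.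
  have clo' i : [/\ N (p'' 0 i - Psi q 0 i) < e, N (p'' 0 i - Psi q 0 i) < ee,
      N (p'' 0 i - Psi q 0 i) < w, N (p'' 0 i - Psi q 0 i) < N (Psi q 0 1) &
      N (p'' 0 i - Psi q 0 i) < N (Psi q 0 2)].
    by have := clo i; rewrite !lt_min => /andP[/andP[? ?] /and3P[? ? ?]].
  have nz i : N (p'' 0 i - Psi q 0 i) < N (Psi q 0 i) -> p'' 0 i != 0.
    by move=> h; apply/negP => /eqP z; move: h; rewrite z sub0r cNN ltxx.
  have P1 : p'' 0 1 != 0 by apply: nz; have [] := clo' 1.
  have P2 : p'' 0 2 != 0 by apply: nz; have [] := clo' 2.
  have bP : bal (vp (Psi q)) e (vp p'').
    have h i : N (p'' 0 i - Psi q 0 i) < e by have [] := clo' i.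
    by apply/balP; split; [exact: (h 0)|exact: (h 1)|exact: (h 2)|exact: (h 3)|rewrite subrr cN0].
  have bc : bal (cqf (vp (Psi q))) (Num.min d d') (cqf (vp p'')) by move=> i; apply: he.
  have bs : bal (base s0) rho (cqf (vp p'')).
    by apply: hd'; apply: bal_sub bc; rewrite ge_min lexx orbT.
  have se : Psi (cqf (vp p'')) = p''.
    apply: sect => //; have [_ h _ _ _] := clo' 2.
    have := cN_dist K (p'' 0 2) (Psi q 0 2) r0.
    by move: h; rewrite /ee -p2E; clear; lra.
  exists (cqf (vp p'')); split=> //.
    split=> //; rewrite se //; apply: hy' => i.
    by have := hp'' i; rewrite lt_min => /andP[].
  by rewrite -{1}qE; apply: bal_sub bc; rewrite ge_min lexx.
have b0 := bal_self K (base s0) rho0.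
have [qg [gq qg1 _]] := dens _ _ rho0 b0 (erefl _).
have pdi (F : pt -> C) k q : k != i1 -> (forall q, F (upd q i1 0) = F q) ->
    pd k F (upd q i1 0) = pd k F q.
  move=> k1 iF; rewrite /pd /upd (negbTE k1); congr (der K _ _).
  apply/funext => z; rewrite -[RHS]iF; congr F; apply/funext => i; rewrite /upd.
  by case: (eqVneq i i1) => // ->; rewrite eq_sym (negbTE k1).
apply: (@mk_rep _ _ K E lam _ s0 r0 rho A B) => //.
- move=> q r bq r2 rr Bn; have [_ _ _ u] := hg _ (hr2 q bq).
  have -> : r = g (sq q) by apply: u => //; apply: lt_le_trans rr hr1.
  by rewrite /A /B -fab //; apply: WPsi.
- move=> q bq; rewrite -/(Rel q).
  have rE : Rel (upd q i1 0) = Rel q.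
    by rewrite /Rel /th !pdi // /A /B !inv.
  (* The relation is known at good points only, and extends by continuity since they are dense. *)
  rewrite -rE; apply: (@small_eq0 _ _ K _ 1) => e e0; rewrite mul1r.
  have bu := star q bq.
  have cR : ch Rel (upd q i1 0).
    have [cA cB] := cAB _ bu.
    have cth k := ch_th k cA cB.
    have c k := ch_coord K k (upd q i1 0); have z (k : C) := ch_cst K k (upd q i1 0).
    have yn : 4 * upd q i1 0 i0 * yv (upd q i1 0) != 0.
      have [g2 _ _ _] := hg _ (hr2 _ bu).
      have := gnz _ bu; apply: contraNneq => e'; rewrite -[_ == 0](expf_eq0 _ 2) g2.
      rewrite /sq; apply/eqP.
      by have -> : 16 * upd q i1 0 i0 * yv (upd q i1 0) = 4 * (4 * upd q i1 0 i0 * yv (upd q i1 0));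
        [ring | rewrite e' mulr0].
    rewrite /Rel; apply: chD; [apply: chD => //|]; apply: chM => //.
      by rewrite /X1; repeat first [exact: ch_cst | exact: ch_coord | apply: chM | apply: chD | apply: chN | apply: chX].
    rewrite /X2; apply: chM; last first.
      apply: (@chV _ _ K (fun q => 4 * q i0 * yv q)) => //.
      rewrite /yv /c1.
      by repeat first [exact: ch_cst | exact: ch_coord | apply: chM | apply: chD | apply: chN | apply: chX].
    by repeat first [exact: ch_cst | exact: ch_coord | apply: chM | apply: chD | apply: chN | apply: chX].
  have [d d0 hd] := ch_cont cR e0.
  have [q' [gq' q'1 bq']] := dens _ _ d0 bu (upd_eq q i1 0).
  by have := hd q' bq'; rewrite (relg q' gq' q'1) sub0r cNN.
- by exists qg; [have [] := gq | have [_ _] := gq].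
- by exists qg; [have [] := gq | apply: thg].
Qed.

End RepExist.

(** * Solutions at the regular singular point *)

Section Exponential.
Variables (R : realType) (C : numClosedFieldType) (K : cdata R C).
Notation j := (jr K).
Notation N := (cN K).
Notation cd := (cd K).
Notation hol := (hol K).
Notation cis := (cis K).

Lemma creD : {morph cre K : x y / x + y}.
Proof. by move=> x y; apply: (jr_inj (K := K)); rewrite rmorphD !creE raddfD. Qed.

Lemma cimD : {morph cim K : x y / x + y}.
Proof. by move=> x y; apply: (jr_inj (K := K)); rewrite rmorphD !cimE raddfD. Qed.

Lemma cre_ij (y : R) : cre K ('i * j y) = 0.
Proof.
apply: (jr_inj (K := K)); rewrite creE rmorph0.
by have := Re_rect (rpred0 _) (jr_real K y); rewrite add0r.
Qed.

Lemma cim_ij (y : R) : cim K ('i * j y) = y.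
Proof.
apply: (jr_inj (K := K)); rewrite cimE.
by have := Im_rect (rpred0 _) (jr_real K y); rewrite add0r.
Qed.

Lemma cim_jr (y : R) : cim K (j y) = 0.
Proof.
apply: (jr_inj (K := K)); rewrite cimE rmorph0.
by have := Im_rect (jr_real K y) (rpred0 _); rewrite mulr0 addr0.
Qed.

Definition ce (w : C) : C := j (expR (cre K w)) * cis (cim K w).

Lemma ceD w w' : ce (w + w') = ce w * ce w'.
Proof. by rewrite /ce creD cimD expRD rmorphM cisD mulrACA. Qed.

Lemma N_ce w : N (ce w) = expR (cre K w).
Proof. by rewrite cNM N_cis mulr1 cN_jr ger0_norm // expR_ge0. Qed.

Lemma ce_neq0 w : ce w != 0.
Proof. by rewrite -(cN_gt0 K) N_ce expR_gt0. Qed.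

Lemma ce0 : ce 0 = 1.
Proof.
rewrite /ce -(rmorph0 j) cre_jr cim_jr expR0 rmorph1 mul1r.
exact: cis0.
Qed.

Definition ipi : C := 'i * j pi.

Lemma ce_ipi w : ce (w + ipi) = - ce w.
Proof.
rewrite ceD /ipi {2}/ce cre_ij cim_ij expR0 rmorph1 mul1r /cis cospi sinpi.
by rewrite rmorphN rmorph1 rmorph0; ring.
Qed.

Lemma expR_sub (x : R) : `|x| <= 1 / 2 -> `|expR x - 1 - x| <= 2 * x ^+ 2.
Proof.
rewrite ler_norml => /andP[x1 x2].
have lo := expR_ge1Dx x; have lo' := expR_ge1Dx (- x).
have e := expRxMexpNx_1 x; have p := expR_gt0 x.
have up : expR x * (1 - x) <= 1 by rewrite -[leRHS]e ler_pM2l //; move: lo'; clear; lra.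
have x0 : 0 < 1 - x by move: x2; clear; lra.
rewrite ger0_norm; last by move: lo; clear; lra.
have h : expR x <= (1 - x)^-1 by rewrite -[leRHS]mul1r ler_pdivlMr.
suff : (1 - x)^-1 <= 1 + x + 2 * x ^+ 2 by move: h; clear; lra.
rewrite -[leLHS]mul1r ler_pdivrMr //.
by have := sqr_ge0 x; move: x1 x2; clear; nra.
Qed.

Lemma sin_sub (y : R) : `|y| <= 1 -> `|sin y - y| <= `|y| ^+ 2.
Proof.
have pos (x : R) : 0 <= x -> x <= 1 -> `|sin x - x| <= x ^+ 2.
  move=> x0 hx.
  have d1 z : z \in `]0, x[ -> is_derive z 1 (fun t : R => sin t - t) (cos z - 1).
    by move=> _; apply: is_deriveB.
  have c1 : {within `[0, x], continuous (fun t : R => sin t - t)}%classic.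
    by apply: continuous_subspaceT => z; apply: continuousB; [apply: continuous_sin | apply: cvg_id].
  have [c /andP[c0 cx]] := MVT_segment x0 d1 c1; rewrite sin0 !subr0 => ->.
  rewrite normrM (ger0_norm x0) expr2 ler_wpM2r //.
  have y1 : `|cos c - 1| <= c ^+ 2 by apply: cos_sub1.
  apply: le_trans y1 _; rewrite !bnd_simp in c0 cx.
  by move: c0 cx hx; clear; nra.
case: (leP 0 y) => [y0|/ltW y0]; first by rewrite (ger0_norm y0); apply: pos.
rewrite ler0_norm // => y1; have := pos (- y); rewrite oppr_ge0 sinN opprK => /(_ y0 y1).
by rewrite -normrN opprD opprK.
Qed.

(** The real expansions of exp, cos and sin give the derivative at 0, and the functional equation
    moves it to [w]. *)
Lemma cd_ce w : cd ce w (ce w).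
Proof.
have k0 : cd ce 0 1.
  apply/cdP => e e0; exists (Num.min (1 / 2) (e / 8)).
    by rewrite lt_min !divr_gt0.
  move=> h; rewrite lt_min subr0 => /andP[h1 h2]; rewrite ce0 mul1r.
  set x := cre K h; set y := cim K h.
  have xh : `|x| <= N h := cN_re K h; have yh : `|y| <= N h := cN_im K h.
  have a1 : `|expR x - 1 - x| <= 2 * x ^+ 2 by apply: expR_sub; move: xh h1; clear; lra.
  have a2 := cos_sub1 y; have a3 : `|sin y - y| <= `|y| ^+ 2.
    by apply: sin_sub; move: yh h1; clear; lra.
  have -> : ce h - 1 - h = j (expR x - 1 - x) * cis y
     + j (1 + x) * (j (cos y - 1) + 'i * j (sin y - y)) + 'i * (j x * j y).
    rewrite {2}(c_rect K h) -/x -/y /ce -/x -/y /cis !(rmorphB, rmorphD, rmorph1).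
    by ring.
  apply: le_trans (cN_tri _ _ _) _; rewrite !cNM cN_i mul1r !cN_jr.
  have b1 : N (j (expR x - 1 - x) * cis y) <= 2 * x ^+ 2 by rewrite cNM N_cis mulr1 cN_jr.
  have b2 : N (j (cos y - 1) + 'i * j (sin y - y)) <= 2 * `|y| ^+ 2.
    apply: le_trans (cN_tri _ _ _) _; rewrite !cNM cN_i mul1r !cN_jr.
    by move: a2 a3; rewrite real_normK ?num_real //; clear; lra.
  have b3 : `|1 + x| <= 2 by move: xh h1 (ler_normD 1 x); rewrite normr1; clear; lra.
  have b4 : N (j (1 + x) * (j (cos y - 1) + 'i * j (sin y - y))) <= 2 * (2 * `|y| ^+ 2).
    by rewrite cNM cN_jr; apply: ler_pM => //; exact: cN_ge0.
  have b5 := cN_tri K (j (expR x - 1 - x) * cis y) (j (1 + x) * (j (cos y - 1) + 'i * j (sin y - y))).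
  have b6 : 2 * x ^+ 2 + 2 * (2 * `|y| ^+ 2) + `|x| * `|y| <= 8 * N h * N h.
    rewrite -[x ^+ 2]real_normK ?num_real //.
    by move: (normr_ge0 x) (normr_ge0 y) xh yh; clear; nra.
  have b7 : 8 * N h * N h <= e * N h.
    by apply: ler_wpM2r; [exact: cN_ge0 | move: h2; clear; lra].
  by move: b1 b4 b5 b6 b7; clear; lra.
have e : ce = fun z => ce w * ce (z + - w) by apply/funext => z; rewrite -ceD addrC subrK.
have k1 : cd (fun z => z + - w) w 1.
  by rewrite -[X in cd _ _ X](addr0 1); apply: cdD; [apply: cd_id | apply: cd_cst].
rewrite {1}e -[X in cd _ _ X]mulr1 -[X in ce w * X]mulr1.
by apply: cdZ; apply: cd_comp k1 _; rewrite subrr.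
Qed.

End Exponential.

(** * Power series with geometrically bounded coefficients *)

Section PowerSeries.
Variables (R : realType) (C : numClosedFieldType) (K : cdata R C).
Notation j := (jr K).
Notation N := (cN K).
Notation cd := (cd K).
Notation hol := (hol K).
Notation clim := (clim K).
Implicit Types (a b : nat -> C) (t z : C) (A B : R).

Definition ps a n t := \sum_(k < n) a k * t ^+ k.

Definition conv_to a t l := clim (fun n => ps a n t) l.

Lemma climD (u v : nat -> C) l m : clim u l -> clim v m -> clim (fun n => u n + v n) (l + m).
Proof.
move=> hu hv; have := climB hu (climZ (-1) hv).
rewrite mulN1r opprK; apply: clim_ext => n; ring.
Qed.

Lemma clim_cst l : clim (fun=> l) l.
Proof. by move=> e e0; exists 0%N => n _; rewrite subrr cN0 ltW. Qed.

Lemma clim_shift (u : nat -> C) l : clim u l -> clim (fun n => u n.+1) l.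
Proof. by move=> h e /h [n0 hn]; exists n0 => n n0n; apply: hn; apply: leqW. Qed.

Lemma clim_unshift (u : nat -> C) l : clim (fun n => u n.+1) l -> clim u l.
Proof. by move=> h e /h [n0 hn]; exists n0.+1 => -[//|n] n0n; apply: hn. Qed.

Lemma conv_toD a b t l m : conv_to a t l -> conv_to b t m ->
  conv_to (fun k => a k + b k) t (l + m).
Proof.
move=> ha hb; apply: clim_ext (climD ha hb) => n.
by rewrite /ps -big_split; apply: eq_bigr => i _; rewrite mulrDl.
Qed.

Lemma conv_toZ c a t l : conv_to a t l -> conv_to (fun k => c * a k) t (c * l).
Proof.
move=> ha; apply: clim_ext (climZ c ha) => n.
by rewrite /ps mulr_sumr; apply: eq_bigr => i _; rewrite mulrA.
Qed.

Lemma conv_to0 t : conv_to (fun=> 0) t 0.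
Proof.
apply: clim_ext (clim_cst 0) => n.
by rewrite /ps big1 // => i _; rewrite mul0r.
Qed.

Lemma conv_to_ext a b t l : (forall k, a k = b k) -> conv_to a t l -> conv_to b t l.
Proof.
by move=> ab; apply: clim_ext => n; apply: eq_bigr => i _; rewrite ab.
Qed.

Definition shift i a k := if (i <= k)%N then a (k - i)%N else 0.

Lemma conv_to_shift1 a t l : conv_to a t l -> conv_to (shift 1 a) t (t * l).
Proof.
move=> ha; apply: clim_unshift; apply: clim_ext (climZ t ha) => n.
rewrite /ps big_ord_recl /shift /= mul0r add0r mulr_sumr; apply: eq_bigr => i _.
by rewrite subn1 /= exprS mulrCA.
Qed.

Lemma conv_to_shift i a t l : conv_to a t l -> conv_to (shift i a) t (t ^+ i * l).
Proof.
move=> ha; elim: i => [|i ih].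
  by rewrite mul1r; apply: conv_to_ext ha => k; rewrite /shift subn0.
rewrite exprS -mulrA; apply: conv_to_ext (conv_to_shift1 ih) => -[|k] //.
by rewrite /shift /= subn1 ltnS subSS.
Qed.

Lemma conv_to_sum (m : nat) (F : nat -> nat -> C) t (l : nat -> C) :
  (forall i, conv_to (F i) t (l i)) ->
  conv_to (fun k => \sum_(i < m) F i k) t (\sum_(i < m) l i).
Proof.
move=> h; elim: m => [|m ih].
  by rewrite big_ord0; apply: conv_to_ext (conv_to0 t) => k; rewrite big_ord0.
rewrite big_ord_recr /=; apply: conv_to_ext (conv_toD ih (h m)) => k.
by rewrite big_ord_recr.
Qed.

Definition grow a A B := forall k, N (a k) <= A * B ^+ k.

Definition dseq a k := k.+1%:R * a k.+1.

(** The factor [k + 1 <= 2^k] is absorbed by doubling [B]. *)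
Lemma grow_dseq a A B : 0 <= B -> grow a A B -> grow (dseq a) (A * B) (2 * B).
Proof.
move=> B0 h k; rewrite cNM cN_nat.
have k2 : (k.+1%:R : R) <= 2 ^+ k by rewrite -natrX ler_nat ltn_expl.
have p := cN_ge0 K (a k.+1).
apply: le_trans (_ : 2 ^+ k * (A * B ^+ k.+1) <= _).
  by apply: ler_pM => //; rewrite ler0n.
by rewrite exprMn exprS le_eqVlt; apply/orP; left; apply/eqP; ring.
Qed.

Lemma ps_diff a A B t n m : 0 <= B -> grow a A B -> N t * (2 * B) <= 1 ->
  N (ps a (n + m) t - ps a n t) <= 2 * A * (2^-1) ^+ n.
Proof.
move=> B0 h tB; have A0 : 0 <= A by have := h 0%N; rewrite mulr1; apply: le_trans; exact: cN_ge0.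
have -> : ps a (n + m) t - ps a n t = \sum_(i < m) a (n + i)%N * t ^+ (n + i).
  by rewrite /ps big_split_ord /= addrAC subrr add0r.
suff h2 : \sum_(i < m) N (a (n + i)%N * t ^+ (n + i)) <= 2 * A * 2^-1 ^+ n * (1 - 2^-1 ^+ m).
  apply: le_trans (cN_sum _ _ _ _) _; apply: le_trans h2 _.
  rewrite ler_piMr ?mulr_ge0 ?exprn_ge0 ?invr_ge0 //.
  by rewrite gerBl exprn_ge0 // invr_ge0.
elim: m => [|m ih]; first by rewrite big_ord0 expr0 subrr mulr0.
rewrite big_ord_recr /=.
have b : N (a (n + m)%N * t ^+ (n + m)) <= A * 2^-1 ^+ (n + m).
  rewrite cNM cNX; apply: le_trans (ler_wpM2r _ (h _)) _; first by rewrite exprn_ge0 // cN_ge0.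
  rewrite -mulrA -exprMn ler_wpM2l // lerXn2r ?nnegrE ?mulr_ge0 ?cN_ge0 ?invr_ge0 //.
  by move: tB; clear; lra.
apply: le_trans (lerD ih b) _; rewrite exprD exprS.
move: (2^-1 ^+ n) (2^-1 ^+ m) => x y; by rewrite le_eqVlt; apply/orP; left; apply/eqP; field.
Qed.

Lemma half_small (A e : R) : 0 < e -> exists n0, forall n, (n0 <= n)%N -> A * (2^-1) ^+ n <= e.
Proof.
move=> e0; have [n0 hn] : exists n0 : nat, `|A| / e <= n0%:R.
  by exists (Num.bound (`|A| / e)); apply: ltW; apply: archi_boundP; rewrite divr_ge0 // ltW.
exists n0 => n n0n; apply: le_trans (ler_norm _) _.
rewrite normrM [X in _ * X]ger0_norm ?exprn_ge0 ?invr_ge0 // exprVn ler_pdivrMr ?exprn_gt0 //.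
rewrite mulrC -ler_pdivrMr //; apply: le_trans hn _.
apply: (@le_trans _ _ n%:R); first by rewrite ler_nat.
by rewrite -natrX ler_nat ltnW // ltn_expl.
Qed.

Lemma conv_ex a A B t : 0 <= B -> grow a A B -> N t * (2 * B) <= 1 -> exists l, conv_to a t l.
Proof.
move=> B0 h tB; apply: ccauchy => e e0.
have e2 : 0 < e / 2 by rewrite divr_gt0.
have [n0 hn] := half_small (2 * A) e2; exists n0 => m n hm hn'.
have b k : (n0 <= k)%N -> N (ps a k t - ps a n0 t) <= e / 2.
  by move=> hk; rewrite -(subnKC hk); apply: le_trans (ps_diff _ _ B0 h tB) (hn _ _).
have := cN_dist K (ps a m t) (ps a n0 t) (ps a n t); rewrite [N (ps a n0 t - _)]cNB.
by move: (b _ hm) (b _ hn'); clear; lra.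
Qed.

Definition psum a t := xget 0 [set l | conv_to a t l]%classic.

Lemma psumP a A B t : 0 <= B -> grow a A B -> N t * (2 * B) <= 1 -> conv_to a t (psum a t).
Proof.
move=> B0 h tB; have [l hl] := conv_ex B0 h tB.
by rewrite /psum; case: xgetP => [x -> //|/(_ l)].
Qed.

Lemma ps_cd a n t : cd (ps a n) t (ps (dseq a) n.-1 t).
Proof.
elim: n => [|n ih].
  rewrite /ps /= big_ord0; apply: (@cd_ext _ _ K (fun=> 0) _ _ _ 1) (cd_cst _ _ _) => // s _.
  by rewrite /ps big_ord0.
apply: (@cd_ext _ _ K (fun s => ps a n s + a n * s ^+ n) _ _ _ 1) => // [s _|].
  by rewrite /ps big_ord_recr.
have -> : ps (dseq a) n.+1.-1 t = ps (dseq a) n.-1 t + a n * (n%:R * t ^+ n.-1 * 1).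
  case: n {ih} => [|n] /=; first by rewrite /ps !big_ord0 !mul0r mulr0 addr0.
  by rewrite /ps big_ord_recr /= /dseq; ring.
by apply: cdD ih _; apply: cdZ; apply: cdX; apply: cd_id.
Qed.

(** Termwise differentiation is [hol_lim] applied to the partial sums, which are uniformly bounded
    on a small disc around [t]. *)
Lemma psum_cd a A B t : 0 < B -> grow a A B -> N t * (4 * B) < 1 ->
  cd (psum a) t (psum (dseq a) t).
Proof.
move=> B0 h tB; have B0' := ltW B0; have t0 := cN_ge0 K t.
pose r : R := (2 * B)^-1 - N t; have r0 : 0 < r.
  rewrite subr_gt0 -[ltRHS]mul1r ltr_pdivlMr ?mulr_gt0 //.
  by move: B0 t0 tB; clear; nra.
have dom z : N (z - t) <= r -> N z * (2 * B) <= 1.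
  move=> zr; have zt : N z <= (2 * B)^-1.
    by have := cN_low K z t; move: zr; rewrite /r; clear; lra.
  have := ler_wpM2r (_ : 0 <= 2 * B) zt; rewrite mulVf; first by apply; rewrite mulr_ge0.
  by rewrite mulf_neq0 ?pnatr_eq0 // gt_eqF.
have hb n : hball K (ps a n) t r (2 * A).
  move=> z /dom zB; split; first by exists (ps (dseq a) n.-1 z); apply: ps_cd.
  by have := ps_diff 0 n B0' h zB; rewrite /ps big_ord0 subr0 expr0 mulr1.
have [l hl lim] := hol_lim r0 hb (fun z zr => psumP B0' h (dom z zr)).
have k := lim _ (fun n => ps_cd a n t).
have k2 : conv_to (dseq a) t (psum (dseq a) t).
  apply: (psumP _ (grow_dseq B0' h)); first by rewrite mulr_ge0.
  by apply: ltW; have -> : 2 * (2 * B) = 4 * B by ring.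
rewrite -(clim_uniq (clim_shift k) k2); exact: hl.
Qed.

Lemma psum0 a A B : 0 <= B -> grow a A B -> psum a 0 = a 0%N.
Proof.
move=> B0 h; have := psumP (t := 0) B0 h; rewrite cN0 mul0r => /(_ ler01) k.
apply: clim_uniq k _; apply: clim_unshift; apply: clim_ext (clim_cst (a 0%N)) => n.
rewrite /ps big_ord_recl expr0 mulr1 big1 ?addr0 // => i _.
by rewrite exprS mul0r mulr0.
Qed.

(** Course-of-values recursion: [F n] sees the terms before [n], padded with 0. *)
Lemma strong_rec (F : nat -> (nat -> C) -> C) :
  exists a : nat -> C, forall n, a n = F n (fun k => if (k < n)%N then a k else 0).
Proof.
pose al := fix al n : seq C := if n is m.+1 then rcons (al m) (F m (nth 0 (al m))) else [::].
have sz n : size (al n) = n by elim: n => //= n ih; rewrite size_rcons ih.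
pose a n := nth 0 (al n.+1) n.
have st n k : (k < n)%N -> nth 0 (al n) k = a k.
  elim: n => // n ih; rewrite ltnS leq_eqVlt => /orP[/eqP -> //|kn].
  by rewrite /= nth_rcons sz kn ih.
exists a => n; rewrite {1}/a /= nth_rcons sz ltnn eqxx; congr (F n _).
apply/funext => k; case: ltnP => [/st //|nk].
by rewrite nth_default // sz.
Qed.

End PowerSeries.

(** * Frobenius' method *)

Section Frobenius.
Variables (R : realType) (C : numClosedFieldType) (K : cdata R C).
Notation j := (jr K).
Notation N := (cN K).
Notation cd := (cd K).
Notation psum := (psum K).
Variables (P Q W : {poly C}) (m : nat).

(** Coefficient of [t^(k + i)] produced from [t^k] by the terms of degree [i] in [P], [Q], [W];
    [cc 0] is the indicial polynomial. At [k = 0] the truncated predecessor is multiplied by 0. *)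
Definition cc i (k : nat) : C := P`_i * (k%:R * k.-1%:R) + Q`_i * k%:R + W`_i.

(* Coefficient of [t ^+ k] in [t^2 P y'' + t Q y' + W y] for [y = \sum_k a k t^k]. *)
Definition rec_at (a : nat -> C) k := \sum_(i < m.+1) shift i (fun l => cc i l * a l) k.

Lemma cc_bound : exists2 M : R, 0 <= M & forall i k, (i < m.+1)%N -> N (cc i k) <= M * k.+1%:R ^+ 2.
Proof.
pose f i : R := N P`_i + N Q`_i + N W`_i.
have f0 i : 0 <= f i by rewrite !addr_ge0 // cN_ge0.
exists (\sum_(i < m.+1) f i) => [|i k im]; first by apply: sumr_ge0.
have fM : f i <= \sum_(i < m.+1) f i.
  by rewrite (bigD1 (Ordinal im)) //= lerDl sumr_ge0.
apply: le_trans (ler_wpM2r (sqr_ge0 _) fM).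
have x0 : (0 : R) <= k%:R by rewrite ler0n.
have y0 : (0 : R) <= k.-1%:R by rewrite ler0n.
have yx : (k.-1%:R : R) <= k%:R by rewrite ler_nat leq_pred.
rewrite /cc /f -natr1.
have h1 := cN_tri K (P`_i * (k%:R * k.-1%:R) + Q`_i * k%:R) W`_i.
have h2 := cN_tri K (P`_i * (k%:R * k.-1%:R)) (Q`_i * k%:R).
rewrite !cNM !cN_nat in h1 h2.
have p0 := cN_ge0 K P`_i; have q0 := cN_ge0 K Q`_i; have w0 := cN_ge0 K W`_i.
have a1 : k%:R * k.-1%:R <= (k%:R + 1) ^+ 2 :> R by nra.
have a2 : k%:R <= (k%:R + 1) ^+ 2 :> R by nra.
have a3 : 1 <= (k%:R + 1) ^+ 2 :> R by nra.
have b1 := ler_wpM2l p0 a1; have b2 := ler_wpM2l q0 a2; have b3 := ler_wpM2l w0 a3.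
by lra.
Qed.

(** From [k0] on the indicial polynomial has no zero, so the recursion can be solved. It grows
    quadratically, as do all [cc i] at most; the weight [(k + 1)^2] on the coefficients cancels this
    growth and leaves a geometric bound with [B = 1 + m M / c]. *)
Lemma frobenius (k0 : nat) (init : nat -> C) (c : R) : 0 < c ->
  (forall k, (k0 <= k)%N -> c * k.+1%:R ^+ 2 <= N (cc 0 k)) ->
  (forall k, (k < k0)%N -> rec_at init k = 0) ->
  exists a A B, [/\ 0 < B, grow K a A B, forall k, (k < k0)%N -> a k = init k &
    forall k, rec_at a k = 0].
Proof.
move=> c0 hc hi.
have [a ha] := strong_rec (fun k a => if (k < k0)%N then init k else
   - (\sum_(i < m) shift i.+1 (fun l => cc i.+1 l * a l) k) / cc 0 k).
have ai k : (k < k0)%N -> a k = init k by move=> kk; rewrite ha kk.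
have ar k : (k0 <= k)%N -> a k = - (\sum_(i < m) shift i.+1 (fun l => cc i.+1 l * a l) k) / cc 0 k.
  move=> kk; rewrite ha ltnNge kk /=; congr (- _ / _); apply: eq_bigr => i _.
  rewrite /shift; case: ifP => // ik.
  by rewrite ltn_subrL /= (leq_trans _ ik).
have [M M0 hM] := cc_bound.
pose A : R := \sum_(k < k0) N (init k) * k.+1%:R ^+ 2.
have A0 : 0 <= A by apply: sumr_ge0 => k _; rewrite mulr_ge0 ?cN_ge0 ?sqr_ge0.
pose B : R := 1 + m%:R * M / c.
have mM : 0 <= m%:R * M / c by rewrite divr_ge0 ?mulr_ge0 ?ler0n // ltW.
have B1 : 1 <= B by rewrite lerDl.
have B0 : 0 < B by apply: lt_le_trans B1.
have s1 k : (1 : R) <= k.+1%:R ^+ 2 by rewrite exprn_ege1 // ler1n.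
have al k : N (a k) * k.+1%:R ^+ 2 <= A * B ^+ k.
  elim/ltn_ind: k => k ih; case: (ltnP k k0) => kk.
    rewrite ai //; apply: (@le_trans _ _ A); last by rewrite ler_peMr // exprn_ege1.
    rewrite /A (bigD1 (Ordinal kk)) //= lerDl sumr_ge0 // => i _.
    by rewrite mulr_ge0 ?cN_ge0 ?sqr_ge0.
  have hk := hc k kk.
  have cn : 0 < N (cc 0 k).
    by apply: lt_le_trans hk; rewrite mulr_gt0 // (lt_le_trans _ (s1 k)).
  have e : N (a k) * N (cc 0 k) <= m%:R * (M * (A * B ^+ k / B)).
    rewrite -cNM ar // divfK -?(cN_gt0 K) // cNN.
    apply: le_trans (cN_sum _ _ _ _) _.
    have -> : m%:R * (M * (A * B ^+ k / B)) = \sum_(i < m) M * (A * B ^+ k / B).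
      by rewrite sumr_const card_ord mulr_natl.
    apply: ler_sum => i _; rewrite /shift; case: ifP => [ik|_]; last first.
      by rewrite cN0 !mulr_ge0 // ?exprn_ge0 ?invr_ge0 // ltW.
    rewrite cNM; have lk : (k - i.+1 < k)%N by rewrite ltn_subrL /= (leq_trans _ ik).
    apply: (@le_trans _ _ (M * (k - i.+1).+1%:R ^+ 2 * N (a (k - i.+1)%N))).
      by apply: ler_wpM2r; [exact: cN_ge0 | apply: hM; rewrite ltnS].
    rewrite -mulrA ler_wpM2l // mulrC; apply: le_trans (ih _ lk) _.
    rewrite -mulrA ler_wpM2l // ler_pdivlMr // -exprSr.
    by apply: ler_weXn2l => //; rewrite -subSn // leq_subr.
  have cB : m%:R * M <= c * B.
    by rewrite /B mulrDr mulr1 (mulrCA c) divff ?gt_eqF // mulr1 lerDr ltW.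
  have X0 : 0 <= A * B ^+ k / B by rewrite !mulr_ge0 ?invr_ge0 ?exprn_ge0 // ltW.
  have e2 : m%:R * (M * (A * B ^+ k / B)) <= c * (A * B ^+ k).
    rewrite mulrA; apply: le_trans (ler_wpM2r X0 cB) _.
    rewrite le_eqVlt; apply/orP; left; apply/eqP.
    by rewrite -(mulrA c) (mulrCA B) divff ?gt_eqF // mulr1.
  have e3 := ler_wpM2l (cN_ge0 K (a k)) hk.
  rewrite -(ler_pM2l c0) mulrCA.
  by apply: le_trans e3 _; apply: le_trans e e2.
exists a, A, B; split=> // [k|k].
  by apply: le_trans (al k); rewrite ler_peMr // cN_ge0.
case: (ltnP k k0) => kk.
  rewrite -(hi k kk) /rec_at; apply: eq_bigr => i _; rewrite /shift; case: ifP => // ik.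
  by rewrite ai // (leq_ltn_trans _ kk) // leq_subr.
have cn : cc 0 k != 0.
  rewrite -(cN_gt0 K); apply: lt_le_trans (hc k kk).
  by rewrite mulr_gt0 // (lt_le_trans _ (s1 k)).
rewrite /rec_at big_ord_recl {1}/shift /= subn0 (ar k kk) mulrC divfK //.
by rewrite addNr.
Qed.

Lemma series_ode a A B t : (size P <= m.+1)%N -> (size Q <= m.+1)%N -> (size W <= m.+1)%N ->
  0 < B -> grow K a A B -> (forall k, rec_at a k = 0) -> N t * (8 * B) <= 1 ->
  t ^+ 2 * P.[t] * psum (dseq (dseq a)) t + t * Q.[t] * psum (dseq a) t + W.[t] * psum a t = 0.
Proof.
move=> sP sQ sW B0 ga hr tB; have B0' := ltW B0; have t0 := cN_ge0 K t.
have B2 : 0 <= 2 * B by rewrite mulr_ge0.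
have g1 := grow_dseq B0' ga; have g2 := grow_dseq B2 g1.
have tb : 0 <= N t * B by rewrite mulr_ge0.
rewrite (mulrCA (N t)) in tB.
have c0 : conv_to K a t (psum a t).
  by apply: psumP B0' ga _; rewrite !(mulrCA (N t)); lra.
have c1 : conv_to K (dseq a) t (psum (dseq a) t).
  by apply: psumP B2 g1 _; rewrite !(mulrCA (N t)); lra.
have c2 : conv_to K (dseq (dseq a)) t (psum (dseq (dseq a)) t).
  by apply: psumP g2 _; rewrite ?mulr_ge0 // !(mulrCA (N t)); lra.
move: (psum _ _) (psum _ _) (psum _ _) c0 c1 c2 => y2 y1 y c0 c1 c2.
have d i : conv_to K (fun l => cc i l * a l) t (P`_i * (t ^+ 2 * y2) + Q`_i * (t ^+ 1 * y1) + W`_i * y).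
  have h := conv_toD (conv_toD (conv_toZ P`_i (conv_to_shift 2 c2)) (conv_toZ Q`_i (conv_to_shift 1 c1)))
    (conv_toZ W`_i c0).
  apply: conv_to_ext h => -[|[|k]]; rewrite /shift /dseq /cc /= ?subn1 ?subn2 /=; ring.
have h := conv_to_sum m.+1 (fun i => conv_to_shift i (d i)).
have z := conv_to_ext (fun k => hr k) h.
rewrite (horner_coef_wide t sP) (horner_coef_wide t sQ) (horner_coef_wide t sW).
rewrite !(mulr_sumr, mulr_suml) -!big_split -[RHS](clim_uniq z (conv_to0 K t)).
by apply: eq_bigr => i _; rewrite expr1 /=; ring.
Qed.

End Frobenius.

(** * Taylor series, primitives and residues *)

Section Primitive.
Variables (R : realType) (C : numClosedFieldType) (K : cdata R C).
Notation j := (jr K).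
Notation N := (cN K).
Notation cd := (cd K).
Notation hol := (hol K).
Notation psum := (psum K).
Notation ce := (ce K).

Definition dq (h : C -> C) z :=
  if z == 0 then der K (fun z => h z - h 0) 0 else (h z - h 0) / z.

Lemma dqE h z : h z = h 0 + z * dq h z.
Proof.
rewrite /dq; case: eqVneq => [->|z0]; first by rewrite mul0r addr0.
by rewrite mulrC divfK // addrC subrK.
Qed.

Lemma hol_dq0 h : hol h 0 -> hol (dq h) 0.
Proof.
move=> hh; pose f (q : pt C) := h (q i1) - h 0; pose p : pt C := fun=> 0.
have cf : ch K f p.
  apply: chB; last exact: ch_cst.
  by apply: (@ch_hol _ _ K h (fun q => q i1)) => //; apply: ch_coord.
have cdv : ch K (dv K i1 f) p.
  by apply: (@ch_dv _ _ K i1 f p 1 cf) => // q _ q1; rewrite /f q1 subrr.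
have e0 : upd p i1 0 = p by apply/funext => i; rewrite /upd; case: eqP.
have := @ch_holp _ _ K (dv K i1 f) (upd p i1) 0; rewrite e0 => /(_ cdv (holp_upd1 _ _ _ _)).
apply: (@hol_ext _ _ K _ _ _ 1) => // z _; rewrite /dv upd_eq /dq /f; case: eqP => // _.
Qed.

Lemma hol_dq h z : hol h z -> hol h 0 -> hol (dq h) z.
Proof.
move=> hz h0; case: (eqVneq z 0) => [->|z0]; first exact: hol_dq0.
have p : 0 < N z by rewrite cN_gt0.
apply: (@hol_ext _ _ K (fun z => (h z - h 0) * z^-1) _ _ (N z)) => // [s sz|].
  rewrite /dq; case: eqP => // s0; move: sz; rewrite s0 sub0r cNN ltxx //.
by apply: holM; [apply: holB => //; apply: hol_cst | apply: holV => //; apply: hol_id].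
Qed.

(** The coefficients are the values at 0 of iterated divided differences; each division multiplies
    the bound on the circle of radius [r] by at most [2 / r]. *)
Lemma taylor h (r M : R) : 0 < r -> (forall z, N z <= r -> hol h z) ->
  (forall z, N z <= r -> N (h z) <= M) ->
  exists2 a, grow K a M (2 / r) & forall t, N t <= r / 4 -> conv_to K a t (h t).
Proof.
move=> r0 hh hM; pose hk k := iter k dq h.
have hol_k k z : N z <= r -> hol (hk k) z.
  elim: k z => [|k ih] z zr; first exact: hh.
  by apply: hol_dq; apply: ih; rewrite ?cN0 // ltW.
have M0 : 0 <= M by apply: le_trans (hM 0 _); rewrite ?cN_ge0 ?cN0 ?ltW.
have r2 : 0 < 2 / r by rewrite divr_gt0.
have at0 k (B : R) : (forall z, N z = r -> N (hk k z) <= B) ->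
    forall t, N t < r -> N (hk k t) <= B * (r / (r - N t)).
  move=> hB t tr; have := @mv_bound _ _ K (hk k) 0 r B t tr; rewrite add0r; apply=> z zr.
    by apply: hol_cd; apply: hol_k; rewrite subr0 in zr.
  by rewrite add0r; apply: hB.
have bk k z : N z = r -> N (hk k z) <= M * (2 / r) ^+ k.
  elim: k z => [|k ih] z zr; first by rewrite mulr1; apply: hM; rewrite zr.
  have z0 : z != 0 by rewrite -(cN_gt0 K) zr.
  have b0 := at0 k _ ih 0; rewrite cN0 subr0 divff ?gt_eqF // mulr1 in b0.
  have -> : M * (2 / r) ^+ k.+1 = M * (2 / r) ^+ k * 2 / r by rewrite exprSr !mulrA.
  rewrite /hk iterS {1}/dq (negbTE z0) cNM cNV zr.
  rewrite ler_pM2r ?invr_gt0 // -/(hk k).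
  have := cN_triB K (hk k z) (hk k 0); have := ih z zr; have := b0 r0.
  by clear; lra.
have tay k t : h t = ps (fun i => hk i 0) k t + t ^+ k * hk k t.
  elim: k => [|k ih]; first by rewrite /ps big_ord0 add0r mul1r.
  by rewrite ih {1}(dqE (hk k) t) /ps big_ord_recr /= exprS -/(hk k.+1); ring.
exists (fun k => hk k 0) => [k|t tr].
  have := at0 k _ (bk k) 0; rewrite cN0 subr0 divff ?gt_eqF // mulr1; exact.
move=> e e0; have [n0 hn] := half_small (2 * M) e0; exists n0 => n nn.
apply: le_trans (hn n nn); rewrite (tay n t) -opprB cNN addrAC subrr add0r cNM cNX.
have t0 := cN_ge0 K t; have tr' : N t < r by move: tr r0 t0; clear; lra.
have b1 := at0 n _ (bk n) t tr'.
have b2 : r / (r - N t) <= 2.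
  by rewrite ler_pdivrMr; move: tr r0 t0; clear; lra.
have p0 : 0 <= M * (2 / r) ^+ n by rewrite mulr_ge0 // exprn_ge0 // ltW.
have b3 := le_trans b1 (ler_wpM2l p0 b2).
have q0 : 0 <= N t ^+ n by rewrite exprn_ge0.
apply: le_trans (ler_wpM2l q0 b3) _.
have -> : N t ^+ n * (M * (2 / r) ^+ n * 2) = 2 * M * (N t * (2 / r)) ^+ n.
  by rewrite [(N t * _) ^+ n]exprMn; ring.
rewrite ler_wpM2l ?mulr_ge0 // lerXn2r ?nnegrE ?mulr_ge0 ?invr_ge0 ?(ltW r0) ?(ltW r2) //.
by rewrite mulrA ler_pdivrMr //; move: tr; clear; lra.
Qed.

Lemma primitive h : hol h 0 -> exists P, exists2 d : R, 0 < d & forall t, N t < d -> cd P t (h t).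
Proof.
move=> hh; have [r1 r10 hr1] := hol_near hh; have [r2 r20 hb] := hol_hball hh.
pose r : R := Num.min r1 r2 / 2.
have rr : 0 < Num.min r1 r2 by rewrite lt_min r10.
have r0 : 0 < r by rewrite divr_gt0.
have rm : r < Num.min r1 r2 by rewrite gtr_pMr // invf_lt1 ?ltr1n.
move: (rm); rewrite lt_min => /andP[rr1 rr2].
have [z zr|z zr|a ga ca] := @taylor h r (N (h 0) + 1) r0.
- by apply: hr1; rewrite subr0; apply: le_lt_trans rr1.
- by apply: (hb z _).2; rewrite subr0; apply: le_trans zr (ltW rr2).
set M := N (h 0) + 1 in ga; pose B := 2 / r.
have B0 : 0 < B by rewrite divr_gt0.
have M0 : 0 <= M by rewrite addr_ge0 // cN_ge0.
pose b k := if k is k'.+1 then a k' / k'.+1%:R else 0.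
have gb : grow K b (M / B) B.
  move=> [|k] /=; first by rewrite cN0 mulr1 divr_ge0 // ltW.
  rewrite cNM cNV cN_nat exprS mulrA divfK ?gt_eqF //; apply: le_trans (ga k).
  by rewrite ler_pdivrMr ?ltr0n // ler_peMr ?cN_ge0 // ler1n.
have db : dseq b = a.
  by apply/funext => k; rewrite /dseq /= mulrC divfK // pnatr_eq0.
exists (psum b), (r / 8); first by rewrite divr_gt0.
move=> t tr; have t4 : N t * (4 * B) < 1.
  by rewrite /B !mulrA ltr_pdivrMr //; move: tr; clear; lra.
have := psum_cd B0 gb t4; rewrite db.
have t0 := cN_ge0 K t.
have <- // : psum a t = h t.
apply: clim_uniq (ca t _); last by move: tr t0; clear; lra.
apply: psumP ga _; first exact: ltW.
have tb : 0 <= N t * B by rewrite mulr_ge0 // ltW.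
by move: t4 tb; rewrite -/B !(mulrCA (N t)); clear; lra.
Qed.

Definition tpi : C := ipi K + ipi K.

Lemma ce_tpi w : ce (w + tpi) = ce w.
Proof. by rewrite /tpi addrA !ce_ipi opprK. Qed.

(* [N (ce w) < d] is a left half plane, covering a punctured disc around [0]. *)
Definition per (kap : C) (g : C -> C) := exists V, exists2 d : R, 0 < d &
  forall w, N (ce w) < d -> cd V w (g w) /\ V (w + tpi) = V w + kap * tpi.

Lemma perD k k' g g' : per k g -> per k' g' -> per (k + k') (fun w => g w + g' w).
Proof.
move=> [V [d d0 h]] [V' [d' d'0 h']]; exists (fun w => V w + V' w), (Num.min d d').
  by rewrite lt_min d0.
move=> w; rewrite lt_min => /andP[/h [a ->] /h' [a' ->]]; split; first exact: cdD.
by ring.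
Qed.

Lemma perZ c k g : per k g -> per (c * k) (fun w => c * g w).
Proof.
move=> [V [d d0 h]]; exists (fun w => c * V w), d => // w /h [a ->].
by split; [apply: cdZ | ring].
Qed.

Lemma per_ext k g g' (d : R) : 0 < d -> (forall w, N (ce w) < d -> g w = g' w) ->
  per k g -> per k g'.
Proof.
move=> d0 e [V [d' d'0 h]]; exists V, (Num.min d d'); first by rewrite lt_min d0.
by move=> w; rewrite lt_min => /andP[/e <- /h].
Qed.

(** As [dw = dz / z] with [z = ce w], a Laurent expansion in [z] has a primitive which is periodic
    up to the contribution of its constant term, and this term is the number [kap]. *)
Lemma per1 : per 1 (fun=> 1).
Proof. by exists id, 1 => // w _; split; [apply: cd_id | rewrite mul1r]. Qed.

Lemma per_hol F : hol F 0 -> per 0 (fun w => ce w * F (ce w)).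
Proof.
move=> /primitive [P [d d0 hP]]; exists (fun w => P (ce w)), d => // w wd.
split; last by rewrite ce_tpi mul0r addr0.
by rewrite mulrC; apply: cd_comp (cd_ce K w) (hP _ wd).
Qed.

Lemma per_neg m : (0 < m)%N -> per 0 (fun w => ce w ^- m).
Proof.
move=> m0; exists (fun w => - m%:R^-1 * ce w ^- m), 1 => // w _.
split; last by rewrite ce_tpi mul0r addr0.
have mn : (m%:R : C) != 0 by rewrite pnatr_eq0 -lt0n.
have zn := ce_neq0 K w.
have k := cdZ (- m%:R^-1) (cdV (cdX m (cd_ce K w)) (expf_neq0 m zn)).
suff -> : ce w ^- m = - m%:R^-1 * (- (m%:R * ce w ^+ m.-1 * ce w) / (ce w ^+ m) ^+ 2) by [].
case: m m0 mn {k} => // m _ mn /=; rewrite exprS; have xn := expf_neq0 m zn.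
move: (ce w ^+ m) (ce w) (m.+1%:R) xn zn mn => x z c xn zn cn.
by field; rewrite xn zn cn.
Qed.

End Primitive.

(** * Expansions to second order *)

Section Taylor3.
Variables (R : realType) (C : numClosedFieldType) (K : cdata R C).
Notation N := (cN K).
Notation hol := (hol K).
Notation cd := (cd K).
Notation psum := (psum K).

(** Two orders suffice: the worst pole met in the second variation is [z^-4], and [s^2 = z^4]. *)
Definition T3 (f : C -> C) (a b c : C) := exists2 g, hol g 0 & exists2 d : R, 0 < d &
  forall s, N s < d -> f s = a + b * s + c * s ^+ 2 + s ^+ 3 * g s.

Lemma T3_eq f a b c a' b' c' : a = a' -> b = b' -> c = c' -> T3 f a b c -> T3 f a' b' c'.
Proof. by move=> -> -> ->. Qed.

Lemma T3_hol f a b c : T3 f a b c -> hol f 0.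
Proof.
move=> [g hg [d d0 h]].
apply: (@hol_ext _ _ K (fun s => a + b * s + c * s ^+ 2 + s ^+ 3 * g s) _ _ d) => //.
  by move=> s; rewrite subr0 => /h ->.
by repeat first [exact: hg | exact: hol_cst | exact: hol_id | apply: holD | apply: holM | apply: holX].
Qed.

Lemma T3_0 f a b c : T3 f a b c -> f 0 = a.
Proof. by move=> [g _ [d d0 ->]]; rewrite ?cN0 //; ring. Qed.

Lemma T3_cst a : T3 (fun=> a) a 0 0.
Proof. by exists (fun=> 0); [apply: hol_cst | exists 1 => // s _; ring]. Qed.

Lemma T3_id : T3 id 0 1 0.
Proof. by exists (fun=> 0); [apply: hol_cst | exists 1 => // s _; ring]. Qed.

Lemma T3D f f' a b c a' b' c' : T3 f a b c -> T3 f' a' b' c' ->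
  T3 (fun s => f s + f' s) (a + a') (b + b') (c + c').
Proof.
move=> [g hg [d d0 h]] [g' hg' [d' d'0 h']]; exists (fun s => g s + g' s); first exact: holD.
exists (Num.min d d'); first by rewrite lt_min d0.
by move=> s; rewrite lt_min => /andP[/h -> /h' ->]; ring.
Qed.

Lemma T3M f f' a b c a' b' c' : T3 f a b c -> T3 f' a' b' c' ->
  T3 (fun s => f s * f' s) (a * a') (a * b' + b * a') (a * c' + b * b' + c * a').
Proof.
move=> h1 h2; have hf' := T3_hol h2; case: h1 h2 => [g hg [d d0 h]] [g' hg' [d' d'0 h']].
exists (fun s => g s * f' s + (a + b * s + c * s ^+ 2) * g' s + (b * c' + c * b' + c * c' * s)).
  by repeat first [exact: hg | exact: hg' | exact: hf' | exact: hol_cst | exact: hol_id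
    | apply: holD | apply: holM | apply: holX].
exists (Num.min d d'); first by rewrite lt_min d0.
by move=> s; rewrite lt_min => /andP[/h -> /h' ->]; ring.
Qed.

Lemma T3V f a b c : a != 0 -> T3 f a b c ->
  T3 (fun s => (f s)^-1) a^-1 (- b / a ^+ 2) (b ^+ 2 / a ^+ 3 - c / a ^+ 2).
Proof.
move=> a0 h; have hf := T3_hol h; have f0 := T3_0 h.
have hfn : f 0 != 0 by rewrite f0.
have [y y0 hy] := cont_nz (hol_cont hf) hfn.
case: h => [g hg [d d0 h]].
pose e0 := a^-1; pose e1 := - b / a ^+ 2; pose e2 := b ^+ 2 / a ^+ 3 - c / a ^+ 2.
exists (fun s => - (f s)^-1 * (g s * (e0 + e1 * s + e2 * s ^+ 2) + (b * e2 + c * e1 + c * e2 * s))).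
  have hi : hol (fun s => (f s)^-1) 0 by apply: holV.
  by repeat first [exact: hg | exact: hi | exact: hol_cst | exact: hol_id
    | apply: holD | apply: holM | apply: holN | apply: holX].
exists (Num.min d y); first by rewrite lt_min d0.
move=> s; rewrite lt_min => /andP[sd sy].
have fn : f s != 0.
  rewrite -(cN_gt0 K); apply: lt_le_trans (hy s _); last by rewrite subr0.
  by rewrite divr_gt0 // cN_gt0.
have k : f s * (e0 + e1 * s + e2 * s ^+ 2)
   = 1 + s ^+ 3 * (g s * (e0 + e1 * s + e2 * s ^+ 2) + (b * e2 + c * e1 + c * e2 * s)).
  by rewrite (h s sd) /e0 /e1 /e2; field.
rewrite -/e0 -/e1 -/e2; move: k; set p := e0 + _ + _ => k.
move: (g s * p + _) k => G k; rewrite -[X in _ = X + _](mulKf fn) k; ring.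
Qed.

Lemma T3_ext f f' a b c (d : R) : 0 < d -> (forall s, N s < d -> f s = f' s) ->
  T3 f a b c -> T3 f' a b c.
Proof.
move=> d0 e [g hg [d' d'0 h]]; exists g => //; exists (Num.min d d'); first by rewrite lt_min d0.
by move=> s; rewrite lt_min => /andP[/e <- /h].
Qed.

Lemma grow_shift (a : nat -> C) (A B : R) : 0 < B -> grow K a A B ->
  grow K (fun k => a k.+1) (A * B) B.
Proof. by move=> B0 h k; apply: le_trans (h k.+1) _; rewrite exprS mulrA. Qed.

Lemma psum_hol (a : nat -> C) (A B : R) : 0 < B -> grow K a A B -> hol (psum a) 0.
Proof.
move=> B0 h; exists (1 / (4 * B)); first by rewrite divr_gt0 // mulr_gt0.
move=> s; rewrite subr0 ltr_pdivlMr ?mulr_gt0 // => sB; exists (psum (dseq a) s).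
exact: psum_cd sB.
Qed.

Lemma psum_step (a : nat -> C) (A B : R) : 0 < B -> grow K a A B ->
  forall t, N t * (2 * B) <= 1 -> psum a t = a 0%N + t * psum (fun k => a k.+1) t.
Proof.
move=> B0 h t tB; have B0' := ltW B0.
have c1 := psumP B0' h tB; have c2 := psumP B0' (grow_shift B0 h) tB.
apply: clim_uniq c1 _; apply: clim_unshift.
apply: clim_ext (climD (clim_cst K (a 0%N)) (climZ t c2)) => n.
rewrite /ps big_ord_recl expr0 mulr1 mulr_sumr; congr (_ + _).
by apply: eq_bigr => i _; rewrite exprS mulrCA.
Qed.

Lemma T3_psum (a : nat -> C) (A B : R) : 0 < B -> grow K a A B ->
  T3 (psum a) (a 0%N) (a 1%N) (a 2%N).
Proof.
move=> B0 h; have h1 := grow_shift B0 h; have h2 := grow_shift B0 h1.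
have h3 := grow_shift B0 h2; exists (psum (fun k => a k.+3)); first exact: psum_hol h3.
exists (1 / (2 * B)); first by rewrite divr_gt0 // mulr_gt0.
move=> s; rewrite ltr_pdivlMr ?mulr_gt0 // => /ltW sB.
by rewrite (psum_step B0 h sB) (psum_step B0 h1 sB) (psum_step B0 h2 sB); ring.
Qed.

Lemma ode_sol (P Q W : {poly C}) (m k0 : nat) (init : nat -> C) (c : R) :
  (size P <= m.+1)%N -> (size Q <= m.+1)%N -> (size W <= m.+1)%N -> 0 < c ->
  (forall k, (k0 <= k)%N -> c * k.+1%:R ^+ 2 <= N (cc P Q W 0 k)) ->
  (forall k, (k < k0)%N -> rec_at P Q W m init k = 0) ->
  exists a (A B : R), [/\ 0 < B, grow K a A B, forall k, (k < k0)%N -> a k = init k,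
    forall k, rec_at P Q W m a k = 0 &
    exists2 d : R, 0 < d & forall t, N t < d ->
      [/\ cd (psum a) t (psum (dseq a) t), cd (psum (dseq a)) t (psum (dseq (dseq a)) t) &
       t ^+ 2 * P.[t] * psum (dseq (dseq a)) t + t * Q.[t] * psum (dseq a) t + W.[t] * psum a t = 0]].
Proof.
move=> sP sQ sW c0 hc hi; have [a [A [B [B0 ga ai ar]]]] := frobenius c0 hc hi.
exists a, A, B; split=> //; exists (1 / (8 * B)); first by rewrite divr_gt0 // mulr_gt0.
have B2 : 0 < 2 * B by rewrite mulr_gt0.
move=> t; rewrite ltr_pdivlMr ?mulr_gt0 // => tB.
have tb : 0 <= N t * B by rewrite mulr_ge0 ?cN_ge0 // ltW.
split.
- by apply: psum_cd B0 ga _; move: tB tb; rewrite !(mulrCA (N t)); clear; lra.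
- by apply: psum_cd B2 (grow_dseq (ltW B0) ga) _; have -> : 4 * (2 * B) = 8 * B by ring.
by apply: series_ode ga ar _ => //; apply: ltW.
Qed.

End Taylor3.

(** This and the next two bound from below the indicial polynomials at an ordinary point and at
    [s = 0] for the exponents 0 and [- 1 / 2]; [x] counts the indices after the initial ones. *)
Lemma quad0 (R : realType) (x : R) : 0 <= x -> 2 * (9^-1 * (x + 3) ^+ 2) <= (x + 2) * (x + 1).
Proof. by nra. Qed.

Lemma quad1 (R : realType) (x : R) : 0 <= x -> 4^-1 * (x + 2) ^+ 2 <= (x + 1) * (2 * x + 3).
Proof. by nra. Qed.

Lemma quad2 (R : realType) (x : R) : 0 <= x -> 4^-1 * (x + 2) ^+ 2 <= (x + 1) * (2 * x + 1).
Proof. by nra. Qed.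

(** * The first order variational equation *)

Section Nve.
Variables (R : realType) (C : numClosedFieldType) (K : cdata R C) (E lam : C).
Notation N := (cN K).
Notation hol := (hol K).
Notation cd := (cd K).
Notation psum := (psum K).
Notation ce := (ce K).
Notation T3 := (T3 K).
Notation c1 := (c1 E lam).

(** The reduced flow linearized at [base s] at fixed energy. Eliminating [b] gives
    [s c1 e'' + 3 (E - s) e' + 27 e = 0]. *)
Definition nve (e b : C -> C) s :=
  cd e s (3 / 2 * b s) /\ cd b s (- 3 * (6 * e s + (E - s) * b s) / (s * c1 s)).

Lemma lin_solve (a b x : C) : a != 0 -> a * x + b = 0 -> x = - b / a.
Proof.
move=> a0 h; apply: (mulfI a0); rewrite [RHS]mulrC divfK //.
by apply/eqP; rewrite -addr_eq0 h.
Qed.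

Lemma nve_reg s0 x y : s0 != 0 -> c1 s0 != 0 -> exists e b, [/\ e s0 = x, b s0 = y &
  exists2 d : R, 0 < d & forall s, N (s - s0) < d -> nve e b s].
Proof.
(* The coefficients of this equation in powers of [t = s - s0]. It is multiplied by [t^2] to fit the
   form of [series_ode], hence the zeros at the head of [Q] and [W]. *)
move=> s00 c10; pose P := Poly [:: s0 * c1 s0; 16 * lam * s0 ^+ 3 - 6 * s0 + 2 * E;
  24 * lam * s0 ^+ 2 - 3; 16 * lam * s0; 4 * lam].
pose Q := Poly [:: 0; 3 * (E - s0); -3]; pose W : {poly C} := Poly [:: 0; 0; 27].
pose p0 := s0 * c1 s0; have p00 : p0 != 0 by rewrite mulf_neq0.
have np : 0 < N p0 by rewrite cN_gt0.
pose init k : C := if k == 0%N then x else 3 / 2 * y.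
have [|||||k kk|a [A [B [B0 ga ai ar [d d0 hd]]]]] := @ode_sol _ _ K P Q W 4 2 init (N p0 * 2 / 9).
- exact: size_Poly.
- by apply: leq_trans (size_Poly _) _.
- by apply: leq_trans (size_Poly _) _.
- by rewrite divr_gt0 // mulr_gt0.
- move=> k k2; rewrite /cc !coef_Poly /= mul0r !addr0 -/p0 !cNM !cN_nat -!mulrA.
  rewrite (ler_pM2l (_ : 0 < N s0)) ?(ler_pM2l (_ : 0 < N (c1 s0))) ?cN_gt0 //.
  case: k k2 => [|[|k]] // _ /=; rewrite -[k.+3]addn3 -[k.+2]addn2 -[k.+1]addn1 !natrD.
  by apply: quad0; rewrite ler0n.
- case: k kk => [|[|k]] // _; rewrite /rec_at !big_ord_recl big_ord0 /shift /= ?subSS ?subn0 /cc !coef_Poly /=; ring.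
have cs s : cd (fun z => z - s0) s 1.
  by rewrite -[X in cd _ _ X]subr0; apply: cdB (cd_id _ _) (cd_cst _ _ _).
have B0' := ltW B0; have ga1 := grow_dseq B0' ga.
have B2 : 0 <= 2 * B by rewrite mulr_ge0.
exists (fun s => psum a (s - s0)), (fun s => 2 / 3 * psum (dseq a) (s - s0)); split.
- by rewrite subrr (psum0 B0' ga) ai.
- by rewrite subrr (psum0 B2 ga1) /dseq ai // /init /= mul1r; field.
have [d' d'0 hd'] : exists2 d' : R, 0 < d' & forall s, N (s - s0) < d' -> s * c1 s != 0.
  have ck : cont K (fun s => s * c1 s) s0.
    apply: (@hol_cont _ _ K); rewrite /c1.
    by repeat first [exact: hol_cst | exact: hol_id | apply: holD | apply: holM | apply: holN | apply: holX].
  have [y' y'0 h] := cont_nz ck p00; exists y' => // s /h b.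
  by rewrite -(cN_gt0 K); apply: lt_le_trans b; rewrite divr_gt0.
exists (Num.min d d'); first by rewrite lt_min d0.
move=> s; rewrite lt_min => /andP[/hd [k1 k2 k3] /hd' sn]; split.
  have -> : 3 / 2 * (2 / 3 * psum (dseq a) (s - s0)) = psum (dseq a) (s - s0) * 1 by field.
  exact: cd_comp (cs s) k1.
have -> : - 3 * (6 * psum a (s - s0) + (E - s) * (2 / 3 * psum (dseq a) (s - s0))) / (s * c1 s)
   = 2 / 3 * (psum (dseq (dseq a)) (s - s0) * 1); last by apply: cdZ; apply: cd_comp (cs s) k2.
have key : s * c1 s * psum (dseq (dseq a)) (s - s0) + 3 * (E - s) * psum (dseq a) (s - s0)
   + 27 * psum a (s - s0) = 0.
  (* At [s0] the factor [t^2] cannot be cancelled; the equation there is the recurrence at index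
     2. *)
  case: (eqVneq s s0) => [->|ss].
    have ga2 := grow_dseq B2 ga1; have B4 : 0 <= 2 * (2 * B) by rewrite mulr_ge0.
    rewrite subrr (psum0 B4 ga2) (psum0 B2 ga1) (psum0 B0' ga).
    have := ar 2%N; rewrite /rec_at !big_ord_recl big_ord0 /shift /= ?subSS ?subn0 /cc !coef_Poly /dseq /= => h.
    by rewrite -[RHS]h; ring.
  have t0 : s - s0 != 0 by rewrite subr_eq0.
  apply: (mulfI (expf_neq0 2 t0)); rewrite mulr0 -[RHS]k3 !horner_Poly /= /c1; ring.
move: (psum _ _) (psum _ _) (psum _ _) key => y0 y1 y2 key.
apply: (mulfI sn); rewrite mulrC divfK //.
have -> : s * c1 s * (2 / 3 * (y2 * 1)) = 2 / 3 * (s * c1 s * y2) by ring.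
have -> : s * c1 s * y2 = - (3 * (E - s) * y1 + 27 * y0).
  by apply/eqP; rewrite -addr_eq0 addrA key.
by field.
Qed.

(* The exponents at [s = 0] are [0] and [- 1 / 2]; [z = ce w] is a square root of [s]. *)
Lemma nve_zero : E != 0 -> exists yh yt yp yq : C -> C, exists2 cq, [/\
  T3 yh 1 (- 105 / (4 * E)) (3675 / (32 * E ^+ 2)),
  T3 yt (- 3^-1) (- 35 / (4 * E)) (3675 / (32 * E ^+ 2)),
  T3 yp 1 (- 9 / E) (108 / (5 * E ^+ 2)) &
  T3 yq (- 6 / E) (144 / (5 * E ^+ 2)) cq] &
  exists2 d : R, 0 < d & forall s, N s < d -> s != 0 -> c1 s != 0 /\ nve yp yq s /\
    exists l l', [/\ cd yh s l, cd yt s l', s * l = 3 / 2 * yt s + yh s / 2 &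
      c1 s * (2 * s * l' - 3 * yt s) = - 6 * (6 * s * yh s + (E - s) * yt s)].
Proof.
move=> E0; have nE : 0 < N E by rewrite cN_gt0.
(* Here [P] is [c1], and the equation is multiplied by [s]; the indicial polynomial is
   [E k (2 k + 1)]. *)
pose P := Poly [:: 2 * E; -3; 0; 4 * lam].
pose Q := Poly [:: 3 * E; -3]; pose W : {poly C} := Poly [:: 0; 27].
(* The equation for [h] after the substitution [e = s^(- 1 / 2) h]; its indicial polynomial
   [E k (2 k - 1)] has no positive integral zero. *)
pose Q' := Poly [:: E; 0; 0; - (4 * lam)]; pose W' := Poly [:: 0; 105 / 4; 0; 3 * lam].
pose init k : C := if k == 0%N then 1 else 0.
have c0 : 0 < N E / 4 by rewrite divr_gt0.
have sP : (size P <= 4)%N by exact: size_Poly.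
have sQ : (size Q <= 4)%N by apply: leq_trans (size_Poly _) _.
have sW : (size W <= 4)%N by apply: leq_trans (size_Poly _) _.
have sQ' : (size Q' <= 4)%N by exact: size_Poly.
have sW' : (size W' <= 4)%N by exact: size_Poly.
have [|k|a [A [B [B0 ga ai ar [d d0 hd]]]]] := @ode_sol _ _ K P Q W 3 1 init _ sP sQ sW c0.
- case=> // k _; rewrite /cc !coef_Poly /= addr0.
  have -> : 2 * E * (k.+1%:R * k%:R) + 3 * E * k.+1%:R = E * (k.+1 * (2 * k + 3))%:R.
    by rewrite natrM natrD natrM; ring.
  rewrite cNM cN_nat -mulrA ler_pM2l // natrM natrD natrM -[k.+2]addn2 -[k.+1]addn1 !natrD.
  by apply: quad1; rewrite ler0n.
- case: k => // _; rewrite /rec_at !big_ord_recl big_ord0 /shift /= ?subSS ?subn0 /cc !coef_Poly /=; ring.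
have [|k|b [A' [B' [B'0 gb bi br [d' d'0 hd']]]]] := @ode_sol _ _ K P Q' W' 3 1 init _ sP sQ' sW' c0.
- case=> // k _; rewrite /cc !coef_Poly /= addr0.
  have -> : 2 * E * (k.+1%:R * k%:R) + E * k.+1%:R = E * (k.+1 * (2 * k + 1))%:R.
    by rewrite natrM natrD natrM; ring.
  rewrite cNM cN_nat -mulrA ler_pM2l // natrM natrD natrM -[k.+2]addn2 -[k.+1]addn1 !natrD.
  by apply: quad2; rewrite ler0n.
- by case: k => // _; rewrite /rec_at !big_ord_recl big_ord0 /shift /= ?subSS ?subn0 /cc !coef_Poly /=; ring.
have a0 : a 0%N = 1 by rewrite ai.
have b0 : b 0%N = 1 by rewrite bi.
have a1 : a 1%N = - 9 / E.
  have := ar 1%N; rewrite /rec_at !big_ord_recl big_ord0 /shift /= ?subSS ?subn0 /cc !coef_Poly /= a0 => h.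
  rewrite (@lin_solve (3 * E) 27 (a 1%N)); [by field | by rewrite mulf_neq0 // pnatr_eq0 |].
  by rewrite -[RHS]h; ring.
have a2 : a 2%N = 108 / (5 * E ^+ 2).
  have := ar 2%N; rewrite /rec_at !big_ord_recl big_ord0 /shift /= ?subSS ?subn0 /cc !coef_Poly /= a0 => h.
  rewrite (@lin_solve (10 * E) (24 * a 1%N) (a 2%N)); [by rewrite a1; field | by rewrite mulf_neq0 // pnatr_eq0 |].
  by rewrite -[RHS]h; ring.
have b1 : b 1%N = - 105 / (4 * E).
  have := br 1%N; rewrite /rec_at !big_ord_recl big_ord0 /shift /= ?subSS ?subn0 /cc !coef_Poly /= b0 => h.
  rewrite (@lin_solve E (105 / 4) (b 1%N)) //; first by field.
  by rewrite -[RHS]h; ring.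
have b2 : b 2%N = 3675 / (32 * E ^+ 2).
  have := br 2%N; rewrite /rec_at !big_ord_recl big_ord0 /shift /= ?subSS ?subn0 /cc !coef_Poly /= b0 => h.
  rewrite (@lin_solve (6 * E) (105 / 4 * b 1%N) (b 2%N)); [by rewrite b1; field | by rewrite mulf_neq0 // pnatr_eq0 |].
  by rewrite -[RHS]h; ring.
have B0' := ltW B0; have ga1 := grow_dseq B0' ga; have gb1 := grow_dseq (ltW B'0) gb.
have B2 : 0 < 2 * B by rewrite mulr_gt0.
have B2' : 0 < 2 * B' by rewrite mulr_gt0.
have Ta := T3_psum B0 ga; have Tb := T3_psum B'0 gb.
have Ta1 := T3_psum B2 ga1; have Tb1 := T3_psum B2' gb1.
have c2 : c1 0 != 0 by rewrite /c1 expr0n /= !mulr0 subrr add0r mulf_neq0 // pnatr_eq0.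
have [y y0 hy] : exists2 y : R, 0 < y & forall s, N s < y -> c1 s != 0.
  have ck : cont K c1 0.
    apply: (@hol_cont _ _ K); rewrite /c1.
    by repeat first [exact: hol_cst | exact: hol_id | apply: holD | apply: holM | apply: holN | apply: holX].
  have [y y0 h] := cont_nz ck c2; exists y => // s sy.
  rewrite -(cN_gt0 K); apply: lt_le_trans (h s _); last by rewrite subr0.
  by rewrite divr_gt0 // cN_gt0.
exists (psum b), (fun s => 2 / 3 * (s * psum (dseq b) s + - 2^-1 * psum b s)), (psum a),
  (fun s => 2 / 3 * psum (dseq a) s), (2 / 3 * (dseq a) 2%N).
  split.
  - by move: Tb; rewrite b0 b1 b2.
  - apply: T3_eq (T3M (T3_cst K _) (T3D (T3M (T3_id K) Tb1) (T3M (T3_cst K _) Tb))).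
    + by rewrite /dseq b0; field.
    + by rewrite /dseq b0 b1; field.
    + by rewrite /dseq b0 b1 b2; field.
  - by move: Ta; rewrite a0 a1 a2.
  apply: T3_eq (T3M (T3_cst K _) Ta1).
  + by rewrite /dseq a1; field.
  + by rewrite /dseq a1 a2; field.
  by ring.
exists (Num.min y (Num.min d d')); first by rewrite !lt_min y0 d0.
move=> s; rewrite !lt_min => /and3P[/hy sy /hd [k1 k2 k3] /hd' [l1 l2 l3]] s0; split=> //.
have e1 x : P.[x] = c1 x by rewrite horner_Poly /= /c1; ring.
rewrite e1 in k3 l3; split.
  split; first by have -> : 3 / 2 * (2 / 3 * psum (dseq a) s) = psum (dseq a) s by [field].
  have -> : - 3 * (6 * psum a s + (E - s) * (2 / 3 * psum (dseq a) s)) / (s * c1 s) =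
     2 / 3 * psum (dseq (dseq a)) s; last exact: cdZ.
  apply: (mulfI (mulf_neq0 s0 sy)); rewrite mulrC divfK ?mulf_neq0 //.
  apply: (mulfI s0); apply/eqP; rewrite -subr_eq0; apply/eqP.
  rewrite !horner_Poly /= in k3; rewrite -[RHS](mulr0 (- (2 / 3))) -k3; by field.
exists (psum (dseq b) s), (2 / 3 * ((1 * psum (dseq b) s + s * psum (dseq (dseq b)) s) + - 2^-1 * psum (dseq b) s)).
split=> //.
- by apply: cdZ; apply: cdD (cdZ _ l1); apply: cdM (cd_id _ _) l2.
- by field.
apply/eqP; rewrite -subr_eq0; apply/eqP.
rewrite !horner_Poly /= /c1 in l3; rewrite -[RHS](mulr0 (4 / 3)) -l3 /c1; by field.
Qed.

End Nve.

(** * Monodromy of the second variation *)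

Ltac hols := repeat first [assumption | exact: hol_cst | exact: hol_id | apply: holD | apply: holB
  | apply: holN | apply: holM | apply: holX].

Section SecondVariation.
Variables (R : realType) (C : numClosedFieldType) (K : cdata R C) (E lam : C).
Notation N := (cN K).
Notation hol := (hol K).
Notation cd := (cd K).
Notation ce := (ce K).
Notation T3 := (T3 K).
Notation per := (per K).
Notation tpi := (tpi K).
Notation c1 := (c1 E lam).

Definition sw (w : C) : C := ce w ^+ 2.

Lemma sw_small (d : R) : 0 < d -> exists2 d' : R, 0 < d' & forall w, N (ce w) < d' -> N (sw w) < d.
Proof.
move=> d0; exists (Num.min 1 d); first by rewrite lt_min ltr01.
move=> w; rewrite lt_min => /andP[w1 wd]; rewrite /sw cNX expr2.
by apply: le_lt_trans wd; rewrite ler_piMl ?cN_ge0 ?ltW.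
Qed.

Lemma sw_tpi w : sw (w + tpi) = sw w.
Proof. by rewrite /sw ce_tpi. Qed.

Lemma sw_neq0 w : sw w != 0.
Proof. by rewrite expf_neq0 // ce_neq0. Qed.

Lemma cd_sw w : cd sw w (2 * sw w).
Proof.
have -> : 2 * sw w = 2%:R * ce w ^+ 2.-1 * ce w by rewrite /sw /= expr1 -mulrA expr2.
exact: cdX (cd_ce K w).
Qed.

Lemma hol_sq0 f : hol f 0 -> hol (fun z => f (z ^+ 2)) 0.
Proof.
by move=> h; apply: (@hol_comp _ _ _ (fun z => z ^+ 2)); [apply: holX (hol_id _ _) | rewrite expr0n].
Qed.

(** The product has only odd powers of [z], hence no constant term. *)
Lemma per_im1 f : hol f 0 -> per 0 (fun w => (ce w)^-1 * f (sw w)).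
Proof.
move=> h; have k1 := perZ (f 0) (per_neg K (isT : (0 < 1)%N)).
have k2 := per_hol (hol_sq0 (hol_dq0 h)).
have k := perD k1 k2; rewrite mulr0 addr0 in k; apply: per_ext ltr01 _ k => w _ /=.
rewrite (dqE K f (sw w)) /sw expr1; have := ce_neq0 K w; move: (dq _ _ _) => y z0.
by field.
Qed.

Lemma per_0 f : hol f 0 -> f 0 = 0 -> per 0 (fun w => f (sw w)).
Proof.
move=> h f0; have h2 : hol (fun z => z * dq K f (z ^+ 2)) 0.
  by apply: holM (hol_id _ _) (hol_sq0 (hol_dq0 h)).
apply: per_ext ltr01 _ (per_hol h2) => w _ /=.
by rewrite (dqE K f (sw w)) f0 add0r mulrA -expr2.
Qed.

Lemma per_3 f : hol f 0 -> per 0 (fun w => ce w ^+ 3 * f (sw w)).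
Proof.
move=> h; have h2 : hol (fun z => z ^+ 2 * f (z ^+ 2)) 0.
  by apply: holM (hol_sq0 h); apply: holX (hol_id _ _).
by apply: per_ext ltr01 _ (per_hol h2) => w _ /=; rewrite mulrA -exprS.
Qed.

(** In [z^-4 f(z^2)] the constant term is the coefficient of [s^2] in [f]. *)
Lemma per_m4 f a b c : T3 f a b c -> per c (fun w => ce w ^- 4 * f (sw w)).
Proof.
move=> [g hg [d d0 hd]].
have h2 : hol (fun z => z * g (z ^+ 2)) 0 by apply: holM (hol_id _ _) (hol_sq0 hg).
have k := perD (perD (perZ a (per_neg K (isT : (0 < 4)%N))) (perZ b (per_neg K (isT : (0 < 2)%N))))
  (perD (perZ c (per1 K)) (per_hol h2)).
rewrite !mulr0 mulr1 !addr0 add0r in k.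
have [d' d'0 hd'] := sw_small d0.
apply: per_ext d'0 _ k => w /hd' wd /=; rewrite hd // /sw; move: (g _) (ce_neq0 K w) => y z0.
by field.
Qed.

Lemma T3_c1 : T3 c1 (2 * E) (- 3) 0.
Proof.
exists (fun=> 4 * lam); first exact: hol_cst.
by exists 1 => // s _; rewrite /c1; ring.
Qed.

(* Quadratic terms of the equation for [b]; [k] is the variation of the energy. *)
Definition qterms s c n b k := - k * b - 6 * b * n + 3 / 2 * s * b ^+ 2
  - (- 6 * n - (E - s) * b) * (2 * k + 12 * n) / c.

(** [(n1, n2)] and [(p1, p2)] are the singular and the regular first order solution as functions of
    [w] and of [s]. For amplitudes [u], [v] and energy variation [k], the second order solution is
    [UU] times the singular plus [VV] times the regular one, by variation of constants; only [VV]
    has a period. *)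
Record frame := Frame {
  fd : R; fd_gt0 : 0 < fd;
  n1 : C -> C; n2 : C -> C; p1 : C -> C; p2 : C -> C;
  UU : C -> C -> C -> C -> C; VV : C -> C -> C -> C -> C;
  f_c1 : forall s, N s < fd -> s != 0 -> c1 s != 0;
  f_small : forall w, N (ce w) < fd -> N (sw w) < fd;
  f_n : forall w, N (ce w) < fd -> cd n1 w (2 * sw w * (3 / 2 * n2 w)) /\
    cd n2 w (2 * sw w * (- 3 * (6 * n1 w + (E - sw w) * n2 w) / (sw w * c1 (sw w))));
  f_p : forall s, N s < fd -> s != 0 -> nve K E lam p1 p2 s;
  f_p0 : p1 0 = 1; f_hp : hol p1 0 /\ hol p2 0;
  f_det : forall w, N (ce w) < fd -> n1 w * p2 (sw w) - n2 w * p1 (sw w) != 0;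
  f_per : forall w, n1 (w + tpi) = n1 w /\ n2 (w + tpi) = n2 w;
  f_UV : forall u v k w, N (ce w) < fd -> exists U' V', [/\ cd (UU u v k) w U',
    cd (VV u v k) w V',
    let b := u * n2 w + v * p2 (sw w) in U' * n1 w + V' * p1 (sw w) = 2 * sw w * (3 / 4 * b ^+ 2) &
    let b := u * n2 w + v * p2 (sw w) in let n := u * n1 w + v * p1 (sw w) in
    U' * n2 w + V' * p2 (sw w) = 2 * sw w * (3 / (sw w * c1 (sw w)) * qterms (sw w) (c1 (sw w)) n b k)];
  f_mono : forall u v k w, N (ce w) < fd -> UU u v k (w + tpi) = UU u v k w /\
    VV u v k (w + tpi) = VV u v k w + 540 * u ^+ 2 / E ^+ 2 * tpi }.

Lemma T3_eqx f f' a b c a' b' c' : T3 f a b c -> (forall s, f s = f' s) -> a = a' -> b = b' ->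
  c = c' -> T3 f' a' b' c'.
Proof. by move=> h e <- <- <-; apply: T3_ext ltr01 _ h => s _. Qed.

Section Monomials.
Variables yh yt yp yq ci di : C -> C.
(** [qA], [qAB], [qB] are the coefficients of [u^2], [u v], [v^2] in [qterms], and [lA], [lB] those
    of [k u], [k v], each stripped of its power of [z]. *)
Definition qA s := - 6 * yt s * yh s + 3 / 2 * yt s ^+ 2
  + 12 * ci s * yh s * (6 * s * yh s + (E - s) * yt s).
Definition qAB s := - 6 * (yt s * yp s + s * (yq s * yh s)) + 3 * s * yt s * yq s
  + 12 * ci s * (s * yh s * (6 * yp s + (E - s) * yq s) + yp s * (6 * s * yh s + (E - s) * yt s)).
Definition qB s := - 6 * yq s * yp s + 3 / 2 * s * yq s ^+ 2
  + 12 * ci s * yp s * (6 * yp s + (E - s) * yq s).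
Definition lA s := 2 * ci s * (6 * s * yh s + (E - s) * yt s) - yt s.
Definition lB s := 2 * ci s * (6 * yp s + (E - s) * yq s) - yq s.
(** [v1] to [v5] and [u1] to [u5] result from Cramer's rule for the derivatives of [VV] and [UU],
    with [ci] the inverse of [c1] and [di] that of the determinant. *)
Definition v1 s := 2 * (3 * ci s * s * yh s * qA s - 3 / 4 * yt s ^+ 3) * di s.
Definition v2 s := 2 * (3 * ci s * yh s * qAB s - 3 / 2 * yt s ^+ 2 * yq s) * di s.
Definition v3 s := 2 * s * (3 * ci s * yh s * qB s - 3 / 4 * yt s * yq s ^+ 2) * di s.
Definition v4 s := 6 * ci s * yh s * lA s * di s.
Definition v5 s := 6 * s * ci s * yh s * lB s * di s.
Definition u1 s := (3 / 2 * yq s * yt s ^+ 2 - 6 * yp s * ci s * qA s) * di s.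
Definition u2 s := (3 * s * yt s * yq s ^+ 2 - 6 * yp s * ci s * qAB s) * di s.
Definition u3 s := (3 / 2 * s * yq s ^+ 3 - 6 * yp s * ci s * qB s) * di s.
Definition u4 s := - (6 * yp s * ci s * lA s) * di s.
Definition u5 s := - (6 * yp s * ci s * lB s) * di s.

(** Nine of the ten terms have no residue: they are odd in [z], or vanish at [z = 0], which for [u2]
    and [u4] is due to [2 E ci = 1] at [s = 0]. Only [v1], which carries [u^2], has one. *)
Lemma mono_per : E != 0 ->
  T3 yh 1 (- 105 / (4 * E)) (3675 / (32 * E ^+ 2)) ->
  T3 yt (- 3^-1) (- 35 / (4 * E)) (3675 / (32 * E ^+ 2)) ->
  T3 ci ((2 * E)^-1) (3 / (4 * E ^+ 2)) (9 / (8 * E ^+ 3)) ->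
  T3 di 3 (9 / (4 * E)) (81 / (32 * E ^+ 2)) ->
  hol yp 0 -> hol yq 0 -> yp 0 = 1 ->
  [/\ per (540 / E ^+ 2) (fun w => ce w ^- 4 * v1 (sw w)),
      per 0 (fun w => (ce w)^-1 * v2 (sw w)), per 0 (fun w => v3 (sw w)),
      per 0 (fun w => (ce w)^-1 * v4 (sw w)) & per 0 (fun w => v5 (sw w))] /\
  [/\ per 0 (fun w => (ce w)^-1 * u1 (sw w)),
      per 0 (fun w => u2 (sw w)), per 0 (fun w => ce w ^+ 3 * u3 (sw w)),
      per 0 (fun w => u4 (sw w)) & per 0 (fun w => ce w ^+ 3 * u5 (sw w))].
Proof.
move=> E0 th tt tc td hp hq p0.
have hh := T3_hol th; have ht := T3_hol tt; have hc := T3_hol tc; have hd := T3_hol td.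
have t0 := T3_0 tt; have c0 := T3_0 tc.
split; split.
- apply: (@per_m4 _ (6^-1) (59 / (4 * E))).
  have t6 : T3 (fun s => 6 * s * yh s + (E - s) * yt s) (- E / 3) (- 29 / 12) (- 1085 / (32 * E)).
    apply: T3_eqx (T3D (T3M (T3M (T3_cst K 6) (T3_id K)) th)
      (T3M (T3D (T3_cst K E) (T3M (T3_cst K (-1)) (T3_id K))) tt)) _ _ _ _ => [s|||]; first by ring.
    + by field.
    + by field.
    + by field.
  have tq : T3 qA 6^-1 (175 / (4 * E)) (- 3675 / (2 * E ^+ 2)).
    apply: T3_eqx (T3D (T3D (T3M (T3M (T3_cst K (-6)) tt) th)
      (T3M (T3_cst K (3 / 2)) (T3M tt tt))) (T3M (T3M (T3M (T3_cst K 12) tc) th) t6)) _ _ _ _ => [s|||].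
    + by rewrite /qA; ring.
    + by field.
    + by field.
    + by field.
  (* After multiplication by [2 di] the last coefficient is [2 (3 (11283 / 128) + (9 / 4) (39 / 16)
     + 81 / (32 x 36)) / E^2], with [x] a product sign, that is [540 / E^2]. *)
  have tn : T3 (fun s => 3 * ci s * s * yh s * qA s - 3 / 4 * yt s ^+ 3) 36^-1 (39 / (16 * E))
      ((11 * 1000 + 283) / (128 * E ^+ 2)).
    apply: T3_eqx (T3D (T3M (T3M (T3M (T3M (T3_cst K 3) tc) (T3_id K)) th) tq)
      (T3M (T3_cst K (- (3 / 4))) (T3M (T3M tt tt) tt))) _ _ _ _ => [s|||].
    + by ring.
    + by field.
    + by field.
    + by field.
  apply: T3_eqx (T3M (T3M (T3_cst K 2) tn) td) _ _ _ _ => [s|||].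
  + by rewrite /v1.
  + by field.
  + by field.
  + by field.
- by apply: per_im1; rewrite /v2 /qAB; hols.
- by apply: per_0; rewrite /v3 /qB ?mulr0 ?mul0r //; hols.
- by apply: per_im1; rewrite /v4 /lA; hols.
- by apply: per_0; rewrite /v5 /lB ?mulr0 ?mul0r //; hols.
- by apply: per_im1; rewrite /u1 /qA; hols.
- apply: per_0; rewrite /u2 /qAB; first by hols.
  by rewrite t0 c0 p0; field.
- by apply: per_3; rewrite /u3 /qB; hols.
- apply: per_0; rewrite /u4 /lA; first by hols.
  by rewrite t0 c0 p0; field.
- by apply: per_3; rewrite /u5 /lB; hols.
Qed.
End Monomials.

Lemma min_exists5 (d1 d2 d3 d4 d5 : R) : 0 < d1 -> 0 < d2 -> 0 < d3 -> 0 < d4 -> 0 < d5 ->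
  exists2 d : R, 0 < d & [/\ d <= d1, d <= d2, d <= d3, d <= d4 & d <= d5].
Proof.
move=> h1 h2 h3 h4 h5; exists (Num.min d1 (Num.min d2 (Num.min d3 (Num.min d4 d5)))).
  by rewrite !lt_min h1 h2 h3 h4.
by split; rewrite !ge_min lexx ?orbT.
Qed.

Lemma frame_exists : E != 0 -> inhabited frame.
Proof.
move=> E0; have [yh [yt [yp [yq [cq [th tt tp tq] [d0 d00 hd]]]]]] := nve_zero K lam E0.
(* [D] is [z^3] times the determinant of the two first order solutions. *)
pose ci s := (c1 s)^-1; pose D s := s * yh s * yq s - yt s * yp s; pose di s := (D s)^-1.
have tc : T3 ci ((2 * E)^-1) (3 / (4 * E ^+ 2)) (9 / (8 * E ^+ 3)).
  have e0 : 2 * E != 0 by rewrite mulf_neq0 // pnatr_eq0.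
  by apply: T3_eqx (T3V e0 T3_c1) _ _ _ _ => [s|||]; rewrite /ci //; field.
have tD : T3 D 3^-1 (- (4 * E)^-1) (- 3 / (32 * E ^+ 2)).
  by apply: T3_eqx (T3D (T3M (T3M (T3_id K) th) tq) (T3M (T3_cst K (- 1)) (T3M tt tp))) _ _ _ _ => [s|||];
     rewrite /D; [ring | field | field | field].
have td : T3 di 3 (9 / (4 * E)) (81 / (32 * E ^+ 2)).
  have e0 : (3^-1 : C) != 0 by rewrite invr_eq0 pnatr_eq0.
  by apply: T3_eqx (T3V e0 tD) _ _ _ _ => [s|||]; rewrite /di //; field.
have hp := T3_hol tp; have hq := T3_hol tq; have p0 := T3_0 tp.
have [d1 d10 hD] : exists2 d : R, 0 < d & forall s, N s < d -> D s != 0.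
  have D0 : D 0 != 0 by rewrite (T3_0 tD) invr_eq0 pnatr_eq0.
  have [d d0' h] := cont_nz (hol_cont (T3_hol tD)) D0; exists d => // s sd.
  rewrite -(cN_gt0 K); apply: lt_le_trans (h s _); last by rewrite subr0.
  by rewrite divr_gt0 // cN_gt0.
have [[]] := mono_per E0 th tt tc td hp hq p0.
move=> [V1 [a1 a10 hV1]] [V2 [a2 a20 hV2]] [V3 [a3 a30 hV3]] [V4 [a4 a40 hV4]] [V5 [a5 a50 hV5]].
move=> [] [U1 [b1 b10 hU1]] [U2 [b2 b20 hU2]] [U3 [b3 b30 hU3]] [U4 [b4 b40 hU4]] [U5 [b5 b50 hU5]].
have [a a0 [la1 la2 la3 la4 la5]] := min_exists5 a10 a20 a30 a40 a50.
have [b b0 [lb1 lb2 lb3 lb4 lb5]] := min_exists5 b10 b20 b30 b40 b50.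
have [d d_0 [dd0 dd1 da db d_1]] := min_exists5 d00 d10 a0 b0 (ltr01 : (0 : R) < 1).
have small w : N (ce w) < d -> N (sw w) < d.
  move=> wd; have w1 := ltW (lt_le_trans wd d_1).
  by rewrite /sw cNX expr2; apply: le_lt_trans wd; rewrite ler_piMl ?cN_ge0.
have at0 w : N (ce w) < d -> [/\ c1 (sw w) != 0, D (sw w) != 0, nve K E lam yp yq (sw w) &
    exists l l', [/\ cd yh (sw w) l, cd yt (sw w) l', sw w * l = 3 / 2 * yt (sw w) + yh (sw w) / 2 &
      c1 (sw w) * (2 * sw w * l' - 3 * yt (sw w)) = - 6 * (6 * sw w * yh (sw w) + (E - sw w) * yt (sw w))]].
  move=> /small wd; have [c0 [nv e]] := hd _ (lt_le_trans wd dd0) (sw_neq0 w).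
  by split=> //; apply: hD (lt_le_trans wd dd1).
pose n1 w := (ce w)^-1 * yh (sw w); pose n2 w := ce w ^- 3 * yt (sw w).
pose UU u v k w := u ^+ 2 * U1 w + u * v * U2 w + v ^+ 2 * U3 w + k * u * U4 w + k * v * U5 w.
pose VV u v k w := u ^+ 2 * V1 w + u * v * V2 w + v ^+ 2 * V3 w + k * u * V4 w + k * v * V5 w.
have cUV (A1 A2 A3 A4 A5 : C -> C) l1 l2 l3 l4 l5 (x1 x2 x3 x4 x5 : C) w : cd A1 w l1 -> cd A2 w l2 ->
    cd A3 w l3 -> cd A4 w l4 -> cd A5 w l5 ->
    cd (fun w => x1 * A1 w + x2 * A2 w + x3 * A3 w + x4 * A4 w + x5 * A5 w) w
       (x1 * l1 + x2 * l2 + x3 * l3 + x4 * l4 + x5 * l5).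
  by move=> h1 h2 h3 h4 h5; apply: cdD (cdZ _ h5); apply: cdD (cdZ _ h4);
     apply: cdD (cdZ _ h3); apply: cdD (cdZ _ h2); apply: cdZ h1.
constructor; apply: (@Frame d d_0 n1 n2 yp yq UU VV) => //.
- by move=> s sd s0; have [] := hd s (lt_le_trans sd dd0) s0.
- move=> w wd; have [c0 _ _ [l [l' [h1 h2 e1 e2]]]] := at0 w wd.
  have z0 := ce_neq0 K w; have cz := cd_ce K w; split.
    apply: cd_eq (cdM (cdV cz z0) (cd_comp (cd_sw w) h1)).
    have -> : l * (2 * sw w) = 3 * yt (sw w) + yh (sw w).
      by rewrite mulrCA [l * _]mulrC e1; field.
    by rewrite /n2 /sw; field.
  apply: cd_eq (cdM (cdV (cdX 3 cz) (expf_neq0 3 z0)) (cd_comp (cd_sw w) h2)).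
  have -> : l' * (2 * sw w) = 3 * yt (sw w) - 6 * (6 * sw w * yh (sw w) + (E - sw w) * yt (sw w)) / c1 (sw w).
    apply: (mulfI c0); rewrite mulrBr [c1 _ * (_ / _)]mulrC divfK //.
    have -> : c1 (sw w) * (l' * (2 * sw w)) =
      c1 (sw w) * (2 * sw w * l' - 3 * yt (sw w)) + c1 (sw w) * (3 * yt (sw w)) by ring.
    by rewrite e2; ring.
  rewrite /n1 /n2; move: (c1 (sw w)) c0 => c c0; rewrite /sw; field.
  by rewrite c0 z0.
- by move=> s sd s0; have [_ []] := hd s (lt_le_trans sd dd0) s0.
- move=> w wd; have [_ D0 _ _] := at0 w wd; move: D0; rewrite /D /n1 /n2 /sw.
  have z0 := ce_neq0 K w; apply: contraNneq => e; apply/eqP.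
  rewrite -[RHS](mulr0 (ce w ^+ 3)) -e; by field.
- by move=> w; rewrite /n1 /n2 !ce_tpi !sw_tpi.
- move=> u v k w wd; have [c0 D0 _ _] := at0 w wd.
  have wa := lt_le_trans wd da; have wb := lt_le_trans wd db.
  do 2 eexists; split.
  + by apply: cUV; [apply: (hU1 _ _).1 | apply: (hU2 _ _).1 | apply: (hU3 _ _).1 |
      apply: (hU4 _ _).1 | apply: (hU5 _ _).1]; apply: lt_le_trans wb _.
  + by apply: cUV; [apply: (hV1 _ _).1 | apply: (hV2 _ _).1 | apply: (hV3 _ _).1 |
      apply: (hV4 _ _).1 | apply: (hV5 _ _).1]; apply: lt_le_trans wa _.
  + rewrite /= /v1 /v2 /v3 /v4 /v5 /u1 /u2 /u3 /u4 /u5 /lA /lB /qA /qAB /qB.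
    move: D0 c0; rewrite /di /ci /D /n1 /n2; have := ce_neq0 K w.
    move: (c1 (sw w)) => c; rewrite /sw; move: (ce w) (yh _) (yt _) (yp _) (yq _) => z h t p q z0 D0 c0.
    field.
    by rewrite c0 z0 D0.
  rewrite /= /qterms /v1 /v2 /v3 /v4 /v5 /u1 /u2 /u3 /u4 /u5 /lA /lB /qA /qAB /qB.
  move: D0 c0; rewrite /di /ci /D /n1 /n2; have := ce_neq0 K w.
  move: (c1 (sw w)) => c; rewrite /sw; move: (ce w) (yh _) (yt _) (yp _) (yq _) => z h t p q z0 D0 c0.
  field.
  by rewrite c0 z0 D0.
move=> u v k w wd; have wa := lt_le_trans wd da; have wb := lt_le_trans wd db.
rewrite /UU /VV.
rewrite (hU1 _ (lt_le_trans wb lb1)).2 (hU2 _ (lt_le_trans wb lb2)).2 (hU3 _ (lt_le_trans wb lb3)).2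
  (hU4 _ (lt_le_trans wb lb4)).2 (hU5 _ (lt_le_trans wb lb5)).2 (hV1 _ (lt_le_trans wa la1)).2
  (hV2 _ (lt_le_trans wa la2)).2 (hV3 _ (lt_le_trans wa la3)).2 (hV4 _ (lt_le_trans wa la4)).2
  (hV5 _ (lt_le_trans wa la5)).2 !mul0r !addr0; split=> //; by field.
Qed.
End SecondVariation.

Section IsolatedZeros.
Variables (R : realType) (C : numClosedFieldType) (K : cdata R C).
Notation N := (cN K).
Notation hol := (hol K).
Notation ch := (ch K).

(** The case of [ch_factor] in which a single coordinate matters. *)
Lemma iso_zero (h : C -> C) a (r : R) : 0 < r -> (forall z, N (z - a) < r -> hol h z) ->
  (exists2 z, N (z - a) < r & h z != 0) ->
  exists2 d : R, 0 < d & forall z, z != a -> N (z - a) < d -> h z != 0.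
Proof.
move=> r0 hh [z0 z0r z0n].
have [||||n [g1 [g2 [cg fg [q [Dq q1 gq]]]]]] := @ch_factor _ _ K i1 (fun q => N (q i1) < r)
  (fun q => h (a + q i1)) (fun q => h (a + q i1)).
- move=> q qr; exists (r - N (q i1)); first by rewrite subr_gt0.
  move=> q' /(_ i1) b; have := cN_tri K (q' i1 - q i1) (q i1); rewrite subrK; lra.
- move=> q qr; have k : ch (fun q => h (a + q i1)) q.
    apply: (ch_hol (chD (ch_cst _ _ _) (ch_coord _ _ _))); apply: hh.
    by have -> : a + q i1 - a = q i1 by ring.
  by [].
- by move=> q qr z zq; rewrite upd_eq; apply: le_lt_trans qr.
- exists (upd (base 0) i1 (z0 - a)); first by rewrite upd_eq.
  by left; rewrite upd_eq addrC subrK.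
have key (g : (pt C) -> C) : ch g q -> g q != 0 ->
   (forall z, N z < r -> h (a + z) = z ^+ n * g (upd q i1 z)) ->
   exists2 d : R, 0 < d & forall z, z != a -> N (z - a) < d -> h z != 0.
  move=> cg' nz eqn; have ng : 0 < N (g q) / 2 by rewrite divr_gt0 // cN_gt0.
  have [d d0 hd] := ch_cont cg' ng; exists (Num.min d r); first by rewrite lt_min d0.
  move=> z za; rewrite lt_min => /andP[zd zr].
  have -> : z = a + (z - a) by ring.
  rewrite eqn // mulf_neq0 ?expf_neq0 ?subr_eq0 //.
  have b : bal K q d (upd q i1 (z - a)).
    move=> i; rewrite /upd; case: eqP => [->|_]; last by rewrite subrr cN0.
    by rewrite q1 subr0.
  have := hd _ b; apply: contraTneq => ->; rewrite sub0r cNN -ltNge.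
  by rewrite ltr_pdivrMr // ltr_pMr ?cN_gt0 // ltr1n.
have [c1 c2] := cg q Dq.
case: gq => nz; [apply: (key g1) | apply: (key g2)] => // z zr;
  have := fg (upd q i1 z); rewrite upd_eq => /(_ zr) [] //.
Qed.

End IsolatedZeros.

(** * The first integral along approximate solutions *)

Section Monodromy.
Variables (R : realType) (C : numClosedFieldType) (K : cdata R C) (E lam : C).
Notation N := (cN K).
Notation hol := (hol K).
Notation cd := (cd K).
Notation ce := (ce K).
Notation tpi := (tpi K).
Notation pt := (pt C).
Notation ch := (ch K).
Notation bal := (bal K).
Notation pd := (pd K).
Notation c1 := (c1 E lam).
Notation sq := (sq E lam).
Notation sw := (sw K).

Variables (T : frame K E lam) (dd : R) (rw : C -> C) (F : pt -> C -> C).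
Hypothesis dd_fd : dd <= fd T.
Let W w := N (ce w) < dd.
Hypothesis rw_sq : forall w, W w -> rw w ^+ 2 = sq (base (sw w)).
Hypothesis rw_hol : forall w, W w -> hol rw w.
Hypothesis rw_per : forall w, rw (w + tpi) = rw w.
Hypothesis reps : forall s0 r0, s0 != 0 -> r0 != 0 -> r0 ^+ 2 = sq (base s0) ->
  inhabited (rep K E lam F s0 r0).

Implicit Types (x : pt) (w e : C).

Definition a1 x w := x i2 * n1 T w + x i3 * p1 T (sw w).
Definition b1 x w := x i2 * n2 T w + x i3 * p2 T (sw w).
Definition a2 x w := UU T (x i2) (x i3) (x i4) w * n1 T w + VV T (x i2) (x i3) (x i4) w * p1 T (sw w).
Definition b2 x w := UU T (x i2) (x i3) (x i4) w * n2 T w + VV T (x i2) (x i3) (x i4) w * p2 T (sw w).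
(** Approximate solution of order two in the blow-up at time [w]; [x i2] and [x i3] are the
    amplitudes of the singular and the regular solution, [x i4] the variation of the energy. *)
Definition Y x w e : pt := mk (sw w) e (a1 x w + e * a2 x w) (b1 x w + e * b2 x w) (x i4).

Let Wf w : W w -> N (ce w) < fd T.
Proof. by move=> h; apply: lt_le_trans h _. Qed.

Lemma W_open w : W w -> exists2 d : R, 0 < d & forall w', N (w' - w) < d -> W w'.
Proof.
rewrite /W => h; have h0 : 0 < (dd - N (ce w)) / 2 by rewrite divr_gt0 // subr_gt0.
have [d d0 hd] := cd_cont (cd_ce K w) h0; exists d => // w' /hd h'.
have := cN_tri K (ce w' - ce w) (ce w); rewrite subrK; lra.
Qed.

Lemma W_hol f w : (forall w, W w -> exists l, cd f w l) -> W w -> hol f w.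
Proof. by move=> h /W_open [d d0 hd]; exists d => // s /hd /h. Qed.

Let nl s n b := - 6 * n - (E - s) * b.

Lemma c1_sw w : W w -> c1 (sw w) != 0.
Proof. by move=> /Wf h; apply: f_c1 (f_small h) (sw_neq0 K w). Qed.

Lemma cd_frame x w : W w -> let s := sw w in
  [/\ cd (a1 x) w (2 * s * (3 / 2 * b1 x w)),
      cd (b1 x) w (2 * s * (3 / (s * c1 s) * nl s (a1 x w) (b1 x w))),
      cd (a2 x) w (2 * s * (3 / 2 * b2 x w + 3 / 4 * b1 x w ^+ 2)) &
      cd (b2 x) w (2 * s * (3 / (s * c1 s) * (nl s (a2 x w) (b2 x w) +
        qterms E s (c1 s) (a1 x w) (b1 x w) (x i4))))].
Proof.
move=> Ww s; have h := Wf Ww; have s0 := sw_neq0 K w; have c0 := c1_sw Ww.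
have [k1 k2] := f_n h; have [k3 k4] := f_p (f_small h) s0.
have k5 := cd_comp (cd_sw K w) k3; have k6 := cd_comp (cd_sw K w) k4.
have [U' [V' [cU cV]]] := f_UV (x i2) (x i3) (x i4) h.
cbv zeta => e1 e2; rewrite /nl; split.
- apply: cd_eq (cdD (cdZ _ k1) (cdZ _ k5)); rewrite /b1 /s; ring.
- apply: cd_eq (cdD (cdZ _ k2) (cdZ _ k6)); rewrite /b1 /a1 /s; field.
  by rewrite c0 s0.
- apply: cd_eq (cdD (cdM cU k1) (cdM cV k5)).
  rewrite -/s in e1 *; rewrite mulrDr /b1 -e1 /b2; ring.
apply: cd_eq (cdD (cdM cU k2) (cdM cV k6)).
rewrite -/s in e2 c0 s0 *; rewrite (mulrDr (3 / (s * c1 s))) (mulrDr (2 * s)) /b1 /a1 -e2 /b2 /a2; field.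
by rewrite c0 s0.
Qed.

Lemma W_chW q (f : C -> C) : (forall w, W w -> hol f w) -> W (q i0) -> ch (fun q => f (q i0)) q.
Proof. by move=> h Wq; apply: ch_hol (ch_coord _ _ _) (h _ Wq). Qed.

Lemma ch_Y x q i : W (q i0) -> ch (fun q => Y x (q i0) (q i1) i) q.
Proof.
move=> Wq; have ha f : (forall w, W w -> exists l, cd f w l) -> ch (fun q => f (q i0)) q.
  by move=> h; apply: W_chW Wq => w; apply: W_hol h.
case: i => [[|[|[|[|[|m]]]]] Hm] //=; rewrite /Y /mk /=; try exact: ch_cst; try exact: ch_coord.
- by apply: ha => w _; eexists; apply: cd_sw.
- apply: chD; first by apply: ha => w /(cd_frame x) [h _ _ _]; eexists; apply: h.
  by apply: chM (ch_coord _ _ _) _; apply: ha => w /(cd_frame x) [_ _ h _]; eexists; apply: h.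
apply: chD; first by apply: ha => w /(cd_frame x) [_ h _ _]; eexists; apply: h.
by apply: chM (ch_coord _ _ _) _; apply: ha => w /(cd_frame x) [_ _ _ h]; eexists; apply: h.
Qed.

Definition cv x w e : pt := bl (Y x w e).

Lemma cd_cv x w e : W w -> let s := sw w in
  [/\ cd (fun w => cv x w e i0) w (2 * s), cd (fun w => cv x w e i1) w 0,
   cd (fun w => cv x w e i2) w (e * (2 * s * (3 / 2 * b1 x w) + e * (2 * s * (3 / 2 * b2 x w + 3 / 4 * b1 x w ^+ 2)))),
   cd (fun w => cv x w e i3) w (e * (2 * s * (3 / (s * c1 s) * nl s (a1 x w) (b1 x w)) +
       e * (2 * s * (3 / (s * c1 s) * (nl s (a2 x w) (b2 x w) +
        qterms E s (c1 s) (a1 x w) (b1 x w) (x i4)))))) &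
   cd (fun w => cv x w e i4) w 0].
Proof.
move=> /(cd_frame x) [h1 h2 h3 h4] s; split.
- exact: cd_sw.
- exact: (cd_cst K 0 w).
- by apply: cdZ; apply: cdD h1 (cdZ _ h3).
- by apply: cdZ; apply: cdD h2 (cdZ _ h4).
exact: (cd_cst K (e * x i4) w).
Qed.

(** Chosen so that [c1 + e kap] is [12 yv] along the curve. [dl1] and [dl2] are what is left of the
    flow equations after division by [e^3]. *)
Definition kap x w e := 2 * x i4 + 12 * (a1 x w + e * a2 x w).
Definition dl1 x w e := - (3 / 4) * (2 * sw w) * (2 * b1 x w * b2 x w + e * b2 x w ^+ 2).
Definition dl2 x w e := let s := sw w in let c := c1 s in
  let m2 := - x i4 * b2 x w - 6 * (b2 x w * a1 x w + b1 x w * a2 x w + e * b2 x w * a2 x w)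
    + 3 / 2 * s * (2 * b1 x w * b2 x w + e * b2 x w ^+ 2) in
  let n3 := s / 2 * (b1 x w + e * b2 x w) ^+ 3 in
  6 / (c + e * kap x w e) * (12 * nl s (a1 x w) (b1 x w) * a2 x w / c
    + (nl s (a2 x w) (b2 x w) + qterms E s c (a1 x w) (b1 x w) (x i4)) / c * kap x w e - m2 - n3).

(* The curve [cv] satisfies the reduced flow up to third order. *)
Lemma defect x w e : W w -> c1 (sw w) + e * kap x w e != 0 -> let s := sw w in
  e * (2 * s * (3 / 2 * b1 x w) + e * (2 * s * (3 / 2 * b2 x w + 3 / 4 * b1 x w ^+ 2)))
    - 2 * s * X1 (cv x w e) = e ^+ 3 * dl1 x w e /\
  e * (2 * s * (3 / (s * c1 s) * nl s (a1 x w) (b1 x w)) +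
       e * (2 * s * (3 / (s * c1 s) * (nl s (a2 x w) (b2 x w) +
        qterms E s (c1 s) (a1 x w) (b1 x w) (x i4)))))
    - 2 * s * X2 E lam (cv x w e) = e ^+ 3 * dl2 x w e.
Proof.
move=> Ww k0 s; have c0 := c1_sw Ww; have s0 := sw_neq0 K w; split.
  by rewrite /X1 /cv /bl /Y /mk /= /dl1 -/s; field.
rewrite /X2 /dl2 /kap /qterms /nl /yv /cv /bl /Y /mk /= -/s.
move: k0; rewrite /kap -/s in c0 s0 *; move: (c1 s) c0 => c c0.
move: s s0 (a1 x w) (a2 x w) (b1 x w) (b2 x w) (x i4) => s s0 A A' B B' k k0.
field.
by rewrite s0 c0 k0.
Qed.

(** [F] changes by [O(e^(n - 2m + 3))] between the times [w] and [w'], for any choice of roots close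
    to [rw]; multiplication by [e^(2m)] avoids negative exponents. *)
Definition Val m n x w w' := exists2 M : R, 0 <= M & exists2 d : R, 0 < d &
  forall e r r', e != 0 -> N e < d -> r ^+ 2 = sq (cv x w e) -> r' ^+ 2 = sq (cv x w' e) ->
    N (r - rw w) < d -> N (r' - rw w') < d ->
    N (F (cv x w e) r - F (cv x w' e) r') * N e ^+ (m + m) <= M * N e ^+ (n + 3).

Lemma bl_base (q : pt) : q i1 = 0 -> bl q = base (q i0).
Proof. by move=> q1; rewrite /bl q1 !mul0r. Qed.

Lemma cv0 x w : cv x w 0 = base (sw w).
Proof. by rewrite /cv bl_base. Qed.

Lemma cv_near x w0 (d : R) : W w0 -> 0 < d -> exists2 rho : R, 0 < rho & forall w e,
  N (w - w0) < rho -> N e < rho ->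
  [/\ W w, bal (base (sw w0)) d (cv x w e), bal (Y x w0 0) d (Y x w e) & c1 (sw w) + e * kap x w e != 0].
Proof.
move=> W0 d0; pose p := pl (base 0) w0 0; have Wp : W (p i0) by [].
have [d1 d10 h1] : exists2 d1 : R, 0 < d1 & forall i q, bal p d1 q -> N (Y x (q i0) (q i1) i - Y x w0 0 i) <= d / 2.
  have [|i|d1 d10 h] := @fin5 _ (fun i (d1 : R) => forall q, bal p d1 q -> N (Y x (q i0) (q i1) i - Y x w0 0 i) <= d / 2).
  - by move=> i u v v0 vu h q bq; apply: h; apply: bal_sub bq.
  - by apply: ch_cont (ch_Y x i Wp) _; rewrite divr_gt0.
  by exists d1.
have [d2 d20 h2] : exists2 d1 : R, 0 < d1 & forall i q, bal p d1 q -> N (cv x (q i0) (q i1) i - cv x w0 0 i) <= d / 2.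
  have [|i|d1' d10' h] := @fin5 _ (fun i (d1 : R) => forall q, bal p d1 q -> N (cv x (q i0) (q i1) i - cv x w0 0 i) <= d / 2).
  - by move=> i u v v0 vu h q bq; apply: h; apply: bal_sub bq.
  - apply: (@ch_cont _ _ K (fun q => cv x (q i0) (q i1) i) p); last by rewrite divr_gt0.
    by apply: (@ch_comp _ _ K (fun q => bl q i)); [apply: ch_bl | move=> k; apply: ch_Y].
  by exists d1'.
have chk : ch (fun q => c1 (q i0) + q i1 * (2 * x i4 + 12 * q i2)) (Y x w0 0).
  rewrite /c1; repeat first [exact: ch_cst | exact: ch_coord | apply: chD | apply: chB | apply: chN | apply: chM | apply: chX].
have chk' : ch (fun q => c1 (sw (q i0)) + q i1 * kap x (q i0) (q i1)) p.
  by apply: (@ch_comp _ _ K (fun q => c1 (q i0) + q i1 * (2 * x i4 + 12 * q i2)) (fun q => Y x (q i0) (q i1))) => // i; apply: ch_Y.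
have c0 := c1_sw W0; have nc : 0 < N (c1 (sw w0)) / 2 by rewrite divr_gt0 // cN_gt0.
have [d3 d30 h3] := ch_cont chk' nc.
have [d4 d40 h4] := W_open W0.
exists (Num.min (Num.min d1 d2) (Num.min d3 d4)); first by rewrite !lt_min d10 d20 d30.
move=> w e; rewrite !lt_min => /andP[/andP[w1 w2] /andP[w3 w4]] /andP[/andP[e1 e2] /andP[e3 _]].
have near (d' : R) : 0 < d' -> N (w - w0) < d' -> N e < d' -> bal p d' (pl (base 0) w e).
  by move=> d'0 hw he; apply/balP; rewrite /pl /upd /= !subrr !cN0 subr0.
have half (y : R) : y <= d / 2 -> y < d by move: d0; lra.
split; first exact: h4.
- by move=> i; apply: half; rewrite -(cv0 x); apply: (h2 i _ (near _ d20 w2 e2)).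
- by move=> i; apply: half; apply: (h1 i _ (near _ d10 w1 e1)).
have := h3 _ (near _ d30 w3 e3); rewrite /= -/(kap x w0 0) mul0r addr0 => h.
apply: contraTneq nc => /= z; move: h; rewrite z sub0r cNN -leNgt.
by rewrite ler_pdivlMr // ler_pdivrMr // mul0r; move: (cN_ge0 K (c1 (sw w0))); lra.
Qed.

Lemma sum5 (f : 'I_5 -> C) : \sum_(i < 5) f i = f i0 + f i1 + f i2 + f i3 + f i4.
Proof.
rewrite !big_ord_recl big_ord0 addr0 !addrA.
by congr (f _ + f _ + f _ + f _ + f _); apply: val_inj.
Qed.

Lemma cd_along (A : pt -> C) x w e l0 l2 l3 : W w -> ch A (cv x w e) ->
  cd (fun w => cv x w e i0) w l0 -> cd (fun w => cv x w e i1) w 0 ->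
  cd (fun w => cv x w e i2) w l2 -> cd (fun w => cv x w e i3) w l3 ->
  cd (fun w => cv x w e i4) w 0 ->
  cd (fun w => A (cv x w e)) w
    (pd i0 A (cv x w e) * l0 + pd i2 A (cv x w e) * l2 + pd i3 A (cv x w e) * l3).
Proof.
move=> Ww cA h0 h1 h2 h3 h4.
have hG : holp K (fun w => cv x w e) w.
  have h' i w' : W w' -> exists l, cd (fun w => cv x w e i) w' l.
    move=> /(cd_cv x e) [k0 k1 k2 k3 k4].
    by case: i => [[|[|[|[|[|m]]]]] Hm] //; eexists; first [apply: k0 | apply: k1 | apply: k2 | apply: k3 | apply: k4].
  by move=> i; apply: W_hol (h' i) Ww.
pose l i := nth 0 [:: l0; 0; l2; l3; 0] (i : 'I_5).
have hl i : cd (fun w => cv x w e i) w (l i) by case: i => [[|[|[|[|[|m]]]]] Hm].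
apply: cd_eq (chain_rule (G := fun w => cv x w e) cA hG hl).
by rewrite sum5 /l /= !mulr0 !addr0.
Qed.

(** If a direction differs from the flow by [(d2, d3)], then [B dA - A dB] on it is the transversal
    part evaluated on [(d2, d3)], because the flow itself contributes nothing. *)
Lemma rel_alg (A B al0 al2 al3 be0 be2 be3 l0 l2 l3 x1 x2 d2 d3 : C) :
  l2 - l0 * x1 = d2 -> l3 - l0 * x2 = d3 ->
  B * al0 - A * be0 + x1 * (B * al2 - A * be2) + x2 * (B * al3 - A * be3) = 0 ->
  B * (al0 * l0 + al2 * l2 + al3 * l3) - A * (be0 * l0 + be2 * l2 + be3 * l3) =
  d2 * (B * al2 - A * be2) + d3 * (B * al3 - A * be3).
Proof.
move=> <- <- h; apply/eqP; rewrite -subr_eq0; apply/eqP.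
by rewrite -[RHS](mulr0 l0) -h; ring.
Qed.

(** Along the curve [B dA - A dB] is the defect, of order [e^3], paired with the transversal
    differential, of order [e^n]; [local_const] turns this into a bound for the change of
    [A / B]. *)
Lemma step x w0 s1 r1 (P : rep K E lam F s1 r1) : W w0 -> N (sw w0 - s1) < rho P ->
  N (rw w0 - r1) < rho P -> exists2 d : R, 0 < d & forall w w', N (w - w0) < d ->
    N (w' - w0) < d -> rBh P (Y x w 0) != 0 -> rBh P (Y x w' 0) != 0 ->
    Val (rm P) (rn P) x w w'.
Proof.
move=> W0 sP rP; pose D := Num.min (rho P - N (sw w0 - s1)) ((rho P - N (rw w0 - r1)) / 2).
have D0 : 0 < D by rewrite lt_min subr_gt0 sP divr_gt0 // subr_gt0.
have [d d0 hd] := cv_near x W0 D0.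
have [d' d'0 hd'] := hol_cont (rw_hol W0) D0.
have inP w e : N (w - w0) < d -> N e < d -> bal (base s1) (rho P) (cv x w e).
  move=> h1 h2; have [_ b _ _] := hd w e h1 h2; apply/balP; move/balP: b.
  rewrite /base /mk /= !subr0 /D !lt_min => -[/andP[k0 _] /andP[k1 _] /andP[k2 _] /andP[k3 _] /andP[k4 _]].
  have := cN_dist K (cv x w e i0) (sw w0) s1; move: k0 k1 k2 k3 k4 (cN_ge0 K (sw w0 - s1)).
  by clear; move=> *; split; lra.
pose rr := Num.min d d'; exists rr; first by rewrite lt_min d0.
move=> w w'; rewrite /rr !lt_min => /andP[wd wd'] /andP[w'd w'd'] nz nz'.
pose a q := rA P (cv x (q i0) (q i1)); pose b q := rB P (cv x (q i0) (q i1)).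
pose bh q := rBh P (Y x (q i0) (q i1)).
pose q0 : pt := base 0.
(* The leading covector evaluated on the defect, with both powers of [e] removed. *)
pose Z q := (dl1 x (q i0) (q i1) * rT1 P (Y x (q i0) (q i1)) + dl2 x (q i0) (q i1) * rT2 P (Y x (q i0) (q i1))).
have [|M M0 [d2 d20 h2]] := @local_const _ _ K w0 d q0 a b bh Z (rm P) (rn P + 3) _ w w' wd w'd nz nz'.
  move=> u e hu he; have [Wu _ _ kz] := hd u e hu he; set q := pl q0 u e.
  have Wq : W (q i0) by [].
  have bu := inP u e hu he; have [cA cB] := rAB_ch bu.
  have [cBh cT1 cT2] := r_ch bu; have [fB f1 f2] := r_fac bu.
  have cY (f : pt -> C) : ch f (Y x u e) -> ch (fun q => f (Y x (q i0) (q i1))) q.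
    by move=> h; apply: (@ch_comp _ _ K f (fun q => Y x (q i0) (q i1))) => // i; apply: ch_Y.
  have ccv (f : pt -> C) : ch f (cv x u e) -> ch (fun q => f (cv x (q i0) (q i1))) q.
    move=> h; apply: (@ch_comp _ _ K f (fun q => cv x (q i0) (q i1))) => // i.
    by apply: (cY (fun q => bl q i)); apply: ch_bl.
  have cf (f : C -> C) : (forall w, W w -> exists l, cd f w l) -> ch (fun q => f (q i0)) q.
    by move=> h; apply: W_chW Wq => z; apply: W_hol h.
  have [ca1 cb1 ca2 cb2] : [/\ ch (fun q => a1 x (q i0)) q, ch (fun q => b1 x (q i0)) q,
      ch (fun q => a2 x (q i0)) q & ch (fun q => b2 x (q i0)) q].
    split; apply: cf => z /(cd_frame x) [h1 h2 h3 h4].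
    - by eexists; exact: h1.
    - by eexists; exact: h2.
    - by eexists; exact: h3.
    by eexists; exact: h4.
  have cs : ch (fun q => sw (q i0)) q by apply: cf => z _; eexists; apply: cd_sw.
  have cc : ch (fun q => c1 (sw (q i0))) q.
    by rewrite /c1; repeat first [exact: ch_cst | assumption | apply: chD | apply: chN | apply: chM | apply: chX].
  have ck : ch (fun q => kap x (q i0) (q i1)) q.
    by rewrite /kap; repeat first [exact: ch_cst | exact: ch_coord | assumption | apply: chD | apply: chM].
  have cV : ch (fun q => (c1 (sw (q i0)))^-1) q by apply: chV cc _; apply: c1_sw.
  have cV' : ch (fun q => (c1 (sw (q i0)) + q i1 * kap x (q i0) (q i1))^-1) q.
    by apply: chV kz; apply: chD cc (chM (ch_coord _ _ _) ck).
  have cd1 : ch (fun q => dl1 x (q i0) (q i1)) q.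
    by rewrite /dl1; repeat first [exact: ch_cst | exact: ch_coord | assumption | apply: chD | apply: chM | apply: chX].
  have cd2 : ch (fun q => dl2 x (q i0) (q i1)) q.
    move: ca1 cb1 ca2 cb2 ck cs cV cV'; rewrite /dl2 /qterms /nl; clear.
    move: (a1 x) (b1 x) (a2 x) (b2 x) (kap x) => A1 B1 A2 B2 kp *.
    by repeat first [exact: ch_cst | exact: ch_coord | assumption | apply: chD | apply: chB
      | apply: chN | apply: chM | apply: chX].
  split; first split.
  - exact: ccv.
  - exact: ccv.
  - exact: cY.
  - by apply: chD; apply: chM => //; apply: cY.
  split; first exact: fB.
  have [k0 k1 k2 k3 k4] := cd_cv x e Wu; have [df1 df2] := defect Wu kz.
  have dA := cd_along Wu cA k0 k1 k2 k3 k4; have dB := cd_along Wu cB k0 k1 k2 k3 k4.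
  have pda (f : pt -> C) l : cd (fun w => f (cv x w e)) u l ->
      pd i0 (fun q => f (cv x (q i0) (q i1))) q = l.
    by move=> h; apply: pd_eq.
  rewrite (pda _ _ dA) (pda _ _ dB) {1}/a {1}/b /=.
  have := r_rel bu; rewrite -/(cv x u e) /th in f1 f2 *.
  rewrite /q /= !pl0 !pl1 => rel; rewrite (rel_alg df1 df2 rel) f1 f2 /Z !pl0 !pl1 exprD. ring.
exists M => //; have [d3 d30 [l1 l2 l3 _ _]] := min_exists5 d20 d0 D0 ltr01 ltr01.
exists d3 => //.
move=> e r r' e0 ed rs rs' hr hr'; have ed2 := lt_le_trans ed l1.
have {}hr := lt_le_trans hr l3; have {}hr' := lt_le_trans hr' l3; have {}ed := lt_le_trans ed l2.
have [bz bz' ineq] := h2 e e0 ed2.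
have rval u q : N (u - w0) < d -> N (u - w0) < d' -> N (q - rw u) < D -> q ^+ 2 = sq (cv x u e) ->
    rB P (cv x u e) != 0 -> F (cv x u e) q = rA P (cv x u e) / rB P (cv x u e).
  move=> ud ud' qd qs nB; apply: r_val => //; first exact: inP.
  have := hd' u ud'; move: qd; rewrite /D lt_min le_min => /andP[_ k1] /andP[_ k2].
  have := cN_dist K q (rw u) r1; have := cN_dist K (rw u) (rw w0) r1; lra.
by rewrite (rval w r) // (rval w' r').
Qed.

End Monodromy.

Lemma mul_le (R : realType) (a b c k M y : R) : a * b <= M * c -> 0 <= k -> 0 < b ->
  y * b = c * k -> a * k <= M * y.
Proof.
move=> h k0 b0 e; rewrite -(ler_pM2r b0) -[leRHS]mulrA e.
by have := ler_wpM2r k0 h; lra.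
Qed.

Lemma tri_mul (R : realType) (x a b M M' y k : R) : x <= a + b -> a * k <= M * y ->
  b * k <= M' * y -> 0 <= k -> x * k <= (M + M') * y.
Proof. by move=> h h1 h2 k0; have := ler_wpM2r k0 h; lra. Qed.

(** * Continuation of the estimate over a full turn *)

Section Continuation.
Variables (R : realType) (C : numClosedFieldType) (K : cdata R C) (E lam : C).
Notation N := (cN K).
Notation hol := (hol K).
Notation cd := (cd K).
Notation ce := (ce K).
Notation tpi := (tpi K).
Notation pt := (pt C).
Notation ch := (ch K).
Notation bal := (bal K).
Notation c1 := (c1 E lam).
Notation sq := (sq E lam).
Notation sw := (sw K).

Variables (T : frame K E lam) (dd : R) (rw : C -> C) (F : pt -> C -> C).
Hypothesis dd_fd : dd <= fd T.
Let W w := N (ce w) < dd.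
Hypothesis rw_sq : forall w, W w -> rw w ^+ 2 = sq (base (sw w)).
Hypothesis rw_hol : forall w, W w -> hol rw w.
Hypothesis rw_per : forall w, rw (w + tpi) = rw w.
Hypothesis reps : forall s0 r0, s0 != 0 -> r0 != 0 -> r0 ^+ 2 = sq (base s0) ->
  inhabited (rep K E lam F s0 r0).
Notation a1 := (a1 T).
Notation b1 := (b1 T).
Notation Y := (Y T).
Notation cv := (cv T).
Notation Val := (Val T rw F).

Implicit Types (x : pt) (w e : C).

Lemma rw_neq0 w : W w -> rw w != 0.
Proof.
move=> W2; have s0 := sw_neq0 K w; have : rw w ^+ 2 != 0; last by rewrite expf_eq0.
have := c1_sw dd_fd W2; rewrite rw_sq // /sq /yv /base /mk /= mulr0 !addr0 => c0.
have n12 : (12 : C)^-1 != 0 by rewrite invr_eq0 pnatr_eq0.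
by apply: mulf_neq0 (mulf_neq0 _ s0) (mulf_neq0 c0 n12); rewrite pnatr_eq0.
Qed.

Lemma Val_trans m n x w1 w2 w3 : W w2 -> Val m n x w1 w2 -> Val m n x w2 w3 -> Val m n x w1 w3.
Proof.
move=> W2 [M M0 [d d0 h]] [M' M'0 [d' d'0 h']].
have rz := rw_neq0 W2.
have [t t0 ht] : exists2 t : R, 0 < t & t <= d /\ t <= d'.
  by exists (Num.min d d'); [rewrite lt_min d0 | split; rewrite ge_min lexx ?orbT].
have [d1 d10 h1] := root_near K rz t0.
have d12 : 0 < d1 / 2 by rewrite divr_gt0.
have [d2 d20 h2] := ch_cont (ch_sq K E lam (base (sw w2))) d12.
have [d3 d30 h3] := cv_near dd_fd x W2 d20.
have [d4 d40 [l1 l2 l3 _ _]] := min_exists5 d0 d'0 d30 ltr01 ltr01.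
exists (M + M'); first by rewrite addr_ge0.
exists d4 => // e r r' e0 ed rs rs' hr hr'.
have [_ b _ _] : [/\ W w2, bal (base (sw w2)) d2 (cv x w2 e), bal (Y x w2 0) d2 (Y x w2 e)
    & c1 (sw w2) + e * kap T x w2 e != 0].
  by apply: h3; [rewrite subrr cN0 | apply: lt_le_trans l3].
have [|y ys yt] := h1 (sq (cv x w2 e)).
  by rewrite rw_sq //; apply: le_lt_trans (h2 _ b) _; move: d10; lra.
have k1 := h e r y e0 (lt_le_trans ed l1) rs ys (lt_le_trans hr l1) (lt_le_trans yt ht.1).
have k2 := h' e y r' e0 (lt_le_trans ed l2) ys rs' (lt_le_trans yt ht.2) (lt_le_trans hr' l2).
by apply: tri_mul (cN_dist _ _ _ _) k1 k2 _; rewrite exprn_ge0 ?cN_ge0.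
Qed.

Lemma Val_ord m n m' n' x w w' : (n + (m' + m') = n' + (m + m))%N ->
  Val m' n' x w w' -> Val m n x w w'.
Proof.
move=> e [M M0 [d d0 h]]; exists M => //; exists d => // z r r' z0 zd rs rs' hr hr'.
have k := h z r r' z0 zd rs rs' hr hr'.
apply: mul_le k _ _ _; first by rewrite exprn_ge0 ?cN_ge0.
  by rewrite exprn_gt0 // cN_gt0.
by rewrite -!exprD; congr (_ ^+ _); lia.
Qed.

Definition subb v1 (d1 : R) v0 (d0 : R) := forall z, N (z - v1) < d1 -> N (z - v0) < d0.

(** [step] requires the leading term of [B] to be nonzero at both times, which may fail at [w] or
    [w']. The estimate is therefore asked only on small discs arbitrarily close to them. Since the
    position of the discs is free, the relation is transitive. *)
Definition Rx m n x w w' := exists2 rh : R, 0 < rh & forall v0 v0' (d : R),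
  N (v0 - w) < rh -> N (v0' - w') < rh -> 0 < d -> exists v1 v1', exists2 d' : R, 0 < d' &
    [/\ subb v1 d' v0 d, subb v1' d' v0' d, W v1, W v1' &
     forall v v', N (v - v1) < d' -> N (v' - v1') < d' -> Val m n x v v'].

Lemma Rx_trans m n x w w' w'' : Rx m n x w w' -> Rx m n x w' w'' -> Rx m n x w w''.
Proof.
move=> [r1 r10 h1] [r2 r20 h2]; exists (Num.min r1 r2); first by rewrite lt_min r10.
move=> v0 v0'' d; rewrite !lt_min => /andP[a1' a2'] /andP[b1' b2'] d0.
have [||v1 [v1' [d' d'0 [s1 s1' W1 _ hv]]]] := h1 v0 w' (Num.min d r2) a1'.
- by rewrite subrr cN0.
- by rewrite lt_min d0.
have mdd : 0 < Num.min d d' by rewrite lt_min d0.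
have in1 : N (v1' - w') < r2.
  by have := s1' v1'; rewrite subrr cN0 lt_min => /(_ d'0) /andP[].
have [v2 [v2' [d'' d''0 [s2 s2' W2 W2' hv2]]]] := h2 v1' v0'' (Num.min d d') in1 b2' mdd.
exists v1, v2'; exists (Num.min d' d''); first by rewrite lt_min d'0.
split=> //.
- by move=> z; rewrite lt_min => /andP[/s1]; rewrite lt_min => /andP[].
- by move=> z; rewrite lt_min => /andP[_ /s2']; rewrite lt_min => /andP[].
move=> v v'; rewrite !lt_min => /andP[k1 _] /andP[_ k2].
apply: (@Val_trans _ _ _ _ v2) => //; last by apply: hv2 => //; rewrite subrr cN0.
by apply: hv => //; have := s2 v2; rewrite subrr cN0 lt_min => /(_ d''0) /andP[].
Qed.

Lemma Rx_ord m n m' n' x w w' : (n + (m' + m') = n' + (m + m))%N ->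
  Rx m' n' x w w' -> Rx m n x w w'.
Proof.
move=> e [r r0 h]; exists r => // v0 v0' d h0 h0' d0.
have [v1 [v1' [d' d'0 [s1 s1' W1 W1' hv]]]] := h v0 v0' d h0 h0' d0.
exists v1, v1'; exists d' => //; split=> // v v' k k'.
exact: Val_ord e (hv v v' k k').
Qed.

Definition inD s1 r1 (P : rep K E lam F s1 r1) w :=
  [/\ W w, N (sw w - s1) < rho P & N (rw w - r1) < rho P].

Lemma inD_open s1 r1 (P : rep K E lam F s1 r1) w0 : inD P w0 ->
  exists2 d : R, 0 < d & forall w, N (w - w0) < d -> inD P w.
Proof.
move=> [W0 hs hr]; have [d1 d10 h1] := W_open W0.
have s0 : 0 < (rho P - N (sw w0 - s1)) / 2 by rewrite divr_gt0 // subr_gt0.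
have r0 : 0 < (rho P - N (rw w0 - r1)) / 2 by rewrite divr_gt0 // subr_gt0.
have [d2 d20 h2] := cd_cont (cd_sw K w0) s0.
have [d3 d30 h3] := hol_cont (rw_hol W0) r0.
have [d d0 [l1 l2 l3 _ _]] := min_exists5 d10 d20 d30 ltr01 ltr01.
exists d => // w wd; split; first by apply: h1; apply: lt_le_trans l1.
  have := h2 w (lt_le_trans wd l2); have := cN_dist K (sw w) (sw w0) s1; lra.
have := h3 w (lt_le_trans wd l3); have := cN_dist K (rw w) (rw w0) r1; lra.
Qed.

Definition hx s1 r1 (P : rep K E lam F s1 r1) x w := rBh P (Y x w 0).

Lemma holp_Y x w : W w -> holp K (fun w => Y x w 0) w.
Proof.
move=> Ww i; have k : ch (fun q => Y x (q i0) (q i1) i) (pl (base 0) w 0) by apply: (ch_Y dd_fd).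
apply: (@ch_holp _ _ K (fun q => Y x (q i0) (q i1) i) (fun w => pl (base 0) w 0)) => //.
move=> j; rewrite /pl /upd; case: eqP => _; first exact: hol_cst.
by case: eqP => _; [exact: hol_id | exact: hol_cst].
Qed.

Lemma hx_hol s1 r1 (P : rep K E lam F s1 r1) x w : inD P w -> hol (hx P x) w.
Proof.
move=> [Ww hs hr]; apply: (@ch_holp _ _ K (rBh P) (fun w => Y x w 0)); last exact: holp_Y.
have [] // := @r_ch _ _ _ _ _ _ _ _ P (Y x w 0).
exact: (@bal_slice _ _ K s1 _ (Y x w 0) (rho_gt0 P) (erefl _)).2 hs.
Qed.

Lemma hx_gen s1 r1 (P : rep K E lam F s1 r1) w0 (d1 : R) x v1 : 0 < d1 ->
  (forall w, N (w - w0) < d1 -> inD P w) -> N (v1 - w0) < d1 -> hx P x v1 != 0 ->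
  forall v0 (e : R), 0 < e -> N (v0 - w0) < d1 -> exists v, exists2 e' : R, 0 < e' &
    subb v e' v0 e /\ forall z, N (z - v) < e' -> N (z - w0) < d1 /\ hx P x z != 0.
Proof.
move=> d10 hd v1d nz v0 e e0 v0w.
have dv : 0 < d1 - N (v0 - w0) by rewrite subr_gt0.
have [e1 e10 [k1 k2 _ _ _]] := min_exists5 e0 dv ltr01 ltr01 ltr01.
have hol_x z : N (z - w0) < d1 -> hol (hx P x) z by move=> /hd; apply: hx_hol.
have [v vv nv] : exists2 v, N (v - v0) < e1 & hx P x v != 0.
  apply: contrapT => none; move/negP: nz; apply; apply/eqP.
  apply: (@ident _ _ K (hx P x) w0 d1 v0) => //.
  exists e1 => // z ze; apply/eqP; rewrite -[_ == _]negbK; apply/negP => n0.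
  by apply: none; exists z.
have vu : N (v - w0) < d1 by have := cN_dist K v v0 w0; lra.
have nn : 0 < N (hx P x v) / 2 by rewrite divr_gt0 // cN_gt0.
have [e2 e20 h2'] := hol_cont (hol_x v vu) nn.
have ev : 0 < e1 - N (v - v0) by rewrite subr_gt0.
have [e3 e30 [k3 k4 _ _ _]] := min_exists5 e20 ev ltr01 ltr01 ltr01.
exists v; exists e3 => //; split=> z ze.
  by have := cN_dist K z v v0; lra.
split; first by have := cN_dist K z v0 w0; have := cN_dist K z v v0; lra.
have := h2' z (lt_le_trans ze k3); apply: contraTneq => ->; rewrite sub0r cNN -ltNge.
by rewrite ltr_pdivrMr // ltr_pMr ?cN_gt0 // ltr1n.
Qed.

Lemma disc_local s1 r1 (P : rep K E lam F s1 r1) w0 (d1 : R) x v1 : 0 < d1 ->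
  (forall w, N (w - w0) < d1 -> inD P w) -> N (v1 - w0) < d1 -> hx P x v1 != 0 ->
  forall u, N (u - w0) < d1 -> exists2 d : R, 0 < d & forall w w', N (w - u) < d -> N (w' - u) < d ->
    Rx (rm P) (rn P) x w w'.
Proof.
move=> d10 hd v1d nz u ud; have [Wu hs hr] := hd u ud.
have [d2 d20 h2] := step dd_fd rw_hol x Wu hs hr.
have uu : 0 < d1 - N (u - w0) by rewrite subr_gt0.
have [d d0 [l1 l2 _ _ _]] := min_exists5 d20 uu ltr01 ltr01 ltr01.
have inb z : N (z - u) < d -> N (z - w0) < d1.
  by move=> zd; have := cN_dist K z u w0; have := lt_le_trans zd l2; lra.
have gen v0 (e : R) : 0 < e -> N (v0 - u) < d -> exists v, exists2 e' : R, 0 < e' &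
    subb v e' v0 e /\ forall z, N (z - v) < e' -> N (z - u) < d /\ hx P x z != 0.
  move=> e0 v0u; have dv : 0 < d - N (v0 - u) by rewrite subr_gt0.
  have [e1 e10 [k1 k2 _ _ _]] := min_exists5 e0 dv ltr01 ltr01 ltr01.
  have [v [e' e'0 [sb g]]] := hx_gen d10 hd v1d nz e10 (inb _ v0u).
  exists v; exists e' => //; split=> z /[dup] ze /sb zv.
    exact: lt_le_trans zv k1.
  by split; [have := cN_dist K z v0 u; lra | have [] := g z ze].
exists (d / 2); first by rewrite divr_gt0.
move=> w w' wd w'd; exists (d / 2); first by rewrite divr_gt0.
move=> v0 v0' e v0d v0'd e0.
have [|v [e1 e10 [sb1 g1]]] := gen v0 e e0; first by have := cN_dist K v0 w u; lra.
have [|v' [e2 e20 [sb2 g2]]] := gen v0' e e0; first by have := cN_dist K v0' w' u; lra.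
have [e' e'0 [k1 k2 _ _ _]] := min_exists5 e10 e20 ltr01 ltr01 ltr01.
exists v, v'; exists e' => //; split.
- by move=> z ze; apply: sb1; apply: lt_le_trans k1.
- by move=> z ze; apply: sb2; apply: lt_le_trans k2.
- have [|k _] := g1 v; first by rewrite subrr cN0.
  by have [] := hd v (inb _ k).
- have [|k _] := g2 v'; first by rewrite subrr cN0.
  by have [] := hd v' (inb _ k).
move=> z z' /lt_le_trans/(_ k1)/g1 [zd nz1] /lt_le_trans/(_ k2)/g2 [zd' nz2].
by apply: h2 => //; apply: lt_le_trans l1.
Qed.

Lemma conv_in w0 (d1 : R) u u' (t : R) : 0 <= t <= 1 -> N (u - w0) < d1 -> N (u' - w0) < d1 ->
  N (u + jr K t * (u' - u) - w0) < d1.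
Proof. by move=> t01 h h'; have := @conv_disc _ _ K w0 d1 u u' t t01 h h'. Qed.

Lemma seg_near u u' (d : R) : 0 < d -> exists2 e : R, 0 < e & forall t t' : R, `|t' - t| < e ->
  N (u + jr K t' * (u' - u) - (u + jr K t * (u' - u))) < d.
Proof.
move=> d0; have n1 : 0 < N (u' - u) + 1 by rewrite ltr_wpDl // cN_ge0.
exists (d / (N (u' - u) + 1)); first by rewrite divr_gt0.
move=> t t' h.
have -> : u + jr K t' * (u' - u) - (u + jr K t * (u' - u)) = jr K (t' - t) * (u' - u).
  by rewrite rmorphB; ring.
rewrite cNM cN_jr; move: h; rewrite ltr_pdivlMr //; apply: le_lt_trans.
by rewrite ler_wpM2l // lerDl.
Qed.

Lemma disc_Rx s1 r1 (P : rep K E lam F s1 r1) w0 (d1 : R) x v1 : 0 < d1 ->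
  (forall w, N (w - w0) < d1 -> inD P w) -> N (v1 - w0) < d1 -> hx P x v1 != 0 ->
  forall u u', N (u - w0) < d1 -> N (u' - w0) < d1 -> Rx (rm P) (rn P) x u u'.
Proof.
move=> d10 hd v1d nz u u' ud ud'.
pose g (t : R) := u + jr K t * (u' - u).
have := @chain R (fun a b => Rx (rm P) (rn P) x (g a) (g b)) 0 1 ler01.
rewrite /g rmorph0 rmorph1 mul0r addr0 mul1r [u + _]addrC subrK; apply.
  by move=> a b c; apply: Rx_trans.
move=> t t01; have [d d0 hd'] := disc_local d10 hd v1d nz (conv_in t01 ud ud').
have [e e0 he] := seg_near u u' d0.
have self : N (u + jr K t * (u' - u) - (u + jr K t * (u' - u))) < d by rewrite subrr cN0.
exists e => //; split=> z /andP[z1 z2] z3; apply: hd' => //; apply: he.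
  by rewrite ler0_norm; lra.
by rewrite ger0_norm; lra.
Qed.

Definition Y0 x w : pt := mk (sw w) 0 (a1 x w) (b1 x w) (x i4).

Lemma Y_0 x w : Y x w 0 = Y0 x w.
Proof. by rewrite /Y0 /Y !mul0r !addr0. Qed.

(** The determinant of the two first order solutions is nonzero, so the amplitudes can be adapted to
    any prescribed direction over [sw w]. *)
Lemma Y0_onto (q : pt) w : W w -> q i0 = sw w -> q i1 = 0 -> exists x : pt, Y0 x w = q.
Proof.
move=> Ww q0 q1; have D := f_det (lt_le_trans Ww dd_fd).
set d := _ - _ in D.
exists (mk 0 0 ((q i2 * p2 T (sw w) - q i3 * p1 T (sw w)) / d) ((n1 T w * q i3 - n2 T w * q i2) / d) (q i4)).
apply: ptP; rewrite /Y0 /mk /= /a1 /b1 /=.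
- by rewrite q0.
- by rewrite q1.
- by move: D; rewrite /d => D; field.
- by move: D; rewrite /d => D; field.
by [].
Qed.

Lemma ch_Y0 x w i : ch (fun x => Y0 x w i) x.
Proof.
case: i => [[|[|[|[|[|m]]]]] Hm] //=; rewrite /Y0 /mk /=; try exact: ch_cst; try exact: ch_coord.
  by rewrite /a1; apply: chD; apply: chM (ch_coord _ _ _) (ch_cst _ _ _).
by rewrite /b1; apply: chD; apply: chM (ch_coord _ _ _) (ch_cst _ _ _).
Qed.

Lemma genx (g : pt -> C) w x0 (d : R) : W w -> (forall q, q i0 = sw w -> q i1 = 0 -> ch g q) ->
  0 < d -> (exists q, [/\ q i0 = sw w, q i1 = 0 & g q != 0]) ->
  exists2 x1, bal x0 d x1 & g (Y0 x1 w) != 0.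
Proof.
move=> Ww cg d0 [q [q0 q1 nz]]; apply: contrapT => none.
have [y Yy] := Y0_onto Ww q0 q1.
move/negP: nz; apply; rewrite -Yy; apply/eqP.
apply: (@ch_ident _ _ K (fun x => g (Y0 x w)) x0 y).
  move=> t _; apply: (@ch_comp _ _ K g (fun x => Y0 x w)) => [|i]; last exact: ch_Y0.
  exact: cg.
exists d => // x bx; apply/eqP; rewrite -[_ == _]negbK; apply/negP => n0.
by apply: none; exists x.
Qed.

Lemma sw_sep w0 : exists2 d : R, 0 < d & forall v, N (v - w0) < d -> v != w0 -> sw v != sw w0.
Proof.
have [phi [cphi e] hphi] := cd_sw K w0.
have n0 : phi w0 != 0 by rewrite e mulf_neq0 ?sw_neq0 // pnatr_eq0.
have [d d0 hd] := cont_nz cphi n0; exists d => // v vd vw.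
rewrite (hphi v) -subr_eq0 addrC addKr mulf_neq0 ?subr_eq0 //.
by rewrite -(cN_gt0 K); apply: lt_le_trans (hd v vd); rewrite divr_gt0 // cN_gt0.
Qed.

Lemma small_step (d : R) w0 : 0 < d -> exists2 v, N (v - w0) < d & v != w0.
Proof.
move=> d0; exists (w0 + jr K (d / 2)).
  by rewrite addrC addKr cN_jr ger0_norm; move: d0; lra.
by rewrite -subr_eq0 addrC addKr -(cN_gt0 K) cN_jr gtr0_norm; move: d0; lra.
Qed.

(** For special amplitudes the leading term of [B] could vanish along the whole curve. It is not
    identically zero on the exceptional divisor and [Y0] reaches all of it, so an arbitrarily small
    change of [x0] repairs this, uniformly on a ball. *)
Lemma rep_gen s1 r1 (P : rep K E lam F s1 r1) w0 (d1 : R) x0 (d : R) : 0 < d1 -> 0 < d ->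
  (forall w, N (w - w0) < d1 -> inD P w) -> exists x1 v1, exists2 d' : R, 0 < d' &
    [/\ forall x, bal x1 d' x -> bal x0 d x, N (v1 - w0) < d1 &
        forall x, bal x1 d' x -> hx P x v1 != 0].
Proof.
move=> d10 d0 hd; have [|W0 hs hr] := hd w0; first by rewrite subrr cN0.
have u0 : 0 < rho P - N (sw w0 - s1) by rewrite subr_gt0.
have [q [q1 qs _ nq]] := rep_Bnz u0 hs.
have inr z : N (z - sw w0) < rho P - N (sw w0 - s1) -> N (z - s1) < rho P.
  by move=> h; have := cN_dist K z (sw w0) s1; lra.
have hh z : N (z - sw w0) < rho P - N (sw w0 - s1) -> hol (fun z => rBh P (upd q i0 z)) z.
  move=> /inr h; apply: (@ch_holp _ _ K (rBh P)); last exact: holp_upd1.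
  have [] // := @r_ch _ _ _ _ _ _ _ _ P (upd q i0 z).
  exact: ((@bal_slice _ _ K s1 _ (upd q i0 z) (rho_gt0 P) q1).2 h).
have nzz : exists2 z, N (z - sw w0) < rho P - N (sw w0 - s1) & rBh P (upd q i0 z) != 0.
  by exists (q i0) => //; rewrite upd_id.
have [d2 d20 h2] := iso_zero u0 hh nzz.
have d22 : 0 < d2 / 2 by rewrite divr_gt0.
have [d3 d30 h3] := cd_cont (cd_sw K w0) d22; have [d4 d40 h4] := sw_sep w0.
have [d5 d50 [l1 l2 l3 _ _]] := min_exists5 d10 d30 d40 ltr01 ltr01.
have [v1 vd vw] := small_step w0 d50.
have [W1 hs1 hr1] := hd v1 (lt_le_trans vd l1).
have n1 := h2 (sw v1) (h4 v1 (lt_le_trans vd l3) vw) (_ : N (sw v1 - sw w0) < d2).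
have {}n1 : rBh P (upd q i0 (sw v1)) != 0.
  by apply: n1; have := h3 v1 (lt_le_trans vd l2); move: d20; lra.
have cg q' : q' i0 = sw v1 -> q' i1 = 0 -> ch (rBh P) q'.
  move=> e0 e1; have [] // := @r_ch _ _ _ _ _ _ _ _ P q'.
  by apply: ((@bal_slice _ _ K s1 _ q' (rho_gt0 P) e1).2 _); rewrite e0.
have d00 : 0 < d / 2 by rewrite divr_gt0.
have [x1 b1 nx1] := @genx (rBh P) v1 x0 (d / 2) W1 cg d00 (ex_intro _ (upd q i0 (sw v1)) (And3 erefl q1 n1)).
have ck : ch (fun x => rBh P (Y0 x v1)) x1.
  apply: (@ch_comp _ _ K (rBh P) (fun x => Y0 x v1)) => [|i]; last exact: ch_Y0.
  exact: cg.
have nn : 0 < N (rBh P (Y0 x1 v1)) / 2 by rewrite divr_gt0 // cN_gt0.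
have [d6 d60 h6] := ch_cont ck nn.
have [d7 d70 [k1 k2 _ _ _]] := min_exists5 d60 d00 ltr01 ltr01 ltr01.
exists x1, v1; exists d7 => //; split.
- move=> x bx i; have := bx i; have := b1 i; have := cN_dist K (x i) (x1 i) (x0 i); move: k2; lra.
- exact: lt_le_trans l1.
move=> x bx; rewrite /hx Y_0; have := h6 x (bal_sub k1 bx).
apply: contraTneq => ->; rewrite sub0r cNN -ltNge.
by rewrite ltr_pdivrMr // ltr_pMr ?cN_gt0 // ltr1n.
Qed.

Lemma reps_at w : W w -> inhabited (rep K E lam F (sw w) (rw w)).
Proof. by move=> Ww; apply: reps (sw_neq0 K w) (rw_neq0 Ww) (rw_sq Ww). Qed.

Lemma inD_self w (P : rep K E lam F (sw w) (rw w)) : W w -> inD P w.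
Proof. by move=> Ww; split=> //; rewrite subrr cN0 rho_gt0. Qed.

(** Each change of local expression excludes further amplitudes, so the estimate is claimed for all
    [x] in some ball inside any given one; nested balls make this transitive. The equality of orders
    lets the exponents of [P] serve throughout. *)
Definition Rel w w' := forall (P : rep K E lam F (sw w) (rw w)) (P' : rep K E lam F (sw w') (rw w')),
  (rn P + (rm P' + rm P') = rn P' + (rm P + rm P))%N /\
  forall x0 (d : R), 0 < d -> exists x1, exists2 d' : R, 0 < d' &
    (forall x, bal x1 d' x -> bal x0 d x) /\
    forall x, bal x1 d' x -> Rx (rm P) (rn P) x w w'.

Lemma Rel_trans w w' w'' : W w' -> Rel w w' -> Rel w' w'' -> Rel w w''.
Proof.
move=> W' h h' P P''; have [P'] := reps_at W'; have [e1 k1] := h P P'; have [e2 k2] := h' P' P''.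
split=> [|x0 d d0]; first by lia.
have [x1 [d1 d10 [b1 r1]]] := k1 x0 d d0; have [x2 [d2 d20 [b2 r2]]] := k2 x1 d1 d10.
exists x2; exists d2 => //; split=> [x /b2/b1 //|x bx].
by apply: Rx_trans (r1 x (b2 x bx)) _; apply: Rx_ord (r2 x bx); rewrite e1.
Qed.

Lemma same_ord s1 r1 s2 r2 (P : rep K E lam F s1 r1) (Q : rep K E lam F s2 r2) w : inD P w -> inD Q w ->
  (rn P + (rm Q + rm Q) = rn Q + (rm P + rm P))%N.
Proof.
by move=> [Ww h1 h2] [_ h3 h4]; apply: rep_ord (rw_neq0 Ww) (rw_sq Ww) h1 h2 h3 h4.
Qed.

Lemma Rel_local w0 : W w0 -> exists2 d : R, 0 < d & forall w w', N (w - w0) < d -> N (w' - w0) < d ->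
  Rel w w'.
Proof.
move=> W0; have [P0] := reps_at W0; have [d d0 hd] := inD_open (inD_self P0 W0).
exists d => // w w' wd wd' P P'.
have D1 := hd w wd; have D2 := hd w' wd'.
have [W1 _ _] := D1; have [W2 _ _] := D2.
have e1 := same_ord (inD_self P W1) D1; have e2 := same_ord (inD_self P' W2) D2.
split=> [|x0 t t0]; first by lia.
have [x1 [v1 [t' t'0 [bx hv nz]]]] := rep_gen x0 d0 t0 hd.
exists x1; exists t' => //; split=> // x xb.
by apply: Rx_ord e1 _; apply: disc_Rx d0 hd hv (nz x xb) _ _ wd wd'.
Qed.

Lemma tpiE : tpi = 'i * jr K (pi + pi).
Proof. by rewrite /tpi /ipi -mulrDr -rmorphD. Qed.

Lemma W_turn w (t : R) : W w -> W (w + jr K t * tpi).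
Proof. by rewrite /W !N_ce creD tpiE mulrCA -rmorphM cre_ij addr0. Qed.

(** The segment from [w] to [w + tpi] stays in [W], since [N (ce w)] is constant on it. *)
Lemma Rel_turn w : W w -> Rel w (w + tpi).
Proof.
move=> Ww; have := @chain R (fun a b => W (w + jr K a * tpi) /\ W (w + jr K b * tpi) /\
   Rel (w + jr K a * tpi) (w + jr K b * tpi)) 0 1 ler01.
rewrite rmorph0 rmorph1 mul0r addr0 mul1r => -[]; last by move=> _ [].
  by move=> a b c [h1 [h2 h3]] [h4 [h5 h6]]; split=> //; split=> //; apply: Rel_trans h3 h6.
move=> t _; have [d d0 hd] := Rel_local (W_turn t Ww).
have [e e0 he] := seg_near w (w + tpi) d0.
have self : N (w + jr K t * tpi - (w + jr K t * tpi)) < d by rewrite subrr cN0.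
rewrite [w + tpi]addrC addrK in he.
exists e => //; split=> z /andP[z1 z2] z3; do 2 (split; first exact: W_turn); apply: hd => //; apply: he.
  by rewrite ler0_norm; lra.
by rewrite ger0_norm; lra.
Qed.
End Continuation.

(** * The regular solution is annihilated near [s = 0] *)

Section Kill.
Variables (R : realType) (C : numClosedFieldType) (K : cdata R C) (E lam : C).
Notation N := (cN K).
Notation hol := (hol K).
Notation cd := (cd K).
Notation ce := (ce K).
Notation tpi := (tpi K).
Notation pt := (pt C).
Notation ch := (ch K).
Notation bal := (bal K).
Notation c1 := (c1 E lam).
Notation sq := (sq E lam).
Notation sw := (sw K).

Variables (T : frame K E lam) (dd : R) (rw : C -> C) (F : pt -> C -> C).
Hypothesis dd_fd : dd <= fd T.
Let W w := N (ce w) < dd.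
Hypothesis rw_sq : forall w, W w -> rw w ^+ 2 = sq (base (sw w)).
Hypothesis rw_hol : forall w, W w -> hol rw w.
Hypothesis rw_per : forall w, rw (w + tpi) = rw w.
Hypothesis reps : forall s0 r0, s0 != 0 -> r0 != 0 -> r0 ^+ 2 = sq (base s0) ->
  inhabited (rep K E lam F s0 r0).
Notation a1 := (a1 T).
Notation b1 := (b1 T).
Notation Y := (Y T).
Notation cv := (cv T).
Notation Val := (Val T rw F).
Notation a2 := (a2 T).
Notation b2 := (b2 T).
Notation pd := (pd K).
Hypothesis E0 : E != 0.

Implicit Types (x : pt) (w e : C).

Lemma root_ex x w (t : R) : W w -> 0 < t -> exists2 d : R, 0 < d & forall e, N e < d ->
  exists2 y, y ^+ 2 = sq (cv x w e) & N (y - rw w) < t.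
Proof.
move=> Ww t0; have rz := rw_neq0 dd_fd rw_sq Ww.
have [d1 d10 h1] := root_near K rz t0.
have d12 : 0 < d1 / 2 by rewrite divr_gt0.
have [d2 d20 h2] := ch_cont (ch_sq K E lam (base (sw w))) d12.
have [d3 d30 h3] := cv_near dd_fd x Ww d20.
exists d3 => // e ed.
have [|_ b _ _] := h3 w e _ ed; first by rewrite subrr cN0.
have [|y ys yt] := h1 (sq (cv x w e)); last by exists y.
by rewrite rw_sq //; apply: le_lt_trans (h2 _ b) _; move: d10; lra.
Qed.

Section Limit.
Variables (x : pt) (v s1 r1 : C) (P : rep K E lam F s1 r1).
Hypothesis Pv : inD dd rw P v.
Hypothesis Bz : rBh P (Y x v 0) != 0.
Let Wv : W v. Proof. by case: Pv. Qed.
Let P1 := p1 T (sw v).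
Let P2 := p2 T (sw v).
Let kp := 540 * x i2 ^+ 2 / E ^+ 2 * tpi.
(** Interpolates between the point [Y x v e], at [t = 0], and the point after a turn, at [t = kp],
    in the direction of the regular solution. *)
Definition Yt t e : pt := mk (sw v) e (a1 x v + e * (a2 x v + t * P1)) (b1 x v + e * (b2 x v + t * P2)) (x i4).

Lemma Yt0 e : Yt 0 e = Y x v e.
Proof. by rewrite /Yt !mul0r !addr0. Qed.

Lemma Yt_turn e : Yt kp e = Y x (v + tpi) e.
Proof.
have [hn1 hn2] := f_per T v; have [hU hV] := f_mono (x i2) (x i3) (x i4) (lt_le_trans Wv dd_fd).
rewrite /Yt /Y /a1 /a2 /b1 /b2 sw_tpi hn1 hn2 hU hV -/kp -/P1 -/P2.
by congr mk; ring.
Qed.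

Lemma Yt_near (d : R) : 0 < d -> exists2 d' : R, 0 < d' & forall (t : R) e, 0 <= t <= 1 -> N e < d' ->
  bal (Y x v 0) d (Yt (jr K t * kp) e).
Proof.
move=> d0; pose L := 1 + N (a2 x v) + N (b2 x v) + N kp * N P1 + N kp * N P2.
have L0 : 0 < L.
  by rewrite /L -!addrA ltr_pwDl // !addr_ge0 ?cN_ge0 // mulr_ge0 ?cN_ge0.
exists (d / L); first by rewrite divr_gt0.
move=> t e /andP[t0 t1]; rewrite ltr_pdivlMr // => eL.
have key (a p b : C) : N a + N kp * N p <= L -> N (b + e * (a + jr K t * kp * p) - (b + 0 * 0)) < d.
  move=> h; have -> : b + e * (a + jr K t * kp * p) - (b + 0 * 0) = e * (a + jr K t * (kp * p)) by ring.
  rewrite cNM; apply: le_lt_trans eL; rewrite ler_wpM2l ?cN_ge0 //.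
  apply: le_trans (cN_tri _ _ _) (le_trans _ h); rewrite lerD2l cNM cN_jr ger0_norm // cNM.
  by rewrite ler_piMl // mulr_ge0 ?cN_ge0.
have n0 := cN_ge0 K; have p0 a b : 0 <= N a * N b by rewrite mulr_ge0.
apply/balP; rewrite /Yt /Y /mk /= !subrr !cN0 subr0 !mul0r; split=> //.
- apply: le_lt_trans eL; rewrite ler_peMr // /L -!addrA lerDl !addr_ge0 //.
- have := key (a2 x v) P1 (a1 x v); rewrite !mul0r; apply; rewrite /L.
  by have := n0 (b2 x v); have := p0 kp P2; lra.
have := key (b2 x v) P2 (b1 x v); rewrite !mul0r; apply; rewrite /L.
by have := n0 (a2 x v); have := p0 kp P1; lra.
Qed.

(** Derivative of [A / B] in [t] along [Yt], divided by [e^(n - 2m + 2)]. *)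
Definition kratio (q : pt) := (rT1 P q * P1 + rT2 P q * P2) / rBh P q ^+ 2.

Lemma cd_Yt (A : pt -> C) t e : ch A (bl (Yt t e)) ->
  cd (fun t => A (bl (Yt t e))) t (pd i2 A (bl (Yt t e)) * (e ^+ 2 * P1) + pd i3 A (bl (Yt t e)) * (e ^+ 2 * P2)).
Proof.
move=> cA; pose l (i : 'I_5) := nth 0 [:: 0; 0; e ^+ 2 * P1; e ^+ 2 * P2; 0] i.
have hl t' (i : 'I_5) : cd (fun t => bl (Yt t e) i) t' (l i).
  case: i => [[|[|[|[|[|m]]]]] Hm] //=; rewrite /bl /Yt /mk /l /=; try exact: cd_cst.
    apply: cd_eq (cdZ e (cdD (cd_cst K (a1 x v) t') (cdZ e (cdD (cd_cst K (a2 x v) t') (cdM (cd_id K t') (cd_cst K P1 t')))))).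
    by ring.
  apply: cd_eq (cdZ e (cdD (cd_cst K (b1 x v) t') (cdZ e (cdD (cd_cst K (b2 x v) t') (cdM (cd_id K t') (cd_cst K P2 t')))))).
  by ring.
have hG : holp K (fun t => bl (Yt t e)) t by move=> i; exists 1 => // s _; exists (l i).
apply: cd_eq (chain_rule (G := fun t => bl (Yt t e)) cA hG (hl t)).
by rewrite sum5 /l /= !mulr0 addr0 !add0r.
Qed.

(** After the turn [F] has changed by [e^(n - 2m + 2)] times [kratio kp] up to smaller terms, but by
    [Val] only by [O(e^(n - 2m + 3))]. As [e] tends to 0 the product [kratio kp] must vanish, and
    [kp] is nonzero when the singular amplitude is. *)
Lemma limit_kill : Val (rm P) (rn P) x v (v + tpi) -> x i2 != 0 ->
  rT1 P (Y x v 0) * P1 + rT2 P (Y x v 0) * P2 = 0.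
Proof.
move=> [M M0 [d d0 hV]] x0.
have kp0 : kp != 0.
  have p0 : 0 < pi + pi :> R by rewrite addr_gt0 // pi_gt0.
  have t0 : tpi != 0 by rewrite tpiE -(cN_gt0 K) cNM cN_i mul1r cN_jr gtr0_norm.
  by rewrite /kp !mulf_neq0 ?invr_eq0 ?expf_neq0 // pnatr_eq0.
suff h : kratio (Y x v 0) * kp = 0.
  move/eqP: h; rewrite mulf_eq0 (negbTE kp0) orbF /kratio mulf_eq0 invr_eq0 (negbTE (expf_neq0 2 Bz)) orbF.
  by move/eqP.
have W' : W (v + tpi) by rewrite /W ce_tpi.
have [_ hs hr] := Pv; have hr0 : 0 < rho P - N (rw v - r1) by rewrite subr_gt0.
have inP : bal (base s1) (rho P) (bl (Y x v 0)).
  exact: (@bal_slice _ _ K s1 _ (Y x v 0) (rho_gt0 P) (erefl _)).2.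
have [cB cT1 cT2] := r_ch inP.
have cS : ch kratio (Y x v 0).
  apply: chM; last by apply: chV (chX _ cB) _; rewrite expf_neq0.
  by apply: chD; apply: chM => //; apply: ch_cst.
apply: (@small_eq0 _ _ K _ (M + N kp)) => ep ep0.
have [d1 d10 h1] := ch_cont cS ep0.
have nB : 0 < N (rBh P (Y x v 0)) / 2 by rewrite divr_gt0 // cN_gt0.
have [d2 d20 h2] := ch_cont cB nB.
have [d3 d30 h3] : exists2 d3 : R, 0 < d3 & forall q, bal (Y x v 0) d3 q -> bal (base s1) (rho P) (bl q).
  exact: (@opn_bl _ _ K s1 (rho P)).
have [d4 d40 [l1 l2 l3 _ _]] := min_exists5 d10 d20 d30 ltr01 ltr01.
have [d5 d50 h5] := Yt_near d40.
have [d6 d60 [m1 m2 m3 _ _]] := min_exists5 d0 hr0 d50 ltr01 ltr01.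
have [d7 d70 h7] := root_ex x Wv d60; have [d8 d80 h8] := root_ex x W' d60.
have [d9 d90 [k1 k2 k3 k4 k5]] := min_exists5 d70 d80 d60 ep0 ep0.
pose e := jr K (d9 / 2); have e0 : e != 0 by rewrite -(cN_gt0 K) cN_jr gtr0_norm divr_gt0.
have ed : N e < d9 by rewrite cN_jr gtr0_norm ?divr_gt0 // ltr_pdivrMr // ltr_pMr // ltr1n.
have [r rs rv] := h7 e (lt_le_trans ed k1); have [r' rs' rv'] := h8 e (lt_le_trans ed k2).
have key := hV e r r' e0 (lt_le_trans ed (le_trans k3 m1)) rs rs' (lt_le_trans rv m1) (lt_le_trans rv' m1).
have near (t : R) : 0 <= t <= 1 -> bal (Y x v 0) d4 (Yt (jr K t * kp) e).
  by move=> t01; apply: h5 => //; apply: lt_le_trans ed (le_trans k3 m3).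
have at_t (t : R) : 0 <= t <= 1 -> let q := Yt (jr K t * kp) e in
    [/\ bal (base s1) (rho P) (bl q), rBh P q != 0 & N (kratio q - kratio (Y x v 0)) <= ep].
  move=> /near b q; split.
  - exact: h3 (bal_sub l3 b).
  - have := h2 _ (bal_sub l2 b); rewrite -/q; apply: contraTneq => ->; rewrite sub0r cNN -ltNge.
    by rewrite ltr_pdivrMr // ltr_pMr ?cN_gt0 // ltr1n.
  exact: h1 (bal_sub l1 b).
pose Ph t := rA P (bl (Yt t e)) / rB P (bl (Yt t e)).
have FE (t : R) r0 : 0 <= t <= 1 -> r0 ^+ 2 = sq (bl (Yt (jr K t * kp) e)) -> N (r0 - rw v) < d6 ->
    F (bl (Yt (jr K t * kp) e)) r0 = Ph (jr K t * kp).
  move=> t01 rs0 rv0; have [b nz _] := at_t t t01; have [fB _ _] := r_fac b.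
  rewrite (@r_val _ _ _ _ _ _ _ _ P) //.
    by apply: le_lt_trans (cN_dist K r0 (rw v) r1) _; rewrite -ltrBrDr; apply: lt_le_trans m2.
  by rewrite fB mulf_neq0 ?expf_neq0.
have z01 : 0 <= (0 : R) <= 1 by rewrite lexx ler01.
have o01 : 0 <= (1 : R) <= 1 by rewrite lexx ler01.
have F0 : F (cv x v e) r = Ph 0.
  by have := FE 0 r z01; rewrite rmorph0 mul0r Yt0 => ->.
have F1 : F (cv x (v + tpi) e) r' = Ph kp.
  by have := FE 1 r' o01; rewrite rmorph1 mul1r Yt_turn => -> //; rewrite -(rw_per v).
rewrite F0 F1 in key.
set S0 := kratio (Y x v 0) in at_t *.
(* The expected linear term is subtracted, so that the derivative of [g] is small by continuity of
   [kratio] and [mvt] applies. *)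
pose g t := e ^+ (rm P + rm P) * Ph t - e ^+ (rn P + 2) * S0 * t.
have := @mvt _ _ K g 0 kp (N e ^+ (rn P + 2) * ep).
have gE (t : R) : 0 <= t <= 1 -> exists2 l, cd g (0 + jr K t * (kp - 0)) l & N l <= N e ^+ (rn P + 2) * ep.
  move=> t01; rewrite add0r subr0; have [b nz Sb] := at_t t t01.
  have [cA cB'] := rAB_ch b; have [fB f2 f3] := r_fac b.
  have nB' : rB P (bl (Yt (jr K t * kp) e)) != 0 by rewrite fB mulf_neq0 ?expf_neq0.
  exists (e ^+ (rn P + 2) * (kratio (Yt (jr K t * kp) e) - S0)); last first.
    by rewrite cNM cNX ler_wpM2l ?exprn_ge0 ?cN_ge0.
  have dd1 := cdM (cd_Yt cA) (cdV (cd_Yt cB') nB').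
  apply: cd_eq (cdB (cdZ _ dd1) (cdZ _ (cd_id K _))).
  rewrite mulr1 mulrBr; congr (_ - _).
  move: f2 f3; rewrite /th fB /kratio; move: nz.
  set q := Yt _ e; rewrite (_ : q i1 = e) //.
  move: (rA P (bl q)) (rBh P q) (rT1 P q) (rT2 P q) (pd i2 _ _) (pd i3 _ _) (pd i2 _ _) (pd i3 _ _).
  move=> A Bh T1 T2 B2 B3 A2 A3 nz f2 f3; have em := expf_neq0 (rm P) e0.
  rewrite (_ : e ^+ (rn P + 2) = e ^+ 2 * e ^+ rn P); last by rewrite exprD mulrC.
  rewrite exprD; move: (e ^+ rm P) (e ^+ rn P) em f2 f3 => y z y0 f2 f3.
  have -> : e ^+ 2 * z * ((T1 * P1 + T2 * P2) / Bh ^+ 2) =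
    e ^+ 2 * ((z * T1) * P1 + (z * T2) * P2) / Bh ^+ 2 by ring.
  rewrite -f2 -f3; field.
  by rewrite y0 nz.
move=> /(_ gE); rewrite subr0 => bd.
have ne k : 0 < N e ^+ k by rewrite exprn_gt0 // cN_gt0.
have eq1 : e ^+ (rn P + 2) * (S0 * kp) =
    e ^+ (rm P + rm P) * (Ph kp - Ph 0) - (g kp - g 0) by rewrite /g; ring.
have l_e : N e <= ep by rewrite ltW // (lt_le_trans ed).
have : N e ^+ (rn P + 2) * N (S0 * kp) <= N e ^+ (rn P + 2) * ((M + N kp) * ep).
  rewrite -cNX -cNM eq1; apply: le_trans (cN_triB _ _ _) _.
  rewrite cNM !cNX mulrC [N (Ph kp - _)]cNB.
  have k' : M * N e ^+ (rn P + 3) <= N e ^+ (rn P + 2) * (M * ep).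
    rewrite (_ : (rn P + 3 = (rn P + 2) + 1)%N); last by rewrite -addnA.
    by rewrite exprD expr1 mulrCA; apply: ler_wpM2l; [rewrite ltW | apply: ler_wpM2l].
  by rewrite mulrDl mulrDr; apply: lerD (le_trans key k') _; rewrite [N kp * ep]mulrC mulrA.
by rewrite ler_pM2l.
Qed.
End Limit.

Lemma Y_turn x w : Y x (w + tpi) 0 = Y x w 0.
Proof.
by have [h1 h2] := f_per T w; rewrite !Y_0 /Y0 /a1 /b1 h1 h2 sw_tpi.
Qed.

(** [Rx] relates [z] to generic times near [z + tpi], not to [z + tpi] itself; [step] near
    [w0 + tpi] closes the gap, since the leading term of [B] is the same there as one turn
    earlier. *)
Lemma turn_zero w0 (P : rep K E lam F (sw w0) (rw w0)) (d1 : R) x v1 : W w0 -> 0 < d1 ->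
  (forall w, N (w - w0) < d1 -> inD dd rw P w) -> N (v1 - w0) < d1 -> hx T P x v1 != 0 ->
  x i2 != 0 -> Rx T dd rw F (rm P) (rn P) x w0 (w0 + tpi) ->
  exists b, exists2 e : R, 0 < e & N (b - w0) < d1 /\ forall z, N (z - b) < e ->
    rT1 P (Y x z 0) * p1 T (sw z) + rT2 P (Y x z 0) * p2 T (sw z) = 0.
Proof.
move=> W0 d10 hd v1d nz x0 [rh rh0 hR].
have W1 : W (w0 + tpi) by rewrite /W ce_tpi.
have [] := @step _ _ K E lam T dd rw F dd_fd rw_hol x (w0 + tpi) _ _ P W1.
- by rewrite sw_tpi subrr cN0 rho_gt0.
- by rewrite rw_per subrr cN0 rho_gt0.
move=> du du0 hstep.
have [e0 e00 [k1 k2 k3 _ _]] := min_exists5 rh0 du0 d10 ltr01 ltr01.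
have [|v [e1 e10 [sb g1]]] := hx_gen dd_fd d10 hd v1d nz e00 (_ : N (w0 - w0) < d1).
  by rewrite subrr cN0.
have vin : N (v - w0) < e0 by apply: sb; rewrite subrr cN0.
have vin' : N (v + tpi - (w0 + tpi)) < rh by rewrite opprD addrACA subrr addr0; apply: lt_le_trans k1.
have [z0 [z0' [e2 e20 [s1 s1' Wz Wz' hv]]]] := hR v (v + tpi) e1 (lt_le_trans vin k1) vin' e10.
have z0in : N (z0 - v) < e1 by apply: s1; rewrite subrr cN0.
exists z0; exists e2 => //; split; first by have [] := g1 z0 z0in.
move=> z ze; have zv := s1 z ze; have [zd nzz] := g1 z zv.
have z0v : N (z0' - tpi - v) < e1.
  by have := s1' z0'; rewrite subrr cN0 opprD addrA addrAC => /(_ e20).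
have [z0d nz0] := g1 _ z0v.
have eY : Y x z0' 0 = Y x (z0' - tpi) 0 by rewrite -[in LHS](subrK tpi z0') Y_turn.
apply: (@limit_kill x z _ _ P) => //; first exact: hd.
apply: (@Val_trans _ _ K E lam T dd rw F dd_fd rw_sq _ _ x z z0' (z + tpi) Wz').
  by apply: hv => //; rewrite subrr cN0.
apply: hstep.
- have := sb _ z0v; rewrite -addrA -opprD [tpi + _]addrC => h; exact: lt_le_trans k2.
- by have := sb _ zv; rewrite opprD addrACA subrr addr0 => h; apply: lt_le_trans k2.
- by rewrite eY.
by rewrite Y_turn.
Qed.

Lemma nz_i2 (x : pt) : bal (mk 0 0 1 0 0) 1 x -> x i2 != 0.
Proof.
move=> /(_ i2); apply: contraTneq => ->; rewrite -leNgt.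
have -> : 0 - mk 0 0 1 0 0 i2 = - 1 :> C by rewrite /mk /= sub0r.
by rewrite cNN cN1.
Qed.

(** The annihilation is first obtained for generic amplitudes near generic times, then for all times
    of a disc by the identity theorem, then for all directions because [Y0] is onto. *)
Lemma turn_kill w0 (P : rep K E lam F (sw w0) (rw w0)) : W w0 -> killn P (p1 T) (p2 T) (sw w0).
Proof.
move=> W0; have D0 := inD_self P W0.
have [d1 d10 hd] := inD_open rw_hol D0.
have W1 : W (w0 + tpi) by rewrite /W ce_tpi.
have [P'] := reps_at dd_fd rw_sq reps W1.
have [_ hX] := Rel_turn dd_fd rw_sq rw_hol reps W0 P P'.
(* The ball of radius 1 around [x i2 = 1] keeps the amplitude of the singular solution nonzero. *)
have [x1 [d' d'0 [b1 hR]]] := hX (mk 0 0 1 0 0) 1 ltr01.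
pose g q := rT1 P q * p1 T (q i0) + rT2 P q * p2 T (q i0).
pose s0 := sw w0; have W0' := lt_le_trans W0 dd_fd.
have sfd : 0 < fd T - N s0 by rewrite subr_gt0 f_small.
have sn : 0 < N s0 by rewrite cN_gt0 sw_neq0.
have [r r0 [r1 r2 r3 _ _]] := min_exists5 sfd sn (rho_gt0 P) ltr01 ltr01.
have hp z : N (z - s0) < r -> hol (p1 T) z /\ hol (p2 T) z.
  move=> zr; have nv z' : N (z' - s0) < r -> nve K E lam (p1 T) (p2 T) z'.
    move=> h; apply: f_p.
      by have := cN_tri K (z' - s0) s0; rewrite subrK; lra.
    by apply: contraTneq h => ->; rewrite sub0r cNN -leNgt.
  have e0 : 0 < r - N (z - s0) by rewrite subr_gt0.
  split; exists (r - N (z - s0)) => // s sz; have [|h1 h2] := nv s; try by eexists; eassumption.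
    by have := cN_dist K s z s0; lra.
  by have := cN_dist K s z s0; lra.
have cg q : q i1 = 0 -> N (q i0 - s0) < r -> ch g q.
  move=> q1 qr; have [h1 h2] := hp _ qr.
  have [_ c1' c2'] := r_ch ((@bal_slice _ _ K s0 _ q (rho_gt0 P) q1).2 (lt_le_trans qr r3)).
  by apply: chD; apply: chM => //; apply: ch_hol (ch_coord _ _ _) _.
have [d3 d30 hs] : exists2 d3 : R, 0 < d3 & forall v, N (v - w0) < d3 -> N (v - w0) < d1 /\ N (sw v - s0) < r.
  have r20 : 0 < r / 2 by rewrite divr_gt0.
  have [d4 d40 h4] := cd_cont (cd_sw K w0) r20.
  have [d5 d50 [l1 l2 _ _ _]] := min_exists5 d10 d40 ltr01 ltr01 ltr01.
  exists d5 => // v vd; split; first exact: lt_le_trans l1.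
  by have := h4 v (lt_le_trans vd l2); move: r0; rewrite -/s0; lra.
have hd3 w : N (w - w0) < d3 -> inD dd rw P w by move=> /hs [/hd].
have [x2 [v1 [d2 d20 [b2 v1d nz]]]] := rep_gen dd_fd x1 d30 d'0 hd3.
have zero_xv x v : bal x2 d2 x -> N (v - w0) < d3 -> g (Y x v 0) = 0.
  move=> bx; have bx' := b2 x bx.
  have [b [e e0 [bd hz]]] := turn_zero W0 d30 hd3 v1d (nz x bx) (nz_i2 (b1 x bx')) (hR x bx').
  apply: (@ident _ _ K (fun v => g (Y x v 0)) w0 d3 b) => //; last by exists e.
  move=> z zd; have [zd1 zr] := hs z zd; have [Wz _ _] := hd z zd1.
  apply: (@ch_holp _ _ K g (fun v => Y x v 0)); last exact: (holp_Y dd_fd).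
  exact: cg.
have zero_q v q : N (v - w0) < d3 -> q i0 = sw v -> q i1 = 0 -> g q = 0.
  move=> vd q0 q1; apply/eqP; rewrite -[_ == _]negbK; apply/negP => n0.
  have [vd1 vr] := hs v vd; have [Wv _ _] := hd v vd1.
  have cg' q' : q' i0 = sw v -> q' i1 = 0 -> ch g q' by move=> e0 e1; apply: cg => //; rewrite e0.
  have [x bx] := genx dd_fd x2 Wv cg' d20 (ex_intro _ q (And3 q0 q1 n0)).
  by rewrite -Y_0 zero_xv // eqxx.
(* Over [sw v] the function vanishes for all directions, and [sw v] comes arbitrarily close to [s0]
   without being equal to it; so the zeros on the line through [q] are not isolated. *)
exists r => // q q1 qr; apply/eqP; rewrite -[_ == _]negbK; apply/negP => n0.
have hh z : N (z - s0) < r -> hol (fun z => g (upd q i0 z)) z.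
  by move=> zr; apply: (@ch_holp _ _ K g); [apply: cg | apply: holp_upd1].
have [|e e0 he] := iso_zero r0 hh; first by exists (q i0) => //; rewrite upd_id.
have e20 : 0 < e / 2 by rewrite divr_gt0.
have [d4 d40 h4] := cd_cont (cd_sw K w0) e20; have [d5 d50 h5] := sw_sep K w0.
have [d6 d60 [l1 l2 l3 _ _]] := min_exists5 d30 d40 d50 ltr01 ltr01.
have [v vd vw] := small_step K w0 d60.
have se : N (sw v - s0) < e by have := h4 v (lt_le_trans vd l2); move: e0; rewrite -/s0; lra.
have := he (sw v) (h5 v (lt_le_trans vd l3) vw) se.
by rewrite (zero_q v) ?eqxx // (lt_le_trans vd).
Qed.
End Kill.

(** * The annihilated solution germ at [s = 0] *)

Section Germ.
Variables (R : realType) (C : numClosedFieldType) (K : cdata R C) (E lam : C).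
Notation j := (jr K).
Notation N := (cN K).
Notation hol := (hol K).
Notation cd := (cd K).
Notation ce := (ce K).
Notation tpi := (tpi K).
Notation pt := (pt C).
Notation c1 := (c1 E lam).
Notation sq := (sq E lam).
Notation sw := (sw K).

Lemma N_reim z : N z ^+ 2 = cre K z ^+ 2 + cim K z ^+ 2.
Proof.
by apply: (@jr_inj _ _ K); rewrite rmorphD !rmorphXn cNE creE cimE normC2_Re_Im.
Qed.

Lemma ce_onto z : z != 0 -> exists2 w, ce w = z & N w <= `|ln (N z)| + pi.
Proof.
move=> z0; have n0 : 0 < N z by rewrite cN_gt0.
pose u := z / j (N z); have j0 : j (N z) != 0 by rewrite -(cN_gt0 K) cN_jr gtr0_norm.
have Nu : N u = 1 by rewrite /u cNM cNV cN_jr gtr0_norm // divff // gt_eqF.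
have := N_reim u; rewrite Nu expr1n; set a := cre K u; set b := cim K u => ab.
have a1 : -1 <= a <= 1 by apply/andP; split; nra.
have aK : cos (acos a) = a by apply: acosK; rewrite in_itv.
have sa : sin (acos a) ^+ 2 = b ^+ 2 by rewrite sin2cos2 aK; lra.
have [th [ct st tp]] : exists th, [/\ cos th = a, sin th = b & `|th| <= pi].
  have ge0 := acos_ge0 a1; have lepi := acos_lepi a1.
  have [e|e] : sin (acos a) = b \/ sin (acos a) = - b.
  - by move/eqP: sa; rewrite eqf_sqr => /orP[/eqP|/eqP]; [left | right].
  - by exists (acos a); rewrite aK ger0_norm.
  by exists (- acos a); rewrite cosN sinN aK e opprK normrN ger0_norm.
exists (j (ln (N z)) + 'i * j th); last first.
  apply: le_trans (cN_tri _ _ _) _; rewrite cNM cN_i mul1r !cN_jr; exact: lerD.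
rewrite ceD /ce cre_jr cim_jr cre_ij cim_ij lnK ?posrE // expR0 rmorph1 mul1r /cis cos0 sin0 ct st.
rewrite rmorph1 rmorph0 mulr0 addr0 mulr1 -/(cim K) -[X in _ * X](c_rect K u) /u mulrC divfK //.
Qed.

Lemma sq_base s : sq (base s) = s * (4 / 3 * c1 s).
Proof. by rewrite /sq /yv /base /mk /=; field. Qed.

Lemma kill_zero F : E != 0 -> (forall s0 r0, s0 != 0 -> r0 != 0 -> r0 ^+ 2 = sq (base s0) ->
    inhabited (rep K E lam F s0 r0)) ->
  exists e1 e2 : C -> C, exists2 d : R, 0 < d & [/\ hol e1 0, hol e2 0, e1 0 = 1 &
    forall s, s != 0 -> N s < d -> [/\ c1 s != 0, nve K E lam e1 e2 s &
      forall r (P : rep K E lam F s r), r ^+ 2 = sq (base s) -> killn P e1 e2 s]].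
Proof.
move=> E0 reps; have [T] := frame_exists K lam E0.
pose k s := 4 / 3 * c1 s; pose r0 := sqrtC (k 0).
have k0 : k 0 != 0.
  by rewrite /k /c1 expr0n /= !mulr0 subrr add0r !mulf_neq0 ?invr_eq0 ?pnatr_eq0.
have r00 : r0 != 0 by rewrite sqrtC_eq0.
have [g _ [d1 d10 hg]] := lroot K r00.
have hk s : hol k s.
  apply: holM (hol_cst _ _ _) _; rewrite /c1; hols.
have d12 : 0 < d1 / 2 by rewrite divr_gt0.
have [d2 d20 h2] := hol_cont (hk 0) d12.
have near s : N s < d2 -> N (k s - r0 ^+ 2) < d1.
  by move=> sd; rewrite sqrtCK; have := h2 s; rewrite subr0 => /(_ sd); move: d10; lra.
have [d3 d30 h3] := sw_small K d20.
have [dd dd0 [l1 l2 _ _ _]] := min_exists5 (fd_gt0 T) d30 ltr01 ltr01 ltr01.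
(* [sq (base s)] is [s] times [k s], so [z] times a branch of the root of [k] is a root of it. It
   returns after a turn of [w], whereas a single turn of [s] would change its sign. *)
pose rw w := ce w * g (k (sw w)).
have rsq w : N (ce w) < dd -> rw w ^+ 2 = sq (base (sw w)).
  move=> wd; have [e _ _ _] := hg _ (near _ (h3 w (lt_le_trans wd l2))).
  by rewrite /rw exprMn e sq_base.
have rhol w : N (ce w) < dd -> hol rw w.
  move=> wd; have [_ _ hgw _] := hg _ (near _ (h3 w (lt_le_trans wd l2))).
  have hce : hol ce w by exists 1 => // s _; eexists; apply: cd_ce.
  apply: holM => //; apply: (@hol_comp _ _ K (fun w => k (sw w))) => //.
  by apply: hol_comp (hk _); apply: holX.
have rper w : rw (w + tpi) = rw w by rewrite /rw ce_tpi sw_tpi.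
have [hp1 hp2] := f_hp T.
have [d d0 [m1 m2 m3 _ _]] := min_exists5 (fd_gt0 T) d20 (exprn_gt0 2 dd0) ltr01 ltr01.
exists (p1 T), (p2 T); exists d => //; split=> // [|s s0 sd]; first exact: f_p0.
have sf := lt_le_trans sd m1; split; [exact: f_c1 sf s0 | exact: f_p |].
move=> r P rs; have [gk _ _ _] := hg _ (near _ (lt_le_trans sd m2)).
have ks : k s != 0 by rewrite mulf_neq0 ?(f_c1 sf s0) // mulf_neq0 ?invr_eq0 ?pnatr_eq0.
have g0 : g (k s) != 0 by apply: contraNneq ks => e; rewrite -gk e expr0n.
(* Division of the given root by the branch gives a root [z] of [s], and a logarithm [w] of [z]
   realizes both [s] and [r]; so both signs of [r] are covered. *)
have z2 : (r / g (k s)) ^+ 2 = s by rewrite expr_div_n gk rs sq_base -/(k s) mulfK.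
have z0 : r / g (k s) != 0 by apply: contraTneq s0 => e; rewrite -z2 e expr0n eqxx.
have [w ew _] := ce_onto z0.
have es : s = sw w by rewrite /sw ew z2.
have er : r = rw w by rewrite /rw -es ew divfK.
have Ww : N (ce w) < dd.
  by rewrite -(@ltr_pXn2r _ 2) ?nnegrE ?cN_ge0 ?(ltW dd0) // -cNX -/(sw w) -es (lt_le_trans sd).
move: P {rs gk ks g0 z2 z0 ew sf s0 sd}; subst s r => P.
exact: (turn_kill l1 rsq rhol rper reps E0 P Ww).
Qed.
End Germ.

(** * Continuation of the annihilated line *)

Section Lines.
Variables (R : realType) (C : numClosedFieldType) (K : cdata R C) (E lam : C).
Notation j := (jr K).
Notation N := (cN K).
Notation hol := (hol K).
Notation cd := (cd K).
Notation pt := (pt C).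
Notation ch := (ch K).
Notation c1 := (c1 E lam).
Notation sq := (sq E lam).
Notation nve := (nve K E lam).

Definition c2 s := 35 * lam * s ^+ 3 + 210 * s + 4 * E.
Definition qr s := 3 / 2 * s * (- (35 * lam * s ^+ 3) + 3 * lam * E * s ^+ 2 + 8 * E).
Definition qt s := s / 36 * (3 * (- (140 * lam * s ^+ 3) + 9 * lam * E * s ^+ 2 + 8 * E) + 3 * c2 s) * c1 s
  - qr s * c1 s / 6 + qr s * (E - s) / 6.

(* An invariant quadratic form of the first variational equation: its solutions are
   the square roots of the products of two solutions of the second order equation. *)
Definition Qf s n b := (c2 s * n ^+ 2 + 2 * qr s * n * b + qt s * b ^+ 2) / c1 s.

Lemma cd_c1 s : cd c1 s (12 * lam * s ^+ 2 - 3).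
Proof.
apply: cd_eq (cdD (cdB (cdZ (4 * lam) (cdX 3 (cd_id K s))) (cdZ 3 (cd_id K s))) (cd_cst K (2 * E) s)).
by rewrite /=; ring.
Qed.

Lemma cd_Qf e b s : s != 0 -> c1 s != 0 -> nve e b s -> cd (fun s => Qf s (e s) (b s)) s 0.
Proof.
move=> s0 c0 [he hb].
have h2 : cd c2 s (105 * lam * s ^+ 2 + 210).
  apply: cd_eq (cdD (cdD (cdZ (35 * lam) (cdX 3 (cd_id K s))) (cdZ 210 (cd_id K s))) (cd_cst K (4 * E) s)).
  by rewrite /=; ring.
pose r1 := 3 / 2 * (- (140 * lam * s ^+ 3) + 9 * lam * E * s ^+ 2 + 8 * E).
have hr : cd qr s r1.
  apply: cd_eq (cdM (cdZ (3 / 2) (cd_id K s)) (cdD (cdD (cdN (cdZ (35 * lam) (cdX 3 (cd_id K s))))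
    (cdZ (3 * lam * E) (cdX 2 (cd_id K s)))) (cd_cst K (8 * E) s))).
  by rewrite /r1 /=; field.
have h1 := cd_c1 s.
have hr1 : cd (fun s => 3 * (- (140 * lam * s ^+ 3) + 9 * lam * E * s ^+ 2 + 8 * E) + 3 * c2 s) s
   (3 * (- (420 * lam * s ^+ 2) + 18 * lam * E * s) + 3 * (105 * lam * s ^+ 2 + 210)).
  apply: cd_eq (cdD (cdZ 3 (cdD (cdD (cdN (cdZ (140 * lam) (cdX 3 (cd_id K s))))
    (cdZ (9 * lam * E) (cdX 2 (cd_id K s)))) (cd_cst K (8 * E) s))) (cdZ 3 h2)).
  by rewrite /=; ring.
have ht := cdD (cdB (cdM (cdM (cdM (cd_id K s) (cd_cst K (36^-1) s)) hr1) h1) (cdM (cdM hr h1) (cd_cst K (6^-1) s)))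
   (cdM (cdM hr (cdB (cd_cst K E s) (cd_id K s))) (cd_cst K (6^-1) s)).
have hq := cdM (cdD (cdD (cdM h2 (cdX 2 he)) (cdM (cdM (cdZ 2 hr) he) hb)) (cdM ht (cdX 2 hb))) (cdV h1 c0).
apply: cd_eq hq.
rewrite /= /qt /qr /c2 /r1; move: (e s) (b s) c0; rewrite /c1 => x y c0.
field.
by rewrite c0 s0.
Qed.

Lemma const_ball f a (d : R) : (forall z, N (z - a) < d -> cd f z 0) ->
  forall z z', N (z - a) < d -> N (z' - a) < d -> f z = f z'.
Proof.
move=> h z z' zd zd'; apply/eqP; rewrite -subr_eq0 -(cN_eq0 K) eq_le cN_ge0 andbT.
have -> : 0 = 0 * N (z - z') by rewrite mul0r.
apply: (@mvt _ _ K) => x x01; exists 0; last by rewrite cN0.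
by apply: h; apply: (@conv_disc _ _ K a d).
Qed.

Definition dom s := s != 0 /\ c1 s != 0.

Lemma dom_open s : dom s -> exists2 d : R, 0 < d & forall z, N (z - s) < d -> dom z.
Proof.
move=> [s0 c0]; have n0 : N s != 0 by rewrite cN_eq0.
have ns : 0 < N s / 2 by rewrite divr_gt0 // cN_gt0.
have nc : 0 < N (c1 s) / 2 by rewrite divr_gt0 // cN_gt0.
have [d d0 hd] := cd_cont (cd_c1 s) nc.
have [t t0 [l1 l2 _ _ _]] := min_exists5 d0 ns ltr01 ltr01 ltr01.
have low x : x != 0 -> N (0 - x) <= N x / 2 -> False.
  move=> x0; rewrite sub0r cNN leNgt => /negP; apply.
  by rewrite ltr_pdivrMr // ltr_pMr ?cN_gt0 // ltr1n.
exists t => // z zt; split; apply/eqP => e.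
  by apply: (low s s0); have := lt_le_trans zt l2; rewrite e => /ltW.
by apply: (low (c1 s) c0); have := hd z (lt_le_trans zt l1); rewrite e.
Qed.

Lemma nveL e b f g al be s : nve e b s -> nve f g s ->
  nve (fun s => al * e s + be * f s) (fun s => al * b s + be * g s) s.
Proof.
move=> [h1 h2] [h3 h4]; split.
  by apply: cd_eq (cdD (cdZ al h1) (cdZ be h3)); ring.
by apply: cd_eq (cdD (cdZ al h2) (cdZ be h4)); ring.
Qed.

Lemma nve_hol e b s (d : R) : (forall z, N (z - s) < d -> nve e b z) ->
  forall z, N (z - s) < d -> hol e z /\ hol b z.
Proof.
move=> h z zd; have t0 : 0 < d - N (z - s) by rewrite subr_gt0.
have k z' : N (z' - z) < d - N (z - s) -> nve e b z'.
  by move=> zz; apply: h; have := cN_dist K z' z s; lra.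
by split; exists (d - N (z - s)) => // z' /k [h1 h2]; eexists; eassumption.
Qed.

Lemma wronski_const e b f g f' g' s : dom s -> nve e b s -> nve f g s -> nve f' g' s ->
  f s * g' s - f' s * g s != 0 ->
  cd (fun s => (e s * g' s - f' s * b s) / (f s * g' s - f' s * g s)) s 0.
Proof.
move=> [s0 c0] [h1 h2] [h3 h4] [h5 h6] w0.
have dw := cdB (cdM h3 h6) (cdM h5 h4); have da := cdB (cdM h1 h6) (cdM h5 h2).
apply: cd_eq (cdM da (cdV dw w0)).
move: w0 c0; move: (c1 s) (e s) (b s) (f s) (g s) (f' s) (g' s) => c x y p q p' q' w0 c0.
field.
by rewrite w0 c0 s0.
Qed.

(** The disc depends on [s0] only: by Cramer's rule every solution germ in it is a combination of
    two fixed solutions with locally constant coefficients. *)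
Lemma nve_disc s0 : dom s0 -> exists2 d : R, 0 < d & (forall z, N (z - s0) < d -> dom z) /\
  forall e b s1 (r : R), N (s1 - s0) < d -> 0 < r -> (forall z, N (z - s1) < r -> nve e b z) ->
  exists e' b', (forall z, N (z - s0) < d -> nve e' b' z) /\
    exists2 r' : R, 0 < r' & forall z, N (z - s1) < r' -> e' z = e z /\ b' z = b z.
Proof.
move=> D0; have [s00 c0] := D0.
have [f [g [f0 g0 [d1 d10 h1]]]] := nve_reg K 1 0 s00 c0.
have [f' [g' [f0' g0' [d2 d20 h2]]]] := nve_reg K 0 1 s00 c0.
have [d3 d30 h3] := dom_open D0.
pose w z := f z * g' z - f' z * g z.
have w1 : w s0 = 1 by rewrite /w f0 g0 f0' g0'; ring.
have [d4 d40 h4] : exists2 d : R, 0 < d & forall z, N (z - s0) < d -> w z != 0.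
  have s0in d : 0 < d -> N (s0 - s0) < d by rewrite subrr cN0.
  have [hf hg] := nve_hol h1 (s0in _ d10); have [hf' hg'] := nve_hol h2 (s0in _ d20).
  have hw : cont K w s0 by apply: hol_cont; apply: holB; apply: holM.
  have w0 : w s0 != 0 by rewrite w1 oner_neq0.
  have [d d0 hd] := cont_nz hw w0; exists d => // z /hd h.
  by rewrite -(cN_gt0 K); apply: lt_le_trans h; rewrite divr_gt0 // cN_gt0.
have [d d0 [l1 l2 l3 l4 _]] := min_exists5 d10 d20 d30 d40 ltr01.
have hd z : N (z - s0) < d -> [/\ nve f g z, nve f' g' z, dom z & w z != 0].
  by move=> zd; split; [apply: h1 | apply: h2 | apply: h3 | apply: h4]; apply: lt_le_trans zd _.
exists d => //; split=> [z /hd [] //|e b s1 r s1d r0 he].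
pose al z := (e z * g' z - f' z * b z) / w z.
pose be z := (e z * g z - f z * b z) / (f' z * g z - f z * g' z).
have r1 : 0 < d - N (s1 - s0) by rewrite subr_gt0.
have [t t0 [m1 m2 _ _ _]] := min_exists5 r0 r1 ltr01 ltr01 ltr01.
have ht z : N (z - s1) < t -> [/\ nve e b z, nve f g z, nve f' g' z, dom z & w z != 0].
  move=> zt; have [|k1 k2 k3 k4] := hd z; last by split=> //; apply: he; apply: lt_le_trans m1.
  by have := cN_dist K z s1 s0; lra.
have w' z : w z != 0 -> f' z * g z - f z * g' z != 0.
  by move=> wz; rewrite -oppr_eq0 opprB.
have s1t : N (s1 - s1) < t by rewrite subrr cN0.
have alc z : N (z - s1) < t -> al z = al s1.
  by move=> zt; apply: (const_ball _ zt s1t) => y /ht [k1 k2 k3 k4 k5]; apply: wronski_const.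
have bec z : N (z - s1) < t -> be z = be s1.
  move=> zt; apply: (const_ball _ zt s1t) => y /ht [k1 k2 k3 k4 k5].
  by apply: wronski_const => //; apply: w'.
exists (fun z => al s1 * f z + be s1 * f' z), (fun z => al s1 * g z + be s1 * g' z); split.
  by move=> z /hd [k1 k2 _ _]; apply: nveL.
exists t => // z zt; have [_ _ _ _ wz] := ht z zt; rewrite -(alc z zt) -(bec z zt) /al /be.
have wz' := w' z wz; move: wz wz'; rewrite /w.
move: (e z) (b z) (f z) (g z) (f' z) (g' z) => x y p q p' q' wz wz'.
by split; field; rewrite wz wz'.
Qed.

Variable F : pt -> C -> C.
Hypothesis reps : forall s0 r0, s0 != 0 -> r0 != 0 -> r0 ^+ 2 = sq (base s0) ->
  inhabited (rep K E lam F s0 r0).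

Definition killed e b z := forall r (P : rep K E lam F z r), r ^+ 2 = sq (base z) -> killn P e b z.

(** [(x, y)] is the value at [s] of an annihilated solution; the value 2 of the invariant form fixes
    it up to sign. *)
Definition good s x y := exists e b, exists2 d : R, 0 < d &
  (forall z, N (z - s) < d -> nve e b z) /\ [/\ e s = x, b s = y, Qf s x y = 2 & killed e b s].

Lemma sq_base_neq0 s : dom s -> sq (base s) != 0.
Proof.
by move=> [s0 c0]; rewrite sq_base; apply: mulf_neq0 s0 (mulf_neq0 _ c0); rewrite mulf_neq0 ?invr_eq0 ?pnatr_eq0.
Qed.

Lemma killn_ext s0 r0 (P : rep K E lam F s0 r0) e b e' b' z (d : R) : 0 < d ->
  (forall y, N (y - z) < d -> e' y = e y /\ b' y = b y) -> killn P e b z -> killn P e' b' z.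
Proof.
move=> d0 h [t t0 ht]; have [u u0 [l1 l2 _ _ _]] := min_exists5 d0 t0 ltr01 ltr01 ltr01.
exists u => // q q1 qu; have [-> ->] := h _ (lt_le_trans qu l1).
exact: ht (lt_le_trans qu l2).
Qed.

(** The germ extends to a disc by [nve_disc]. Its annihilation passes from [s1] to a local
    expression centred at [s0], spreads over the disc by [kill_extend], and passes on to the
    expressions centred at [z]. *)
Lemma good_local s0 : dom s0 -> exists2 d : R, 0 < d & forall s1 x y, N (s1 - s0) < d -> good s1 x y ->
  exists e b, [/\ e s1 = x, b s1 = y & forall z, N (z - s0) < d ->
    [/\ dom z, nve e b z & good z (e z) (b z)]].
Proof.
move=> D0; have [d1 d10 [hd hex]] := nve_disc D0.
pose r0 := sqrtC (sq (base s0)); have r00 : r0 != 0 by rewrite sqrtC_eq0 sq_base_neq0.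
have r0s : r0 ^+ 2 = sq (base s0) by rewrite sqrtCK.
have [P] := reps D0.1 r00 r0s.
(* Every root of [sq (base z)] is near one of the two roots at [s0], and each of them needs its own
   local expression. *)
have [P'] : inhabited (rep K E lam F s0 (- r0)).
  by apply: reps D0.1 _ _; rewrite ?oppr_eq0 // sqrrN.
have [rh rh0 [l1 l2 _ _ _]] := min_exists5 (rho_gt0 P) (rho_gt0 P') ltr01 ltr01 ltr01.
have [d2 d20 h2] := root_near K r00 rh0.
have d22 : 0 < d2 / 2 by rewrite divr_gt0.
have [d3 d30 h3] := ch_cont (ch_sq K E lam (base s0)) d22.
have [d d0 [m1 m2 m3 _ _]] := min_exists5 d10 d30 rh0 ltr01 ltr01.
have near_root z r : N (z - s0) < d -> r ^+ 2 = sq (base z) -> N (r - r0) < rh \/ N (r - - r0) < rh.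
  move=> zd rs; have [|y ys yr] := h2 (sq (base z)).
    by rewrite r0s; apply: le_lt_trans (h3 _ (base_in d30 (lt_le_trans zd m2))) _; move: d20; lra.
  have : r ^+ 2 == y ^+ 2 by rewrite ys rs.
  rewrite eqf_sqr => /orP[/eqP ->|/eqP ->]; [by left | right].
  by rewrite opprK addrC cNB.
exists d => // s1 x y s1d [e [b [t t0 [nv [ex by' Q2 kl]]]]].
have [e' [b' [nv' [r' r'0 ext]]]] := hex e b s1 t (lt_le_trans s1d m1) t0 nv.
have [ee bb] : e' s1 = x /\ b' s1 = y by rewrite -ex -by'; apply: ext; rewrite subrr cN0.
exists e', b'; split=> // z zd; have D := hd z (lt_le_trans zd m1).
split=> //; first exact: nv' (lt_le_trans zd m1).
have zin : 0 < d - N (z - s0) by rewrite subr_gt0.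
exists e', b'; exists (d - N (z - s0)) => //; split.
  by move=> z' h; apply: nv'; have := cN_dist K z' z s0; lra.
split=> //.
  rewrite (_ : Qf z (e' z) (b' z) = Qf s1 (e' s1) (b' s1)); first by rewrite ee bb.
  apply: (@const_ball (fun z => Qf z (e' z) (b' z)) s0 d) => // z' z'd.
  have [z0 cz0] := hd z' (lt_le_trans z'd m1).
  by apply: cd_Qf z0 cz0 (nv' _ (lt_le_trans z'd m1)).
have hol' z' : N (z' - s0) < d -> hol e' z' /\ hol b' z'.
  by move=> z'd; apply: (nve_hol (d := d1)) nv' _ (lt_le_trans z'd m1).
have D1 := hd s1 (lt_le_trans s1d m1).
have main sg (P0 : rep K E lam F s0 sg) : rh <= rho P0 -> sg ^+ 2 = sq (base s0) ->
    (forall y, y ^+ 2 = sq (base s1) -> N (y - sg) < rh \/ N (- y - sg) < rh) ->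
    forall r (Q : rep K E lam F z r), r ^+ 2 = sq (base z) -> N (r - sg) < rh -> killn Q e' b' z.
  move=> lr sgs roots r Q rs rd.
  have [r1 r1s r1d] : exists2 r1, r1 ^+ 2 = sq (base s1) & N (r1 - sg) < rh.
    have ys := sqrtCK (sq (base s1)); have [h|h] := roots _ ys.
      by exists (sqrtC (sq (base s1))).
    by exists (- sqrtC (sq (base s1))) => //; rewrite sqrrN.
  have sq1 := sq_base_neq0 D1.
  have r1z : r1 != 0 by apply: contraNneq sq1 => e0; rewrite -r1s e0 expr0n.
  have [P1] := reps D1.1 r1z r1s.
  have s0P : N (s1 - s0) < rho P0 by apply: lt_le_trans s1d (le_trans m3 lr).
  have zP : N (z - s0) < rho P0 by apply: lt_le_trans zd (le_trans m3 lr).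
  have k1 : killn P1 e' b' s1 by apply: killn_ext r'0 ext _; apply: kl.
  have [he1 hb1] := hol' s1 s1d.
  have k0 : killn P0 e' b' s1.
    apply: (@kill_transfer _ _ K E lam F _ _ _ _ P1 P0 s1 r1) => //; rewrite ?subrr ?cN0 ?rho_gt0 //.
    exact: lt_le_trans lr.
  have kz : killn P0 e' b' z.
    have := kill_extend hol' s0P s1d k0 => hk.
    have t1 : 0 < rho P0 - N (z - s0) by rewrite subr_gt0.
    have [u u0 [n1 n2 _ _ _]] := min_exists5 zin t1 ltr01 ltr01 ltr01.
    by exists u => // q q1 qu; apply: hk => //; apply: le_lt_trans (cN_dist K (q i0) z s0) _; rewrite -ltrBrDr; apply: lt_le_trans qu _.
  have sqz := sq_base_neq0 D.
  have rz : r != 0 by apply: contraNneq sqz => e0; rewrite -rs e0 expr0n.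
  have [hez hbz] := hol' z zd.
  apply: (@kill_transfer _ _ K E lam F _ _ _ _ P0 Q z r) => //; rewrite ?subrr ?cN0 ?rho_gt0 //.
  exact: lt_le_trans lr.
move=> r Q rs; have [h|h] := near_root z r zd rs.
  apply: (main r0 P) => // y0 y0s; have [] := near_root s1 y0 s1d y0s; first by left.
  by rewrite opprK => h'; right; rewrite -opprD cNN.
apply: (main (- r0) P') => //; first by rewrite sqrrN.
move=> y0 y0s; have [] := near_root s1 y0 s1d y0s; last by left.
by move=> h'; right; rewrite opprK addrC cNB.
Qed.
End Lines.

Section Everywhere.
Variables (R : realType) (C : numClosedFieldType) (K : cdata R C) (E lam : C).
Notation j := (jr K).
Notation N := (cN K).
Notation hol := (hol K).
Notation cd := (cd K).
Notation pt := (pt C).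
Notation c1 := (c1 E lam).
Notation sq := (sq E lam).
Notation nve := (nve K E lam).
Notation dom := (dom E lam).
Notation Qf := (Qf E lam).
Variable F : pt -> C -> C.
Hypothesis reps : forall s0 r0, s0 != 0 -> r0 != 0 -> r0 ^+ 2 = sq (base s0) ->
  inhabited (rep K E lam F s0 r0).
Notation good := (@good R C K E lam F).

Lemma good_nve_at s x y : good s x y -> exists e b, [/\ hol e s, hol b s, e s = x & b s = y] /\ killed K E lam F e b s
  /\ Qf s x y = 2.
Proof.
move=> [e [b [d d0 [nv [ex by' Q2 kl]]]]]; exists e, b.
by have [|h1 h2] := nve_hol nv (z := s); first by rewrite subrr cN0.
Qed.

(** By [kill_uniq] the two vectors are proportional, and the quadratic form with the same nonzero
    value forces the factor to be 1 or -1. *)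
Lemma good_uniq s x y x' y' : dom s -> good s x y -> good s x' y' ->
  (x' = x /\ y' = y) \/ (x' = - x /\ y' = - y).
Proof.
move=> D /good_nve_at [e [b [[h1 h2 <- <-] [k Q2]]]] /good_nve_at [e' [b' [[h1' h2' <- <-] [k' Q2']]]].
have sqn := sq_base_neq0 D; pose r := sqrtC (sq (base s)).
have rs : r ^+ 2 = sq (base s) by rewrite sqrtCK.
have rn : r != 0 by rewrite sqrtC_eq0.
have [P] := reps D.1 rn rs.
have sP : N (s - s) < rho P by rewrite subrr cN0 rho_gt0.
have := kill_uniq sP h1 h2 h1' h2' (k r P rs) (k' r P rs).
move: (e s) (b s) (e' s) (b' s) Q2 Q2' => x0 y0 x1 y1; rewrite /Qf => Q Q' pr.
have c0 := D.2; have n2 : (2 : C) != 0 by rewrite pnatr_eq0.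
have [c [ex ey]] : exists c, x1 = c * x0 /\ y1 = c * y0.
  have [x00|x00] := eqVneq x0 0; last first.
    exists (x1 / x0); rewrite divfK //; split=> //.
    apply: (mulfI x00); have -> : x0 * (x1 / x0 * y0) = y0 * x1 by field.
    by apply/eqP; rewrite -subr_eq0 pr.
  have [y00|y00] := eqVneq y0 0.
    by move/eqP: Q; rewrite x00 y00 !expr0n /= !mulr0 !addr0 mul0r eq_sym (negbTE n2).
  move: pr; rewrite x00 mul0r sub0r => /eqP; rewrite oppr_eq0 mulf_eq0 (negbTE y00) /= => /eqP ->.
  by exists (y1 / y0); rewrite mulr0 divfK.
have cc : c ^+ 2 = 1.
  apply: (mulIf n2); rewrite mul1r -{1}Q -[RHS]Q' ex ey; ring.
move/eqP: cc; rewrite -(expr1n _ 2) eqf_sqr => /orP[/eqP e1|/eqP e1]; [left | right];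
  by rewrite ex ey e1 ?mul1r ?mulN1r.
Qed.

Lemma good_seg u u' x y : (forall t : R, 0 <= t <= 1 -> dom (u + j t * (u' - u))) -> good u x y ->
  exists x' y', good u' x' y'.
Proof.
move=> hD gu; pose g (t : R) := u + j t * (u' - u).
have := @chain R (fun a b => (exists x y, good (g a) x y) -> exists x y, good (g b) x y) 0 1 ler01.
rewrite /g rmorph0 rmorph1 mul0r addr0 mul1r [u + _]addrC subrK; apply; last by exists x, y.
  by move=> a b c h1 h2 /h1/h2.
move=> t t01; have [d d0 hd] := good_local reps (hD t t01).
have [e e0 he] := seg_near K u u' d0.
have self : N (u + j t * (u' - u) - (u + j t * (u' - u))) < d by rewrite subrr cN0.
have tr t1 t2 : N (u + j t1 * (u' - u) - (u + j t * (u' - u))) < d ->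
    N (u + j t2 * (u' - u) - (u + j t * (u' - u))) < d ->
    (exists x y, good (u + j t1 * (u' - u)) x y) -> exists x y, good (u + j t2 * (u' - u)) x y.
  move=> n1 n2 [x1 [y1 /(hd _ _ _ n1) [e1 [b1 [_ _ /(_ _ n2) [_ _ k]]]]]].
  by exists (e1 (u + j t2 * (u' - u))), (b1 (u + j t2 * (u' - u))); exact: k.
exists e => //; split=> z /andP[z1 z2] z3; apply: tr => //; apply: he.
  by rewrite ler0_norm; lra.
by rewrite ger0_norm; lra.
Qed.

Lemma avoid (bad : nat -> C -> Prop) : (forall p k k', bad k p -> bad k' p -> k = k') ->
  forall (l : seq C) m, exists2 k, (m <= k)%N & forall p, p \in l -> ~ bad k p.
Proof.
move=> hb; elim=> [|a l ih] m; first by exists m.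
have [[k0 b0]|none] := pselect (exists k0, bad k0 a).
  have [k mk hk] := ih (maxn m k0.+1); exists k; first by apply: leq_trans mk; rewrite leq_maxl.
  move=> p; rewrite in_cons => /orP[/eqP ->|/hk //] b1.
  by have := leq_trans (leq_maxr _ _) mk; rewrite (hb _ _ _ b0 b1) ltnn.
have [k mk hk] := ih m; exists k => // p; rewrite in_cons => /orP[/eqP ->|/hk //] b1.
by apply: none; exists k.
Qed.

Lemma C1E s : (C1 E lam).[s] = c1 s.
Proof. by rewrite /C1 !(hornerD, hornerN, hornerZ, hornerXn, hornerX, hornerC). Qed.

Lemma C1_neq0 : lam != 0 -> C1 E lam != 0.
Proof.
move=> l0; apply/eqP => e; have := congr1 (fun q : {poly C} => q`_3) e.
rewrite /C1 !coefE /= mulr0 subr0 addr0 mulr1 => /eqP.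
by rewrite mulf_eq0 pnatr_eq0 (negbTE l0).
Qed.

Lemma c1_roots : lam != 0 -> exists l : seq C, forall s, c1 s = 0 -> s \in l.
Proof.
move=> /C1_neq0 p0; have [l hl] := closed_field_poly_normal (C1 E lam); exists l => s /eqP.
by rewrite -C1E hl hornerZ mulf_eq0 lead_coef_eq0 (negbTE p0) /= -[_ == 0]/(root _ _) root_prod_XsubC.
Qed.

(** [Qf] of the solution is constant and holomorphic up to [s = 0], where [qr] and [qt] vanish; its
    value there is [4 E / (2 E) = 2]. *)
Lemma good_zero : E != 0 -> exists e b : C -> C, exists2 d : R, 0 < d & [/\ hol e 0, hol b 0, e 0 = 1 &
  forall s, s != 0 -> N s < d -> dom s /\ good s (e s) (b s)].
Proof.
move=> E0; have [e [b [d d0 [he hb e0 h]]]] := kill_zero E0 reps.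
have [d1 d10 h1] := hol_near he; have [d2 d20 h2] := hol_near hb.
have [t t0 [l1 l2 l3 _ _]] := min_exists5 d0 d10 d20 ltr01 ltr01.
exists e, b; exists t => //; split=> // s s0 st; have sd := lt_le_trans st l1.
have [c0 nv k] := h s s0 sd; split; first by split.
have s0' : 0 < N s by rewrite cN_gt0.
have ts : 0 < t - N s by rewrite subr_gt0.
have [u u0 [m1 m2 _ _ _]] := min_exists5 s0' ts ltr01 ltr01 ltr01.
have near z : N (z - s) < u -> z != 0 /\ N z < t.
  move=> zu; split; last by have := cN_tri K (z - s) s; rewrite subrK; lra.
  by apply: contraTneq zu => ->; rewrite sub0r cNN -leNgt.
have nvz z : N (z - s) < u -> nve e b z.
  by move=> /near [z0 zt]; have [] := h z z0 (lt_le_trans zt l1).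
exists e, b; exists u => //; split=> //; split=> //.
pose q z := Qf z (e z) (b z) - Qf s (e s) (b s).
have c00 : c1 0 != 0 by rewrite /c1 expr0n /= !mulr0 subrr add0r mulf_neq0 ?pnatr_eq0.
have hq z : N (z - 0) < t -> hol q z.
  rewrite subr0 => zt; have k1 : hol e z by apply: h1; rewrite subr0; apply: lt_le_trans l2.
  have k2 : hol b z by apply: h2; rewrite subr0; apply: lt_le_trans l3.
  have cz : c1 z != 0.
    by have [->|z0] := eqVneq z 0; last by have [] := h z z0 (lt_le_trans zt l1).
  have hc : hol c1 z by rewrite /c1; hols.
  apply: holB (hol_cst _ _ _); rewrite /Qf; apply: holM (holV hc cz).
  by rewrite /c2 /qr /qt /c2 /qr; hols.
have q0 : q 0 = 0.
  apply: (@ident _ _ K q 0 t s) => //; rewrite ?subr0 ?subrr ?cN0 //.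
  exists u => // z zu; apply/eqP; rewrite subr_eq0; apply/eqP.
  apply: (@const_ball _ _ K (fun z => Qf z (e z) (b z)) s u) => // [y yu|]; last by rewrite subrr cN0.
  have [y0 yt] := near y yu; have [cy _ _] := h y y0 (lt_le_trans yt l1).
  exact: cd_Qf (nvz y yu).
have -> : Qf s (e s) (b s) = Qf 0 (e 0) (b 0) by apply/eqP; rewrite eq_sym -subr_eq0 -/(q 0) q0.
rewrite /Qf e0 /qt /qr /c2 /c1 !expr0n /= !(mulr0, mul0r, subrr, addr0, add0r, subr0, expr1n, mulr1).
by field.
Qed.

(** The point is joined by a segment to a point near 0, where the solution is known. Infinitely many
    segments are available and any two of them meet only at [s], so one avoids 0 and the finitely
    many roots of [C1]. *)
Lemma all_good s : lam != 0 -> E != 0 -> dom s -> exists x y, good s x y.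
Proof.
move=> l0 E0 D; have [s0 cs] := D; have [l hl] := c1_roots l0.
have [e [b [d d0 [_ _ _ hz]]]] := good_zero E0.
pose de := Num.min (1 / 2) (d / (2 * N s)).
have ns : 0 < N s by rewrite cN_gt0.
have de0 : 0 < de by rewrite lt_min !divr_gt0 // mulr_gt0.
have de1 : de <= 1 / 2 by rewrite ge_min lexx.
have de2 : de * N s < d.
  have : de <= d / (2 * N s) by rewrite ge_min lexx orbT.
  by rewrite ler_pdivlMr ?mulr_gt0 //; lra.
(* The endpoints lie on the real line through [i s]: for a point [p] of a segment, the real part of
   [(p - s) / s] gives the parameter, and the imaginary part then gives [k]. *)
pose st (k : nat) : C := s * ('i * j (de / k.+1%:R)).
pose bad k p := p != s /\ exists2 t : R, 0 <= t <= 1 & p = s + j t * (st k - s).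
have hbad p k k' : bad k p -> bad k' p -> k = k'.
  move=> [ps [t t01 e1]] [_ [t' t01' e2]].
  have dir m (x : R) : p = s + j x * (st m - s) -> (p - s) / s = j (- x) + 'i * j (x * (de / m.+1%:R)).
    by move=> ->; rewrite /st rmorphN rmorphM; apply: (mulIf s0); rewrite divfK //; ring.
  have f1 := dir k t e1; have f2 := dir k' t' e2.
  have tt : t = t'.
    have := congr1 (cre K) f1; rewrite f2 !creD !cre_jr !cre_ij; lra.
  have := congr1 (cim K) f1; rewrite f2 !cimD !cim_jr !cim_ij !add0r -tt.
  have t0 : t != 0 by apply: contraNneq ps => t0; rewrite e1 t0 rmorph0 mul0r addr0.
  move=> /(mulfI t0) /(mulfI (lt0r_neq0 de0)) /invr_inj /eqP.
  by rewrite eqr_nat => /eqP [].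
have [k _ hk] := avoid hbad (0 :: l) 0.
have k1 : 1 <= k.+1%:R :> R by rewrite ler1n.
have nst : N (st k) = N s * (de / k.+1%:R).
  by rewrite /st !cNM cN_i mul1r cN_jr gtr0_norm // divr_gt0.
have stz : st k != 0 by rewrite -(cN_gt0 K) nst mulr_gt0 // divr_gt0.
have std : N (st k) < d.
  by rewrite nst mulrC; apply: le_lt_trans de2; rewrite ler_wpM2r ?(ltW ns) // ler_pdivrMr // ler_peMr // ltW.
have [D1 g1] := hz _ stz std.
apply: good_seg g1 => t t01.
have e1 : st k + j t * (s - st k) = s + j (1 - t) * (st k - s) by rewrite rmorphB rmorph1; ring.
have t01' : 0 <= 1 - t <= 1 by move: t01; lra.
rewrite e1; have [->|ns'] := eqVneq (s + j (1 - t) * (st k - s)) s; first exact: D.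
split; apply/eqP => z.
  by apply: (hk 0); [rewrite mem_head | split; [rewrite -z | exists (1 - t)]].
apply: (hk (s + j (1 - t) * (st k - s))); first by rewrite in_cons hl ?orbT.
by split=> //; exists (1 - t).
Qed.
End Everywhere.

(** * Growth and rationality of the square *)

Lemma exp_close (R : realType) (m m' k : R) : `|m' - m| <= k * m -> 0 <= k -> k <= 1 / 2 -> 0 < m ->
  m' <= m * expR (2 * k) /\ m <= m' * expR (2 * k).
Proof.
move=> h k0 k1 m0; have := expR_ge1Dx (2 * k); set y := expR _ => hy.
move: h; rewrite ler_norml => /andP[h1 h2].
split; first by have := ler_wpM2l (ltW m0) hy; lra.
have m'0 : m * (1 - k) <= m' by lra.
have k2 : 0 <= 1 - k by lra.
have p1 : m <= m * (1 - k) * (1 + 2 * k).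
  have : 0 <= m * (k * (1 - 2 * k)) by rewrite mulr_ge0 ?(ltW m0) // mulr_ge0 //; lra.
  by lra.
have p2 : m * (1 - k) * (1 + 2 * k) <= m' * y.
  by apply: ler_pM; rewrite ?mulr_ge0 ?(ltW m0) //; lra.
exact: le_trans p2.
Qed.

Lemma mul_trans (R : realType) (a b c x y : R) : b <= a * x -> c <= b * y -> 0 <= y -> c <= a * (x * y).
Proof. by move=> h h' y0; have := ler_wpM2r y0 h; lra. Qed.

Lemma sum_close (R : realFieldType) (x x' y y' dx dy lx ly h L m : R) : m = x + y ->
  dx <= lx * h + m / 2 * h -> dy <= ly * h + m / 2 * h ->
  x' - x <= dx -> x - x' <= dx -> y' - y <= dy -> y - y' <= dy ->
  lx * h <= L * y * h -> ly * h <= (L * y + L * x) * h ->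
  L * y * h + (L * y + L * x) * h <= 2 * L * h * m ->
  `|x' + y' - m| <= (2 * L + 1) * h * m.
Proof. by rewrite ler_norml => -> *; apply/andP; split; lra. Qed.

Section Growth.
Variables (R : realType) (C : numClosedFieldType) (K : cdata R C) (E lam : C).
Notation j := (jr K).
Notation N := (cN K).
Notation hol := (hol K).
Notation cd := (cd K).
Notation ce := (ce K).
Notation pt := (pt C).
Notation c1 := (c1 E lam).
Notation sq := (sq E lam).
Notation nve := (nve K E lam).
Notation dom := (dom E lam).
Notation Qf := (Qf E lam).
Variable F : pt -> C -> C.
Hypothesis reps : forall s0 r0, s0 != 0 -> r0 != 0 -> r0 ^+ 2 = sq (base s0) ->
  inhabited (rep K E lam F s0 r0).
Notation good := (@good R C K E lam F).
Variables X Z : C -> C.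
Hypothesis gXZ : forall s, dom s -> good s (X s) (Z s).

Lemma good_nz s x y : good s x y -> x != 0 \/ y != 0.
Proof.
move=> [e [b [d d0 [_ [_ _ Q2 _]]]]]; have [x0|x0] := eqVneq x 0; last by left.
right; apply/eqP => y0; move/eqP: Q2; rewrite /Qf x0 y0 !expr0n /= !mulr0 !addr0 mul0r eq_sym.
by rewrite pnatr_eq0.
Qed.

(* The germs are unique up to sign, so locally [X] and [Z] agree with a solution up to sign. *)
Lemma XZ_local s0 : dom s0 -> exists e b, exists2 d : R, 0 < d & forall z, N (z - s0) < d ->
  [/\ dom z, nve e b z & (X z = e z /\ Z z = b z) \/ (X z = - e z /\ Z z = - b z)].
Proof.
move=> D; have [d d0 hd] := good_local reps D.
have [|e [b [_ _ h]]] := hd s0 _ _ _ (gXZ D); first by rewrite subrr cN0.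
exists e, b; exists d => // z zd; have [Dz nv g] := h z zd; split=> //.
exact: (good_uniq reps Dz g (gXZ Dz)).
Qed.

Section Path.
Variables (a u u' : C) (L : R) (om om1 : C -> C).
Let G w := a + ce w.
Let D := N (u' - u).
(** The weight [om] makes the system in [(e, om b)] Fuchsian: it will be 1 at a root of [C1] and [s]
    at infinity. The size ignores the sign of the germ. *)
Definition size_at s := N (X s) + N (om s * Z s).
Hypothesis L0 : 0 <= L.
Hypothesis hG : forall t : R, 0 <= t <= 1 -> let w := u + j t * (u' - u) in let s := G w in
  [/\ dom s, om s != 0, cd om s (om1 s), N (ce w * (3 / 2) / om s) <= L &
     N (ce w * (om1 s / om s - 3 * (E - s) / (s * c1 s))) <= L /\
     N (ce w * (18 * om s / (s * c1 s))) <= L].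

(** Gronwall's inequality in the logarithmic variable [w], where the coefficients are bounded by
    [L]. The estimate is carried in both directions so that [chain] can use points on either side;
    [exp_close] accounts for the factor 2. *)
Lemma growth : size_at (G u') <= size_at (G u) * expR (2 * (2 * L + 1) * D).
Proof.
pose ka := 2 * (2 * L + 1) * D.
pose g (t : R) := G (u + j t * (u' - u)).
have D0 : 0 <= D by exact: cN_ge0.
have ka0 : 0 <= ka by rewrite !mulr_ge0 // addr_ge0 // mulr_ge0.
have := @chain R (fun x y => size_at (g y) <= size_at (g x) * expR (ka * (y - x)) /\
  size_at (g x) <= size_at (g y) * expR (ka * (y - x))) 0 1 ler01.
rewrite /g rmorph0 rmorph1 mul0r addr0 mul1r [u + _]addrC !subrK subr0 mulr1 => -[]; last by [].
  move=> x y z [h1 h2] [h3 h4].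
  have -> : ka * (z - x) = ka * (y - x) + ka * (z - y) by ring.
  rewrite expRD; split.
    exact: mul_trans h1 h3 (expR_ge0 _).
  by rewrite [expR _ * _]mulrC; apply: mul_trans h4 h2 (expR_ge0 _).
move=> t t01; have [Dt omn homt b1 [b2 b3]] := hG t01.
move: b1 b2 b3 Dt omn homt; set w := u + j t * (u' - u); set s := G w => b1 b2 b3 Dt omn homt.
have [e [b [d d0 hd]]] := XZ_local Dt.
pose x w := e (G w); pose y w := om (G w) * b (G w).
have [|_ [he hb] _] := hd s; first by rewrite subrr cN0.
have hGw : cd G w (ce w).
  by apply: cd_eq (cdD (cd_cst K a w) (cd_ce K w)); rewrite add0r.
have hx : cd x w (ce w * (3 / 2) / om s * y w).
  by apply: cd_eq (cd_comp hGw he); rewrite /y -/s; field.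
have s0 : s * c1 s != 0 by rewrite mulf_neq0; case: Dt.
have hy : cd y w (ce w * (om1 s / om s - 3 * (E - s) / (s * c1 s)) * y w - ce w * (18 * om s / (s * c1 s)) * x w).
  apply: cd_eq (cdM (cd_comp hGw homt) (cd_comp hGw hb)); rewrite /y /x -/s.
  by move: s0 => /[dup]; rewrite {1}mulf_eq0 negb_or => /andP[s0 c0] sc0; field; rewrite omn s0 c0.
pose m := N (x w) + N (y w).
have [dd dd0 same] : exists2 dd : R, 0 < dd & forall w', N (w' - w) < dd -> size_at (G w') = N (x w') + N (y w').
  have d20 : 0 < d / 2 by rewrite divr_gt0.
  have [d1 d10 h1] := cd_cont hGw d20; exists d1 => // w' /h1 h.
  have [|_ _ k] := hd (G w'); first by move: h d0; rewrite -/s; lra.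
  by rewrite /size_at /x /y; case: k => [[-> ->]|[-> ->]] //; rewrite mulrN !cNN.
have mE : size_at s = m by apply: same; rewrite subrr cN0.
have m0 : 0 < m.
  rewrite -mE /size_at; have := good_nz (gXZ Dt) => -[nz|nz].
    by rewrite ltr_wpDr ?cN_ge0 // cN_gt0.
  by rewrite ltr_wpDl ?cN_ge0 // cN_gt0 mulf_neq0.
have m20 : 0 < m / 2 by rewrite divr_gt0.
have [t1 t10 k1] := (cdP K x w _).1 hx _ m20; have [t2 t20 k2] := (cdP K y w _).1 hy _ m20.
set lx := _ / om s * y w in k1 hx; set ly := _ - _ in k2 hy.
have blx : N lx <= L * N (y w) by rewrite /lx cNM ler_wpM2r ?cN_ge0.
have bly : N ly <= L * N (y w) + L * N (x w).
  by apply: le_trans (cN_triB _ _ _) _; rewrite !cNM -!cNM lerD // cNM ler_wpM2r ?cN_ge0.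
have Lx : 0 <= L * N (x w) by rewrite mulr_ge0 ?cN_ge0.
have key w' : N (w' - w) < t1 -> N (w' - w) < t2 ->
    `|(N (x w') + N (y w')) - m| <= (2 * L + 1) * N (w' - w) * m.
  move=> /k1 q1 /k2 q2; set h := N (w' - w) in q1 q2 *.
  have h0 : 0 <= h := cN_ge0 _ _.
  have e1 (f l : C) : N (f - l * (w' - w)) <= m / 2 * h -> N f <= N l * h + m / 2 * h.
    move=> q; rewrite -[f](subrK (l * (w' - w))); apply: le_trans (cN_tri _ _ _) _.
    by rewrite cNM addrC lerD2l.
  have q1' := e1 _ _ q1; have q2' := e1 _ _ q2.
  have n1 := cN_low K (x w') (x w); have n1' := cN_low K (x w) (x w').
  have n2 := cN_low K (y w') (y w); have n2' := cN_low K (y w) (y w').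
  rewrite cNB in n1' ; rewrite cNB in n2'.
  have B1 := ler_wpM2r h0 blx; have B2 := ler_wpM2r h0 bly.
  have LL : (L * N (y w) * h + (L * N (y w) + L * N (x w)) * h) <= 2 * L * h * m.
    by rewrite /m; have := mulr_ge0 Lx h0; lra.
  exact: sum_close (erefl m) q1' q2' n1 n1' n2 n2' B1 B2 LL.
have Dp : 0 < (2 * L + 1) * (D + 1).
  by rewrite mulr_gt0 // ltr_wpDl // mulr_ge0.
have hlf : 0 < 1 / 2 / ((2 * L + 1) * (D + 1)) by rewrite !divr_gt0.
have [r r0 [l1 l2 l3 _ _]] := min_exists5 dd0 t10 t20 ltr01 ltr01.
have [ep ep0 near] := seg_near K u u' r0.
have [ep' ep'0 [l4 l5 _ _ _]] := min_exists5 ep0 hlf ltr01 ltr01 ltr01.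
have rel z : `|z - t| < ep' -> size_at (g z) <= size_at s * expR (ka * `|z - t|) /\
    size_at s <= size_at (g z) * expR (ka * `|z - t|).
  move=> zt; have nr := near t z (lt_le_trans zt l4); rewrite -/w in nr.
  rewrite /g same ?mE; last exact: lt_le_trans l1.
  have := key _ (lt_le_trans nr l2) (lt_le_trans nr l3).
  have -> : N (u + j z * (u' - u) - w) = `|z - t| * D.
    by rewrite /w opprD addrACA subrr add0r -mulrBl -rmorphB cNM cN_jr.
  move=> k; have -> : ka * `|z - t| = 2 * ((2 * L + 1) * (`|z - t| * D)) by rewrite /ka; ring.
  apply: exp_close => //; first by rewrite !mulr_ge0 // addr_ge0 // mulr_ge0.
  have := lt_le_trans zt l5; rewrite ltr_pdivlMr //.
  by have a0 := normr_ge0 (z - t); have := mulr_ge0 L0 a0; lra.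
exists ep' => //; split=> z /andP[z1 z2] z3.
  have zz : `|z - t| = t - z by rewrite ler0_norm ?opprB // subr_le0.
  by have := rel z; rewrite zz => -[]; [by rewrite ltrBlDl -ltrBlDr | split].
have zz : `|z - t| = z - t by rewrite ger0_norm ?subr_ge0.
by have := rel z; rewrite zz => -[]; [by rewrite ltrBlDl | split].
Qed.
End Path.
End Growth.

(** * Polynomial growth at the roots of [C1] and at infinity *)

Section Bounds.
Variables (R : realType) (C : numClosedFieldType) (K : cdata R C) (E lam : C).
Notation j := (jr K).
Notation N := (cN K).
Notation hol := (hol K).
Notation cd := (cd K).
Notation ce := (ce K).
Notation pt := (pt C).
Notation c1 := (c1 E lam).
Notation sq := (sq E lam).
Notation dom := (dom E lam).
Variable F : pt -> C -> C.
Hypothesis reps : forall s0 r0, s0 != 0 -> r0 != 0 -> r0 ^+ 2 = sq (base s0) ->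
  inhabited (rep K E lam F s0 r0).
Notation good := (@good R C K E lam F).
Variables X Z : C -> C.
Hypothesis gXZ : forall s, dom s -> good s (X s) (Z s).

Lemma N_ce_seg u u' (t : R) : 0 <= t <= 1 ->
  Num.min (N (ce u)) (N (ce u')) <= N (ce (u + j t * (u' - u))) <= Num.max (N (ce u)) (N (ce u')).
Proof.
move=> /andP[t0 t1]; have -> : u + j t * (u' - u) = j (1 - t) * u + j t * u'.
  by rewrite rmorphB rmorph1; ring.
have cre_jM (x : R) z : cre K (j x * z) = x * cre K z.
  by rewrite {1}(c_rect K z) mulrDr -rmorphM mulrCA -rmorphM creD cre_jr cre_ij addr0.
rewrite !N_ce creD !cre_jM le_max ge_min !ler_expR.
by have [h|h] := leP (cre K u) (cre K u'); apply/andP; split; apply/orP; nra.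
Qed.

Lemma exp_pow (k x y : R) (n : nat) : 0 <= k -> k <= n%:R -> 0 < y -> y <= 1 ->
  x <= `|ln y| -> expR (k * x) <= (y ^+ n)^-1.
Proof.
move=> k0 kn y0 y1 xy; have l0 : ln y <= 0 by rewrite ln_le0.
rewrite ler0_norm // in xy.
have -> : (y ^+ n)^-1 = expR (n%:R * - ln y) by rewrite expRM_natl expRN lnK ?posrE // exprVn.
rewrite ler_expR; apply: le_trans (ler_wpM2l k0 xy) _.
by rewrite ler_wpM2r // oppr_ge0.
Qed.

Lemma exp_pow2 (k x c y : R) (n : nat) : 0 <= k -> k <= n%:R -> 0 < y -> y <= 1 ->
  x <= `|ln y| + c -> expR (k * x) <= expR (k * c) * (y ^+ n)^-1.
Proof.
move=> k0 kn y0 y1 xy; have -> : k * x = k * c + k * (x - c) by ring.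
rewrite expRD ler_wpM2l ?expR_ge0 // exp_pow //; lra.
Qed.

Lemma nat_above (x : R) : exists n : nat, x <= n%:R.
Proof. by exists (Num.bound `|x|); apply: le_trans (ler_norm x) (ltW (archi_boundP (normr_ge0 x))). Qed.

(** With [t = exp w] the path from a fixed [u] to a logarithm of [t] has length at most [|ln N t|]
    plus a constant, and exponential growth in this length is a power of [N t]. *)
Lemma root_bound p : p != 0 -> c1 p = 0 -> 12 * lam * p ^+ 2 - 3 != 0 ->
  exists n (B : R), exists2 d : R, 0 < d & forall t, t != 0 -> N t < d ->
    dom (p + t) /\ N (X (p + t)) <= B * (N t ^+ n)^-1.
Proof.
move=> p0 cp0 cp'.
(* Quotient of [c1 (p + t)] by [t]; it is nonzero at 0 because the root is simple. *)
pose dd t := 12 * lam * p ^+ 2 - 3 + 12 * lam * p * t + 4 * lam * t ^+ 2.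
have cE t : c1 (p + t) = t * dd t.
  by rewrite -[LHS]subr0 -cp0 /c1 /dd; ring.
have hdd : hol dd 0 by rewrite /dd; hols.
have dd0 : dd 0 != 0 by rewrite /dd expr0n /= !mulr0 !addr0.
pose f2 t := 3 * (E - (p + t)) / ((p + t) * dd t).
pose f3 t := 18 / ((p + t) * dd t).
have nz0 : (p + 0) * dd 0 != 0 by rewrite addr0 mulf_neq0.
have hV : hol (fun t => ((p + t) * dd t)^-1) 0 by apply: holV => //; hols.
have h2 : hol f2 0 by apply: holM hV; hols.
have h3 : hol f3 0 by apply: holM hV; hols.
have [e2 e20 b2] := cont_bdd (hol_cont h2).
have [e3 e30 b3] := cont_bdd (hol_cont h3).
have [e4 e40 b4] := cont_nz (hol_cont (holM (holD (hol_cst K p 0) (hol_id K 0)) hdd)) nz0.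
have [d d0 [l2 l3 l4 l1 _]] := min_exists5 e20 e30 e40 (ltr01 : 0 < (1 : R)) ltr01.
have nz t : N t < d -> (p + t) * dd t != 0.
  move=> td; rewrite -(cN_gt0 K); apply: lt_le_trans (b4 t _); first by rewrite divr_gt0 // cN_gt0.
  by rewrite subr0; apply: lt_le_trans l4.
have nzd t : t != 0 -> N t < d -> dom (p + t).
  move=> t0 /nz; rewrite mulf_eq0 negb_or => /andP[h1 h2']; split=> //.
  by rewrite cE mulf_neq0.
pose L := 3 / 2 + (N (f2 0) + 1) + (N (f3 0) + 1).
have [F2 F3] : 0 <= N (f2 0) /\ 0 <= N (f3 0) by split; apply: cN_ge0.
have L0 : 0 <= L by rewrite /L; lra.
have b0 : j (d / 2) != 0 by rewrite -(cN_gt0 K) cN_jr gtr0_norm divr_gt0.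
have [u eu _] := ce_onto K b0.
have Nu : N (ce u) < d by rewrite eu cN_jr gtr0_norm ?divr_gt0 //; move: d0; lra.
pose k := 2 * (2 * L + 1); have k0 : 0 <= k by rewrite /k; lra.
have [n kn] := nat_above k.
pose sz := size_at K X Z (fun=> 1).
exists n, (sz (p + ce u) * expR (k * (pi + N u))); exists d => // t t0 td; split; first exact: nzd.
have [w ew Nw] := ce_onto K t0.
have gr : sz (p + ce w) <= sz (p + ce u) * expR (k * N (w - u)).
  apply: (growth reps gXZ (om1 := fun=> 0) L0) => x x01; have /andP[_] := N_ce_seg u w x01.
  set w' := u + _; rewrite ew => le_m; have wd : N (ce w') < d.
    by apply: le_lt_trans le_m _; rewrite gt_max Nu td.
  have w'0 := ce_neq0 K w'; have nzw := nz _ wd.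
  have [pw dw] : p + ce w' != 0 /\ dd (ce w') != 0 by move: nzw; rewrite mulf_eq0 negb_or => /andP[].
  cbv zeta; split; first exact: nzd.
  - exact: oner_neq0.
  - exact: cd_cst.
  - rewrite divr1 cNM.
    have -> : N (3 / 2) = 3 / 2 by rewrite cNM cNV !cN_nat.
    by rewrite /L; have := lt_le_trans wd l1; have := cN_ge0 K (ce w'); lra.
  split.
    have -> : ce w' * (0 / 1 - 3 * (E - (p + ce w')) / ((p + ce w') * c1 (p + ce w'))) = - f2 (ce w').
      by rewrite cE /f2; field; rewrite pw dw w'0.
    rewrite cNN; apply: le_trans (b2 _ _) _; first by rewrite subr0; apply: lt_le_trans l2.
    by rewrite /L; lra.
  have -> : ce w' * (18 * 1 / ((p + ce w') * c1 (p + ce w'))) = f3 (ce w').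
    by rewrite cE /f3; field; rewrite pw dw w'0.
  apply: le_trans (b3 _ _) _; first by rewrite subr0; apply: lt_le_trans l3.
  by rewrite /L; lra.
have s0 : 0 <= sz (p + ce u) by rewrite addr_ge0 ?cN_ge0.
rewrite -ew; apply: le_trans (_ : sz (p + ce w) <= _); first by rewrite /sz /size_at lerDl cN_ge0.
apply: le_trans gr _; rewrite -mulrA ler_wpM2l // ew.
apply: exp_pow2 => //; rewrite ?cN_gt0 //.
  exact: ltW (lt_le_trans td l1).
by apply: le_trans (cN_triB K w u) _; rewrite addrA lerD2r.
Qed.

(** The same argument in [v = 1 / s]; [kk v] is [v^3 c1 (1 / v)], nonzero at [v = 0] because [lam]
    is. *)
Lemma inf_bound : lam != 0 -> exists n (B : R), exists2 r : R, 0 < r & forall s, r < N s ->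
    dom s /\ N (X s) <= B * N s ^+ n.
Proof.
move=> lam0; pose kk v := 4 * lam - 3 * v ^+ 2 + 2 * E * v ^+ 3.
have cE v : v != 0 -> c1 v^-1 = kk v / v ^+ 3 by move=> v0; rewrite /c1 /kk; field.
have hk : hol kk 0 by rewrite /kk; hols.
have k0 : kk 0 != 0 by rewrite /kk !expr0n /= !mulr0 subr0 addr0 mulf_neq0 // pnatr_eq0.
pose f2 v := 1 - 3 * (E * v - 1) * v ^+ 2 / kk v.
pose f3 v := 18 * v ^+ 2 / kk v.
have hV : hol (fun v => (kk v)^-1) 0 by apply: holV hk k0.
have h2 : hol f2 0 by apply: holB (hol_cst _ _ _) _; apply: holM hV; hols.
have h3 : hol f3 0 by apply: holM hV; hols.
have [e2 e20 b2] := cont_bdd (hol_cont h2).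
have [e3 e30 b3] := cont_bdd (hol_cont h3).
have [e4 e40 b4] := cont_nz (hol_cont hk) k0.
have [d d0 [l2 l3 l4 l1 _]] := min_exists5 e20 e30 e40 (ltr01 : 0 < (1 : R)) ltr01.
have inv s : d^-1 < N s -> s != 0 /\ N s^-1 < d.
  move=> sd; have s0 : 0 < N s by apply: lt_trans sd; rewrite invr_gt0.
  by split; [rewrite -(cN_gt0 K) | rewrite cNV -[ltRHS]invrK ltf_pV2 ?posrE ?invr_gt0].
have nz v : N v < d -> kk v != 0.
  move=> vd; rewrite -(cN_gt0 K); apply: lt_le_trans (b4 v _); first by rewrite divr_gt0 // cN_gt0.
  by rewrite subr0; apply: lt_le_trans l4.
have nzd s : d^-1 < N s -> dom s.
  move=> /inv [s0 sd]; split=> //; have v0 : s^-1 != 0 by rewrite invr_eq0.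
  by rewrite -[s]invrK (cE _ v0) mulf_neq0 ?nz // invr_eq0 expf_neq0.
pose L := 3 / 2 + (N (f2 0) + 1) + (N (f3 0) + 1).
have [F2 F3] : 0 <= N (f2 0) /\ 0 <= N (f3 0) by split; apply: cN_ge0.
have L0 : 0 <= L by rewrite /L; lra.
have dV : 0 < d^-1 by rewrite invr_gt0.
have b0 : j (2 * d^-1) != 0 by rewrite -(cN_gt0 K) cN_jr gtr0_norm mulr_gt0.
have [u eu _] := ce_onto K b0.
have Nu : d^-1 < N (ce u) by rewrite eu cN_jr gtr0_norm ?mulr_gt0 //; move: dV; lra.
pose k := 2 * (2 * L + 1); have k00 : 0 <= k by rewrite /k; lra.
have [n kn] := nat_above k.
pose sz := size_at K X Z id.
exists n, (sz (0 + ce u) * expR (k * (pi + N u))); exists d^-1 => // s sd; split; first exact: nzd.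
have [s0 vd] := inv s sd; have [w ew Nw] := ce_onto K s0.
have gr : sz (0 + ce w) <= sz (0 + ce u) * expR (k * N (w - u)).
  apply: (growth reps gXZ (om1 := fun=> 1) L0) => x x01; have /andP[+ _] := N_ce_seg u w x01.
  set w' := u + _; rewrite ew => le_m; have wd : d^-1 < N (ce w').
    by apply: lt_le_trans le_m; rewrite lt_min Nu sd.
  have [w'0 vd'] := inv _ wd; have kz := nz _ vd'.
  have v0 : (ce w')^-1 != 0 by rewrite invr_eq0.
  have c1E : c1 (ce w') = kk (ce w')^-1 * ce w' ^+ 3 by rewrite -[in LHS](invrK (ce w')) (cE _ v0) exprVn invrK.
  cbv zeta beta; rewrite add0r; split; first exact: nzd.
  - by [].
  - exact: cd_id.
  - rewrite mulrC mulKf //.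
    have -> : N (3 / 2) = 3 / 2 by rewrite cNM cNV !cN_nat.
    by rewrite /L; lra.
  split.
    have -> : ce w' * (1 / ce w' - 3 * (E - ce w') / (ce w' * c1 (ce w'))) = f2 (ce w')^-1.
      by rewrite c1E /f2; move: (kk _) kz => y y0; field; rewrite y0 w'0.
    apply: le_trans (b2 _ _) _; first by rewrite subr0; apply: lt_le_trans l2.
    by rewrite /L; lra.
  have -> : ce w' * (18 * ce w' / (ce w' * c1 (ce w'))) = f3 (ce w')^-1.
    by rewrite c1E /f3; move: (kk _) kz => y y0; field; rewrite y0 w'0.
  apply: le_trans (b3 _ _) _; first by rewrite subr0; apply: lt_le_trans l3.
  by rewrite /L; lra.
have sz0 : 0 <= sz (0 + ce u) by rewrite addr_ge0 ?cN_ge0.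
rewrite -ew -[ce w]add0r; apply: le_trans (_ : sz (0 + ce w) <= _); first by rewrite /sz /size_at lerDl cN_ge0.
apply: le_trans gr _; rewrite -mulrA ler_wpM2l // add0r ew.
have -> : N s ^+ n = ((N s^-1) ^+ n)^-1 by rewrite cNV exprVn invrK.
apply: exp_pow2 => //; rewrite ?cN_gt0 ?invr_eq0 //.
  exact: ltW (lt_le_trans vd l1).
have -> : `|ln (N s^-1)| = `|ln (N s)| by rewrite cNV lnV ?posrE ?cN_gt0 // normrN.
by apply: le_trans (cN_triB K w u) _; rewrite addrA lerD2r.
Qed.
End Bounds.

(** * Liouville's theorem *)

Section Liouville.
Variables (R : realType) (C : numClosedFieldType) (K : cdata R C).
Notation N := (cN K).
Notation hol := (hol K).
Notation cd := (cd K).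

Lemma liouville h (A r : R) : (forall z, hol h z) -> 0 <= A -> 0 < r ->
  (forall z, r < N z -> N (h z) <= A) -> forall z, h z = h 0.
Proof.
move=> hh A0 r0 hA z; rewrite (dqE K h z) -[RHS]addr0; congr (_ + _).
suff -> : dq K h z = 0 by rewrite mulr0.
have B0 : 0 <= A + N (h 0) by rewrite addr_ge0 ?cN_ge0.
apply: (@small_eq0 _ _ K _ (A + N (h 0))) => e e0.
pose p := N z + (r + e^-1).
have ei : 0 < e^-1 by rewrite invr_gt0.
have zp : N z < p by rewrite /p ltrDl addr_gt0.
have p0 : 0 < p by apply: le_lt_trans zp; apply: cN_ge0.
have rp : r < p by rewrite /p; have := cN_ge0 K z; lra.
have ent y : N (y - 0) <= p -> exists l, cd (dq K h) y l by move=> _; apply: hol_cd; apply: hol_dq.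
have bd y : N y = p -> N (dq K h (0 + y)) <= (A + N (h 0)) / p.
  move=> yp; rewrite add0r; have y0 : y != 0 by rewrite -(cN_gt0 K) yp.
  rewrite /dq (negbTE y0) cNM cNV yp ler_wpM2r ?invr_ge0 ?(ltW p0) //.
  by apply: le_trans (cN_triB _ _ _) _; rewrite lerD2r hA // yp.
have := mv_bound zp ent bd; rewrite add0r => le1; apply: le_trans le1 _; rewrite -mulrA ler_wpM2l // mulKf ?gt_eqF // /p addrAC subrr add0r.
rewrite -[leRHS]invrK lef_pV2 ?posrE ?addr_gt0 // lerDr ltW //.
Qed.

(** The divided difference at 0 is entire and grows with an exponent smaller by one. *)
Lemma liouville_poly M h (A r : R) : (forall z, hol h z) -> 0 <= A -> 0 < r ->
  (forall z, r < N z -> N (h z) <= A * N z ^+ M) -> exists g : {poly C}, forall z, h z = g.[z].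
Proof.
elim: M h A r => [|M ih] h A r hh A0 r0 hA.
  exists (h 0)%:P => z; rewrite hornerC; apply: (liouville hh A0 r0) => y /hA.
  by rewrite expr0 mulr1.
have A'0 : 0 <= A + N (h 0) by rewrite addr_ge0 ?cN_ge0.
have r'0 : 0 < r + 1 by rewrite addr_gt0.
have [z|z rz|g hg] := ih (dq K h) (A + N (h 0)) (r + 1) _ A'0 r'0.
- exact: hol_dq.
- have z1 : 1 <= N z by move: rz r0; lra.
  have z0' : 0 < N z by apply: lt_le_trans z1.
  have z0 : z != 0 by rewrite -(cN_gt0 K).
  rewrite /dq (negbTE z0) cNM cNV ler_pdivrMr // -mulrA -exprSr mulrDl.
  apply: le_trans (cN_triB _ _ _) _; apply: lerD; first by apply: hA; move: rz; lra.
  by rewrite ler_peMr ?cN_ge0 // exprn_ege1.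
by exists ((h 0)%:P + 'X * g) => z; rewrite hornerD hornerM hornerX hornerC -hg -dqE.
Qed.
End Liouville.

(** * The square of the solution times a power of [C1] is a polynomial *)

Section Entire.
Variables (R : realType) (C : numClosedFieldType) (K : cdata R C) (E lam : C).
Notation j := (jr K).
Notation N := (cN K).
Notation hol := (hol K).
Notation cd := (cd K).
Notation pt := (pt C).
Notation c1 := (c1 E lam).
Notation sq := (sq E lam).
Notation dom := (dom E lam).
Variable F : pt -> C -> C.
Hypothesis reps : forall s0 r0, s0 != 0 -> r0 != 0 -> r0 ^+ 2 = sq (base s0) ->
  inhabited (rep K E lam F s0 r0).
Notation good := (@good R C K E lam F).
Variables X Z : C -> C.
Hypothesis gXZ : forall s, dom s -> good s (X s) (Z s).
Hypothesis E0 : E != 0.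
Hypothesis lam0 : lam != 0.
Hypothesis El : 4 * E ^+ 2 * lam != 1.

Lemma c1_at0 : c1 0 = 2 * E.
Proof. by rewrite /c1 expr0n /= !mulr0 subrr add0r. Qed.

(** [2 p - 2 E] is a combination of [c1 p] and its derivative, so a double root would be [E], which
    requires [4 E^2 lam = 1]. *)
Lemma root_simple p : c1 p = 0 -> p != 0 /\ 12 * lam * p ^+ 2 - 3 != 0.
Proof.
move=> cp; have n2 : (2 : C) != 0 by rewrite pnatr_eq0.
have p0 : p != 0.
  by apply/eqP => p00; move/eqP: cp; rewrite p00 c1_at0 mulf_eq0 (negbTE n2) (negbTE E0).
split=> //; apply: contraNneq El => e.
have pE : p = E.
  have h : 2 * p - 2 * E = p / 3 * (12 * lam * p ^+ 2 - 3) - c1 p by rewrite /c1; field.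
  by apply: (mulfI n2); apply/eqP; rewrite -subr_eq0 h e cp mulr0 subr0.
have n3 : (3 : C) != 0 by rewrite pnatr_eq0.
apply/eqP; apply: (mulfI n3); rewrite -pE mulr1.
by apply/eqP; rewrite -subr_eq0; apply/eqP; rewrite -e; ring.
Qed.

Lemma weaken (B t : R) (n m : nat) : 0 <= B -> 0 < t -> t <= 1 -> (n <= m)%N ->
  B * (t ^+ n)^-1 <= B * (t ^+ m)^-1.
Proof.
move=> B0 t0 t1 nm; rewrite ler_wpM2l // lef_pV2 ?posrE ?exprn_gt0 //.
by apply: ler_wiXn2l => //; exact: ltW.
Qed.

Definition bounded_at n p := exists B, exists2 d : R, 0 < d & forall t, t != 0 -> N t < d ->
  dom (p + t) /\ N (X (p + t)) <= B * (N t ^+ n)^-1.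

Lemma uniform_bound : exists n, forall p, c1 p = 0 -> bounded_at n p.
Proof.
have [l hl] := c1_roots E lam0.
suff [n hn] : exists n, forall p, p \in l -> c1 p = 0 -> bounded_at n p.
  by exists n => p cp; apply: hn => //; apply: hl.
elim: l {hl} => [|a l [n hn]]; first by exists 0%N.
have up n1 n2 p : (n1 <= n2)%N -> bounded_at n1 p -> bounded_at n2 p.
  move=> le [B [d d0 h]]; have [d' d'0 [l1 l2 _ _ _]] := min_exists5 d0 (ltr01 : 0 < (1 : R)) ltr01 ltr01 ltr01.
  exists B; exists d' => // t t0 td; have [D b] := h t t0 (lt_le_trans td l1); split=> //.
  have nt : 0 < N t by rewrite cN_gt0.
  apply: le_trans b _; apply: weaken => //; last exact: ltW (lt_le_trans td l2).
  have [_ b] := h t t0 (lt_le_trans td l1).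
  have := le_trans (cN_ge0 K _) b; rewrite pmulr_lge0 // invr_gt0 exprn_gt0 //.
have [ca|/eqP ca] := eqVneq (c1 a) 0; last first.
  exists n => p; rewrite in_cons => /orP[/eqP -> e|/hn //]; by case: ca.
have [a0 ca'] := root_simple ca.
have [m [B [d d0 h]]] := root_bound reps gXZ a0 ca ca'.
exists (maxn n m) => p; rewrite in_cons => /orP[/eqP -> _|pl cp].
  by apply: (up m); [rewrite leq_maxr | exists B; exists d].
by apply: (up n); [rewrite leq_maxl | apply: hn].
Qed.

(** The singularities are filled in: 0 at the roots of [C1], and at [s = 0] the value prescribed by
    the regular solution, which is 1 there. *)
Definition entire k s := if c1 s == 0 then 0 else if s == 0 then c1 0 ^+ k else c1 s ^+ k * X s ^+ 2.

Lemma entire_dom k s : dom s -> entire k s = c1 s ^+ k * X s ^+ 2.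
Proof. by move=> [s0 c0]; rewrite /entire (negbTE s0) (negbTE c0). Qed.

Lemma pow_bound (B K1 x t c : R) (n : nat) : 0 < t -> 0 <= K1 -> 0 <= x -> 0 <= c -> x <= B * (t ^+ n)^-1 ->
  c <= K1 * t -> c ^+ (n + n + 2) * x ^+ 2 <= K1 ^+ (n + n + 2) * B ^+ 2 * t ^+ 2.
Proof.
move=> t0 K0 x0 c0 hx hc; have tn : t ^+ n != 0 by rewrite expf_neq0 // gt_eqF.
have -> : K1 ^+ (n + n + 2) * B ^+ 2 * t ^+ 2 = (K1 * t) ^+ (n + n + 2) * (B * (t ^+ n)^-1) ^+ 2.
  by rewrite !exprMn !exprD; move: (t ^+ n) tn => y y0; field.
have h1 : c ^+ (n + n + 2) <= (K1 * t) ^+ (n + n + 2) by apply: lerXn2r => //; rewrite nnegrE // mulr_ge0 // ltW.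
have h2 : x ^+ 2 <= (B * (t ^+ n)^-1) ^+ 2 by apply: lerXn2r => //; rewrite nnegrE // (le_trans x0).
by apply: ler_pM => //; rewrite exprn_ge0.
Qed.

Lemma pow_bound2 (B K1 x t c : R) (n k : nat) : 0 <= t -> 0 <= K1 -> 0 <= x -> 0 <= c -> x <= B * t ^+ n ->
  c <= K1 * t ^+ 3 -> c ^+ k * x ^+ 2 <= K1 ^+ k * B ^+ 2 * t ^+ (3 * k + (n + n)).
Proof.
move=> t0 K0 x0 c0 hx hc.
have -> : K1 ^+ k * B ^+ 2 * t ^+ (3 * k + (n + n)) = (K1 * t ^+ 3) ^+ k * (B * t ^+ n) ^+ 2.
  rewrite (exprD t (3 * k)) (exprD t n n) exprM (exprMn k K1) (exprMn 2 B); move: ((t ^+ 3) ^+ k) => y; ring.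
have h1 : c ^+ k <= (K1 * t ^+ 3) ^+ k by apply: lerXn2r => //; rewrite nnegrE // mulr_ge0 // exprn_ge0.
have h2 : x ^+ 2 <= (B * t ^+ n) ^+ 2 by apply: lerXn2r => //; rewrite nnegrE // (le_trans x0).
by apply: ler_pM => //; rewrite exprn_ge0.
Qed.

(** With exponent [2 n + 2] the function is [O(t^2)] at the root, hence differentiable there with
    derivative 0. *)
Lemma entire_at_root n p : c1 p = 0 -> bounded_at n p -> cd (entire (n + n + 2)) p 0.
Proof.
move=> cp [B [d d0 h]]; apply/cdP => e e0.
have [d1 d10 h1] := (cdP K c1 p _).1 (cd_c1 K E lam p) 1 ltr01.
set l := _ - _ in h1; pose K1 := N l + 1; have K0 : 0 <= K1 by rewrite addr_ge0 ?cN_ge0.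
pose A := K1 ^+ (n + n + 2) * B ^+ 2.
have A0 : 0 <= A by apply: mulr_ge0 (sqr_ge0 B); rewrite exprn_ge0.
have A1 : 0 < e / (A + 1) by rewrite divr_gt0 // ltr_wpDl.
have [d2 d20 [l1 l2 l3 _ _]] := min_exists5 d0 d10 A1 ltr01 ltr01.
exists d2 => // s sd; have Hp : entire (n + n + 2) p = 0 by rewrite /entire cp eqxx.
rewrite Hp mul0r !subr0; have [->|sp] := eqVneq s p; first by rewrite Hp subrr cN0 mulr0.
pose t := s - p; have t0 : t != 0 by rewrite subr_eq0.
have td : N t < d by apply: lt_le_trans l1.
have [] := h t t0 td; rewrite (_ : p + t = s); last by rewrite /t; ring.
move=> Ds Xs; have nt : 0 < N t by rewrite cN_gt0.
have cs : N (c1 s) <= K1 * N t.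
  have := h1 s (lt_le_trans sd l2); rewrite cp subr0 mul1r -/t => k1.
  have := cN_tri K (c1 s - l * t) (l * t); rewrite subrK cNM /K1; lra.
rewrite (entire_dom _ Ds) cNM !cNX; apply: le_trans (pow_bound nt K0 _ _ Xs cs) _; rewrite ?cN_ge0 //.
rewrite -/A expr2 mulrA -/t; have := lt_le_trans sd l3; rewrite -/t ltr_pdivlMr ?ltr_wpDl // => sA.
rewrite ler_wpM2r ?cN_ge0 //; lra.
Qed.

Lemma entire_hol : exists k, (forall s, hol (entire k) s) /\ exists n, k = (n + n + 2)%N.
Proof.
have [n hn] := uniform_bound; exists (n + n + 2)%N; split; last by exists n.
set k := (n + n + 2)%N; suff h s : exists l, cd (entire k) s l by move=> s; exists 1.
have hc s' : hol c1 s' by rewrite /c1; hols.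
have sq_sgn (x y z t : C) : (x = y /\ z = t) \/ (x = - y /\ z = - t) -> x ^+ 2 = y ^+ 2 :> C.
  by case=> -[-> _] //; rewrite sqrrN.
have [c0|c0] := eqVneq (c1 s) 0; first by exists 0; apply: entire_at_root (hn s c0).
have [->|s0] := eqVneq s 0.
  have [e [b [d d0 [he hb e0 h]]]] := good_zero reps E0.
  have [l hl] := hol_cd (holM (holX k (hc 0)) (holX 2 he)).
  exists l; apply: cd_ext d0 _ hl => z; rewrite subr0 => zd.
  have [->|z0] := eqVneq z 0.
    by rewrite /entire eqxx e0 c1_at0 mulf_eq0 pnatr_eq0 (negbTE E0) expr1n mulr1.
  have [D g] := h z z0 zd; rewrite (entire_dom _ D); congr (_ * _).
  exact: sq_sgn (good_uniq reps D (gXZ D) g).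
have D : dom s by split.
have [e [b [d d0 h]]] := XZ_local reps gXZ D.
have nv z : N (z - s) < d -> nve K E lam e b z by move=> /h [].
have sd : N (s - s) < d by rewrite subrr cN0.
have [he _] := nve_hol nv sd.
have [l hl] := hol_cd (holM (holX k (hc s)) (holX 2 he)).
exists l; apply: cd_ext d0 _ hl => z zd; have [Dz _ sg] := h z zd.
by rewrite (entire_dom _ Dz) (sq_sgn _ _ _ _ sg).
Qed.

Lemma polynomial_line : exists k, exists2 g : {poly C}, g.[0] != 0 &
  forall s, dom s -> g.[s] = c1 s ^+ k * X s ^+ 2.
Proof.
have [k [hk _]] := entire_hol.
have [n [B [r r0 hr]]] := inf_bound reps gXZ lam0.
pose A := (4 * N lam + 3 + 2 * N E) ^+ k * B ^+ 2.
have L0 := cN_ge0 K lam; have EE := cN_ge0 K E.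
have A0 : 0 <= A by apply: mulr_ge0 (sqr_ge0 B); rewrite exprn_ge0 //; lra.
have r10 : 0 < r + 1 by rewrite addr_gt0.
have gr z : r + 1 < N z -> N (entire k z) <= A * N z ^+ (3 * k + (n + n)).
  move=> rz; have zr : r < N z by lra.
  have z1 : 1 <= N z by lra.
  have [D Xz] := hr z zr; rewrite (entire_dom _ D) cNM !cNX.
  apply: pow_bound2 Xz _; rewrite ?cN_ge0 //; first by lra.
  have n1 (m : nat) : N m%:R = m%:R := cN_nat K m.
  have t1 : N z <= N z ^+ 3 by rewrite ler_eXnr.
  have t0 : 1 <= N z ^+ 3 by rewrite exprn_ege1.
  apply: le_trans (cN_tri _ _ _) _; rewrite (cNM K 2) n1.
  have h1 := cN_triB K (4 * lam * z ^+ 3) (3 * z).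
  rewrite (cNM K (4 * lam)) (cNM K 4) (cNM K 3) cNX !n1 in h1; have := ler_wpM2l EE t0; lra.
have [g hg] := liouville_poly hk A0 r10 gr.
exists k; exists g; last by move=> s D; rewrite -hg entire_dom.
rewrite -hg /entire c1_at0 eqxx mulf_eq0 pnatr_eq0 (negbTE E0) /=.
by rewrite expf_neq0 // mulf_neq0 // pnatr_eq0.
Qed.
End Entire.

(** * Nonexistence of a polynomial square *)

Section Algebra.
Variables (C : numClosedFieldType) (E lam : C).
Implicit Types p q g : {poly C}.
Notation Cp := (C1 E lam).

Lemma poly_zero p : (forall s, p.[s] = 0) -> p = 0.
Proof.
move=> h; have : ~~ (size (p + 1) != 1).
  by apply/negP => /closed_rootP [x]; rewrite rootE hornerD h hornerC add0r oner_eq0.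
rewrite negbK => /size_poly1P [c _ e].
have : p = (c - 1)%:P by rewrite polyCB polyC1 -e addrK.
by move=> pc; have := h 0; rewrite pc hornerC => ->.
Qed.

(** Numerator of the derivative of [g / C1^k], over [C1^(k + 1)]. *)
Definition da k g := g^`() * Cp - k%:R *: (g * Cp^`()).
(* The equation of the squares of solutions, for [g / C1 ^ k] in place of the square. *)
Definition pe k g := let a := da k g in
  'X * (2 *: (g * (a^`() * Cp - k.+1%:R *: (a * Cp^`()))) - a ^+ 2)
  + 6 *: ((E%:P - 'X) * g * a) + 108 *: (g ^+ 2 * Cp).

Lemma C1' s : (Cp^`()).[s] = 12 * lam * s ^+ 2 - 3.
Proof.
rewrite /C1 !(derivD, derivN, derivZ, derivXn, derivX, derivC) !(hornerD, hornerN, hornerZ, hornerMn, hornerXn, hornerC) /=; ring.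
Qed.

Lemma root_descend k g (p : C) : pe k.+1 g = 0 -> root Cp p -> p != 0 -> (Cp^`()).[p] != 0 -> root g p.
Proof.
move=> h /rootP rp p0 c0; rewrite rootE.
have e : p * (Cp^`()).[p] = - 6 * (E - p).
  have := rp; rewrite C1' /C1 !(hornerD, hornerN, hornerZ, hornerXn, hornerX, hornerC) => r.
  by rewrite -[LHS]subr0 -[X in _ - X](mulr0 3) -r; ring.
have := congr1 (horner^~ p) h; rewrite horner0 /pe /da; move: (C1 E lam) rp e c0 => q rp e c0.
rewrite !(derivD, derivN, derivZ, derivM) !(hornerD, hornerN, hornerZ, hornerM, horner_exp, hornerX, hornerC) rp.
move: e c0; move: (q^`()).[p] g.[p] g^`().[p] (q^`()^`()).[p] (g^`()^`()).[p] => c x y z z' e c0 hh.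
have : x ^+ 2 * (c ^+ 2 * p * k.+1%:R * (k.+1%:R + 3)) = 0.
  rewrite -[RHS]hh (_ : k.+2%:R = k.+1%:R + 1 :> C); last by rewrite -natr1.
  have -> : E = p - p * c / 6 by rewrite e; field.
  by field.
have nz : c ^+ 2 * p * k.+1%:R * (k.+1%:R + 3) != 0.
  have k0 : k.+1%:R != 0 :> C by rewrite pnatr_eq0.
  have k4 : k.+1%:R + 3 != 0 :> C by rewrite -natrD pnatr_eq0.
  exact: mulf_neq0 (mulf_neq0 (mulf_neq0 (expf_neq0 2 c0) p0) k0) k4.
by move/eqP; rewrite mulf_eq0 (negbTE nz) orbF expf_eq0.
Qed.

Lemma C1_dvd g : lam != 0 -> (forall p : C, root Cp p -> (Cp^`()).[p] != 0) -> (forall p : C, root Cp p -> root g p) ->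
  Cp %| g.
Proof.
move=> l0 simple hr; have := divpK (dvdp_gcdl Cp g).
set d := gcdp Cp g; set r := Cp %/ d => e.
have : ~~ (size r != 1).
  apply/negP => /closed_rootP [x rx]; have cx : root Cp x by rewrite -e rootM rx.
  have dx : root d x by rewrite root_gcd cx hr.
  have := simple x cx; rewrite -e derivM hornerD !hornerM (rootP rx) (rootP dx).
  by rewrite mulr0 mul0r addr0 eqxx.
rewrite negbK => /size_poly1P [c c0 rc].
by rewrite -e rc mul_polyC dvdpZl // dvdp_gcdr.
Qed.

Lemma top_mul p q m n : (size p <= m.+1)%N -> (size q <= n.+1)%N -> (p * q)`_(m + n) = p`_m * q`_n.
Proof.
move=> hp hq; have lm : (m < (m + n).+1)%N by rewrite ltnS leq_addr.
rewrite coefM (bigD1 (Ordinal lm)) //= addKn big1 ?addr0 // => i ne.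
have [im|mi|e] := ltngtP i m.
- by rewrite [q`__]nth_default ?mulr0 // (leq_trans hq) //; have := ltn_ord i; lia.
- by rewrite nth_default ?mul0r // (leq_trans hp).
by case/eqP: ne; apply: val_inj.
Qed.

Lemma size_top_mul p q m n : (size p <= m.+1)%N -> (size q <= n.+1)%N -> (size (p * q)%R <= (m + n).+1)%N.
Proof.
move=> hp hq; apply: leq_trans (size_polyMleq _ _) _; lia.
Qed.

Lemma size_XD p n : (size p <= n.+1)%N -> (size ('X * p^`())%R <= n.+1)%N.
Proof.
move=> sp; apply/leq_sizeP => -[|i] // ni; rewrite coefXM /= coef_deriv nth_default ?mul0rn //.
exact: leq_trans sp ni.
Qed.

Lemma coef_XD p n : ('X * p^`())`_n = n%:R * p`_n.
Proof. by rewrite coefXM; case: n => [|n] /=; rewrite ?mul0r // coef_deriv mulr_natl. Qed.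

(** After division by [C1] the leading coefficient bounds the degree of [g] by 2, and the remaining
    coefficients of the equation are incompatible. *)
Lemma no_solution g : E != 0 -> lam != 0 -> pe 0 g = 0 -> g.[0] != 0 -> False.
Proof.
move=> E0 l0 h g0; have cp0 := C1_neq0 E l0.
pose Q := 'X * Cp * (2 *: (g * g^`()^`()) - g^`() ^+ 2) + 6 *: ((E%:P - 'X) * g * g^`()) + 108 *: g ^+ 2.
have Q0 : Q = 0.
  have : Cp * Q = 0.
    rewrite -[RHS]h /pe /da scale0r subr0 scale1r derivM /Q -!mul_polyC; ring.
  by move/eqP; rewrite mulf_eq0 (negbTE cp0) => /eqP.
have gn : g != 0 by apply: contraNneq g0 => ->; rewrite horner0.
pose D := (size g).-1.
have sg : (size g <= D.+1)%N by rewrite /D; case: (size g).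
have s1 := size_XD sg; have c1 := coef_XD g D.
(* The operator [X d/dX] preserves the degree, so [X Q] can be compared in degree [2 D + 3], where
   only the terms with [C1] contribute. *)
have e2 : 'X * ('X * g^`()^`()) = 'X * ('X * g^`())^`() - 'X * g^`() by rewrite derivM derivX; ring.
have s2 : (size ('X * ('X * g^`()^`()))%R <= D.+1)%N.
  by rewrite e2 (leq_trans (size_polyD _ _)) // size_polyN geq_max s1 size_XD.
have c2 : ('X * ('X * g^`()^`()))`_D = D%:R * (D%:R - 1) * g`_D by rewrite e2 coefB !coef_XD; ring.
have small : (size g <= 3)%N.
  have : ('X * Q)`_(3 + (D + D)) = 0 by rewrite Q0 mulr0 coef0.
  have -> : 'X * Q = Cp * (2 *: (g * ('X * ('X * g^`()^`()))) - ('X * g^`()) * ('X * g^`())) +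
      (6 *: ((E%:P - 'X) * (g * ('X * g^`()))) + 108 *: ('X * (g * g))).
    by rewrite /Q -!mul_polyC; ring.
  have zero p : (size p <= (1 + (D + D)).+1)%N -> p`_(3 + (D + D)) = 0.
    by move=> sp; rewrite nth_default // (leq_trans sp) //; lia.
  have sEX : (size (E%:P - 'X : {poly C})%R <= 2)%N.
    by rewrite (leq_trans (size_polyD _ _)) // size_polyN size_polyX geq_max (leq_trans (size_polyC_leq1 _)).
  have sX : (size ('X : {poly C})%R <= 2)%N by rewrite size_polyX.
  have sC : (size Cp <= 4)%N.
    by apply/leq_sizeP => -[|[|[|[|i]]]] // _; rewrite /C1 !coefE /= !mulr0 subr0 addr0.
  have cC : Cp`_3 = 4 * lam by rewrite /C1 !coefE /= mulr0 subr0 addr0 mulr1.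
  rewrite coefD (zero (_ + _)); last first.
    apply: leq_trans (size_polyD _ _) _; rewrite geq_max; apply/andP; split.
      by apply: leq_trans (size_scale_leq _ _) _; apply: size_top_mul sEX _; apply: size_top_mul.
    by apply: leq_trans (size_scale_leq _ _) _; apply: size_top_mul sX _; apply: size_top_mul.
  rewrite addr0 (@top_mul _ _ 3 (D + D)) //; last first.
    apply: leq_trans (size_polyD _ _) _; rewrite geq_max size_polyN; apply/andP; split.
      by apply: leq_trans (size_scale_leq _ _) _; apply: size_top_mul.
    exact: size_top_mul.
  rewrite coefB coefZ (top_mul sg s2) (top_mul s1 s1) c1 c2 cC.
  have gD : g`_D != 0 by rewrite -lead_coefE lead_coef_eq0.
  (* The leading coefficient gives [D (D - 2) = 0]. *)
  move=> hh; have : 4 * lam * (g`_D) ^+ 2 * (D%:R * (D%:R - 2)) = 0 by rewrite -[RHS]hh; ring.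
  have n4 : (4 : C) != 0 by rewrite pnatr_eq0.
  have nn := mulf_neq0 (mulf_neq0 n4 l0) (expf_neq0 2 gD).
  move/eqP; rewrite mulf_eq0 (negbTE nn) /= mulf_eq0 pnatr_eq0 subr_eq0 eqr_nat.
  by move: sg => + /orP[/eqP e|/eqP e]; rewrite e => /leq_trans; apply.
pose n0 := g`_0; pose n1 := g`_1; pose n2 := g`_2.
have gE : g = n0%:P + n1 *: 'X + n2 *: 'X^2.
  apply/polyP => i; rewrite !coefE; case: i => [|[|[|i]]] /=; rewrite ?(mulr0, mulr1, addr0, add0r) //.
  by rewrite nth_default // (leq_trans small).
have nz : n0 != 0.
  by move: g0; rewrite gE !(hornerD, hornerZ, hornerXn, hornerX, hornerC) !mulr0 expr0n mulr0 !addr0.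
pose De := 4 * n0 * n2 - n1 ^+ 2; pose m1 := n1 ^+ 2 + 2 * n0 * n2.
(* These are the coefficients of [Q] for [g] of degree at most 2; the first two determine [n1] and
   [n2] from [n0], and the one of [s^3] is then nonzero. *)
have P0 : Poly [:: 6 * E * n0 * n1 + 108 * n0 ^+ 2; 2 * E * De + 6 * E * m1 + 210 * n0 * n1;
    - 3 * De + 18 * E * n1 * n2 + 102 * m1; 12 * E * n2 ^+ 2 + 198 * n1 * n2;
    4 * lam * De + 96 * n2 ^+ 2] = 0 :> {poly C}.
  apply: poly_zero => s; have := congr1 (horner^~ s) Q0; rewrite horner0 => <-.
  rewrite horner_Poly /= /Q gE /De /m1 /C1 !(derivD, derivN, derivM, derivZ, derivXn, derivX, derivC) /=.
  rewrite !(hornerD, hornerN, hornerZ, hornerM, horner_exp, hornerMn, hornerXn, hornerX, hornerC) /=; ring.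
have c i := congr1 (fun p : {poly C} => p`_i) P0.
have q0 := c 0; have q1 := c 1; have q3 := c 3.
rewrite !coef_Poly /= !coef0 in q0 q1 q3.
have e1 : n1 = - 18 * n0 / E.
  have n6 : 6 * E * n0 != 0 by rewrite !mulf_neq0 // pnatr_eq0.
  by apply: (mulfI n6); apply/eqP; rewrite -subr_eq0; apply/eqP; rewrite -q0; field.
have e2' : n2 = 621 / 5 * n0 / E ^+ 2.
  have n20 : 20 * E * n0 != 0 by rewrite !mulf_neq0 // pnatr_eq0.
  apply: (mulfI n20); apply/eqP; rewrite -subr_eq0; apply/eqP; rewrite -q1 /De /m1 e1; field.
  exact: E0.
move/eqP: q3; have -> : 12 * E * n2 ^+ 2 + 198 * n1 * n2 =
   12 * (621 / 5) * (621 / 5 - 297) * n0 ^+ 2 / E ^+ 3 by rewrite e2' e1; field.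
have -> : 621 / 5 - 297 = - (864 / 5) :> C by field.
apply/negP; have nn (n : nat) : (n != 0)%N -> n%:R != 0 :> C by rewrite pnatr_eq0.
apply: mulf_neq0 (mulf_neq0 (mulf_neq0 (mulf_neq0 (nn _ _) (mulf_neq0 (nn _ _) _)) _) (expf_neq0 2 nz)) _;
  rewrite ?oppr_eq0 ?invr_eq0 ?expf_neq0 ?mulf_neq0 ?invr_eq0 ?pnatr_eq0 //.
Qed.
End Algebra.

(** * Descent on the power of [C1] and the contradiction *)

Section Conclusion.
Variables (R : realType) (C : numClosedFieldType) (K : cdata R C) (E lam : C).
Notation N := (cN K).
Notation cd := (cd K).
Notation pt := (pt C).
Notation c1 := (c1 E lam).
Notation sq := (sq E lam).
Notation dom := (dom E lam).
Notation Cp := (C1 E lam).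
Hypothesis E0 : E != 0.
Hypothesis lam0 : lam != 0.
Hypothesis El : 4 * E ^+ 2 * lam != 1.

Section Squares.
Variable F : pt -> C -> C.
Hypothesis reps : forall s0 r0, s0 != 0 -> r0 != 0 -> r0 ^+ 2 = sq (base s0) ->
  inhabited (rep K E lam F s0 r0).
Variables X Z : C -> C.
Hypothesis gXZ : forall s, dom s -> @good R C K E lam F s (X s) (Z s).

Lemma cd_poly (p : {poly C}) s : cd (horner p) s p^`().[s].
Proof.
elim/poly_ind: p => [|p c ih].
  by rewrite deriv0 horner0; apply: cd_ext ltr01 _ (cd_cst K 0 s) => z _; rewrite horner0.
apply: cd_ext ltr01 _ (cd_eq _ (cdD (cdM ih (cd_id K s)) (cd_cst K c s))) => [z _|].
  by rewrite hornerD hornerM hornerX hornerC.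
by rewrite derivMXaddC hornerD hornerM hornerX addr0 mulr1 addrC.
Qed.

Lemma pe_zero k g : (forall s, dom s -> g.[s] = c1 s ^+ k * X s ^+ 2) -> pe E lam k g = 0.
Proof.
move=> hg; have at_dom s : dom s -> (pe E lam k g).[s] = 0.
  move=> D; have [s0 c0] := D; have [e [b [d d0 h]]] := XZ_local reps gXZ D.
  have gE z : N (z - s) < d -> g.[z] = c1 z ^+ k * e z ^+ 2.
    by move=> zd; have [Dz _ sg] := h z zd; rewrite (hg z Dz); congr (_ * _); case: sg => -[-> _] //; rewrite sqrrN.
  have pw z : c1 z != 0 -> k%:R * c1 z ^+ k.-1 = k%:R * c1 z ^+ k / c1 z.
    by move=> cz; case: (k) => [|m] /=; [rewrite !mul0r | rewrite exprS; field].
  have aE z : N (z - s) < d -> (da E lam k g).[z] = 3 * (c1 z ^+ k.+1 * (e z * b z)).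
    move=> zd; have [[z0 cz] [he hb] _] := h z zd.
    have zz : 0 < d - N (z - s) by rewrite subr_gt0.
    have g' : g^`().[z] = k%:R * c1 z ^+ k.-1 * (12 * lam * z ^+ 2 - 3) * e z ^+ 2 +
        c1 z ^+ k * (2%:R * e z ^+ 1 * (3 / 2 * b z)).
      apply: (cd_uniq (cd_poly g z)); apply: cd_ext zz _ (cdM (cdX k (cd_c1 K E lam z)) (cdX 2 he)) => y yz.
      by rewrite gE //; have := cN_dist K y z s; lra.
    rewrite /da; move: (C1 E lam) (C1E E lam z) (C1' E lam z) => q q0 q1.
    rewrite !(hornerD, hornerN, hornerZ, hornerM) q0 q1 g' (gE z zd) pw // (exprS _ k).
    by move: (c1 z ^+ k) (c1 z) cz => y c cz; field.
  have [|_ [he hb] _] := h s; first by rewrite subrr cN0.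
  have sd : N (s - s) < d by rewrite subrr cN0.
  have a' := cd_uniq (cd_poly (da E lam k g) s) (cd_ext d0 (fun z zd => esym (aE z zd))
    (cdZ 3 (cdM (cdX k.+1 (cd_c1 K E lam s)) (cdM he hb)))).
  rewrite /pe; move: a' (aE s sd) (gE s sd) (C1E E lam s) (C1' E lam s).
  move: (da E lam k g) (C1 E lam) => a q a' a0 g0 q0 q'.
  rewrite !(hornerD, hornerN, hornerZ, hornerM, horner_exp, hornerX, hornerC) a' a0 g0 q0 q' /=.
  rewrite (exprS _ k); move: (c1 s) c0 => c c0; move: (c ^+ k) => y.
  by field; rewrite s0 c0.
(* The equation holds away from 0 and the roots of [C1]; multiplied by [X C1] it holds
   everywhere. *)
have nz : 'X * C1 E lam != 0 by rewrite mulf_neq0 ?polyX_eq0 ?C1_neq0.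
apply/eqP; rewrite -(inj_eq (mulIf nz)) mul0r; apply/eqP.
apply: poly_zero => s; rewrite hornerM hornerM hornerX C1E.
have [->|s0] := eqVneq s 0; first by rewrite mul0r mulr0.
have [->|c0] := eqVneq (c1 s) 0; first by rewrite !mulr0.
by rewrite at_dom ?mul0r.
Qed.

(** By [root_descend] and simplicity of the roots, [C1] divides [g] as long as [k] is positive, and
    the quotient serves for [k - 1]; at [k = 0] there is no solution. *)
Lemma no_square k g : (forall s, dom s -> g.[s] = c1 s ^+ k * X s ^+ 2) -> g.[0] != 0 -> False.
Proof.
elim: k g => [|k ih] g hg g0; have p0 := pe_zero hg; first exact: (no_solution E0 lam0 p0 g0).
have simple p : root (C1 E lam) p -> p != 0 /\ (C1 E lam)^`().[p] != 0.
  by move=> /rootP; rewrite C1E C1' => /(root_simple E0 El).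
have dv : C1 E lam %| g.
  apply: C1_dvd => // p rp; have [q0 q1] := simple p rp => //.
  exact: root_descend p0 rp q0 q1.
apply: (ih (g %/ C1 E lam)) => [s D|].
  have [_ c0] := D; apply: (mulIf c0); rewrite -C1E -hornerM divpK // (hg s D) C1E exprS; ring.
by move: g0; rewrite -{1}(divpK dv) hornerM mulf_eq0 negb_or => /andP[].
Qed.
End Squares.

Lemma no_first_integral F : (forall s0 r0, s0 != 0 -> r0 != 0 -> r0 ^+ 2 = sq (base s0) ->
  inhabited (rep K E lam F s0 r0)) -> False.
Proof.
move=> reps; have [|f hf] := @choice C (C * C)%type (fun s xy => dom s -> @good R C K E lam F s xy.1 xy.2).
  move=> s; have [D|nD] := pselect (dom s); last by exists (0, 0) => /nD.
  by have [x [y g]] := all_good reps lam0 E0 D; exists (x, y).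
have [k [g g0 hg]] := polynomial_line reps hf E0 lam0 El.
exact: (no_square reps hf hg g0).
Qed.

Lemma not_integrable : ~ meromorphically_integrable_near (bianchi_curve E lam) (bianchi_H lam).
Proof.
move=> [U [oU sub [_ [f [mf [D [[oD dD hH hf] [ind pb]]]]]]]].
apply: (@no_first_integral (fun q r => f (Ph E lam q r))) => s0 r0 s00 r00 rs.
exact: (rep_exists K oU sub mf oD dD hH hf ind pb s00 r00 rs).
Qed.
End Conclusion.

Section Complex.
Variable R : realType.
Local Open Scope complex_scope.

Lemma complex_jr_le : {mono real_complex R : x y / x <= y}.
Proof. by move=> x y; rewrite lecR. Qed.

Definition complex_data : cdata R R[i] :=
  @CData R R[i] (real_complex R) (@complex.Re R) complex_jr_le (@complexRe R).

End Complex.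

Local Open Scope complex_scope.

Theorem theorem1 (R : realType)
  (conjecture : generic (fun E lam : R[i] =>
     lam <> 0%R -> E <> 0%R -> gammas_not_both_zero E lam)) :
  generic (fun E lam : R[i] =>
    ~ meromorphically_integrable_near
        (bianchi_curve E lam) (bianchi_H lam)).
Proof.
pose e : {poly {poly R[i]}} := ('X)%:P; pose l : {poly {poly R[i]}} := 'X.
pose c (x : R[i]) : {poly {poly R[i]}} := x%:P%:P.
(* Its zero set is the union of the four degenerate loci. *)
pose P := l * e * (c 4 * e ^+ 2 * l - c 1) * (e ^+ 2 * l + c 2450).
have PE E lam : P.[lam%:P].[E] = lam * E * (4 * E ^+ 2 * lam - 1) * (E ^+ 2 * lam + 2450).
  by rewrite /P /c /e /l !(hornerM, hornerD, hornerN, horner_exp, hornerX, hornerC).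
exists [:: P]; split.
- exists 1, 1 => /(_ P (mem_head _ _)); rewrite PE; apply/eqP.
  rewrite !mul1r !expr1n !mulr1.
  (* The value of [P] at [(1, 1)], which shows that the exceptional set is proper. *)
  have -> : (4 - 1) * (1 + 2450) = 7353%:R :> R[i] by ring.
  by rewrite pnatr_eq0.
- move=> E lam dg F; rewrite inE => /eqP ->; rewrite PE.
  by case: dg => [->|->|e1|e1]; rewrite ?mul0r ?mulr0 ?mul0r ?e1 ?subrr ?mulr0 ?mul0r.
move=> E lam nz.
have : P.[lam%:P].[E] <> 0 by move=> z; apply: nz => F; rewrite inE => /eqP ->.
rewrite PE => /eqP; rewrite !mulf_eq0 !negb_or => /andP[/andP[/andP[lam0 E0] El] _].
apply: (not_integrable (complex_data R)) => //.
by rewrite -subr_eq0.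
Qed.
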